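(* Let $\alpha\in\,]0,1[$ and let $\Omega\subset\mathbb R^N$ be a bounded domain of class $C^{4,\alpha}$. Let $0<\lambda_1\leq\lambda_2\leq\cdots\leq\lambda_j\leq\cdots$ be the positive eigenvalues, repeated according to multiplicity, of the problem $$\Delta^2u=\lambda u\ \text{in }\Omega,\qquad \Delta u=0\ \text{on }\partial\Omega,\qquad \frac{\partial\Delta u}{\partial\nu}=0\ \text{on }\partial\Omega,$$ and let $0<\mu_1\leq\mu_2\leq\cdots\leq\mu_j\leq\cdots$ be the eigenvalues, repeated according to multiplicity, of the Dirichlet problem $$\Delta^2w=\mu w\ \text{in }\Omega,\qquad w=0\ \text{on }\partial\Omega,\qquad \frac{\partial w}{\partial\nu}=0\ \text{on }\partial\Omega$$ (both understood as in the context). Then the positive eigenvalues of the first problem coincide with the eigenvalues of the second problem, i.e. $\lambda_j=\mu_j$ for all $j\in\mathbb N$, $j\ge1$.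
   Context: A domain is a connected open set; $\nu$ is the outer unit normal to $\partial\Omega$; function spaces are real. Both problems are understood in weak form. First problem (the Neumann problem with Poisson's ratio $\sigma=1$): $\lambda\neq0$ is an eigenvalue if there is $u\in H^4(\Omega)\cap H^2_0(\Omega)$, $u\ne0$, such that $$\int_\Omega\Delta^2u\,\Delta^2\varphi\,dx=\lambda\int_\Omega\Delta u\,\Delta\varphi\,dx\quad\text{for all }\varphi\in H^4(\Omega)\cap H^2_0(\Omega);$$ the corresponding eigenfunction of the first problem is $v=\Delta u\in\Delta(H^4(\Omega)\cap H^2_0(\Omega))$ (equivalently, $v$ satisfies $\int_\Omega\Delta v\,\Delta\psi\,dx=\lambda\int_\Omega v\psi\,dx$ for all $\psi\in\Delta(H^4(\Omega)\cap H^2_0(\Omega))$). This formulation is motivated by the direct decomposition $H^2(\Omega)=\{h\in H^2(\Omega):\Delta h=0\}\oplus\Delta(H^4(\Omega)\cap H^2_0(\Omega))$, the harmonic functions being the eigenfunctions for $\lambda=0$. The positive eigenvalues have finite multiplicity and form a sequence diverging to $+\infty$. Dirichlet problem: $\mu\in\mathbb R$ is an eigenvalue if there is $w\in H^2_0(\Omega)$, $w\neq0$, such that $\int_\Omega\Delta w\,\Delta\varphi\,dx=\mu\int_\Omega w\varphi\,dx$ for all $\varphi\in H^2_0(\Omega)$. The eigenvalues are positive, have finite multiplicity and form a sequence diverging to $+\infty$. *)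

(* Defs.v *)
From HB Require Import structures.
From mathcomp Require Import all_boot all_order all_algebra.
From mathcomp Require Import all_classical all_reals all_analysis.

Set Implicit Arguments.
Unset Strict Implicit.
Unset Printing Implicit Defensive.

Import Order.TTheory GRing.Theory Num.Theory.
Import numFieldNormedType.Exports.

Local Open Scope classical_set_scope.
Local Open Scope ring_scope.

(* Measurable structure on R^n: the sigma-algebra generated by the coordinates
   (i.e. the Borel sets), as for [n.-tuple T] in the library. *)
Section measurable_rV.
Context {R : realType} (n : nat).

Let coord (i : 'I_n) (x : 'rV[R]_n) : measurableTypeR R := x ord0 i.

Let rV_set0 : g_sigma_preimage coord set0.
Proof. exact: sigma_algebra0. Qed.

Let rV_setC A : g_sigma_preimage coord A -> g_sigma_preimage coord (~` A).
Proof. exact: sigma_algebraC. Qed.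

Let rV_bigcup (F : (set 'rV[R]_n)^nat) :
  (forall i, g_sigma_preimage coord (F i)) ->
  g_sigma_preimage coord (\bigcup_i (F i)).
Proof. exact: sigma_algebra_bigcup. Qed.

HB.instance Definition _ :=
  @isMeasurable.Build (measure_tuple_display default_measure_display) 'rV[R]_n
    (g_sigma_preimage coord) rV_set0 rV_setC rV_bigcup.

End measurable_rV.

Section lebesgue_measure_rV.
Context {R : realType}.

Definition cons_rV n (p : 'rV[R]_n * measurableTypeR R) : 'rV[R]_n.+1 :=
  row_mx (p.2)%:M p.1.

Lemma measurable_coord_rV n (i : 'I_n) :
  measurable_fun [set: 'rV[R]_n] (fun x => x ord0 i : measurableTypeR R).
Proof.
move=> _ Y mY; rewrite setTI; apply: sub_sigma_algebra => /=.
rewrite -bigcup_seq/=; exists i => /=; first by rewrite mem_index_enum.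
by exists Y => //; rewrite setTI.
Qed.

Lemma measurable_cons_rV n :
  measurable_fun [set: 'rV[R]_n * measurableTypeR R] (@cons_rV n).
Proof.
have mi (i : 'I_n.+1) :
    measurable_fun setT (fun p => @cons_rV n p ord0 i : measurableTypeR R).
  case: (split_ordP (i : 'I_(1 + n))) => j ->.
    rewrite (_ : (fun _ => _) = snd); last first.
      by apply/funext => p; rewrite /cons_rV (@row_mxEl _ _ 1 n) mxE !ord1 eqxx mulr1n.
    exact: measurable_snd.
  rewrite (_ : (fun _ => _) =
    (fun x : 'rV[R]_n => x ord0 j : measurableTypeR R) \o fst); last first.
    by apply/funext => p; rewrite /cons_rV (@row_mxEr _ _ 1 n).
  by apply: measurableT_comp; [exact: measurable_coord_rV|exact: measurable_fst].
move=> _ A mA; rewrite setTI.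
suff : g_sigma_preimage (fun (i : 'I_n.+1) p =>
    @cons_rV n p ord0 i : measurableTypeR R) `<=` measurable.
  rewrite (g_sigma_preimage_comp
    (fun (i : 'I_n.+1) (x : 'rV[R]_n.+1) => x ord0 i : measurableTypeR R)).
  by apply; exists A => //; rewrite setTI.
apply: smallest_sub; first exact: sigma_algebra_measurable.
rewrite -bigcup_mkord_ord; apply: bigcup_sub => j _ B [C mC <-].
exact: mi.
Qed.

(* The Lebesgue measure on the Borel sets of R^n, as an iterated product. *)
Fixpoint lebesgue_rV n : {measure set 'rV[R]_n -> \bar R} :=
  match n with
  | 0%N => dirac (0 : 'rV[R]_0)
  | m.+1 => measure_function_pushforward__canonical__measure_function_Measure
      (lebesgue_rV m \x lebesgue_measure)%E (@measurable_cons_rV m)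
  end.

End lebesgue_measure_rV.

Section smoothness.
Context {R : realType}.

(* Iterated partial derivative; the list [s] of directions plays the role of
   a multi-index of order [size s]. *)
Definition partials n (s : seq 'I_n) (f : 'rV[R]_n -> R) : 'rV[R]_n -> R :=
  foldr (fun i g => 'D_(delta_mx ord0 i) g) f s.

Definition Ck n (k : nat) (f : 'rV[R]_n -> R) : Prop :=
  (forall (s : seq 'I_n) (i : 'I_n) x, (size s < k)%N ->
     derivable (partials s f) x (delta_mx ord0 i)) /\
  (forall s : seq 'I_n, (size s <= k)%N -> continuous (partials s f)).

(* Global Hoelder bounds are not a restriction in the local use made below. *)
Definition Ckalpha n (k : nat) (alpha : R) (f : 'rV[R]_n -> R) : Prop :=
  Ck k f /\
  exists K : R, forall (s : seq 'I_n) x y, size s = k ->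
    `|partials s f x - partials s f y| <= K * `|x - y| `^ alpha.

(* Near each boundary point, in suitable orthonormal coordinates, Omega is the
   strict epigraph of a C^{k,alpha} function; the 0-th coordinate is the
   vertical one. *)
Definition of_class_Ckalpha n (k : nat) (alpha : R) (Omega : set 'rV[R]_n.+1)
    : Prop :=
  forall x0, (closure Omega `\` Omega°) x0 ->
    exists (Q : 'M[R]_n.+1) (r : R) (gamma : 'rV[R]_n -> R),
      [/\ Q *m Q^T = 1%:M, 0 < r, Ckalpha k alpha gamma &
        forall x, ball x0 r x ->
          (Omega x <->
           gamma (rsubmx (x *m Q : 'rV_(1 + n))) < (x *m Q) ord0 ord0)].

End smoothness.

Section weak_problems.
Context {R : realType} {n : nat}.
Variable Omega : set 'rV[R]_n.

Local Notation vol := (@lebesgue_rV R n).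
Implicit Types (f g phi u v : 'rV[R]_n -> R) (s : seq 'I_n).

(* Elements of the function spaces are represented by functions on R^n; only
   their values almost everywhere on Omega matter. *)
Definition eq_on f g : Prop := f = g %[ae vol in Omega].

Definition L2norm f : \bar R := 'N[vol]_2%:E[EFin \o (f \_ Omega)]%E.

Definition L2 : set ('rV[R]_n -> R) :=
  [set f | f \_ Omega \in Lfun vol 2%:E].

(* C_c^oo(Omega) *)
Definition test_fun : set ('rV[R]_n -> R) :=
  [set phi | (forall k, Ck k phi) /\
     exists K, [/\ compact K, K `<=` Omega & forall x, ~ K x -> phi x = 0]].

Definition is_weak_deriv s f g : Prop :=
  forall phi, test_fun phi ->
    \int[vol]_(x in Omega) (f x * partials s phi x) =
    (-1) ^+ size s * \int[vol]_(x in Omega) (g x * phi x).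

(* A representative of the weak derivative in L^2, whenever it exists. *)
Definition weak_deriv s f : 'rV[R]_n -> R :=
  xget (fun=> 0) [set g | L2 g /\ is_weak_deriv s f g].

Definition sobolev (k : nat) : set ('rV[R]_n -> R) :=
  [set f | L2 f /\ forall s, (size s <= k)%N ->
     exists2 g, L2 g & is_weak_deriv s f g].

(* The closure of C_c^oo(Omega) in H^k(Omega). *)
Definition sobolev0 (k : nat) : set ('rV[R]_n -> R) :=
  [set f | sobolev k f /\ forall eps : R, 0 < eps ->
     exists2 phi, test_fun phi & forall s, (size s <= k)%N ->
       (L2norm (partials s phi \- weak_deriv s f)%R < eps%:E)%E].

Definition laplacian u : 'rV[R]_n -> R :=
  fun x => \sum_(i < n) weak_deriv [:: i; i] u x.

Definition L2inner f g : R := \int[vol]_(x in Omega) (f x * g x).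

Definition neumann_space : set ('rV[R]_n -> R) := sobolev 4 `&` sobolev0 2.

Definition neumann_solution (lambda : R) u : Prop :=
  neumann_space u /\ forall phi, neumann_space phi ->
    L2inner (laplacian (laplacian u)) (laplacian (laplacian phi)) =
    lambda * L2inner (laplacian u) (laplacian phi).

Definition neumann_eigenvalue (lambda : R) : Prop :=
  lambda != 0 /\ exists2 u, neumann_solution lambda u & ~ eq_on u (fun=> 0).

Definition neumann_eigenspace (lambda : R) : set ('rV[R]_n -> R) :=
  [set v | exists2 u, neumann_solution lambda u & eq_on v (laplacian u)].

Definition dirichlet_eigenspace (mu : R) : set ('rV[R]_n -> R) :=
  [set w | sobolev0 2 w /\ forall phi, sobolev0 2 phi ->
     L2inner (laplacian w) (laplacian phi) = mu * L2inner w phi].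

Definition dirichlet_eigenvalue (mu : R) : Prop :=
  exists2 w, dirichlet_eigenspace mu w & ~ eq_on w (fun=> 0).

(* E has dimension m, functions being identified when they are equal almost
   everywhere on Omega. *)
Definition has_dim (E : set ('rV[R]_n -> R)) (m : nat) : Prop :=
  exists e : 'I_m -> 'rV[R]_n -> R,
    [/\ forall i, E (e i),
        forall c : 'I_m -> R,
          eq_on (fun x => \sum_(i < m) c i * e i x) (fun=> 0) ->
          forall i, c i = 0 &
        forall f, E f -> exists c : 'I_m -> R,
          eq_on f (fun x => \sum_(i < m) c i * e i x)].

(* [lam] lists the elements of [S] in nondecreasing order, [t] being repeated
   as many times as the (finite) dimension of its eigenspace [E t]; indices
   start at 0. *)
Definition enumerates (S : set R) (E : R -> set ('rV[R]_n -> R))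
    (lam : nat -> R) : Prop :=
  [/\ nondecreasing_seq lam, range lam = S &
      forall t, S t -> exists2 m,
        has_dim (E t) m & ([set j | lam j = t] #= `I_m)%card].

End weak_problems.

(* Main.v *)
(* On H = H^4 cap H^2_0, Green's formula turns the right-hand side of the first
   problem into lambda <u, Lap^2 phi>, so Lap^2 u - lambda u is orthogonal to
   Lap^2 H.  By Riesz and H^4 regularity, Lap^2 H is all of L^2: hence u solves
   the first problem iff it is a Dirichlet eigenfunction for lambda.  As Lap is
   injective on H^2_0, the eigenspaces {Lap u} and {u} have equal dimension.

   Regularity is local.  Near a boundary point Omega is {rho > 0} with
   d_q rho = 1.  Difference quotients along the maps
   S_h x = x + h p + (rho x - rho (x + h p)) q, which preserve rho and the
   measure, give the derivatives of g = d_i d_j u along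
   X_p = d_p - (d_p rho) d_q.  The equation then bounds <g, d_q^2 psi> for psi
   supported in Omega; a third-order reflection and the energy estimate on the
   whole space remove this support condition. *)
Require Import Defs.
From HB Require Import structures.
From mathcomp Require Import all_boot all_order all_algebra.
From mathcomp Require Import all_classical all_reals all_analysis.
From mathcomp Require Import measurable_realfun.
From mathcomp Require Import ring lra zify.
Set Implicit Arguments.
Unset Strict Implicit.
Unset Printing Implicit Defensive.
Import Order.TTheory GRing.Theory Num.Theory.
Import numFieldNormedType.Exports.
Local Open Scope classical_set_scope.
Local Open Scope ring_scope.

(** Regularity is stated by duality throughout: a bound $|\langle g, P\psi\rangle| \le C\|\psi\|$
    over compactly supported $\psi$, which Riesz turns into a weak derivative only at the very end.
    The quotients are applied not to the solution but to smooth compactly supported approximations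
    of it. These solve the equation up to an error $\varepsilon$ that a quotient of step $h$
    amplifies to $\varepsilon/|h|$, so the approximation is passed to the limit with $h$ fixed, and
    $h$ tends to 0 afterwards. The equation bounds $\langle g, \Delta\psi\rangle$ directly only for
    $g = \Delta u$. Once every $\langle \Delta u, d_i d_j \psi\rangle$ is bounded, $\langle d_i d_j
    u, \Delta\psi\rangle = \langle \Delta u, d_i d_j\psi\rangle$ gives the missing input for each
    $d_i d_j u$, and the normal argument runs a second time on a smaller ball. The function $g$ is
    extended across the boundary by the adjoint of the reflection of test functions. Four weights
    are what a $C^3$ test function needs to stay $C^3$ after reflection and extension by zero. *)

Local Notation le0_1 := (isT : (0 <= 1)%N) (only parsing).
Local Notation le0_2 := (isT : (0 <= 2)%N) (only parsing).
Local Notation le0_3 := (isT : (0 <= 3)%N) (only parsing).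
Local Notation le0_4 := (isT : (0 <= 4)%N) (only parsing).
Local Notation le1_1 := (isT : (1 <= 1)%N) (only parsing).
Local Notation le1_2 := (isT : (1 <= 2)%N) (only parsing).
Local Notation le1_3 := (isT : (1 <= 3)%N) (only parsing).
Local Notation le1_4 := (isT : (1 <= 4)%N) (only parsing).
Local Notation le2_2 := (isT : (2 <= 2)%N) (only parsing).
Local Notation le2_3 := (isT : (2 <= 3)%N) (only parsing).
Local Notation le2_4 := (isT : (2 <= 4)%N) (only parsing).
Local Notation le3_3 := (isT : (3 <= 3)%N) (only parsing).
Local Notation le3_4 := (isT : (3 <= 4)%N) (only parsing).

(** * Lebesgue measure on row vectors *)

Section affine_line.
Context {R : realType}.
Local Open Scope ereal_scope.
Local Notation leb := (@lebesgue_measure R).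

(** By uniqueness of Lebesgue measure: it agrees on half-open intervals with [a] times its image
    under $t \mapsto at+b$. *)
Let ge0_affine_pos (a b : R) (f : R -> \bar R) : (0 < a)%R ->
  measurable_fun [set: R] f -> (forall x, 0 <= f x) ->
  a%:E * \int[leb]_t f (a * t + b)%R = \int[leb]_t f t.
Proof.
move=> a0 mf f0.
pose phi (t : measurableTypeR R) : measurableTypeR R := (a * t + b)%R.
have mphi : measurable_fun setT phi.
  exact: measurable_funD.
have a0' : (0 <= a)%R by exact: ltW.
pose k := NngNum a0'.
have H : forall A : set (measurableTypeR R), measurable A ->
    leb A = mscale k (measure_function_pushforward__canonical__measure_function_Measure leb mphi) A.
  move=> A mA; apply: lebesgue_measure_unique => // _ [[c d]] _ <-.
  rewrite [RHS](_ : _ = a%:E * leb (phi @^-1` [set` `]c, d]%R]))//.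
  rewrite (_ : phi @^-1` _ = [set` `](c - b) / a, (d - b) / a]%R]); last first.
    apply/seteqP; split => t /=; rewrite !in_itv/= /phi => /andP[h1 h2]; apply/andP; split.
    - by rewrite ltr_pdivrMr// mulrC; lra.
    - by rewrite ler_pdivlMr// mulrC; lra.
    - by move: h1; rewrite ltr_pdivrMr// mulrC; lra.
    - by move: h2; rewrite ler_pdivlMr// mulrC; lra.
  rewrite !lebesgue_measure_itv/= !lte_fin ltr_pM2r ?invr_gt0// ltrD2r.
  case: ifPn => cd; last by rewrite mule0.
  rewrite -!EFinD -EFinM; congr EFin; field; exact: lt0r_neq0.
rewrite [RHS](eq_measure_integral (mscale k (measure_function_pushforward__canonical__measure_function_Measure leb mphi))); last first.
  by move=> A mA _; exact: H.
rewrite ge0_integral_mscale//=; congr *%E.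
by rewrite ge0_integral_pushforward.
Qed.

Lemma ge0_integral_affine (a b : R) (f : R -> \bar R) : a != 0%R ->
  measurable_fun [set: R] f -> (forall x, 0 <= f x) ->
  `|a|%:E * \int[leb]_t f (a * t + b)%R = \int[leb]_t f t.
Proof.
move=> a0 mf f0; have [a1|a1|a1] := ltgtP a 0%R; last by rewrite a1 eqxx in a0.
  rewrite ltr0_norm//.
  have mN : measurable_fun setT (-%R : measurableTypeR R -> measurableTypeR R).
    exact: oppr_measurable.
  rewrite -(@ge0_affine_pos (- a)%R b f)// ?oppr_gt0//; congr *%E.
  pose g (t : measurableTypeR R) := f (- a * t + b)%R.
  have mg : measurable_fun setT g.
    by apply: measurableT_comp => //; apply: measurable_funD.
  transitivity (\int[measure_function_pushforward__canonical__measure_function_Measure leb mN]_t g t).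
    rewrite ge0_integral_pushforward//=; last by move=> y _; exact: f0.
    by rewrite preimage_setT; apply: eq_integral => t _; rewrite /g /= mulrNN.
  by apply: eq_measure_integral => A mA _ /=; rewrite lebesgue_measureN.
by rewrite gtr0_norm// ge0_affine_pos.
Qed.

End affine_line.

Section lebesgue_rV_theory.
Context {R : realType}.
Local Notation leb := (@lebesgue_measure R).

(** A constant of its own, to which the sigma-finite structure used by Tonelli's theorem is attached
    below. *)
Definition vol n : set 'rV[R]_n -> \bar R := lebesgue_rV n.
Arguments vol n _ : clear implicits.

HB.instance Definition _ n := Measure.on (vol n).

Lemma measurable_rVP d (T : measurableType d) n (f : T -> 'rV[R]_n) :
  (forall i, measurable_fun setT (fun x => f x ord0 i : measurableTypeR R)) ->
  measurable_fun setT f.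
Proof.
move=> mf _ A mA; rewrite setTI.
suff : g_sigma_preimage (fun (i : 'I_n) p => f p ord0 i : measurableTypeR R) `<=` measurable.
  rewrite (g_sigma_preimage_comp
    (fun (i : 'I_n) (x : 'rV[R]_n) => x ord0 i : measurableTypeR R)).
  by apply; exists A => //; rewrite setTI.
case: n f mf A mA => [|n] f mf A mA.
  apply: smallest_sub; first exact: sigma_algebra_measurable.
  by rewrite big_ord0.
apply: smallest_sub; first exact: sigma_algebra_measurable.
rewrite -bigcup_mkord_ord; apply: bigcup_sub => j _ B [C mC <-].
exact: mf.
Qed.

Lemma measurable_addrV n (p : 'rV[R]_n) :
  measurable_fun setT (fun x : 'rV[R]_n => x + p).
Proof.
apply: measurable_rVP => i; under eq_fun do rewrite mxE.
by apply: measurable_funD => //; exact: measurable_coord_rV.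
Qed.

Lemma cons_rVl n (x : 'rV[R]_n) (t : R) j :
  @cons_rV R n (x, t) ord0 (lshift n j : 'I_(1 + n)) = t.
Proof. by rewrite /cons_rV (@row_mxEl _ _ 1 n) mxE !ord1 eqxx mulr1n. Qed.

Lemma cons_rVr n (x : 'rV[R]_n) (t : R) j :
  @cons_rV R n (x, t) ord0 (rshift 1 j : 'I_(1 + n)) = x ord0 j.
Proof. by rewrite /cons_rV (@row_mxEr _ _ 1 n). Qed.

Lemma vol_box_lty n (k : R) :
  measurable [set x : 'rV[R]_n | forall i, `|x ord0 i| <= k] /\
  (vol n [set x : 'rV[R]_n | forall i, `|x ord0 i| <= k]%R < +oo)%E.
Proof.
have mB m : measurable [set x : 'rV[R]_m | forall i, `|x ord0 i| <= k].
  rewrite (_ : [set x | _] = \bigcap_(i : 'I_m)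
     (setT `&` (fun x : 'rV[R]_m => x ord0 i : measurableTypeR R) @^-1` `[(- k), k])); last first.
    apply/seteqP; split => x /=.
      by move=> H i _; split => //=; rewrite in_itv/= -ler_norml.
    by move=> H i; have [_ /=] := H i Logic.I; rewrite in_itv/= -ler_norml.
  apply: fin_bigcap_measurable => // i _.
  by apply: measurable_coord_rV => //; exact: measurable_itv.
split => //; elim: n => [|n IH]; rewrite /vol /=.
  by rewrite diracE mem_set ?ltry// => -[].
rewrite /pushforward.
rewrite (_ : _ @^-1` _ = [set x : 'rV[R]_n | forall i, `|x ord0 i| <= k] `*` `[(- k), k]).
  rewrite product_measure1E; [|exact: mB|exact: measurable_itv].
  apply: lte_mul_pinfty => //; first by rewrite ge0_fin_numE.
  have := @lebesgue_measure_itv R `[(- k), k]%R; rewrite /= => H.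
  by rewrite [X in (X < _)%E]H; case: ifP => // _; rewrite -EFinD ltry.
apply/seteqP; split => [[x t] /= H|[x t] /= [H1]].
  split => [i|]; first by have := H (rshift 1 i : 'I_(1 + n)); rewrite cons_rVr.
  by have := H (lshift n ord0 : 'I_(1 + n)); rewrite cons_rVl in_itv/= ler_norml.
rewrite in_itv/= => H2 i; case: (split_ordP (i : 'I_(1 + n))) => j ->.
  by rewrite cons_rVl ler_norml.
by rewrite cons_rVr.
Qed.

Lemma vol_sigma_finite n : sigma_finite setT (vol n).
Proof.
exists (fun k => [set x : 'rV[R]_n | forall i, `|x ord0 i| <= k%:R]); last first.
  by move=> k; exact: vol_box_lty.
apply/seteqP; split => // x _.
pose M := \sum_i `|x ord0 i|.
exists (Num.truncn M).+1 => //= i.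
apply: (@le_trans _ _ M); first by rewrite /M (bigD1 i)//= lerDl sumr_ge0.
exact/ltW/truncnS_gt.
Qed.

HB.instance Definition _ n := Measure_isSigmaFinite.Build _ _ _ (vol n) (vol_sigma_finite n).

Local Open Scope ereal_scope.

Lemma integral_vol_cons n (f : 'rV[R]_n.+1 -> \bar R) :
  measurable_fun [set: _] f -> (forall x, 0 <= f x) ->
  \int[vol n.+1]_x f x = \int[vol n]_x \int[leb]_t f (cons_rV (x, t)).
Proof.
move=> mf f0.
transitivity (\int[vol n \x leb]_z f (cons_rV z)).
  transitivity (\int[measure_function_pushforward__canonical__measure_function_Measure
      (lebesgue_rV n \x leb) (@measurable_cons_rV R n)]_x f x); first by [].
  by rewrite ge0_integral_pushforward//; exact: measurable_cons_rV.
rewrite fubini_tonelli1//.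
exact: measurableT_comp mf (@measurable_cons_rV R n).
Qed.

Lemma integral_vol_translate n (p : 'rV[R]_n) (f : 'rV[R]_n -> \bar R) :
  measurable_fun [set: _] f -> (forall x, 0 <= f x) ->
  \int[vol n]_x f (x + p)%R = \int[vol n]_x f x.
Proof.
elim: n p f => [|n IH] p f mf f0.
  by apply: eq_integral => x _; congr f; apply/matrixP => i [].
rewrite !integral_vol_cons//; last by apply: measurableT_comp => //; exact: measurable_addrV.
have E x t : (cons_rV (x, t) + p)%R =
    cons_rV (x + rsubmx (p : 'rV_(1 + n)), t + p ord0 ord0)%R.
  apply/rowP => i; rewrite mxE; case: (split_ordP (i : 'I_(1 + n))) => j ->.
    by rewrite !cons_rVl; congr (_ + p _ _)%R; apply: val_inj; rewrite /= !ord1.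
  by rewrite !cons_rVr !mxE.
pose g (y : 'rV[R]_n) := \int[leb]_t f (cons_rV (y, t)).
have mfc : measurable_fun setT (fun z => f (@cons_rV R n z)).
  exact: measurableT_comp mf (@measurable_cons_rV R n).
transitivity (\int[vol n]_x g (x + rsubmx (p : 'rV_(1 + n)))%R).
  apply: eq_integral => x _; rewrite /g.
  rewrite -(@ge0_integral_affine _ 1 (p ord0 ord0) (fun t => f (cons_rV (_, t)))) ?oner_neq0//.
    rewrite normr1 mul1e; apply: eq_integral => t _.
    by rewrite E mul1r.
  by apply: (measurableT_comp mfc); exact: measurable_fun_pair.
rewrite IH//; last by move=> x; exact: integral_ge0.
apply: (@measurable_fun_fubini_tonelli_F _ _ _ _ _ leb (fun z => f (cons_rV z))) => //.
Qed.

End lebesgue_rV_theory.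
Arguments vol {R} n _.

Section borel_rV.
Context {R : realType}.
Implicit Types n : nat.

(** An open set is the union of the countably many boxes with rational centre contained in it. A
    half-width below $e/2$ suffices at a point with an $e$-ball inside [U], the centre being chosen
    within that half-width of the point. *)
Lemma open_measurable_rV n (U : set 'rV[R]_n) : open U -> measurable U.
Proof.
move=> oU.
pose c (a : 'rV[rat]_n) : 'rV[R]_n := map_mx ratr a.
pose B (p : 'rV[rat]_n * nat) := [set x : 'rV[R]_n | forall i, `|x ord0 i - c p.1 ord0 i| <= p.2.+1%:R^-1].
have mB p : measurable (B p).
  rewrite (_ : B p = \bigcap_(i : 'I_n)
     (setT `&` (fun x : 'rV[R]_n => x ord0 i : measurableTypeR R) @^-1`
        `[c p.1 ord0 i - p.2.+1%:R^-1, c p.1 ord0 i + p.2.+1%:R^-1])); last first.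
    apply/seteqP; split => x /=.
      by move=> H i _; split => //=; rewrite in_itv/= -ler_distl.
    by move=> H i; have [_ /=] := H i Logic.I; rewrite in_itv/= -ler_distl.
  apply: fin_bigcap_measurable => // i _.
  by apply: measurable_coord_rV => //; exact: measurable_itv.
rewrite (_ : U = \bigcup_(p in [set p | B p `<=` U]) B p); last first.
  apply/seteqP; split => [x Ux|x [p /= BU Bx]]; last exact: BU.
  have /(nbhs_ballP x) [e /= e0 eU] : nbhs x U by exact: open_nbhs_nbhs.
  have e20 : 0 < e / 2 by rewrite divr_gt0.
  pose k := Num.truncn (e / 2)^-1.
  have ke : k.+1%:R^-1 < e / 2.
    by rewrite invf_plt ?posrE//; exact: truncnS_gt.
  have /choice [r Hr] (i : 'I_n) : exists r : rat,
      x ord0 i - k.+1%:R^-1 < ratr r /\ ratr r < x ord0 i + k.+1%:R^-1.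
    have : x ord0 i - k.+1%:R^-1 < x ord0 i + k.+1%:R^-1.
      by rewrite ltrBlDr -addrA ltrDl -mulr2n pmulrn_lgt0.
    move=> /rat_in_itvoo [r]; rewrite in_itv/= => /andP[h1 h2]; exists r; by split.
  exists (\row_i r i, k) => /=; last first.
    move=> i; rewrite /c !mxE; have [h1 h2] := Hr i.
    move: h1 h2; rewrite /=; move: (k.+1%:R^-1 : R) => d *.
    by rewrite ler_distl; apply/andP; split; lra.
  move=> y By; apply: eU; split => // i j; rewrite ord1 /ball/=.
  have := By j; rewrite /c /= !mxE; have [h1 h2] := Hr j.
  rewrite ler_distl => /andP[h3 h4].
  move: ke h1 h2 h3 h4; move: (k.+1%:R^-1 : R) => d *.
  by rewrite ltr_distl; apply/andP; split; lra.
rewrite bigcup_mkcond; apply: countable_bigcupT_measurable => // p.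
by case: ifP.
Qed.

Lemma continuous_measurable_rV n (f : 'rV[R]_n -> R) :
  continuous f -> measurable_fun [set: 'rV[R]_n] f.
Proof.
move=> /continuousP cf; apply: (measurability _ (RGenOpens.measurableE R)).
move=> _ [_ [a [b ->] <-]]; rewrite setTI; apply: open_measurable_rV.
exact/cf/interval_open.
Qed.

Lemma measurable_shift_line n (q : 'rV[R]_n) :
  measurable_fun [set: 'rV[R]_n * R] (fun z => z.1 + z.2 *: q).
Proof.
apply: measurable_rVP => i; under eq_fun do rewrite mxE mxE.
apply: measurable_funD; last by apply: measurable_funM.
by apply: (measurableT_comp (@measurable_coord_rV R n i)).
Qed.

Local Open Scope ereal_scope.

(** On each line parallel to [q] the map is affine with slope [a], whence the factor $|a|$. No
    coordinates adapted to [q] are chosen: a weight [w] of integral one in an auxiliary variable is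
    inserted, and Tonelli with invariance under the translations $tq$ reduces everything to an
    affine substitution in that variable. *)
Lemma ge0_integral_shear n (a : R) (q : 'rV[R]_n) (theta : 'rV[R]_n -> R)
    (f : 'rV[R]_n -> \bar R) :
  a != 0%R -> measurable_fun [set: 'rV[R]_n] theta ->
  (forall x t, theta (x + t *: q) = theta x + (a - 1) * t)%R ->
  measurable_fun [set: 'rV[R]_n] f -> (forall x, 0 <= f x) ->
  `|a|%:E * \int[vol n]_x f (x + theta x *: q)%R = \int[vol n]_x f x.
Proof.
move=> a0 mth th mf f0.
pose w (t : R) : \bar R := (\1_(`[0%R, 1%R]%classic) t)%:E.
have w0 t : 0 <= w t by rewrite lee_fin.
have mw : measurable_fun [set: R] w.
  by apply/measurable_EFinP; exact: measurable_indic.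
have iw b : \int[lebesgue_measure]_t w (t + b)%R = 1.
  have := @ge0_integral_affine R 1 b w (oner_neq0 _) mw w0.
  under eq_integral do rewrite mul1r.
  rewrite normr1 mul1e => ->.
  rewrite integral_indic// setIT; have := @lebesgue_measure_itv R `[0%R, 1%R].
  by rewrite /= lte_fin ltr01 => ->; rewrite oppr0 adde0.
have ms := measurable_shift_line q.
have mfs : measurable_fun [set: 'rV[R]_n * R] (fun z => f (z.1 + z.2 *: q)%R).
  exact: measurableT_comp ms.
have mth1 : measurable_fun [set: 'rV[R]_n * R] (fun z => theta z.1).
  by apply: measurableT_comp.
pose F x := f (x + theta x *: q)%R.
have mF : measurable_fun [set: 'rV[R]_n] F.
  rewrite (_ : F = (fun z : 'rV[R]_n * R => f (z.1 + z.2 *: q)%R) \o (fun x => (x, theta x)))//.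
  by apply: (measurableT_comp mfs); exact: measurable_fun_pair.
transitivity (`|a|%:E * \int[vol n]_x \int[lebesgue_measure]_t (w t * F x)).
  congr *%E; apply: eq_integral => x _.
  rewrite ge0_integralZr//; last exact: f0.
  have := iw 0%R; rewrite (_ : (fun t => w (t + 0)%R) = w).
    by move=> ->; rewrite mul1e.
  by apply/funext => t; rewrite addr0.
(* For fixed $t$, replacing $x$ by $x+tq$ changes the total displacement along [q] into $at +
   \theta(x)$. *)
transitivity (`|a|%:E * \int[vol n]_x \int[lebesgue_measure]_t
    (w t * f (x + (a * t + theta x) *: q)%R)).
  apply: (congr1 (fun z => `|a|%:E * z)).
  rewrite (@fubini_tonelli _ _ _ _ _ (vol n) lebesgue_measure (fun z => w z.2 * F z.1)); last 2 first.
  - by apply: emeasurable_funM; apply: measurableT_comp.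
  - by move=> x; apply: mule_ge0; [exact: w0|exact: f0].
  rewrite (@fubini_tonelli _ _ _ _ _ (vol n) lebesgue_measure (fun z => w z.2 * f (z.1 + (a * z.2 + theta z.1) *: q)%R)); last 2 first.
  - apply: emeasurable_funM; first by apply: measurableT_comp.
    rewrite [X in measurable_fun _ X](_ : _ = (fun z : 'rV[R]_n * R => f (z.1 + z.2 *: q)%R) \o (fun z => (z.1, a * z.2 + theta z.1)%R))//.
    apply: (measurableT_comp mfs); apply: measurable_fun_pair => //.
    apply: measurable_funD => //; exact: measurable_funM.
  - by move=> x; apply: mule_ge0; [exact: w0|exact: f0].
  apply: eq_integral => t _ /=.
  rewrite -(@integral_vol_translate _ n (t *: q) (fun x => w t * F x)); last 2 first.
  - by apply: emeasurable_funM.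
  - by move=> x; apply: mule_ge0; [exact: w0|exact: f0].
  apply: eq_integral => x _; congr (_ * f _).
  by rewrite th -addrA -scalerDl; congr (x + _ *: q)%R; ring.
transitivity (\int[vol n]_x \int[lebesgue_measure]_s
    (w ((s - theta x) / a)%R * f (x + s *: q)%R)).
  have mG x : measurable_fun [set: R] (fun s => w ((s - theta x) / a)%R * f (x + s *: q)%R).
    apply: emeasurable_funM.
      apply: measurableT_comp => //; apply: measurable_funM => //.
      exact: measurable_funB.
    rewrite [X in measurable_fun _ X](_ : _ = (fun z : 'rV[R]_n * R => f (z.1 + z.2 *: q)%R) \o (fun s => (x, s)))//.
    by apply: (measurableT_comp mfs); exact: measurable_fun_pair.
  have G0 x s : 0 <= (w ((s - theta x) / a)%R * f (x + s *: q)%R).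
    by apply: mule_ge0; [exact: w0|exact: f0].
  rewrite -ge0_integralZl//; last 2 first.
  - apply: (@measurable_fun_fubini_tonelli_F _ _ _ _ _ lebesgue_measure
      (fun z : 'rV[R]_n * R => w z.2 * f (z.1 + (a * z.2 + theta z.1) *: q)%R)).
    2: by move=> z; apply: mule_ge0; [exact: w0|exact: f0].
    apply: emeasurable_funM; first by apply: measurableT_comp.
    rewrite [X in measurable_fun _ X](_ : _ = (fun z : 'rV[R]_n * R => f (z.1 + z.2 *: q)%R) \o (fun z => (z.1, a * z.2 + theta z.1)%R))//.
    apply: (measurableT_comp mfs); apply: measurable_fun_pair => //.
    apply: measurable_funD => //; exact: measurable_funM.
  - by move=> x _; apply: integral_ge0 => t _; apply: mule_ge0; [exact: w0|exact: f0].
  apply: eq_integral => x _.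
  rewrite -(ge0_integral_affine (theta x) a0 (mG x) (G0 x)); congr *%E.
  apply: eq_integral => t _; congr (w _ * _); field; exact: a0.
have mH : measurable_fun [set: 'rV[R]_n * R] (fun z => w (z.2 - theta z.1 / a)%R * f z.1).
  apply: emeasurable_funM; last by apply: measurableT_comp.
  apply: measurableT_comp => //; apply: measurable_funB => //.
  exact: measurable_funM.
have H0 z : 0 <= w (z.2 - theta z.1 / a)%R * f z.1.
  by apply: mule_ge0; [exact: w0|exact: f0].
(* For fixed $s$, the translation by $sq$ removes the displacement from [f]; only the weight still
   depends on $\theta$, and its integral in $s$ is one. *)
transitivity (\int[vol n]_x \int[lebesgue_measure]_s (w (s - theta x / a)%R * f x)).
  rewrite (@fubini_tonelli _ _ _ _ _ (vol n) lebesgue_measure (fun z => w ((z.2 - theta z.1) / a)%R * f (z.1 + z.2 *: q)%R)); last 2 first.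
  - apply: emeasurable_funM => //; apply: measurableT_comp => //.
    by apply: measurable_funM => //; exact: measurable_funB.
  - by move=> x; apply: mule_ge0; [exact: w0|exact: f0].
  have /= -> := @fubini_tonelli _ _ _ _ _ (vol n) lebesgue_measure _ mH H0.
  apply: eq_integral => s _ /=.
  rewrite -(@integral_vol_translate _ n (s *: q) (fun x => w (s - theta x / a)%R * f x)); last 2 first.
  - apply: emeasurable_funM => //; apply: measurableT_comp => //.
    by apply: measurable_funB => //; exact: measurable_funM.
  - by move=> x; exact: (H0 (x, s)).
  apply: eq_integral => x _; congr (w _ * _).
  by rewrite th; field; exact: a0.
apply: eq_integral => x _; rewrite ge0_integralZr//.
- by rewrite iw mul1e.
- by apply: measurableT_comp => //; exact: measurable_funB.
Qed.

End borel_rV.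

Lemma discriminant_le (R : realFieldType) (a b c : R) : 0 <= a -> 0 <= b ->
  (forall t, 0 <= a + 2 * t * c + t ^+ 2 * b) -> c ^+ 2 <= a * b.
Proof.
move=> a0 b0 H; have [b1|b1] := eqVneq b 0.
  subst b; have [->|c0] := eqVneq c 0; first by rewrite expr0n mulr0.
  have := H (- (a + 1) / (2 * c)).
  rewrite (_ : a + _ + _ = - 1) ?oppr_ge0 ?ler10//; by field.
have b2 : 0 < b by rewrite lt0r b1.
have := H (- c / b).
rewrite (_ : a + _ + _ = (a * b - c ^+ 2) / b); last by field.
by rewrite pmulr_lge0 ?invr_gt0// subr_ge0.
Qed.

(** * Square-integrable functions on the whole space *)

Section square_integrable.
Context {R : realType} {n : nat}.
Local Notation V := 'rV[R]_n.
Local Notation vol := (@vol R n).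
Implicit Types f g h : V -> R.

(** Functions are not identified almost everywhere: [nrm] is a seminorm, and [nrm (f - g) = 0]
    expresses equality in $L^2$. *)
Definition sq f :=
  measurable_fun [set: V] f /\ vol.-integrable setT (EFin \o (f * f)).
Definition ip f g : R := \int[vol]_x (f x * g x).
Definition nrm f := Num.sqrt (ip f f).

Lemma sq_mble f : sq f -> measurable_fun [set: V] f. Proof. by case. Qed.

Lemma sqM f g : sq f -> sq g -> vol.-integrable setT (EFin \o (f * g)).
Proof.
move=> [mf if2] [mg ig2].
have H := integrableD measurableT if2 ig2.
apply: le_integrable H => //.
  by apply/measurable_EFinP; exact: measurable_funM.
move=> x _ /=; rewrite lee_fin !fctE /=.
rewrite [leRHS]ger0_norm ?addr_ge0 -?expr2 ?sqr_ge0// normrM.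
rewrite -(real_normK (num_real (f x))) -(real_normK (num_real (g x))).
by have := sqr_ge0 (`|f x| - `|g x|); have := sqr_ge0 (`|f x| + `|g x|); nra.
Qed.

Lemma sqP f : measurable_fun [set: V] f ->
  (\int[vol]_x ((f x) ^+ 2)%:E < +oo)%E -> sq f.
Proof.
move=> mf foo; split => //; apply/integrableP; split.
  by apply/measurable_EFinP; exact: measurable_funM.
under eq_integral => x _ do rewrite /= !fctE ger0_norm -?expr2 ?sqr_ge0//.
exact: foo.
Qed.

Lemma sq_lty f : sq f -> (\int[vol]_x ((f x) ^+ 2)%:E < +oo)%E.
Proof.
move=> [mf /integrableP[_]].
by under eq_integral => x _ do rewrite /= !fctE ger0_norm -?expr2 ?sqr_ge0//.
Qed.

Lemma ip_EFin f : sq f -> (ip f f)%:E = (\int[vol]_x ((f x) ^+ 2)%:E)%E.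
Proof.
move=> sf; rewrite /ip /Rintegral fineK.
  by apply: eq_integral => x _; rewrite -expr2.
have [mf i] := sf; exact: (integrable_fin_num _ i).
Qed.

Lemma sq_dom f g (M : R) : measurable_fun [set: V] f -> sq g ->
  (forall x, `|f x| <= M * `|g x|) -> sq f.
Proof.
move=> mf sg fg; split => //.
have H := integrableZl measurableT (M ^+ 2) (proj2 sg).
apply: le_integrable H => //; first by apply/measurable_EFinP; exact: measurable_funM.
move=> x _ /=; rewrite lee_fin !fctE !normrM.
have f0 := normr_ge0 (f x); have := ler_pM f0 f0 (fg x) (fg x).
by rewrite -[`|M| * `|M|]normrM [`|M * M|]ger0_norm -?expr2 ?sqr_ge0// exprMn expr2.
Qed.

Lemma sqD f g : sq f -> sq g -> sq (f + g).
Proof.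
move=> sf sg; split; first by apply: measurable_funD; [case: sf|case: sg].
rewrite (_ : _ \o _ = (fun x => ((f * f)%R x)%:E + ((g * g)%R x)%:E +
   ((f * g)%R x)%:E + ((f * g)%R x)%:E)%E).
  have h := integrableD measurableT (proj2 sf) (proj2 sg).
  exact: (integrableD measurableT (integrableD measurableT h (sqM sf sg)) (sqM sf sg)).
by apply/funext => x; rewrite /= -!EFinD !fctE; congr EFin; ring.
Qed.

Lemma sqZ c f : sq f -> sq (c *: f).
Proof.
move=> sf; apply: (sq_dom (M := `|c|) _ sf); last by move=> x; rewrite !fctE normrM.
rewrite (_ : c *: f = cst c * f)//; apply: measurable_funM => //; exact: (proj1 sf).
Qed.

Lemma sqN f : sq f -> sq (- f).
Proof. by move=> /(sqZ (-1)); rewrite scaleN1r. Qed.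

Lemma sqB f g : sq f -> sq g -> sq (f - g).
Proof. by move=> sf sg; apply: sqD => //; exact: sqN. Qed.

Lemma sq0 : sq (0 : V -> R).
Proof.
apply: sqP; first exact: measurable_cst.
by rewrite (eq_integral (cst 0%E)) ?integral0 ?ltry// => x _; rewrite fctE expr0n.
Qed.

Lemma sq_sum (I : Type) (r : seq I) (P : pred I) (F : I -> V -> R) :
  (forall i, P i -> sq (F i)) -> sq (\sum_(i <- r | P i) F i).
Proof. by move=> sF; apply: (big_ind sq) => //; [exact: sq0|exact: sqD]. Qed.

Lemma sq_mulb (c : V -> R) f (M : R) : measurable_fun [set: V] c -> (forall x, `|c x| <= M) ->
  sq f -> sq (c * f).
Proof.
move=> mc cM sf; apply: (sq_dom (M := M) _ sf).
  by apply: measurable_funM => //; exact: (proj1 sf).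
by move=> x; rewrite !fctE normrM ler_wpM2r.
Qed.

Lemma ipC f g : ip f g = ip g f.
Proof. by apply: eq_Rintegral => x _; rewrite mulrC. Qed.

Lemma ipDl f g h : sq f -> sq g -> sq h -> ip (f + g) h = ip f h + ip g h.
Proof.
move=> sf sg sh; rewrite /ip -RintegralD//; [|exact: (sqM sf)|exact: (sqM sg)].
by apply: eq_Rintegral => x _; rewrite mulrDl.
Qed.

Lemma ipZl c f g : sq f -> sq g -> ip (c *: f) g = c * ip f g.
Proof.
move=> sf sg; rewrite /ip -RintegralZl//; last exact: (sqM sf).
by apply: eq_Rintegral => x _; rewrite mulrA.
Qed.

Lemma ipNl f g : sq f -> sq g -> ip (- f) g = - ip f g.
Proof. by move=> sf sg; rewrite -scaleN1r ipZl// mulN1r. Qed.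

Lemma ipBl f g h : sq f -> sq g -> sq h -> ip (f - g) h = ip f h - ip g h.
Proof. by move=> sf sg sh; rewrite ipDl// ?ipNl//; exact: sqN. Qed.

Lemma ipDr f g h : sq f -> sq g -> sq h -> ip h (f + g) = ip h f + ip h g.
Proof. by move=> sf sg sh; rewrite ipC ipDl// !(ipC h). Qed.
Lemma ipBr f g h : sq f -> sq g -> sq h -> ip h (f - g) = ip h f - ip h g.
Proof. by move=> sf sg sh; rewrite ipC ipBl// !(ipC h). Qed.
Lemma ipZr c f g : sq f -> sq g -> ip g (c *: f) = c * ip g f.
Proof. by move=> sf sg; rewrite ipC ipZl// (ipC g). Qed.
Lemma ipNr f g : sq f -> sq g -> ip g (- f) = - ip g f.
Proof. by move=> sf sg; rewrite ipC ipNl// (ipC g). Qed.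

Lemma ip0l f : ip 0 f = 0.
Proof.
rewrite /ip; under eq_Rintegral do rewrite [X in X * _]/(0%R) mul0r.
by rewrite Rintegral_cst// mul0r.
Qed.
Lemma ip0r f : ip f 0 = 0. Proof. by rewrite ipC ip0l. Qed.

Lemma ip_suml (I : Type) (r : seq I) (P : pred I) (F : I -> V -> R) g :
  (forall i, P i -> sq (F i)) -> sq g ->
  ip (\sum_(i <- r | P i) F i) g = \sum_(i <- r | P i) ip (F i) g.
Proof.
move=> sF sg; elim: r => [|i r IH]; first by rewrite !big_nil ip0l.
rewrite !big_cons; case: ifP => // Pi; rewrite ipDl ?IH//; first exact: sF.
exact: sq_sum.
Qed.

Lemma ip_sumr (I : Type) (r : seq I) (P : pred I) (F : I -> V -> R) g :
  (forall i, P i -> sq (F i)) -> sq g ->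
  ip g (\sum_(i <- r | P i) F i) = \sum_(i <- r | P i) ip g (F i).
Proof. by move=> sF sg; rewrite ipC ip_suml//; apply: eq_bigr => i _; rewrite ipC. Qed.

Lemma ip_mull (c : V -> R) f g : ip (c * f) g = ip f (c * g).
Proof. by apply: eq_Rintegral => x _; rewrite !fctE; ring. Qed.

Lemma ip_ge0 f : 0 <= ip f f.
Proof. by apply: Rintegral_ge0 => x _; rewrite -expr2 sqr_ge0. Qed.

Lemma nrm_ge0 f : 0 <= nrm f. Proof. exact: sqrtr_ge0. Qed.
Lemma nrm_sq f : nrm f ^+ 2 = ip f f. Proof. by rewrite sqr_sqrtr// ip_ge0. Qed.
Lemma nrm0 : nrm 0 = 0. Proof. by rewrite /nrm ip0l sqrtr0. Qed.

Lemma ip_CS f g : sq f -> sq g -> `|ip f g| <= nrm f * nrm g.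
Proof.
move=> sf sg.
have H t : 0 <= ip f f + 2 * t * ip f g + t ^+ 2 * ip g g.
  have := ip_ge0 (f + t *: g).
  rewrite ipDl ?ipDr ?ipZl ?ipZr ?(ipC g f)//; try exact: sqZ; last by apply: sqD => //; exact: sqZ.
  by move=> /le_trans; apply; rewrite le_eqVlt; apply/orP; left; apply/eqP; ring.
rewrite -ler_sqr ?nnegrE ?mulr_ge0 ?nrm_ge0// exprMn !nrm_sq real_normK ?num_real//.
exact: discriminant_le (ip_ge0 f) (ip_ge0 g) H.
Qed.

Lemma nrmD f g : sq f -> sq g -> nrm (f + g) <= nrm f + nrm g.
Proof.
move=> sf sg; rewrite -ler_sqr ?nnegrE ?addr_ge0 ?nrm_ge0// nrm_sq.
rewrite ipDl ?ipDr ?(ipC g f) ?sqrrD ?nrm_sq//; last exact: sqD.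
have := ip_CS sf sg; rewrite ler_norml => /andP[_]; move: (nrm f * nrm g) => m; lra.
Qed.

Lemma nrmZ c f : sq f -> nrm (c *: f) = `|c| * nrm f.
Proof.
move=> sf; rewrite /nrm ipZl ?ipZr//; last exact: sqZ.
by rewrite mulrA -expr2 sqrtrM ?sqr_ge0// sqrtr_sqr.
Qed.

Lemma nrmN f : sq f -> nrm (- f) = nrm f.
Proof. by move=> sf; rewrite -scaleN1r nrmZ// normrN1 mul1r. Qed.

Lemma nrmB f g : sq f -> sq g -> nrm (f - g) <= nrm f + nrm g.
Proof. by move=> sf sg; rewrite -(nrmN sg); apply: nrmD => //; exact: sqN. Qed.

Lemma nrm_distC f g : sq f -> sq g -> nrm (f - g) = nrm (g - f).
Proof. by move=> sf sg; rewrite -nrmN ?opprB//; exact: sqB. Qed.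

Lemma nrm_sum (I : Type) (r : seq I) (P : pred I) (F : I -> V -> R) :
  (forall i, P i -> sq (F i)) ->
  nrm (\sum_(i <- r | P i) F i) <= \sum_(i <- r | P i) nrm (F i).
Proof.
move=> sF; elim: r => [|i r IH]; first by rewrite !big_nil nrm0.
rewrite !big_cons; case: ifP => // Pi.
by apply: (le_trans (nrmD (sF _ Pi) _)); [exact: sq_sum|rewrite lerD2l].
Qed.

Lemma nrm_le f g (M : R) : sq f -> sq g -> 0 <= M ->
  (forall x, `|f x| <= M * `|g x|) -> nrm f <= M * nrm g.
Proof.
move=> sf sg M0 fg; rewrite -(ger0_norm M0) -nrmZ// /nrm ler_wsqrtr//.
apply: le_Rintegral => //; [exact: (sqM sf)|exact: (sqM (sqZ M sg) (sqZ M sg))|].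
move=> x _; rewrite !fctE -!expr2 -[leLHS]real_normK ?num_real// exprMn.
rewrite -[g x ^+ 2]real_normK ?num_real// -exprMn ler_sqr ?nnegrE ?mulr_ge0//.
Qed.

Lemma nrm_mulb (c : V -> R) f (M : R) : measurable_fun [set: V] c -> (forall x, `|c x| <= M) ->
  sq f -> nrm (c * f) <= M * nrm f.
Proof.
move=> mc cM sf; apply: nrm_le => //; first exact: sq_mulb cM sf.
  exact: le_trans (cM 0).
by move=> x; rewrite !fctE normrM ler_wpM2r.
Qed.

Lemma nrm_eq0 f : sq f -> nrm f = 0 -> {ae vol, forall x, f x = 0}.
Proof.
move=> sf f0.
have : (\int[vol]_x `|((f x) ^+ 2)%:E|)%E = 0%E.
  under eq_integral => x _ do rewrite /= ger0_norm ?sqr_ge0//.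
  by rewrite -ip_EFin// -nrm_sq f0 expr0n.
move=> /ae_eq_integral_abs H; have {}H : ae_eq vol setT (fun x => ((f x) ^+ 2)%:E) (cst 0%E).
  apply: H => //; apply/measurable_EFinP; apply: measurable_funX; exact: (proj1 sf).
by apply: filterS H => x /(_ Logic.I) /= [] /eqP; rewrite sqrf_eq0 => /eqP.
Qed.

Lemma ip_ae f g h : sq f -> sq g -> sq h -> {ae vol, forall x, f x = g x} -> ip f h = ip g h.
Proof.
move=> sf sg sh fg; rewrite /ip /Rintegral; congr fine.
apply: ae_eq_integral => //; try (apply/measurable_EFinP; apply: measurable_funM; exact: sq_mble).
by apply: filterS fg => x -> _.
Qed.

Lemma nrm_ae f g : sq f -> sq g -> {ae vol, forall x, f x = g x} -> nrm f = nrm g.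
Proof.
move=> sf sg fg; rewrite /nrm; congr Num.sqrt.
by rewrite (ip_ae sf sg sf fg) ipC (ip_ae sf sg sg fg).
Qed.

End square_integrable.
Arguments sq {R n} f.

(** * Sequences tending to zero *)

Section tends0.
Context {R : realType}.
Implicit Types u v : nat -> R.

(** One-sided: for the nonnegative norms and errors it is applied to, this is convergence to 0, and
    upper bounds alone prove it. *)
Definition tends0 u := forall e, 0 < e -> exists N, forall k, (N <= k)%N -> u k <= e.

Lemma tends0_le u v : (forall k, u k <= v k) -> tends0 v -> tends0 u.
Proof. by move=> uv v0 e /v0[N H]; exists N => k /H; exact: le_trans. Qed.

Lemma tends0D u v : tends0 u -> tends0 v -> tends0 (fun k => u k + v k).
Proof.
move=> u0 v0 e e0; have e2 : 0 < e / 2 by rewrite divr_gt0.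
have [N H] := u0 _ e2; have [M K] := v0 _ e2.
exists (maxn N M) => k; rewrite geq_max => /andP[/H h1 /K h2].
by rewrite [e]splitr lerD.
Qed.

Lemma tends0Z c u : 0 <= c -> tends0 u -> tends0 (fun k => c * u k).
Proof.
move=> c0 u0 e e0; have c1 : 0 < c + 1 by rewrite ltr_pwDr.
have [N H] := u0 (e / (c + 1)) (divr_gt0 e0 c1).
exists N => k /H h; apply: (@le_trans _ _ ((c + 1) * (e / (c + 1)))).
  have [uk|uk] := leP 0 (u k).
    by apply: ler_pM => //; rewrite lerDl.
  apply: (@le_trans _ _ 0); first by rewrite mulr_ge0_le0// ltW.
  by rewrite mulr_ge0 ?divr_ge0// ltW.
by rewrite mulrC divfK ?gt_eqF.
Qed.

Lemma tends0_const0 : tends0 (fun=> 0).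
Proof. by move=> e e0; exists 0%N => k _; exact: ltW. Qed.

Lemma tends0_sum (I : finType) (F : I -> nat -> R) :
  (forall i, tends0 (F i)) -> tends0 (fun k => \sum_i F i k).
Proof.
move=> H; elim: (index_enum I) => [|i r IH].
  by apply: (tends0_le _ tends0_const0) => k; rewrite big_nil.
by apply: (tends0_le _ (tends0D (H i) IH)) => k; rewrite big_cons.
Qed.

Lemma tends0_lim a b u : tends0 u -> (forall k, a <= b + u k) -> a <= b.
Proof.
move=> u0 H; apply/ler_addgt0Pr => e e0; have [N K] := u0 e e0.
by apply: (le_trans (H N)); rewrite lerD2l; exact: K.
Qed.

Lemma tends0_inv : tends0 (fun k => k.+1%:R^-1).
Proof.
move=> e e0; exists (Num.truncn e^-1) => k Nk.
rewrite invf_ple ?posrE// ; apply/ltW/(lt_le_trans (truncnS_gt _)).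
by rewrite ler_nat.
Qed.

End tends0.

(** * Completeness of $L^2$ *)

Section completeness.
Context {R : realType} {n : nat}.
Local Notation V := 'rV[R]_n.
Local Notation vol := (@vol R n).

Lemma L2_complete (f : nat -> V -> R) : (forall k, sq (f k)) ->
  (forall e, 0 < e -> exists N, forall i j, (N <= i)%N -> (N <= j)%N ->
     nrm (f i - f j) <= e) ->
  exists2 g, sq g & tends0 (fun k => nrm (f k - g)).
Proof.
move=> sf cf.
(* With $\|d_k\|^2 \le 4^{-k}2^{-k-1}$ the sum of $4^k d_k^2$ has integral at most 1. Where this sum
   [G] is finite, $|d_k| \le \sqrt{G}\,2^{-k}$, so the subsequence converges absolutely. *)
pose eps k : R := Num.sqrt (((4 ^+ k) * 2 ^+ k.+1)^-1).
have w0 k : 0 < (4 ^+ k * 2 ^+ k.+1 : R) by rewrite mulr_gt0 ?exprn_gt0.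
have eps0 k : 0 < eps k by rewrite sqrtr_gt0 invr_gt0.
have eps0' k : 0 <= eps k by exact: ltW.
have epsE k : eps k ^+ 2 = (4 ^+ k * 2 ^+ k.+1)^-1.
  by rewrite sqr_sqrtr// invr_ge0 ltW.
have /choice[N0 HN0] k := cf _ (eps0 k).
pose N k := (\sum_(j < k.+1) N0 j)%N.
have NS k : (N k <= N k.+1)%N by rewrite /N [X in (_ <= X)%N]big_ord_recr /= leq_addr.
have N0N k : (N0 k <= N k)%N by rewrite /N big_ord_recr /= leq_addl.
have Nmono j k : (j <= k)%N -> (N j <= N k)%N.
  move=> /subnK <-; elim: (k - j)%N => // m IH; exact: leq_trans IH (NS _).
pose h k := f (N k).
have sh k : sq (h k) by exact: sf.
have hh i j k : (k <= i)%N -> (k <= j)%N -> nrm (h i - h j) <= eps k.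
  by move=> ki kj; apply: HN0; apply: leq_trans (N0N _) (Nmono _ _ _).
pose d k := h k.+1 - h k.
have sd k : sq (d k) by exact: sqB.
pose G (x : V) := (\sum_(k <oo) (4 ^+ k * (d k x) ^+ 2)%:E)%E.
have G1_0 k x : (0 <= (4 ^+ k * (d k x) ^+ 2)%:E)%E.
  by rewrite lee_fin mulr_ge0 ?sqr_ge0 ?exprn_ge0.
have mG1 k : measurable_fun [set: V] (fun x => (4 ^+ k * (d k x) ^+ 2)%:E).
  apply/measurable_EFinP; apply: measurable_funM => //; apply: measurable_funX.
  exact: sq_mble.
have mG : measurable_fun [set: V] G.
  by apply: ge0_emeasurable_sum => //.
have GI : (\int[vol]_x G x <= 1)%E.
  rewrite /G integral_nneseries//.
  apply: le_trans (epsilon_trick0 xpredT (@ler01 R)).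
  apply: lee_nneseries => [k _ _|k _]; first exact: integral_ge0.
  under eq_integral do rewrite EFinM.
  rewrite ge0_integralZl//; last first.
  - by move=> x _; rewrite lee_fin sqr_ge0.
  - by apply/measurable_EFinP; apply: measurable_funX; exact: sq_mble.
  rewrite -ip_EFin// -EFinM lee_fin -nrm_sq.
  have H : nrm (d k) <= eps k by apply: hh.
  have : nrm (d k) ^+ 2 <= eps k ^+ 2 by rewrite ler_sqr ?nnegrE ?nrm_ge0.
  rewrite epsE => H2.
  apply: (le_trans (ler_wpM2l _ H2)); first by rewrite exprn_ge0.
  rewrite invfM mulrA divff ?mul1r ?natrX ?div1r// expf_neq0//.
pose A := [set x | G x \is a fin_num].
have mA : measurable A.
  rewrite -[A]setTI; apply: (emeasurable_fin_num _ mG); exact: measurableT.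
have aeA : {ae vol, forall x, A x}.
  have : vol.-integrable setT G.
    apply/integrableP; split => //; apply: le_lt_trans (ltry 1).
    by under eq_integral do rewrite gee0_abs ?nneseries_ge0//.
  by move=> /(integrable_ae measurableT); apply: filterS => x /(_ Logic.I).
(* Setting the functions to 0 on the null set where [G] is infinite makes the limit exist
   everywhere, hence measurable. *)
pose h' k := \1_A * h k.
have sh' k : sq (h' k).
  apply: (sq_dom (M := 1) _ (sh k)).
    by apply: measurable_funM; [exact: measurable_indic|exact: sq_mble].
  move=> x; rewrite mul1r /h' !fctE normrM indicE; case: (x \in A); first by rewrite normr1 mul1r.
  by rewrite normr0 mul0r.
have hh' k : {ae vol, forall x, h' k x = h k x}.
  by apply: filterS aeA => x Ax; rewrite /h' !fctE indicE mem_set// mul1r.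
have cvgh x : A x -> cvgn (fun k => h k x).
  move=> Ax; pose K := Num.sqrt (fine (G x)).
  have dk k : `|d k x| <= K * (2^-1) ^+ k.
    rewrite exprVn ler_pdivlMr ?exprn_gt0// -ler_sqr ?nnegrE ?mulr_ge0 ?exprn_ge0 ?sqrtr_ge0//.
    rewrite sqr_sqrtr; last by apply: fine_ge0; exact: nneseries_ge0.
    rewrite -lee_fin fineK// exprMn real_normK ?num_real// -exprM mulnC exprM -natrX mulrC.
    apply: le_trans (nneseries_lim_ge k.+1 _) => //.
    rewrite big_mkord big_ord_recr /= leeDr// sume_ge0//.
  have : cvgn (series (fun k => d k x)).
    apply: normed_cvg; apply: (series_le_cvg _ _ dk) => //.
      by move=> k; rewrite mulr_ge0 ?sqrtr_ge0// exprn_ge0.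
    by apply: is_cvg_geometric_series; rewrite ger0_norm// invf_lt1// ltr1n.
  rewrite (_ : series _ = fun k => h k x - h 0%N x); last first.
    by apply/funext => k; rewrite /series /= telescope_sumr.
  move=> /(is_cvgD (is_cvg_cst (h 0%N x))).
  rewrite (_ : (fun=> h 0%N x) + _ = (fun k => h k x))//.
  by apply/funext => k; rewrite fctE addrC subrK.
pose g (x : V) : R := limn (fun k => h' k x).
have cvgg x : h' k x @[k --> \oo] --> g x.
  have [xA|xA] := pselect (A x).
    apply: cvgP; rewrite /h'; under eq_fun do rewrite !fctE indicE mem_set// mul1r.
    exact: cvgh.
  rewrite /g /h'; under eq_fun do rewrite !fctE indicE memNset// mul0r.
  by apply: cvgP; exact: cvg_cst.
have mg : measurable_fun [set: V] g.
  by apply: (@measurable_fun_cvg _ _ _ setT h') => // k; exact: sq_mble.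
(* Fatou's lemma applied to $(h'_j - h'_i)^2$ as $j$ grows. *)
have key i : (\int[vol]_x ((g x - h' i x) ^+ 2)%:E <= (eps i ^+ 2)%:E)%E.
  have mhh j : measurable_fun [set: V] (fun x => ((h' j x - h' i x) ^+ 2)%:E).
    apply/measurable_EFinP; apply: measurable_funX.
    by apply: measurable_funB; exact: sq_mble.
  rewrite (_ : (\int[vol]_x _)%E =
      (\int[vol]_x limn_einf (fun j => ((h' j x - h' i x) ^+ 2)%:E))%E); last first.
    apply: eq_integral => x _; apply/esym.
    have : ((h' j x - h' i x) ^+ 2)%:E @[j --> \oo] --> ((g x - h' i x) ^+ 2)%:E.
      apply: cvg_EFin; first exact: nearW.
      apply: (@cvgM R _ _ _ (fun j => h' j x - h' i x) (fun j => h' j x - h' i x));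
      by apply: cvgB => //; exact: cvg_cst.
    by move=> /cvg_limn_einf_sup[].
  apply: (le_trans (fatou _ _ _ _)) => //.
    by move=> j x _; rewrite lee_fin sqr_ge0.
  rewrite limn_einf_lim; apply: lime_le; first exact: is_cvg_einfs.
  near=> m; rewrite /einfs /=.
  have im : (i <= m)%N by near: m; exact: nbhs_infty_ge.
  apply: le_trans (ereal_inf_lbound _) _.
    by exists m => //=; exact: leqnn.
  rewrite -ip_EFin; last exact: sqB.
  rewrite lee_fin -nrm_sq ler_sqr ?nnegrE ?nrm_ge0//.
  rewrite (@nrm_ae _ _ _ (h m - h i)); [|exact: sqB|exact: sqB|].
    exact: hh.
  by apply: filterS2 (hh' m) (hh' i) => x h1 h2; rewrite !fctE h1 h2.
have sgh i : sq (g - h' i).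
  apply: sqP; first by apply: measurable_funB => //; exact: sq_mble.
  exact: le_lt_trans (key i) (ltry _).
have sg : sq g by rewrite -(subrK (h' 0%N) g); exact: sqD.
exists g => // e e0.
have e2 : 0 < e / 2 by rewrite divr_gt0.
have [i Hi] : exists i, eps i <= e / 2.
  have [i Hi] := tends0_inv (exprn_gt0 2 e2).
  exists i; rewrite -ler_sqr ?nnegrE ?(ltW e2)// epsE.
  apply: le_trans (Hi i (leqnn _)).
  rewrite lef_pV2 ?posrE// -!natrX -natrM ler_nat.
  apply: (@leq_trans (2 ^ i.+1)%N); first exact/ltnW/ltn_expl.
  apply: leq_pmull.
  by rewrite expn_gt0.
exists (maxn (N i) (N0 i)) => k; rewrite geq_max => /andP[_ ki].
rewrite (_ : f k - g = (f k - h i) - (g - h i)); last by rewrite opprB addrA subrK.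
apply: (le_trans (nrmB _ _)); [exact: sqB|exact: sqB|].
rewrite [e]splitr lerD//.
  apply: le_trans Hi; apply: HN0 => //; exact: N0N.
apply: le_trans Hi.
rewrite (@nrm_ae _ _ _ (g - h' i)); [|exact: sqB|exact: sgh|]; last first.
  by apply: filterS (hh' i) => x h1; rewrite !fctE h1.
by rewrite -ler_sqr ?nnegrE ?nrm_ge0// nrm_sq -lee_fin ip_EFin//; exact: key.
Unshelve. all: by end_near. Qed.

End completeness.

(** * Approximate Riesz representation *)

Section riesz.
Context {R : realType}.

(* An approximate minimiser of [b u u - 2 l u] approximately represents [l]. *)
Lemma riesz_approx (E : lmodType R) (P : set E) (b : E -> E -> R) (l : E -> R) (C : R) :
  P 0 -> (forall t u v, P u -> P v -> P (t *: u + v)) ->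
  (forall u v, P u -> P v -> b u v = b v u) ->
  (forall t u v w, P u -> P v -> P w -> b (t *: u + v) w = t * b u w + b v w) ->
  (forall u, P u -> 0 <= b u u) ->
  (forall t u v, P u -> P v -> l (t *: u + v) = t * l u + l v) ->
  (forall u, P u -> l u ^+ 2 <= C * b u u) ->
  exists2 phi : nat -> E, (forall k, P (phi k)) &
    forall k psi, P psi ->
      `|b (phi k) psi - l psi| <= k.+1%:R^-1 * Num.sqrt (b psi psi).
Proof.
move=> P0 Plin bC blin b0 llin lC.
pose J u := b u u - 2 * l u.
have [C0 C00 lC0] : exists2 C0, 0 < C0 & forall u, P u -> l u ^+ 2 <= C0 * b u u.
  exists (`|C| + 1); first by rewrite ltr_wpDl.
  move=> u Pu; apply: (le_trans (lC u Pu)); rewrite ler_wpM2r ?b0//.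
  by rewrite (le_trans (ler_norm _))// lerDl.
have Jlb u : P u -> - C0 <= J u.
  move=> Pu; rewrite /J; have := lC0 u Pu; have := b0 u Pu; move: (b u u) (l u) => x y x0 xy.
  have := sqr_ge0 (C0 - y).
  have h : C0 * (x - 2 * y + C0) >= (C0 - y) ^+ 2 by nra.
  move=> h0; have := le_trans h0 h; rewrite pmulr_rge0//; lra.
pose S := [set J u | u in P].
have S0 : S !=set0 by exists (J 0), 0.
have Slb : has_lbound S by exists (- C0) => _ [u Pu <-]; exact: Jlb.
have Sinf : has_inf S by [].
have /choice[phi Hphi] (k : nat) : exists u, P u /\ J u < inf S + (k.+1%:R^-1) ^+ 2.
  have e0 : 0 < (k.+1%:R^-1 : R) ^+ 2 by rewrite exprn_gt0// invr_gt0.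
  by have [_ [u Pu <-] Hu] := inf_adherent e0 Sinf; exists u.
exists phi => [k|k psi Ppsi]; first by have [] := Hphi k.
have [Pk Jk] := Hphi k.
(* Near-minimality makes $J(\varphi_k + t\psi) - J(\varphi_k) + (k+1)^{-2}$ a quadratic polynomial
   in $t$ that is nonnegative everywhere; its discriminant gives the bound. *)
have D : (b (phi k) psi - l psi) ^+ 2 <= (k.+1%:R^-1) ^+ 2 * b psi psi.
  apply: discriminant_le; [exact: sqr_ge0|exact: b0|] => t.
  have Pt : P (t *: psi + phi k) by exact: Plin.
  have : inf S <= J (t *: psi + phi k) by apply: inf_lbound => //; exists (t *: psi + phi k).
  rewrite /J in Jk; rewrite /J llin// blin// (bC psi)// (bC (phi k) (_ + _))// !blin// (bC psi (phi k))//.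
  move: Jk; move: (b psi psi) (b (phi k) psi) (b (phi k) (phi k)) (l psi) (l (phi k)) (inf S) ((k.+1%:R^-1) ^+ 2) => *.
  nra.
rewrite -ler_sqr ?nnegrE// ?mulr_ge0 ?sqrtr_ge0// exprMn sqr_sqrtr ?b0//.
by rewrite real_normK// num_real.
Qed.

End riesz.

(** * Continuous functions with bounded support *)

Section compact_support.
Context {R : realType} {n : nat}.
Local Notation V := 'rV[R]_n.
Local Notation vol := (@vol R n).
Implicit Types f g h : V -> R.

Lemma coord_le_norm (x : V) i : `|x ord0 i| <= `|x|.
Proof. by rewrite [leRHS]/Num.norm /= mx_normrE; exact: (le_bigmax _ (fun ij => `|x ij.1 ij.2|) (ord0, i)). Qed.

Lemma norm_le_coord (x : V) M : 0 <= M -> (forall i, `|x ord0 i| <= M) -> `|x| <= M.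
Proof.
move=> M0 H; rewrite [leLHS]/Num.norm /= mx_normrE; apply: bigmax_le => // -[i j] _ /=.
by rewrite ord1.
Qed.

Definition bs (L : R) f := forall x, L < `|x| -> f x = 0.
Definition cc (L : R) f := continuous f /\ bs L f.

Lemma compact_cball (L : R) : compact [set x : V | `|x| <= L].
Proof.
apply: bounded_closed_compact.
  by exists `|L|; split; [exact: normr_real|] => M LM x /= /le_trans; apply; rewrite (le_trans (ler_norm L))// ltW.
apply: (@closed_comp _ _ (fun x : V => `|x|) [set y | y <= L]); last exact: closed_le.
by move=> x _; exact: norm_continuous.
Qed.

Lemma cc_bounded L f : cc L f -> exists2 M, 0 <= M & forall x, `|f x| <= M.
Proof.
move=> [cf bf]; have [L0|L0] := ltP L 0.
  by exists 0 => // x; rewrite bf ?normr0//; exact: lt_le_trans L0 _.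
have cK := @compact_cball L.
have : compact (f @` [set x : V | `|x| <= L]).
  by apply: continuous_compact => //; exact: continuous_subspaceT.
move=> /compact_bounded [M [Mr HM]]; exists (`|M| + 1); first by rewrite addr_ge0.
move=> x; have [xL|xL] := leP `|x| L; last by rewrite bf// normr0 addr_ge0.
apply: (HM (`|M| + 1)); last by exists x.
by rewrite (le_lt_trans (ler_norm M))// ltrDl.
Qed.

Lemma cc_sq L f : cc L f -> sq f.
Proof.
move=> cf; have [M M0 fM] := cc_bounded cf; have [cof bf] := cf.
have mf : measurable_fun [set: V] f by exact: continuous_measurable_rV.
pose B := [set x : V | forall i, `|x ord0 i| <= L].
have [mB Boo] := @vol_box_lty R n L.
apply: sqP => //.
apply: (@le_lt_trans _ _ (\int[vol]_x ((M ^+ 2)%:E * (\1_B x)%:E))%E).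
  apply: ge0_le_integral => //.
  - by move=> x _; rewrite lee_fin sqr_ge0.
  - by apply/measurable_EFinP; exact: measurable_funX.
  - by apply: emeasurable_funM => //; apply/measurable_EFinP; exact: measurable_indic.
  move=> x _; rewrite -EFinM lee_fin indicE; case: (boolP (x \in B)) => [_|].
    by rewrite mulr1 -[leLHS]real_normK ?num_real// ler_sqr ?nnegrE.
  move=> xB; rewrite mulr0 bf ?expr0n//; rewrite ltNge; apply: contra xB => xL.
  by rewrite inE => i; exact: le_trans (coord_le_norm x i) xL.
rewrite ge0_integralZl//; last 2 first.
- by apply/measurable_EFinP; exact: measurable_indic.
- by rewrite lee_fin sqr_ge0.
rewrite integral_indic// setIT; apply: lte_mul_pinfty => //.
by rewrite lee_fin sqr_ge0.
Qed.

Lemma cc_weak L M f : L <= M -> cc L f -> cc M f.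
Proof. by move=> LM [cf bf]; split => // x Mx; apply: bf; exact: le_lt_trans Mx. Qed.

(** Turns uniform convergence with supports in a fixed ball into convergence in $L^2$. *)
Lemma nrm_sup_bound L : exists2 C, 0 <= C &
  forall f, sq f -> bs L f -> forall M, 0 <= M -> (forall x, `|f x| <= M) -> nrm f <= C * M.
Proof.
pose B := [set x : V | forall i, `|x ord0 i| <= L].
have [mB Boo] := @vol_box_lty R n L.
have sB : sq (\1_B : V -> R).
  apply: sqP; first exact: measurable_indic.
  rewrite (eq_integral (fun x => (\1_B x)%:E)).
    by rewrite integral_indic// setIT.
  by move=> x _; rewrite indicE; case: (_ \in _); rewrite ?expr1n ?expr0n.
exists (nrm (\1_B : V -> R)); first exact: nrm_ge0.
move=> f sf bf M M0 fM; rewrite mulrC; apply: nrm_le => // x.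
rewrite indicE; case: (boolP (x \in B)) => [_|xB]; first by rewrite normr1 mulr1.
rewrite bf ?normr0 ?mulr0//; rewrite ltNge; apply: contra xB => xL.
by rewrite inE => i; exact: le_trans (coord_le_norm x i) xL.
Qed.

End compact_support.

(** * Change of variables by shears *)

Section change_of_variables.
Context {R : realType} {n : nat}.
Local Notation V := 'rV[R]_n.
Local Notation vol := (@vol R n).
Implicit Types f g h : V -> R.
Variables (a : R) (q : V) (theta : V -> R).
Hypothesis a0 : a != 0.
Hypothesis mth : measurable_fun [set: V] theta.
Hypothesis th : forall x t, theta (x + t *: q) = theta x + (a - 1) * t.
Let T x := x + theta x *: q.

Lemma measurable_shear : measurable_fun [set: V] T.
Proof.
rewrite (_ : T = (fun z : V * R => z.1 + z.2 *: q) \o (fun x => (x, theta x)))//.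
by apply: (measurableT_comp (measurable_shift_line q)); exact: measurable_fun_pair.
Qed.

Lemma sq_shear f : sq f -> sq (f \o T).
Proof.
move=> sf; apply: sqP.
  exact: measurableT_comp (sq_mble sf) measurable_shear.
have := sq_lty sf; rewrite -(@ge0_integral_shear _ _ a q theta)//; last 2 first.
- by apply/measurable_EFinP; apply: measurable_funX; exact: sq_mble.
- by move=> x; rewrite lee_fin sqr_ge0.
rewrite -[X in (_ * X)%E]/(\int[vol]_x ((f \o T) x ^+ 2)%:E)%E.
have : (0 <= \int[vol]_x ((f \o T) x ^+ 2)%:E)%E.
  by apply: integral_ge0 => x _; rewrite lee_fin sqr_ge0.
have a1 : 0 < `|a| by rewrite normr_gt0.
case: (\int[vol]_x ((f \o T) x ^+ 2)%:E)%E => [r| |]//= _; first by move=> _; exact: ltry.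
by rewrite gt0_muley ?lte_fin.
Qed.

Lemma ip_shear_sq f : sq f -> `|a| * ip (f \o T) (f \o T) = ip f f.
Proof.
move=> sf; apply/EFin_inj; rewrite EFinM !ip_EFin//; last exact: sq_shear.
apply: (@ge0_integral_shear _ _ a q theta (fun x => ((f x) ^+ 2)%:E)) => //.
- by apply/measurable_EFinP; apply: measurable_funX; exact: sq_mble.
- by move=> x; rewrite lee_fin sqr_ge0.
Qed.

(** Polarisation: the integral formula covers nonnegative integrands only, hence squares. *)
Lemma ip_shear f g : sq f -> sq g -> `|a| * ip (f \o T) (g \o T) = ip f g.
Proof.
move=> sf sg; have sfT := sq_shear sf; have sgT := sq_shear sg.
have := ip_shear_sq (sqD sf sg); have := ip_shear_sq sf; have := ip_shear_sq sg.
rewrite (_ : (f + g) \o T = (f \o T) + (g \o T))//.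
have h1 := sqD sf sg; have h2 := sqD sfT sgT.
rewrite !ipDl// !ipDr// (ipC g f) (ipC (g \o T) (f \o T)).
move: (ip f f) (ip g g) (ip f g) (ip _ _) (ip _ _) (ip _ _) `|a| => *; nra.
Qed.

Lemma nrm_shear f : sq f -> Num.sqrt `|a| * nrm (f \o T) = nrm f.
Proof. by move=> sf; rewrite /nrm -sqrtrM// ip_shear_sq. Qed.

End change_of_variables.

(** * Riesz representation on a subspace of $L^2$ *)

Section representation.
Context {R : realType} {n : nat}.
Local Notation V := 'rV[R]_n.
Implicit Types f g h : V -> R.

(** [P] need not be complete: the approximate representatives form a Cauchy sequence, and their
    limit represents [l]. That the limit lies in the closure of [P] is kept in the conclusion, since
    [density] rests on it. *)
Lemma L2_riesz (P : set (V -> R)) (l : (V -> R) -> R) (C : R) :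
  P 0 -> (forall t u v, P u -> P v -> P (t *: u + v)) -> (forall u, P u -> sq u) ->
  (forall t u v, P u -> P v -> l (t *: u + v) = t * l u + l v) ->
  (forall u, P u -> `|l u| <= C * nrm u) ->
  exists g, [/\ sq g, forall u, P u -> l u = ip g u &
    exists2 phi : nat -> V -> R, (forall k, P (phi k)) & tends0 (fun k => nrm (phi k - g))].
Proof.
move=> P0 Plin Psq llin lC.
have [||||phi Pphi Hphi] := @riesz_approx R _ P ip l (C ^+ 2) P0 Plin _ _ _ llin.
- by move=> u v _ _; rewrite ipC.
- by move=> t u v w /Psq su /Psq sv /Psq sw; rewrite ipDl// ?ipZl//; exact: sqZ.
- by move=> u _; exact: ip_ge0.
- move=> u Pu; rewrite -nrm_sq -exprMn -[leLHS]real_normK ?num_real//.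
  have C0 : 0 <= C * nrm u by exact: le_trans (normr_ge0 _) (lC u Pu).
  by rewrite ler_sqr ?nnegrE// lC.
have sphi k := Psq _ (Pphi k).
(* Both approximants represent [l] tested against their own difference [d], so $\|d\|^2$ is at most
   the sum of the two errors times $\|d\|$. *)
have cau j k : nrm (phi j - phi k) <= j.+1%:R^-1 + k.+1%:R^-1.
  set d := phi j - phi k.
  have Pd : P d by rewrite /d addrC -scaleN1r; exact: Plin.
  have sd := Psq _ Pd.
  have [->|d0] := eqVneq (nrm d) 0; first by rewrite addr_ge0 ?invr_ge0.
  have d1 : 0 < nrm d by rewrite lt0r d0 nrm_ge0.
  rewrite -(ler_pM2r d1) -expr2 nrm_sq {1}/d ipBl//.
  have := Hphi j d Pd; have := Hphi k d Pd; rewrite -/(nrm d) mulrDl !ler_norml.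
  move: (ip (phi j) d) (ip (phi k) d) (_ * nrm d) (_ * nrm d) (l d) => x y z t u /andP[? ?] /andP[? ?].
  lra.
have [|g sg Hg] := L2_complete sphi.
  move=> e e0; have e2 : 0 < e / 2 by rewrite divr_gt0.
  have [N HN] := tends0_inv e2; exists N => i j /HN h1 /HN h2.
  by apply: (le_trans (cau i j)); rewrite [e]splitr lerD.
exists g; split => //; last by exists phi.
move=> u Pu; have su := Psq _ Pu; apply/eqP; rewrite eq_sym -subr_eq0 -normr_eq0 eq_le normr_ge0 andbT.
apply: (@tends0_lim _ _ _ (fun k => nrm u * nrm (phi k - g) + nrm u * k.+1%:R^-1)).
  by apply: tends0D; apply: tends0Z; rewrite ?nrm_ge0//; exact: tends0_inv.
move=> k; rewrite add0r.
have h1 := Hphi k u Pu; have h2 := ip_CS (sqB (sphi k) sg) su.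
rewrite ipBl// in h2.
rewrite (_ : ip g u - l u = (ip (phi k) u - l u) - (ip (phi k) u - ip g u)); last by ring.
apply: (le_trans (ler_normB _ _)); rewrite addrC lerD//; first by rewrite mulrC.
by rewrite mulrC.
Qed.

End representation.

(** * Derivatives along lines *)

Section line_derivative.
Context {R : realType} {n : nat}.
Local Notation V := 'rV[R]_n.
Implicit Types (f g : V -> R) (x v : V).

Let line_quot f x v t : (fun h : R => h^-1 *: (((fun s : R => f (x + s *: v)) \o shift t) (h *: (1 : R)) - f (x + t *: v))) =
  (fun h : R => h^-1 *: ((f \o shift (x + t *: v)) (h *: v) - f (x + t *: v))).
Proof.
apply/funext => h /=; congr (_ *: (f _ - _)).
by rewrite [_%:A]mulr1 scalerDl addrCA.
Qed.

Lemma derivable_line f x v (t : R) :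
  derivable (fun s : R => f (x + s *: v)) t 1 <-> derivable f (x + t *: v) v.
Proof. by rewrite /derivable line_quot. Qed.

Lemma derive_line f x v (t : R) :
  'D_1 (fun s : R => f (x + s *: v)) t = 'D_v f (x + t *: v).
Proof. by rewrite /derive line_quot. Qed.

Let shift_quot f c x v : (fun h : R => h^-1 *: (((fun y => f (y + c)) \o shift x) (h *: v) - f (x + c))) =
  (fun h : R => h^-1 *: ((f \o shift (x + c)) (h *: v) - f (x + c))).
Proof. by apply/funext => h /=; rewrite addrA. Qed.

Lemma derivable_shift f c x v :
  derivable (fun y => f (y + c)) x v <-> derivable f (x + c) v.
Proof. by rewrite /derivable shift_quot. Qed.

Lemma derive_shiftE f c x v : 'D_v (fun y => f (y + c)) x = 'D_v f (x + c).
Proof. by rewrite /derive shift_quot. Qed.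

Lemma MVT_line f x v h : (forall y, derivable f y v) ->
  exists2 xi, `|xi| <= `|h| & f (x + h *: v) - f x = h * 'D_v f (x + xi *: v).
Proof.
move=> df; pose g (s : R) := f (x + s *: v).
have dg (t : R) : is_derive t (1 : R) g ('D_v f (x + t *: v)).
  by apply: DeriveDef; [apply/derivable_line|exact: derive_line].
have cg : continuous g.
  by move=> t; apply/differentiable_continuous/derivable1_diffP; case: (dg t).
have cgs a b : {within `[a, b], continuous g} by exact: continuous_subspaceT.
have [h0|h0|->] := ltgtP h 0.
- have [c + E] := MVT h0 (fun t _ => dg t) (cgs h 0).
  rewrite in_itv/= => /andP[hc c0]; exists c.
    by rewrite !ltr0_norm// lerN2 ltW.
  move: E; rewrite /g scale0r addr0 => E; rewrite -opprB E; ring.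
- have [c + E] := MVT h0 (fun t _ => dg t) (cgs 0 h).
  rewrite in_itv/= => /andP[hc c0]; exists c.
    by rewrite !gtr0_norm// ltW.
  by move: E; rewrite /g scale0r addr0 => ->; ring.
- by exists 0; rewrite ?normr0// scale0r addr0 subrr mul0r.
Qed.

End line_derivative.

(** * Calculus of the classes $C^k$ *)

Section Ck_theory.
Context {R : realType} {n : nat}.
Local Notation V := 'rV[R]_n.
Implicit Types (f g : V -> R) (x v : V).

Definition e_ (i : 'I_n) : V := delta_mx ord0 i.
Definition pd (i : 'I_n) f : V -> R := 'D_(e_ i) f.

Lemma partials_cons i s f : partials (i :: s) f = pd i (partials s f).
Proof. by []. Qed.

Lemma partials_rcons i s f : partials (rcons s i) f = partials s (pd i f).
Proof. by rewrite /partials foldr_rcons. Qed.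

(** [partials] differentiates first along the last direction of its list. Removing that direction
    leaves the partial derivatives of [pd i f], which gives the recursion behind the inductions on
    [k] below. *)
Lemma CkS k f : Ck k.+1 f <->
  [/\ continuous f, (forall i x, derivable f x (e_ i)) & forall i, Ck k (pd i f)].
Proof.
split=> [[df cf]|[cf df Cf]].
  split=> [|i x|i]; [exact: (cf [::])|exact: (df [::])|split => [s j x sk|s sk]].
    by rewrite -partials_rcons; apply: df; rewrite size_rcons.
  by rewrite -partials_rcons; apply: cf; rewrite size_rcons.
split => [s i x|s]; elim/last_ind: s => [|s j _]//.
- by rewrite size_rcons ltnS partials_rcons => sk; apply: (Cf j).1.
- by rewrite size_rcons ltnS partials_rcons => sk; apply: (Cf j).2.
Qed.

Lemma Ck0 f : Ck 0 f <-> continuous f.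
Proof.
split=> [[_ cf]|cf]; first exact: (cf [::]).
by split=> // -[].
Qed.

Lemma Ck_le j k f : (j <= k)%N -> Ck k f -> Ck j f.
Proof.
move=> jk [df cf]; split => [s i x sj|s sj]; first by apply: df; exact: leq_trans jk.
by apply: cf; exact: leq_trans jk.
Qed.

Lemma Ck_cont k f : Ck k f -> continuous f. Proof. by move=> [_ /(_ [::])]; exact. Qed.
Lemma Ck_dist k f x e : Ck k f -> 0 < e ->
  exists2 d, 0 < d & forall y, `|x - y| < d -> `|f x - f y| < e.
Proof.
move=> Hf e0; have cf : {for x, continuous f} by exact: Ck_cont Hf x.
move/cvgrPdist_lt : cf => /(_ e e0) /nbhs_ballP[d /= d0 Hd].
by exists d => // y xy; apply: Hd; rewrite -ball_normE.
Qed.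

Lemma Ck_pd k i f : Ck k.+1 f -> Ck k (pd i f). Proof. by move=> /CkS[_ _]. Qed.
Lemma Ck_derivable k i f x : Ck k.+1 f -> derivable f x (e_ i).
Proof. by move=> /CkS[_ +_]; exact. Qed.

Lemma Ck_partials k s f : Ck (size s + k) f -> Ck k (partials s f).
Proof.
elim/last_ind: s f => [|s i IH] f //.
by rewrite size_rcons addSn partials_rcons => /(Ck_pd i); exact: IH.
Qed.

Lemma pd_cst i (c : R) : pd i (cst c) = cst 0.
Proof. by apply/funext => x; rewrite /pd derive_cst. Qed.

Lemma Ck_cst k (c : R) : Ck k (cst c : V -> R).
Proof.
elim: k c => [|k IH] c; first by apply/Ck0; exact: cst_continuous.
apply/CkS; split => [|i x|i]; [exact: cst_continuous|exact: derivable_cst|].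
by rewrite pd_cst; exact: IH.
Qed.

Lemma pdD i f g : (forall x, derivable f x (e_ i)) -> (forall x, derivable g x (e_ i)) ->
  pd i (f + g) = pd i f + pd i g.
Proof. by move=> df dg; apply/funext => x; rewrite /pd deriveD. Qed.

Lemma pdM i f g : (forall x, derivable f x (e_ i)) -> (forall x, derivable g x (e_ i)) ->
  pd i (f * g) = pd i f * g + f * pd i g.
Proof.
move=> df dg; apply/funext => x; rewrite /pd deriveM// !fctE addrC.
by congr (_ + _); rewrite /GRing.scale /= mulrC.
Qed.

Lemma CkD k f g : Ck k f -> Ck k g -> Ck k (f + g).
Proof.
elim: k f g => [|k IH] f g.
  by move=> /Ck0 cf /Ck0 cg; apply/Ck0 => x; apply: continuousD; [exact: cf|exact: cg].
move=> /CkS[cf df Cf] /CkS[cg dg Cg]; apply/CkS; split => [x|i x|i].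
- by apply: continuousD; [exact: cf|exact: cg].
- exact: derivableD.
- by rewrite pdD//; exact: IH.
Qed.

Lemma CkM k f g : Ck k f -> Ck k g -> Ck k (f * g).
Proof.
elim: k f g => [|k IH] f g.
  by move=> /Ck0 cf /Ck0 cg; apply/Ck0 => x; apply: continuousM; [exact: cf|exact: cg].
move=> Hf Hg; have [cf df Cf] := (CkS _ _).1 Hf; have [cg dg Cg] := (CkS _ _).1 Hg.
apply/CkS; split => [x|i x|i].
- by apply: continuousM; [exact: cf|exact: cg].
- exact: derivableM.
- by rewrite pdM//; apply: CkD; apply: IH => //; exact: Ck_le (leqnSn k) _.
Qed.

Lemma CkZ k (c : R) f : Ck k f -> Ck k (c *: f).
Proof. by move=> Hf; rewrite (_ : c *: f = cst c * f)//; apply: CkM => //; exact: Ck_cst. Qed.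

Lemma CkN k f : Ck k f -> Ck k (- f).
Proof. by rewrite -scaleN1r; exact: CkZ. Qed.

Lemma CkB k f g : Ck k f -> Ck k g -> Ck k (f - g).
Proof. by move=> Hf Hg; apply: CkD => //; exact: CkN. Qed.

Lemma Ck_sum k (I : Type) (r : seq I) (P : pred I) (F : I -> V -> R) :
  (forall i, P i -> Ck k (F i)) -> Ck k (\sum_(i <- r | P i) F i).
Proof. by move=> sF; apply: (big_ind (Ck k)) => //; [exact: Ck_cst|exact: CkD]. Qed.

Lemma pdD1 i f g : Ck 1 f -> Ck 1 g -> pd i (f + g) = pd i f + pd i g.
Proof. by move=> Hf Hg; apply: pdD => x; exact: (@Ck_derivable 0). Qed.

Lemma pdM1 i f g : Ck 1 f -> Ck 1 g -> pd i (f * g) = pd i f * g + f * pd i g.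
Proof. by move=> Hf Hg; apply: pdM => x; exact: (@Ck_derivable 0). Qed.

Lemma pdZ1 i c f : Ck 1 f -> pd i (c *: f) = c *: pd i f.
Proof.
move=> Hf; rewrite (_ : c *: f = cst c * f)// pdM1//; last exact: Ck_cst.
by rewrite pd_cst mul0r add0r.
Qed.

Lemma pdN1 i f : Ck 1 f -> pd i (- f) = - pd i f.
Proof. by move=> Hf; rewrite -scaleN1r pdZ1// scaleN1r. Qed.

Lemma pdB1 i f g : Ck 1 f -> Ck 1 g -> pd i (f - g) = pd i f - pd i g.
Proof. by move=> Hf Hg; rewrite pdD1// ?pdN1//; exact: CkN. Qed.

Lemma pd_sum i (I : Type) (r : seq I) (F : I -> V -> R) :
  (forall j, Ck 1 (F j)) -> pd i (\sum_(j <- r) F j) = \sum_(j <- r) pd i (F j).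
Proof.
move=> HF; elim: r => [|j r IH]; first by rewrite !big_nil pd_cst.
by rewrite !big_cons pdD1 ?IH//; exact: Ck_sum.
Qed.

Definition grad_lin (a : 'I_n -> R) (v : V) : R := \sum_i v ord0 i * a i.

Lemma grad_lin_is_linear a : linear (grad_lin a).
Proof.
move=> c u v; rewrite /grad_lin /GRing.scale /= mulr_sumr -big_split /=.
by apply: eq_bigr => i _; rewrite !mxE mulrDl mulrA.
Qed.

HB.instance Definition _ a := GRing.isLinear.Build R V R _ (grad_lin a) (grad_lin_is_linear a).

Lemma grad_lin_continuous a : continuous (grad_lin a).
Proof.
move=> x; rewrite /grad_lin (_ : (fun v : V => _) = \sum_i (fun v : V => v ord0 i * a i)).
  apply: (big_ind (fun f : V -> R => {for x, continuous f})).
  - exact: cst_continuous.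
  - by move=> f g cf cg; exact: continuousD.
  - move=> i _; apply: continuousM; last exact: cst_continuous.
    exact: coord_continuous.
by apply/funext => v; rewrite fct_sumE.
Qed.

(* Telescope along the coordinates and apply the mean value theorem to each step. *)
Lemma C1_taylor f x : Ck 1 f -> forall e, 0 < e -> exists2 d, 0 < d &
  forall v, `|v| < d -> `|f (x + v) - f x - grad_lin (fun i => pd i f x) v| <= e * `|v|.
Proof.
move=> Hf e e0; pose e' := e / n.+1%:R.
have e'0 : 0 < e' by rewrite divr_gt0.
have [_ df Cf] := (CkS _ _).1 Hf.
have Hn i : exists2 d, 0 < d & forall y, `|x - y| < d -> `|pd i f x - pd i f y| < e'.
  exact: Ck_dist (Cf i) e'0.
have [d d0 Hd] : exists2 d, 0 < d & forall i y, `|x - y| < d -> `|pd i f x - pd i f y| < e'.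
  have /choice[D HD] i : exists d, 0 < d /\ forall y, `|x - y| < d -> `|pd i f x - pd i f y| < e'.
    by have [d ? ?] := Hn i; exists d.
  exists (\big[Num.min/1]_i D i).
    apply: (big_ind (fun z => 0 < z)) => // [u w u0 w0|i _]; first by rewrite lt_min u0.
    exact: (HD i).1.
  move=> i y xy; apply: (HD i).2; apply: lt_le_trans xy _.
  exact: bigmin_le_cond.
exists d => // v vd.
pose w k : V := \row_i (if (i < k)%N then v ord0 i else 0).
have wS (i : 'I_n) : w i.+1 = w i + v ord0 i *: e_ i.
  apply/rowP => j; rewrite !mxE eqxx /= ltnS leq_eqVlt.
  have [->|ji] := eqVneq j i; first by rewrite eqxx /= ltnn add0r mulr1.
  by rewrite (inj_eq val_inj) (negbTE ji) /= mulr0 addr0.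
have w0 : w 0%N = 0 by apply/rowP => j; rewrite !mxE.
have wn : w n = v by apply/rowP => j; rewrite !mxE ltn_ord.
have tele : f (x + v) - f x = \sum_(i < n) (f (x + w i.+1) - f (x + w i)).
  rewrite -(big_mkord xpredT (fun i => f (x + w i.+1) - f (x + w i))).
  by rewrite telescope_sumr// wn w0 addr0.
rewrite tele /grad_lin -sumrB.
apply: (le_trans (ler_norm_sum _ _ _)).
apply: (@le_trans _ _ (\sum_(i < n) e' * `|v|)); last first.
  rewrite sumr_const card_ord -mulr_natl mulrA ler_wpM2r//.
  by rewrite /e' mulrCA ger_pMr// ler_pdivrMr// mul1r ler_nat.
apply: ler_sum => i _; rewrite wS addrA.
have [xi xih ->] := MVT_line (x + w i) (v ord0 i) (df i).
rewrite -mulrBr normrM mulrC ler_pM// ?coord_le_norm//.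
rewrite distrC; apply/ltW/Hd; rewrite -[x + w i + _]addrA opprD addrA subrr sub0r.
rewrite normrN; apply: le_lt_trans vd.
apply: norm_le_coord => // j; rewrite !mxE eqxx /=.
have [->|ji] := eqVneq j i; last first.
  by rewrite mulr0 addr0; case: ifP => _; rewrite ?normr0// coord_le_norm.
by rewrite ltnn add0r mulr1; apply: le_trans xih _; exact: coord_le_norm.
Qed.

Lemma C1_differentiable f x : Ck 1 f -> differentiable f x.
Proof.
move=> Hf; pose L : {linear V -> R} := grad_lin (fun i => pd i f x).
apply/diffP => /=.
apply: (@getPex _ (fun (df : {linear V -> R}) => continuous df /\
  forall y, f y = f (lim (nbhs x)) + df (y - lim (nbhs x))
                  +o_(y \near x) (y - lim (nbhs x)))).
exists L; split; first exact: grad_lin_continuous.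
rewrite lim_id//.
suff : f = (fun y => f x + L (y - x)) +o_ (nbhs x) (fun y => y - x).
  by move=> E y; rewrite {1}E.
apply/eqaddoP => e e0; have [d d0 Hd] := C1_taylor x Hf e0.
apply/nbhs_ballP; exists d => //= y; rewrite -ball_normE /= distrC => xy.
by have := Hd (y - x) xy; rewrite subrKC !fctE opprD addrA.
Qed.

Lemma C1_deriveE f x v : Ck 1 f -> 'D_v f x = \sum_i v ord0 i * pd i f x.
Proof.
move=> Hf; have df := C1_differentiable x Hf; rewrite deriveE//.
rewrite {1}(row_sum_delta v) linear_sum; apply: eq_bigr => i _.
by rewrite linearZ /= /pd deriveE.
Qed.

Definition dv v f : V -> R := \sum_i v ord0 i *: pd i f.

Lemma dvE f v : Ck 1 f -> 'D_v f = dv v f.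
Proof.
by move=> Hf; apply/funext => x; rewrite C1_deriveE// /dv fct_sumE.
Qed.

Lemma Ck_dv k v f : Ck k.+1 f -> Ck k (dv v f).
Proof. by move=> Hf; apply: Ck_sum => i _; apply: CkZ; exact: Ck_pd. Qed.

Lemma C1_derivable f x v : Ck 1 f -> derivable f x v.
Proof. by move=> Hf; apply: diff_derivable; exact: C1_differentiable. Qed.

Lemma MVT_C1 f x v h : Ck 1 f ->
  exists2 xi, `|xi| <= `|h| & f (x + h *: v) - f x = h * dv v f (x + xi *: v).
Proof.
move=> Hf; have [|xi xih E] := @MVT_line _ _ f x v h; first by move=> y; exact: C1_derivable.
by exists xi => //; rewrite E -(dvE v Hf).
Qed.

Lemma dv_e i f : dv (e_ i) f = pd i f.
Proof.
rewrite /dv (bigD1 i)//= big1 ?addr0; first by rewrite /e_ mxE !eqxx scale1r.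
by move=> j ji; rewrite /e_ mxE eqxx (negbTE ji) scale0r.
Qed.

Lemma dvD f g v : Ck 1 f -> Ck 1 g -> dv v (f + g) = dv v f + dv v g.
Proof.
move=> Hf Hg; rewrite /dv -big_split; apply: eq_bigr => i _ /=.
by rewrite pdD1// scalerDr.
Qed.

Lemma dvM f g v : Ck 1 f -> Ck 1 g -> dv v (f * g) = dv v f * g + f * dv v g.
Proof.
move=> Hf Hg; apply/funext => x; rewrite /dv !fctE !fct_sumE mulr_suml mulr_sumr -big_split /=.
by apply: eq_bigr => i _; rewrite pdM1// !fctE /GRing.scale /=; ring.
Qed.

Lemma dvZ c f v : Ck 1 f -> dv v (c *: f) = c *: dv v f.
Proof.
move=> Hf; rewrite /dv scaler_sumr; apply: eq_bigr => i _.
by rewrite pdZ1// !scalerA mulrC.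
Qed.

Lemma dvN f v : Ck 1 f -> dv v (- f) = - dv v f.
Proof. by move=> Hf; rewrite -scaleN1r dvZ// scaleN1r. Qed.

Lemma dv_addl v w f : dv (v + w) f = dv v f + dv w f.
Proof. by rewrite /dv -big_split; apply: eq_bigr => i _; rewrite mxE scalerDl. Qed.

(* Both iterated derivatives are limits of the second difference quotient. *)
Lemma schwarz i j f : Ck 2 f -> pd i (pd j f) = pd j (pd i f).
Proof.
move=> Hf; apply/funext => x.
have H1 := Ck_le le1_2 Hf.
have key k l : forall e, 0 < e -> exists2 d, 0 < d & forall h, 0 < h -> h < d ->
    `|(f (x + h *: e_ k + h *: e_ l) - f (x + h *: e_ k) - f (x + h *: e_ l) + f x)
       - h ^+ 2 * pd l (pd k f) x| <= e * h ^+ 2.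
  move=> e e0.
  have [d d0 Hd] := Ck_dist x (Ck_pd l (Ck_pd k Hf)) e0; exists (d / 2); first by rewrite divr_gt0.
  move=> h h0 hd; pose F (y : V) := f (y + h *: e_ l) - f y.
  have dF y : derivable F y (e_ k).
    apply: derivableB; last exact: C1_derivable.
    by apply/derivable_shift; exact: C1_derivable.
  have [xi xih E] := MVT_line x h dF.
  have [eta etah E'] := MVT_C1 (x + xi *: e_ k) (e_ l) h (Ck_pd k Hf).
  have -> : f (x + h *: e_ k + h *: e_ l) - f (x + h *: e_ k) - f (x + h *: e_ l) + f x
      = h ^+ 2 * pd l (pd k f) (x + xi *: e_ k + eta *: e_ l).
    rewrite -dv_e expr2 -mulrA -E'.
    transitivity (F (x + h *: e_ k) - F x); first by rewrite /F; ring.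
    rewrite E; congr (_ * _); rewrite deriveB; [|by apply/derivable_shift; exact: C1_derivable|exact: C1_derivable].
    by rewrite derive_shiftE.
  rewrite -mulrBr normrM [`|h ^+ 2|]ger0_norm ?sqr_ge0// mulrC ler_wpM2r ?sqr_ge0//.
  rewrite distrC; apply/ltW/Hd; rewrite -addrA opprD addrA subrr sub0r normrN.
  have n1 m : `|e_ m| <= 1.
    apply: norm_le_coord => // q; rewrite mxE eqxx /=.
    by case: (_ == _); rewrite ?normr1 ?normr0.
  apply: (le_lt_trans (ler_normD _ _)); rewrite !normrZ [ltRHS]splitr.
  have h0' := gtr0_norm h0; rewrite h0' in xih etah.
  apply: ltrD; apply: le_lt_trans hd; rewrite -[leRHS]mulr1; exact: ler_pM.
apply/eqP; rewrite -subr_eq0 -normr_eq0 eq_le normr_ge0 andbT.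
apply/ler_addgt0Pr => e e0; rewrite add0r.
have e2 : 0 < e / 2 by rewrite divr_gt0.
have [d1 d10 H2] := key j i _ e2; have [d2 d20 H3] := key i j _ e2.
pose h := Num.min d1 d2 / 2.
have h0 : 0 < h by rewrite divr_gt0// lt_min d10.
have hm : h < Num.min d1 d2 by rewrite /h ltr_pdivrMr// ltr_pMr ?ltr1n// lt_min d10.
move: (hm); rewrite lt_min => /andP[hd1 hd2].
have := H2 h h0 hd1; have := H3 h h0 hd2.
rewrite (addrAC x) (_ : f (x + h *: e_ j + h *: e_ i) - f (x + h *: e_ i) - f (x + h *: e_ j) =
  f (x + h *: e_ j + h *: e_ i) - f (x + h *: e_ j) - f (x + h *: e_ i)); last by ring.
set S := _ + f x; set a := pd i _ x; set b := pd j _ x => h1 h2.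
have hh : 0 < h ^+ 2 by rewrite exprn_gt0.
rewrite -(ler_pM2l hh) -[X in X * `|_|](ger0_norm (ltW hh)) -normrM.
rewrite (_ : h ^+ 2 * (a - b) = (S - h ^+ 2 * b) - (S - h ^+ 2 * a)); last by ring.
apply: (le_trans (ler_normB _ _)); rewrite [e]splitr mulrDr.
by apply: lerD; rewrite [leRHS]mulrC; [exact: h1|exact: h2].
Qed.

(* Maps of this form include the translations along graphs and the reflections used below. *)
Definition shear (b q : V) (theta : V -> R) (x : V) : V := x + b + theta x *: q.

Let F1 (b : V) : V -> V := @id V + @cst V V b.
Let F2 (q : V) (theta : V -> R) : V -> V := fun y => theta y *: q.

Let shearE b q theta : shear b q theta = F1 b + F2 q theta. Proof. by []. Qed.

Lemma continuous_shear (b q : V) (theta : V -> R) : continuous theta -> continuous (shear b q theta).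
Proof.
move=> ct x; rewrite shearE; apply: (@continuousD _ _ _ (F1 b) (F2 q theta) x).
  by apply: (@continuousD _ _ _ (@id V) (@cst V V b) x); [exact: cvg_id|exact: cst_continuous].
exact: cvgZr_tmp (ct x).
Qed.

Lemma differentiable_shear b q theta x : Ck 1 theta ->
  differentiable (shear b q theta) x.
Proof.
move=> Ht; rewrite shearE; apply: differentiableD; first exact: differentiableD.
by apply: differentiableZl; exact: C1_differentiable.
Qed.

Lemma diff_shear b q theta x v : Ck 1 theta ->
  'd (shear b q theta) x v = v + ('D_v theta x) *: q.
Proof.
move=> Ht; have dt := C1_differentiable x Ht.
have d1 : differentiable (F1 b) x by exact: differentiableD.
have d2 : differentiable (F2 q theta) x by exact: differentiableZl.
have E : 'd (shear b q theta) x v = ('d (F1 b) x \+ 'd (F2 q theta) x) v.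
  by rewrite shearE; congr (_ v); exact: diffD d1 d2.
have di : differentiable (@id V) x by [].
have dc : differentiable (@cst V V b) x by [].
have E3 : 'd (@cst V V b) x v = 0.
  by have H : ('d (@cst V V b) x : V -> V) = 0 := diff_cst b x; rewrite H.
have E4 : 'd (@id V) x v = v.
  by have H : ('d (@id V) x : V -> V) = id := diff_val; rewrite H.
have E1a : 'd (F1 b) x v = ('d (@id V) x \+ 'd (@cst V V b) x) v.
  by congr (_ v); exact: diffD di dc.
have E1 : 'd (F1 b) x v = v by exact: (etrans E1a (etrans (congr2 +%R E4 E3) (addr0 v))).
have E2 : 'd (F2 q theta) x v = 'd theta x v *: q.
  by have H : ('d (F2 q theta) x : V -> V) = (fun z => 'd theta x z *: q) := diffZl q dt; rewrite H.
transitivity ('d (F1 b) x v + 'd (F2 q theta) x v); first exact: E.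
by rewrite (deriveE v dt); exact: (congr2 +%R E1 E2).
Qed.

Lemma pd_shear i b q theta f : Ck 1 f -> Ck 1 theta ->
  pd i (f \o shear b q theta) =
  (pd i f) \o shear b q theta + pd i theta * ((dv q f) \o shear b q theta).
Proof.
move=> Hf Ht; apply/funext => x.
have dt := C1_differentiable x Ht; have df := C1_differentiable (shear b q theta x) Hf.
have dS := differentiable_shear b q x Ht.
rewrite /pd deriveE; last exact: differentiable_comp.
by rewrite diff_comp// !fctE /= diff_shear// linearD linearZ /= -!deriveE// -(dvE q Hf).
Qed.

Lemma Ck_shear k b q theta f : Ck k f -> Ck k theta -> Ck k (f \o shear b q theta).
Proof.
elim: k f => [|k IH] f.
  move=> /Ck0 cf /Ck0 ct; apply/Ck0 => x; apply: continuous_comp; last exact: cf.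
  exact: continuous_shear.
move=> Hf Ht; have Hf1 := Ck_le (isT : (1 <= k.+1)%N) Hf; have Ht1 := Ck_le (isT : (1 <= k.+1)%N) Ht.
have Ht' := Ck_le (leqnSn k) Ht.
apply/CkS; split => [x|i x|i].
- apply: continuous_comp; last exact: (Ck_cont Hf).
  by apply: continuous_shear; exact: (Ck_cont Ht).
- apply: diff_derivable; apply: differentiable_comp; last exact: C1_differentiable.
  exact: differentiable_shear.
- rewrite pd_shear//; apply: CkD; first by apply: IH => //; exact: Ck_pd.
  by apply: CkM; [exact: Ck_pd|apply: IH => //; exact: Ck_dv].
Qed.

End Ck_theory.

(** * Smooth step functions *)

Section smooth_step.
Context {R : realType}.

(** The factor $t^{-k}$ makes the span of these functions stable under differentiation, so
    smoothness follows by induction on the order. *)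
Definition expinv (k : nat) (t : R) : R := if 0 < t then t^-1 ^+ k * expR (- t^-1) else 0.

Lemma expinv_ge0 k t : 0 <= expinv k t.
Proof.
by rewrite /expinv; case: ifP => // t0; rewrite mulr_ge0 ?expR_ge0// exprn_ge0// invr_ge0 ltW.
Qed.

(** From $e^s \ge s^{k+2}/(k+2)!$ at $s = 1/t$. The square of $t$ makes the difference quotient at 0
    vanish in the limit. *)
Lemma expinv_le k t : expinv k t <= (k.+2)`!%:R * t ^+ 2.
Proof.
rewrite /expinv; case: ifP => [t0|_]; last by rewrite mulr_ge0// sqr_ge0.
have ti : 0 <= t^-1 by rewrite invr_ge0 ltW.
have := expR_ge1Dxn k.+1 ti; set F := (k.+2)`!%:R => H.
have F0 : 0 < F by rewrite ltr0n fact_gt0.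
have H2 : t^-1 ^+ k.+2 / F <= expR t^-1 by apply: le_trans H; rewrite lerDr.
rewrite expRN ler_pdivrMr ?expR_gt0//.
apply: (@le_trans _ _ (F * t ^+ 2 * (t^-1 ^+ k.+2 / F))); last first.
  by rewrite ler_wpM2l// mulr_ge0// ?sqr_ge0// ltW.
have E : F * t ^+ 2 * (t^-1 ^+ k.+2 / F) = t^-1 ^+ k * (t / t) ^+ 2 * (F / F).
  clear H H2; clearbody F; rewrite -(addn2 k) exprD; move: (t^-1) (F^-1) => u v; ring.
by rewrite E !divff ?gt_eqF// expr1n !mulr1.
Qed.

Lemma is_derive_expinv k (t : R) :
  is_derive t (1 : R) (expinv k) (- k%:R * expinv k.+1 t + expinv k.+2 t).
Proof.
have [t0|t0|->] := ltgtP t 0.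
- apply: (@near_eq_is_derive _ _ _ (cst 0)).
    near=> u; rewrite /expinv ifF//; apply/negbTE; rewrite -leNgt ltW//.
    by near: u; exact: lt_nbhsl.
  rewrite /expinv !ifF ?mulr0 ?addr0; try (by apply/negbTE; rewrite -leNgt ltW).
  exact: is_derive_cst.
- have tn : t != 0 by rewrite gt_eqF.
  have dV : is_derive t (1 : R) (fun u : R => u^-1) (- t ^- 2).
    apply: DeriveDef; first by apply: (@derivableV _ _ id) => //; exact: derivable_id.
    by rewrite (@deriveV _ _ id)//= derive_id /GRing.scale /= mulr1.
  have dX : is_derive t (1 : R) (fun u : R => u^-1 ^+ k) (k%:R * t^-1 ^+ k.-1 * (- t ^- 2)).
    rewrite (_ : (fun u : R => _) = (fun u : R => u^-1) ^+ k); last by apply/funext => u; rewrite exprfctE.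
    apply: (is_derive_eq (is_deriveX k dV)).
    by rewrite /GRing.scale /= mulr_natl.
  have dE : is_derive t (1 : R) (fun u : R => expR (- u^-1)) (expR (- t^-1) * t ^- 2).
    have dN := is_deriveN dV.
    have dC := @is_derive1_comp R expR (- (fun u : R => u^-1)) t _ _ (is_derive_expR _) dN.
    apply: (is_derive_eq dC).
    by rewrite /GRing.scale /= opprK mulrC.
  have D := is_deriveM dX dE.
  apply: (@near_eq_is_derive _ _ _ _ _ _ _ _ _ (is_derive_eq D _)).
    by near=> u; rewrite /expinv ifT//; near: u; exact: lt_nbhsr.
  rewrite /expinv t0 /GRing.scale /=.
  case: k {dX D} => [|k] /=; first by rewrite !exprSr; field.
  by rewrite -!exprVn !exprS; ring.
- rewrite /expinv ltxx mulr0 addr0.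
  have H : (fun h : R => h^-1 *: ((expinv k \o shift 0) (h *: 1) - expinv k 0)) @ 0^' --> (0 : R).
    pose F : R := (k.+2)`!%:R; have F0 : 0 < F by rewrite ltr0n fact_gt0.
    apply/cvgrPdist_lt => e e0; rewrite near_withinE; near=> h => h0.
    rewrite sub0r normrN /= addr0 [h%:A]mulr1 {2}/expinv ltxx subr0.
    rewrite /GRing.scale /= normrM normfV (ger0_norm (expinv_ge0 _ _)).
    rewrite mulrC ltr_pdivrMr ?normr_gt0//.
    apply: le_lt_trans (expinv_le _ _) _; rewrite -/F.
    rewrite -[h ^+ 2]real_normK ?num_real// expr2 mulrA ltr_pM2r ?normr_gt0//.
    rewrite mulrC -ltr_pdivlMr//.
    near: h; apply/nbhs_ballP; exists (e / F); first by rewrite /= divr_gt0.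
    by move=> h; rewrite /= -ball_normE /= sub0r normrN.
  by apply: DeriveDef; [apply/cvg_ex; exists 0; exact: H|exact: cvg_lim H].
Unshelve. all: by end_near. Qed.

Context {n : nat}.
Local Notation V := 'rV[R]_n.
Implicit Types f g l : V -> R.

Lemma pd_comp1 i (G : R -> R) (dG : R) l x : Ck 1 l ->
  is_derive (l x) (1 : R) G dG ->
  derivable (G \o l) x (e_ i) /\ pd i (G \o l) x = dG * pd i l x.
Proof.
move=> Hl [dGl EG]; have dl := C1_differentiable x Hl.
have dG' : differentiable G (l x) by exact/derivable1_diffP.
split; first by apply: diff_derivable; exact: differentiable_comp.
rewrite /pd deriveE; last exact: differentiable_comp.
rewrite diff_comp//= -(deriveE (e_ i) dl) (deriv1E dGl) /GRing.scale /= mulrC.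
by rewrite derive1E EG.
Qed.

(** Stability of [S] under differentiation is all that the chain rule needs at each order. *)
Lemma Ck_comp1 (S : set (R -> R)) m (g : R -> R) l :
  (forall g : R -> R, S g -> exists2 g', S g' & forall t : R, is_derive t (1 : R) g (g' t)) ->
  S g -> Ck m l -> Ck m (g \o l).
Proof.
move=> HS; elim: m g => [|m IH] g Sg.
  move=> /Ck0 cl; apply/Ck0 => x; apply: continuous_comp; first exact: cl.
  have [g' _ dg] := HS _ Sg.
  by apply/differentiable_continuous/derivable1_diffP; case: (dg (l x)).
move=> Hl; have [g' Sg' dg] := HS _ Sg; have Hl1 := Ck_le (isT : (1 <= m.+1)%N) Hl.
apply/CkS; split => [x|i x|i].
- apply: continuous_comp; first exact: (Ck_cont Hl).
  by apply/differentiable_continuous/derivable1_diffP; case: (dg (l x)).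
- exact: (pd_comp1 i Hl1 (dg (l x))).1.
- have -> : pd i (g \o l) = (g' \o l) * pd i l.
    by apply/funext => x; rewrite (pd_comp1 i Hl1 (dg (l x))).2.
  by apply: CkM; [apply: IH => //; exact: Ck_le (leqnSn m) _|exact: Ck_pd].
Qed.

Lemma Ck_expinv m k l : Ck m l -> Ck m (expinv k \o l).
Proof.
pose S := [set g : R -> R | exists r : seq (R * nat), g = fun t => \sum_(p <- r) p.1 * expinv p.2 t].
apply: (@Ck_comp1 S); last by exists [:: (1, k)]; apply/funext => t; rewrite big_seq1 mul1r.
move=> _ [r ->].
elim: r => [|p r [g' [r' ->] IH]].
  exists (fun=> 0); first by exists [::]; apply/funext => t; rewrite big_nil.
  move=> t; rewrite (_ : (fun _ => _) = cst 0); first exact: is_derive_cst.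
  by apply/funext => u; rewrite big_nil.
exists (fun t => \sum_(q <- [:: (p.1 * - p.2%:R, p.2.+1), (p.1, p.2.+2) & r']) q.1 * expinv q.2 t); first by eexists.
move=> t; rewrite (_ : (fun _ => _) = p.1 *: expinv p.2 + (fun t => \sum_(q <- r) q.1 * expinv q.2 t)); last first.
  by apply/funext => u; rewrite big_cons.
have H1 := is_deriveZ p.1 (is_derive_expinv p.2 t).
have H2 := is_deriveD H1 (IH t).
apply: (is_derive_eq H2).
by rewrite !big_cons /= /GRing.scale /=; ring.
Qed.

Lemma Ck_inv m g : (forall x, g x != 0) -> Ck m g -> Ck m (fun x => (g x)^-1).
Proof.
move=> g0; elim: m => [|m IH].
  by move=> /Ck0 cg; apply/Ck0 => x; apply: continuousV => //; exact: cg.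
move=> Hg; have [cg dg Cg] := (CkS _ _).1 Hg; have IHg := IH (Ck_le (leqnSn m) Hg).
apply/CkS; split => [x|i x|i].
- by apply: continuousV => //; exact: cg.
- exact: derivableV.
- rewrite (_ : pd i _ = - (pd i g * ((fun x => (g x)^-1) * (fun x => (g x)^-1)))).
    by apply: CkN; apply: CkM => //; exact: CkM.
  apply/funext => x; rewrite /pd deriveV// !fctE /GRing.scale /= -expr2 exprVn; ring.
Qed.

Definition sstep (t : R) : R := expinv 0 t / (expinv 0 t + expinv 0 (1 - t)).

Lemma expinv_gt0 t : 0 < t -> 0 < expinv 0 t.
Proof. by move=> t0; rewrite /expinv t0 expr0 mul1r expR_gt0. Qed.

Lemma sstep_den_gt0 t : 0 < expinv 0 t + expinv 0 (1 - t).
Proof.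
have [t0|t0] := ltP 0 t; first by rewrite ltr_pwDl ?expinv_gt0// expinv_ge0.
by rewrite ltr_wpDl ?expinv_ge0// expinv_gt0// subr_gt0 (le_lt_trans t0).
Qed.

Lemma sstep_ge0 t : 0 <= sstep t.
Proof. by rewrite /sstep divr_ge0 ?expinv_ge0// ltW// sstep_den_gt0. Qed.

Lemma sstep_le1 t : sstep t <= 1.
Proof. by rewrite /sstep ler_pdivrMr ?sstep_den_gt0// mul1r lerDl expinv_ge0. Qed.

Lemma sstep0 t : t <= 0 -> sstep t = 0.
Proof. by move=> t0; rewrite /sstep {1}/expinv ltNge t0 mul0r. Qed.

Lemma sstep1 t : 1 <= t -> sstep t = 1.
Proof.
move=> t1; rewrite /sstep [expinv 0 (1 - t)]/expinv ifF ?addr0.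
  by rewrite divff// gt_eqF// expinv_gt0// (lt_le_trans ltr01).
by apply/negbTE; rewrite -leNgt subr_le0.
Qed.

Lemma Ck_sstep m l : Ck m l -> Ck m (sstep \o l).
Proof.
move=> Hl; have H1 := Ck_expinv 0 Hl.
have H2 : Ck m (expinv 0 \o (cst 1 - l)) by apply: Ck_expinv; apply: CkB => //; exact: Ck_cst.
rewrite (_ : _ \o _ = (expinv 0 \o l) * (fun x => (((expinv 0 \o l) + (expinv 0 \o (cst 1 - l))) x)^-1))//.
apply: CkM => //; apply: Ck_inv => [x|]; last exact: CkD.
by rewrite gt_eqF//; exact: sstep_den_gt0.
Qed.

End smooth_step.

(** * Plateau functions *)

Section plateau.
Context {R : realType} {n : nat}.
Local Notation V := 'rV[R]_n.

Definition Coo (f : V -> R) := forall m, Ck m f.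

Lemma Coo_coord i : Coo (fun x : V => x ord0 i).
Proof.
case=> [|m]; first by apply/Ck0; exact: coord_continuous.
have E j (x : V) : is_derive x (e_ j) (fun x : V => x ord0 i) (e_ j ord0 i).
  have d := @differentiable_coord R 1 n x ord0 i.
  apply: DeriveDef; first exact: diff_derivable.
  rewrite deriveE//.
  pose g : {linear V -> R} := grad_lin (fun k => (k == i)%:R).
  have gE : (fun x : V => x ord0 i) = g.
    apply/funext => v; rewrite /g /= /grad_lin (bigD1 i)//= eqxx mulr1 big1 ?addr0// => k ki.
    by rewrite (negbTE ki) mulr0.
  by rewrite [in LHS]gE diff_lin ?[in RHS](congr1 (fun h => h _) gE)//; exact: grad_lin_continuous.
apply/CkS; split => [|j x|j]; [exact: coord_continuous|by case: (E j x)|].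
rewrite (_ : pd j _ = cst (e_ j ord0 i)); first exact: Ck_cst.
by apply/funext => x; case: (E j x).
Qed.

Lemma Coo_prod (I : Type) (r : seq I) (F : I -> V -> R) :
  (forall i, Coo (F i)) -> Coo (fun x => \prod_(i <- r) F i x).
Proof.
move=> HF m; elim: r => [|i r IH].
  rewrite (_ : (fun _ => _) = cst 1); first exact: Ck_cst.
  by apply/funext => x; rewrite big_nil.
rewrite (_ : (fun _ => _) = F i * (fun x => \prod_(i <- r) F i x)); first by apply: CkM => //; exact: HF.
by apply/funext => x; rewrite big_cons.
Qed.

Definition boxstep (k : R) (a b : 'I_n -> R) (x : V) : R :=
  \prod_i sstep (k * ((x ord0 i - a i) * (b i - x ord0 i))).

Lemma Coo_boxstep k a b : Coo (boxstep k a b).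
Proof.
apply: Coo_prod => i m.
rewrite (_ : (fun _ => _) = sstep \o (k *: (((fun x : V => x ord0 i) - cst (a i)) * (cst (b i) - (fun x : V => x ord0 i)))))//.
have := @Coo_coord i m; have Hc := @Ck_cst R n m => H.
by apply: Ck_sstep; apply: CkZ; apply: CkM; apply: CkB.
Qed.

Lemma boxstep_ge0 k a b x : 0 <= boxstep k a b x.
Proof. by apply: prodr_ge0 => i _; exact: sstep_ge0. Qed.

Lemma boxstep_le1 k a b x : boxstep k a b x <= 1.
Proof. by apply: prodr_ile1 => i _; rewrite sstep_ge0 sstep_le1. Qed.

Lemma boxstep0 k a b (x : V) i : 0 <= k -> (x ord0 i - a i) * (b i - x ord0 i) <= 0 ->
  boxstep k a b x = 0.
Proof. by move=> k0 H; rewrite /boxstep (bigD1 i)//= sstep0 ?mul0r// mulr_ge0_le0. Qed.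

Lemma boxstep1 k a b (x : V) :
  (forall i, 1 <= k * ((x ord0 i - a i) * (b i - x ord0 i))) -> boxstep k a b x = 1.
Proof. by move=> H; rewrite /boxstep big1// => i _; rewrite sstep1. Qed.

(** The norm is the maximum norm, so balls are boxes and a product of one-variable steps suffices.
    Each factor sees $4r^2-(x-c)_i^2$, which is at least $3r^2$ on the ball of radius [r] and, for
    some $i$, nonpositive outside that of radius $2r$. *)
Lemma plateau_ex (c : V) (r : R) : 0 < r -> exists z : V -> R,
  [/\ Coo z, forall x, 0 <= z x <= 1, forall x, `|x - c| <= r -> z x = 1,
      forall x, 2 * r <= `|x - c| -> z x = 0 &
      forall u, z (c + u) = z (c - u)].
Proof.
move=> r0; exists (boxstep (3 * r ^+ 2)^-1 (fun i => c ord0 i - 2 * r) (fun i => c ord0 i + 2 * r)).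
have r2 : 0 < 3 * r ^+ 2 by rewrite mulr_gt0// exprn_gt0.
have E (x : V) i : (x ord0 i - (c ord0 i - 2 * r)) * (c ord0 i + 2 * r - x ord0 i) =
    4 * r ^+ 2 - ((x - c) ord0 i) ^+ 2 by rewrite !mxE; ring.
split.
- exact: Coo_boxstep.
- by move=> x; rewrite boxstep_ge0 boxstep_le1.
- move=> x xr; apply: boxstep1 => i; rewrite E mulrC ler_pdivlMr// mul1r.
  have := le_trans (coord_le_norm (x - c) i) xr; move: ((x - c) ord0 i) => y.
  rewrite ler_norml => /andP[? ?]; nra.
- move=> x xr; have [i] : exists i, 2 * r <= `|(x - c) ord0 i|.
    apply: contrapT => /forallNP H; suff : `|x - c| < 2 * r by rewrite ltNge xr.
    have := mx_normrE (x - c); rewrite -[mx_norm _]/(`|x - c|) => ->.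
    apply: bigmax_lt; first by rewrite mulr_gt0.
    by move=> [j i] _ /=; rewrite ord1 ltNge; apply/negP; exact: H.
  move=> ir; apply: (@boxstep0 _ _ _ _ i); first by rewrite invr_ge0 ltW.
  rewrite E subr_le0 -[leRHS]real_normK ?num_real// (_ : 4 * r ^+ 2 = (2 * r) ^+ 2); last by ring.
  by rewrite ler_sqr ?nnegrE// mulr_ge0// ltW.
- move=> u; rewrite /boxstep; apply: eq_bigr => i _; congr (sstep (_ * _)).
  by rewrite !E !mxE; ring.
Qed.

End plateau.

(** * Uniform continuity *)

Section heine.
Context {R : realType} {n : nat}.
Local Notation V := 'rV[R]_n.

Lemma cc_unif L (f : V -> R) e : cc L f -> 0 < e ->
  exists2 d, 0 < d & forall x y, `|x - y| < d -> `|f x - f y| < e.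
Proof.
move=> [cf bf] e0.
have := @compact_cball R n (L + 1) => /compact_near_coveringP cK.
pose P (d : R) (x : V) := forall y, `|x - y| < d -> `|f x - f y| < e.
have [] := cK R 0^'+ P _ _.
  move=> x _.
  have [d d0 Hd] := Ck_dist x ((Ck0 f).2 cf) (divr_gt0 e0 (ltr0n _ 2)).
  exists ([set y | `|x - y| < d / 2], [set h | h < d / 2]) => /=.
    split; first by apply/nbhs_ballP; exists (d / 2); [rewrite /= divr_gt0|move=> y; rewrite -ball_normE].
    by apply: nbhs_right_lt; rewrite divr_gt0.
  move=> [x' h] /= [xx' hd] y x'y.
  rewrite (_ : f x' - f y = (f x - f y) - (f x - f x')); last by ring.
  apply: (le_lt_trans (ler_normB _ _)); rewrite [e]splitr ltrD//.
    apply: Hd; rewrite (_ : x - y = (x - x') + (x' - y)); last by rewrite addrA subrK.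
    by apply: (le_lt_trans (ler_normD _ _)); rewrite [d]splitr ltrD// (lt_trans x'y).
  by apply: Hd; apply: lt_trans xx' _; rewrite ltr_pdivrMr// ltr_pMr// ltr1n.
move=> d0 /= d00 Hd; pose d := Num.min (d0 / 2) 1.
have dpos : 0 < d by rewrite lt_min divr_gt0 /=.
exists d => // x y xy; have [xL|xL] := leP `|x| (L + 1).
  apply: (Hd d) => //; rewrite /= sub0r normrN gtr0_norm//.
  by rewrite gt_min ltr_pdivrMr// ltr_pMr ?ltr1n.
rewrite (bf x) ?(lt_trans _ xL) ?ltrDl// bf ?subrr ?normr0//.
have xy1 : `|x - y| < 1 by apply: lt_le_trans xy _; rewrite ge_min lexx orbT.
have := lerB_dist x (x - y); rewrite opprB subrKC => H.
by apply: lt_le_trans H; lra.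
Qed.

End heine.

(** * Locality, translations and integration by parts *)

Section local.
Context {R : realType} {n : nat}.
Local Notation V := 'rV[R]_n.
Local Notation vol := (@vol R n).
Implicit Types (f g : V -> R) (x v : V).

Lemma pd_local i f g (U : set V) x : open U -> (forall y, U y -> f y = g y) -> U x ->
  pd i f x = pd i g x.
Proof.
move=> oU fg Ux; rewrite /pd; apply: near_eq_derive.
by apply: filterS (open_nbhs_nbhs (conj oU Ux)) => y; exact: fg.
Qed.

Lemma partials_local s f g (U : set V) x : open U -> (forall y, U y -> f y = g y) -> U x ->
  partials s f x = partials s g x.
Proof.
move=> oU fg; elim: s x => [|i s IH] x Ux; first exact: fg.
exact: (pd_local i oU IH Ux).
Qed.

Lemma open_norm_gt (L : R) : open [set x : V | L < `|x|].
Proof.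
by apply: (@open_comp _ _ (fun x : V => `|x|) [set y | L < y]);
  [move=> x _; exact: norm_continuous|exact: open_gt].
Qed.

Lemma bs_partials s L f : bs L f -> bs L (partials s f).
Proof.
move=> bf x Lx; rewrite (@partials_local s f (cst 0) _ x (@open_norm_gt L))//.
elim: s {bf} x Lx => [//|i s IH] x Lx; rewrite partials_cons.
rewrite (@pd_local i _ (cst 0) _ x (@open_norm_gt L))//; last by rewrite /pd derive_cst.
Qed.

Lemma bs_pd i L f : bs L f -> bs L (pd i f).
Proof. exact: (@bs_partials [:: i]). Qed.

Lemma bs_dv v L f : bs L f -> bs L (dv v f).
Proof.
move=> bf x Lx; rewrite /dv fct_sumE big1// => i _.
by rewrite fctE (bs_pd _ bf)// scaler0.
Qed.

Lemma bs_add L f g : bs L f -> bs L g -> bs L (f + g).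
Proof. by move=> bf bg x Lx; rewrite fctE bf// bg// addr0. Qed.
Lemma bs_scale L c f : bs L f -> bs L (c *: f).
Proof. by move=> bf x Lx; rewrite fctE bf// scaler0. Qed.
Lemma bs_opp L f : bs L f -> bs L (- f).
Proof. by move=> bf x Lx; rewrite fctE bf// oppr0. Qed.
Lemma bs_mulr L f g : bs L f -> bs L (f * g).
Proof. by move=> bf x Lx; rewrite fctE bf// mul0r. Qed.
Lemma bs_mull L f g : bs L g -> bs L (f * g).
Proof. by move=> bf x Lx; rewrite fctE bf// mulr0. Qed.
Lemma bs_le L M f : L <= M -> bs L f -> bs M f.
Proof. by move=> LM bf x Mx; apply: bf; exact: le_lt_trans Mx. Qed.

Lemma cc_pd i L k f : Ck k.+1 f -> bs L f -> cc L (pd i f).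
Proof. by move=> Hf bf; split; [exact: (Ck_cont (Ck_pd i Hf))|exact: bs_pd]. Qed.

Lemma cc_dv v L k f : Ck k.+1 f -> bs L f -> cc L (dv v f).
Proof. by move=> Hf bf; split; [exact: (Ck_cont (Ck_dv v Hf))|exact: bs_dv]. Qed.

Lemma diffquot_unif v L f e : Ck 1 f -> bs L f -> 0 < e ->
  exists2 d, 0 < d & forall t, t != 0 -> `|t| < d -> forall x,
    `|(f (x + t *: v) - f x) / t - dv v f x| <= e.
Proof.
move=> Hf bf e0; have [d d0 Hd] := cc_unif (cc_dv v Hf bf) e0.
have v1 : 0 < `|v| + 1 by rewrite ltr_wpDl.
exists (d / (`|v| + 1)); first by rewrite divr_gt0.
move=> t t0 td x; have [xi xit ->] := MVT_C1 x v t Hf.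
rewrite mulrC mulKf// distrC; apply/ltW/Hd.
rewrite opprD addrA subrr sub0r normrN normrZ.
apply: (@le_lt_trans _ _ (`|t| * (`|v| + 1))); last by rewrite -ltr_pdivlMr.
by rewrite ler_pM// lerDl.
Qed.

Definition trans (c x : V) : V := x + c.

Lemma trans_shear c : @trans c = fun x => x + (cst 1 : V -> R) x *: c.
Proof. by apply/funext => x; rewrite /trans scale1r. Qed.

Lemma ip_trans c f g : sq f -> sq g -> ip (f \o trans c) (g \o trans c) = ip f g.
Proof.
move=> sf sg; rewrite trans_shear -[RHS](@ip_shear _ _ 1 c (cst 1))//.
- by rewrite normr1 mul1r.
- by move=> x t; rewrite subrr mul0r addr0.
Qed.

Lemma sq_trans c f : sq f -> sq (f \o trans c).
Proof.
move=> sf; rewrite trans_shear; apply: (@sq_shear _ _ 1 c (cst 1)) => //.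
by move=> x t; rewrite subrr mul0r addr0.
Qed.

Lemma nrm_trans c f : sq f -> nrm (f \o trans c) = nrm f.
Proof. by move=> sf; rewrite /nrm ip_trans. Qed.

Lemma bs_trans c L f : bs L f -> bs (L + `|c|) (f \o trans c).
Proof.
move=> bf x Lx; apply: bf; rewrite /trans.
have := lerB_dist x (- c); rewrite opprK normrN; apply: lt_le_trans; by rewrite ltrBrDr.
Qed.

Lemma continuous_trans c : continuous (@trans c).
Proof. by move=> x; apply: continuousD; [exact: cvg_id|exact: cst_continuous]. Qed.

(** Stands in for the constant 1, which is not square integrable: the integral of a boundedly
    supported [f] is written [ip f (boxind L)]. *)
Definition boxind (L : R) : V -> R := \1_[set x : V | forall i, `|x ord0 i| <= L].

Lemma sq_boxind L : sq (boxind L).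
Proof.
have [mB Boo] := @vol_box_lty R n L.
apply: sqP; first exact: measurable_indic.
rewrite (eq_integral (fun x => (boxind L x)%:E)).
  by rewrite integral_indic// setIT.
by move=> x _; rewrite /boxind indicE; case: (_ \in _); rewrite ?expr1n ?expr0n.
Qed.

Lemma boxind1 L x : `|x| <= L -> boxind L x = 1.
Proof.
by move=> xL; rewrite /boxind indicE mem_set// => i; exact: le_trans (coord_le_norm x i) xL.
Qed.

Lemma bs_mul_boxind L M f : L <= M -> bs L f -> f * boxind M = f.
Proof.
move=> LM bf; apply/funext => x; rewrite !fctE.
have [xL|xL] := leP `|x| L; last by rewrite bf// mul0r.
by rewrite boxind1 ?mulr1// (le_trans xL).
Qed.

Lemma sqM_bs c L f : continuous c -> bs L c -> sq f -> sq (c * f).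
Proof.
move=> cc0 bc sf; have [M M0 cM] := cc_bounded (conj cc0 bc).
by apply: (sq_mulb _ cM) => //; exact: continuous_measurable_rV.
Qed.

(** Translation invariance gives every difference quotient integral 0, and the quotients converge
    uniformly within a fixed box. The margin $|v|$ in [M] leaves room for translations of length at
    most $|v|$. *)
Lemma ip_dv0 v L f M : Ck 1 f -> bs L f -> L + `|v| <= M -> ip (dv v f) (boxind M) = 0.
Proof.
move=> Hf bf LM; pose X := boxind M; have sX : sq X by exact: sq_boxind.
have ccf : cc L f by split=> //; exact: Ck_cont Hf.
have sf := cc_sq ccf.
have L0 : L <= M by apply: le_trans LM; rewrite lerDl.
have J t : `|t| <= 1 -> ip (f \o trans (t *: v)) X = ip f X.
  move=> t1; rewrite -[RHS](ip_trans (t *: v))//; apply: eq_Rintegral => x _ /=.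
  have [fx|fx] := eqVneq (f (trans (t *: v) x)) 0; first by rewrite fx !mul0r.
  have xL : `|trans (t *: v) x| <= L.
    by rewrite leNgt; apply: contra fx => fx; rewrite bf.
  rewrite /X !boxind1//; first by rewrite (le_trans xL).
  apply: le_trans LM; rewrite -[x](addrK (t *: v)).
  apply: (le_trans (ler_normB _ _)); rewrite lerD// normrZ.
  by rewrite -[leRHS]mul1r ler_wpM2r.
have [C C0 HC] := @nrm_sup_bound R n (L + `|v|).
apply/eqP; rewrite -normr_eq0 eq_le normr_ge0 andbT.
apply/ler_addgt0Pr => e e0; rewrite add0r.
have k0 : 0 < C * nrm X + 1 by rewrite ltr_wpDl// mulr_ge0// nrm_ge0.
have [d d0 Hd] := diffquot_unif v Hf bf (divr_gt0 e0 k0).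
pose t := Num.min (d / 2) 1.
have t0 : 0 < t by rewrite lt_min divr_gt0 /=.
have t1 : `|t| <= 1 by rewrite gtr0_norm// ge_min lexx orbT.
have td : `|t| < d by rewrite gtr0_norm// gt_min ltr_pdivrMr// ltr_pMr ?ltr1n.
pose g := t^-1 *: (f \o trans (t *: v) - f).
have sft : sq (f \o trans (t *: v)) by exact: sq_trans.
have sg : sq g by apply: sqZ; exact: sqB.
have sd : sq (dv v f) := cc_sq (cc_dv v Hf bf).
have g0 : ip g X = 0 by rewrite /g ipZl ?ipBl ?J ?subrr ?mulr0//; exact: sqB.
have -> : ip (dv v f) X = - ip (g - dv v f) X by rewrite ipBl// g0 sub0r opprK.
rewrite normrN.
apply: (le_trans (ip_CS (sqB sg sd) sX)).
have : nrm (g - dv v f) <= C * (e / (C * nrm X + 1)).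
  apply: HC => //; first exact: sqB.
  - apply: bs_add; last by apply: bs_opp; apply: bs_le (bs_dv v bf); rewrite lerDl.
    apply: bs_scale; apply: bs_add; last by apply: bs_opp; apply: bs_le bf; rewrite lerDl.
    apply: bs_le (@bs_trans (t *: v) L f bf); rewrite lerD2l normrZ.
    by rewrite -[leRHS]mul1r ler_wpM2r.
  - by rewrite divr_ge0// ltW.
  - by move=> x; rewrite /g !fctE /GRing.scale /= mulrC; apply: Hd; rewrite ?gt_eqF.
move=> /(ler_wpM2r (nrm_ge0 X)) /le_trans; apply.
rewrite (_ : C * _ * _ = (C * nrm X) / (C * nrm X + 1) * e); last by ring.
by rewrite ger_pMl// ler_pdivrMr// mul1r lerDl.
Qed.

Lemma ip_byparts v L f g : Ck 1 f -> Ck 1 g -> bs L f ->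
  ip (dv v f) g = - ip f (dv v g).
Proof.
move=> Hf Hg bf; pose M := L + `|v|.
have LM : L <= M by rewrite lerDl.
have := ip_dv0 (CkM Hf Hg) (bs_mulr g bf) (lexx M).
have h1 : bs L (dv v f * g) by apply: bs_mulr; exact: bs_dv.
have h2 : bs L (f * dv v g) by exact: bs_mulr.
have s1 : sq (dv v f * g).
  apply: (@cc_sq _ _ L); split => //; apply: (@Ck_cont _ _ 0); apply: CkM; first exact: Ck_dv.
  exact: Ck_le Hg.
have s2 : sq (f * dv v g).
  apply: (@cc_sq _ _ L); split => //; apply: (@Ck_cont _ _ 0); apply: CkM; last exact: Ck_dv.
  exact: Ck_le Hf.
have red h1' h2' : bs L (h1' * h2') -> ip (h1' * h2') (boxind M) = ip h1' h2'.
  move=> bh; apply: eq_Rintegral => x _.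
  by rewrite -[RHS]/((h1' * h2') x) -[in RHS](bs_mul_boxind LM bh).
rewrite dvM// ipDl//; last exact: sq_boxind.
by rewrite !red// => /eqP; rewrite addr_eq0 => /eqP.
Qed.

Lemma ip_byparts_pd i L f g : Ck 1 f -> Ck 1 g -> bs L f ->
  ip (pd i f) g = - ip f (pd i g).
Proof. by move=> Hf Hg bf; have := ip_byparts (e_ i) Hf Hg bf; rewrite !dv_e. Qed.

End local.

(** * Mollification *)

Section mollify.
Context {R : realType} {n : nat}.
Local Notation V := 'rV[R]_n.
Local Notation vol := (@vol R n).
Implicit Types (f g phi eta : V -> R) (x v : V).

(* Correlation rather than convolution: no reflection of [eta] is needed. *)
Definition corr eta phi (x : V) : R := ip (eta \o trans (- x)) phi.

Lemma corr_shift eta phi x c : corr eta phi (x + c) = corr (eta \o trans (- c)) phi x.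
Proof.
by rewrite /corr; congr ip; apply/funext => y; rewrite /= /trans opprD addrA.
Qed.

Lemma corr_cont eta L phi : cc L eta -> sq phi -> continuous (corr eta phi).
Proof.
move=> ce sphi x; apply/(@cvgrPdist_le _ _ _ (nbhs x)) => e e0.
have cw : cc (L + 1) eta by apply: cc_weak ce; rewrite lerDl.
have sc := cc_sq ce; have [C C0 HC] := @nrm_sup_bound R n (L + 1).
pose K := C * nrm phi + 1.
have K0 : 0 < K by rewrite ltr_wpDl// mulr_ge0// nrm_ge0.
have [d d0 Hd] := cc_unif ce (divr_gt0 e0 K0).
apply/nbhs_ballP; exists (Num.min d 1); first by rewrite /= lt_min d0 /=.
move=> y; rewrite -ball_normE /= lt_min => /andP[xyd xy1].
set c := x - y in xyd xy1 *.
have -> : corr eta phi x = corr (eta \o trans (- c)) phi y by rewrite -corr_shift /c addrC subrK.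
have st := sq_trans (- y) sc; have st' := sq_trans (- y) (sq_trans (- c) sc).
rewrite /corr -ipBl//; apply: (le_trans (ip_CS (sqB st' st) sphi)).
rewrite -[X in nrm X]/((eta \o trans (- c) - eta) \o trans (- y)).
have sB : sq (eta \o trans (- c) - eta) by apply: sqB => //; exact: sq_trans.
rewrite nrm_trans//.
have : nrm (eta \o trans (- c) - eta) <= C * (e / K).
  apply: HC => //.
  - case: ce => _ be; apply: bs_add; last by apply: bs_opp; apply: bs_le be; rewrite lerDl.
    by apply: bs_le (@bs_trans R n (- c) L eta be); rewrite lerD2l normrN ltW.
  - by rewrite divr_ge0// ltW.
  - move=> z; rewrite !fctE /=; apply/ltW/Hd.
    by rewrite /trans addrC addrA subrr add0r normrN in xyd * || by rewrite /trans addrAC subrr add0r normrN.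
move=> /(ler_wpM2r (nrm_ge0 phi)) /le_trans; apply.
rewrite (_ : C * _ * _ = (C * nrm phi) / K * e); last by rewrite /K; ring.
by rewrite ger_pMl// ler_pdivrMr// mul1r lerDl.
Qed.

Lemma corr_pd eta L phi i x : Ck 1 eta -> bs L eta -> sq phi ->
  derivable (corr eta phi) x (e_ i) /\ pd i (corr eta phi) x = - corr (pd i eta) phi x.
Proof.
move=> He be sphi; have ce : cc L eta by split=> //; exact: Ck_cont He.
have cp := cc_pd i He be.
have sc := cc_sq ce; have sp := cc_sq cp.
have [C C0 HC] := @nrm_sup_bound R n (L + 1).
pose K := C * nrm phi + 1.
have K0 : 0 < K by rewrite ltr_wpDl// mulr_ge0// nrm_ge0.
have n1 : `|e_ i : V| <= 1.
  by apply: norm_le_coord => // q; rewrite mxE eqxx /=; case: (_ == _); rewrite ?normr1 ?normr0.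
have H : (fun h : R => h^-1 *: ((corr eta phi \o shift x) (h *: e_ i) - corr eta phi x)) @ 0^' -->
    - corr (pd i eta) phi x.
  apply/cvgrPdist_le => e e0.
  have [d d0 Hd] := diffquot_unif (e_ i) He be (divr_gt0 e0 K0).
  rewrite near_withinE; apply/nbhs_ballP; exists (Num.min d 1); first by rewrite /= lt_min d0 /=.
  move=> h; rewrite -ball_normE /= sub0r normrN lt_min => /andP[hd h1] h0.
  rewrite [h *: _ + x]addrC corr_shift.
  pose g := h^-1 *: (eta \o trans (- (h *: e_ i)) - eta).
  have sht : sq (eta \o trans (- (h *: e_ i))) by exact: sq_trans.
  have sg : sq g by apply: sqZ; exact: sqB.
  rewrite (_ : h^-1 *: _ = ip (g \o trans (- x)) phi); last first.
    rewrite -[g \o _]/(h^-1 *: (((eta \o trans (- (h *: e_ i))) \o trans (- x)) - (eta \o trans (- x)))).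
    by rewrite ipZl ?ipBl//; try apply: sqB; exact: sq_trans.
  rewrite -opprD normrN /corr -ipDl//; try exact: sq_trans.
  apply: (le_trans (ip_CS _ sphi)); first by apply: sqD; exact: sq_trans.
  rewrite -[X in nrm X]/((pd i eta + g) \o trans (- x)) nrm_trans; last exact: sqD.
  have : nrm (pd i eta + g) <= C * (e / K).
    apply: HC; first exact: sqD.
    - apply: bs_add; first by apply: bs_le (bs_pd i be); rewrite lerDl.
      apply: bs_scale; apply: bs_add; last by apply: bs_opp; apply: bs_le be; rewrite lerDl.
      apply: bs_le (@bs_trans R n (- (h *: e_ i)) L eta be); rewrite lerD2l normrN normrZ.
      by rewrite -[leRHS]mul1r ler_pM// ltW.
    - by rewrite divr_ge0// ltW.
    - move=> y; have := Hd (- h) _ _ y; rewrite oppr_eq0 normrN dv_e => /(_ h0 hd).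
      rewrite scaleNr invrN mulrN.
      have -> : (pd i eta + g) y = - (- ((eta (y - h *: e_ i) - eta y) / h) - pd i eta y).
        rewrite -[LHS]/(pd i eta y + h^-1 * (eta (y - h *: e_ i) - eta y)); ring.
      by rewrite normrN.
  move=> /(ler_wpM2r (nrm_ge0 phi)) /le_trans; apply.
  rewrite (_ : C * _ * _ = (C * nrm phi) / K * e); last by rewrite /K; ring.
  by rewrite ger_pMl// ler_pdivrMr// mul1r lerDl.
split; first by apply/cvg_ex; exists (- corr (pd i eta) phi x).
exact: cvg_lim H.
Qed.

Lemma Coo_corr eta L phi : Coo eta -> bs L eta -> sq phi -> Coo (corr eta phi).
Proof.
move=> He be sphi m; elim: m eta He be => [|m IH] eta He be.
  by apply/Ck0; apply: (@corr_cont _ L) => //; split=> //; exact: (Ck_cont (He 0%N)).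
apply/CkS; split => [|i x|i].
- by apply: (@corr_cont _ L) => //; split=> //; exact: (Ck_cont (He 0%N)).
- exact: (corr_pd i x (He 1%N) be sphi).1.
- rewrite (_ : pd i _ = - corr (pd i eta) phi); last first.
    by apply/funext => x; rewrite (corr_pd i x (He 1%N) be sphi).2.
  by apply: CkN; apply: IH; [move=> k; exact: (Ck_pd i (He k.+1))|exact: bs_pd].
Qed.

(** The derivative falls on [eta] with a minus sign, and integration by parts carries it over to
    [phi]. *)
Lemma corr_pd_swap eta L M phi i : Ck 1 eta -> bs L eta -> Ck 1 phi -> bs M phi ->
  pd i (corr eta phi) = corr eta (pd i phi).
Proof.
move=> He be Hp bp; apply/funext => x.
have sphi : sq phi by apply: (@cc_sq _ _ M); split => //; exact: Ck_cont Hp.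
rewrite (corr_pd i x He be sphi).2 /corr.
have -> : pd i eta \o trans (- x) = pd i (eta \o trans (- x)).
  by apply/funext => y; exact/esym/derive_shiftE.
have Ht : Ck 1 (eta \o trans (- x)).
  apply/CkS; split => [y|j y|j].
  - by apply: continuous_comp; [exact: continuous_trans|exact: (Ck_cont He)].
  - by apply/derivable_shift; exact: C1_derivable.
  - rewrite (_ : pd j _ = pd j eta \o trans (- x)); last by apply/funext => y; exact: derive_shiftE.
    by apply/Ck0 => y; apply: continuous_comp; [exact: continuous_trans|exact: (Ck_cont (Ck_pd j He))].
by rewrite (ip_byparts_pd i Ht Hp (@bs_trans R n (- x) L eta be)) opprK.
Qed.

End mollify.

(** * Operators depending on a step, bounded uniformly *)

Section flow.
Context {R : realType} {n : nat}.
Local Notation V := 'rV[R]_n.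
Implicit Types (f g : V -> R) (x v : V).

Definition kc k f := Ck k f /\ exists L, bs L f.

Lemma kc_bs2 f g : (exists L, bs L f) -> (exists L, bs L g) -> exists L, bs L f /\ bs L g.
Proof.
move=> [L bf] [M bg]; exists (Num.max L M); split; [apply: bs_le bf|apply: bs_le bg];
  by rewrite le_max lexx ?orbT.
Qed.

Lemma kc_le j k f : (j <= k)%N -> kc k f -> kc j f.
Proof. by move=> jk [Hf bf]; split => //; exact: Ck_le Hf. Qed.
Lemma kc_cc k f : kc k f -> exists L, cc L f.
Proof. by move=> [Hf [L bf]]; exists L; split => //; exact: Ck_cont Hf. Qed.
Lemma kc_sq k f : kc k f -> sq f.
Proof. by move=> /kc_cc[L /cc_sq]. Qed.
Lemma kcD k f g : kc k f -> kc k g -> kc k (f + g).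
Proof.
move=> [Hf bf] [Hg bg]; split; first exact: CkD.
by have [L [b1 b2]] := kc_bs2 bf bg; exists L; exact: bs_add.
Qed.
Lemma kcZ k a f : kc k f -> kc k (a *: f).
Proof. by move=> [Hf [L bf]]; split; [exact: CkZ|exists L; exact: bs_scale]. Qed.
Lemma kcN k f : kc k f -> kc k (- f).
Proof. by move=> kf; rewrite -scaleN1r; exact: kcZ. Qed.
Lemma kcB k f g : kc k f -> kc k g -> kc k (f - g).
Proof. by move=> kf kg; apply: kcD => //; exact: kcN. Qed.
Lemma kc0 k : kc k (0 : V -> R).
Proof. by split; [exact: (Ck_cst k 0)|exists 0]. Qed.
Lemma kc_sum k (I : Type) (r : seq I) (F : I -> V -> R) :
  (forall i, kc k (F i)) -> kc k (\sum_(i <- r) F i).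
Proof. by move=> H; apply: (big_ind (kc k)) => //; [exact: kc0|exact: kcD]. Qed.
Lemma kcM k (a : V -> R) f : Ck k a -> kc k f -> kc k (a * f).
Proof. by move=> Hc [Hf [L bf]]; split; [exact: CkM|exists L; exact: bs_mull]. Qed.
Lemma kc_pd k i f : kc k.+1 f -> kc k (pd i f).
Proof. by move=> [Hf [L bf]]; split; [exact: Ck_pd|exists L; exact: bs_pd]. Qed.
Lemma kc_dv k v f : kc k.+1 f -> kc k (dv v f).
Proof. by move=> kf; apply: kc_sum => i; apply: kcZ; exact: kc_pd. Qed.

(** A norm of the Sobolev space $H^k$, summing over words of directions instead of multi-indices. *)
Fixpoint Nk k f : R := if k is k'.+1 then nrm f + \sum_i Nk k' (pd i f) else nrm f.

Lemma Nk_ge0 k f : 0 <= Nk k f.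
Proof. by elim: k f => [|k IH] f /=; rewrite ?addr_ge0 ?nrm_ge0// sumr_ge0. Qed.
Lemma nrm_Nk k f : nrm f <= Nk k f.
Proof. by case: k => [//|k] /=; rewrite lerDl sumr_ge0// => i _; exact: Nk_ge0. Qed.
Lemma Nk_pd k i f : Nk k (pd i f) <= Nk k.+1 f.
Proof.
rewrite /= (bigD1 i)//= addrCA lerDl addr_ge0 ?nrm_ge0// sumr_ge0// => j _; exact: Nk_ge0.
Qed.
Lemma Nk_S k f : Nk k f <= Nk k.+1 f.
Proof.
elim: k f => [|k IH] f; first exact: nrm_Nk.
by rewrite /= lerD2l; apply: ler_sum => i _; exact: IH.
Qed.
Lemma Nk_le j k f : (j <= k)%N -> Nk j f <= Nk k f.
Proof.
elim: k => [|k IH]; first by rewrite leqn0 => /eqP->.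
by rewrite leq_eqVlt => /predU1P[->//|/IH /le_trans]; apply; exact: Nk_S.
Qed.
Lemma NkD k f g : kc k f -> kc k g -> Nk k (f + g) <= Nk k f + Nk k g.
Proof.
elim: k f g => [|k IH] f g kf kg; first by apply: nrmD; [exact: kc_sq kf|exact: kc_sq kg].
rewrite /= addrACA lerD//; first by apply: nrmD; [exact: kc_sq kf|exact: kc_sq kg].
rewrite -big_split /=; apply: ler_sum => i _.
by rewrite pdD1 ?IH//; [exact: kc_pd|exact: kc_pd|exact: Ck_le kf.1|exact: Ck_le kg.1].
Qed.
Lemma NkZ k a f : kc k f -> Nk k (a *: f) = `|a| * Nk k f.
Proof.
elim: k f => [|k IH] f kf /=; rewrite nrmZ//; try exact: kc_sq kf.
rewrite mulrDr mulr_sumr; congr (_ + _); apply: eq_bigr => i _.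
by rewrite pdZ1 ?IH//; [exact: kc_pd|exact: Ck_le kf.1].
Qed.

Implicit Types (c d : R -> V -> R) (T : R -> (V -> R) -> V -> R).

(** The admissible steps of a difference quotient; all constants below are uniform over them. *)
Definition ok (h : R) := h != 0 /\ `|h| <= 1.
Lemma okN h : ok h -> ok (- h).
Proof. by move=> [h0 h1]; split; rewrite ?oppr_eq0 ?normrN. Qed.

(** Coefficients bounded in $C^k$ uniformly in the step. *)
Definition ub k (c : R -> V -> R) := (forall h, ok h -> Ck k (c h)) /\
  exists2 M, 0 <= M & forall h s x, ok h -> (size s <= k)%N -> `|partials s (c h) x| <= M.

Lemma ub_Ck k c h : ub k c -> ok h -> Ck k (c h).
Proof. by move=> [H _]; exact: H. Qed.

Lemma ub_bd k c : ub k c -> exists2 M, 0 <= M & forall h x, ok h -> `|c h x| <= M.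
Proof. by move=> [_ [M M0 H]]; exists M => // h x oh; exact: (H h [::] x). Qed.

Lemma ub0 c : ub 0 c <-> (forall h, ok h -> continuous (c h)) /\
  exists2 M, 0 <= M & forall h x, ok h -> `|c h x| <= M.
Proof.
split=> [H|[H1 [M M0 H2]]].
  by split; [move=> h oh; apply/Ck0; exact: ub_Ck oh|exact: ub_bd H].
split; first by move=> h oh; apply/Ck0; exact: H1.
by exists M => // h [|//] x oh _; exact: H2.
Qed.

Lemma ubS k c : ub k.+1 c <-> [/\ (forall h, ok h -> Ck k.+1 (c h)),
  (exists2 M, 0 <= M & forall h x, ok h -> `|c h x| <= M) &
  forall i, ub k (fun h => pd i (c h))].
Proof.
split=> [H|[H1 [M M0 H2] H3]].
  split; [by case: H|exact: ub_bd H|] => i; case: H => H1 [M M0 H2]; split.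
    by move=> h oh; exact: (Ck_pd i (H1 _ oh)).
  exists M => // h s x oh sk; rewrite -partials_rcons; apply: H2 => //.
  by rewrite size_rcons.
split => //.
have /all_sig2[N N0 HN] i : {N | 0 <= N & forall h s x, ok h -> (size s <= k)%N ->
    `|partials s (pd i (c h)) x| <= N}.
  by apply: cid2; case: (H3 i).
exists (M + \sum_i N i); first by rewrite addr_ge0// sumr_ge0.
move=> h s x oh; case/lastP: s => [_|s i]; first by rewrite (le_trans (H2 h x oh))// lerDl sumr_ge0.
rewrite size_rcons ltnS partials_rcons => sk; rewrite (le_trans (HN i h s x oh sk))//.
by rewrite (bigD1 i)//= addrCA lerDl addr_ge0// sumr_ge0.
Qed.

Lemma ub_le j k c : (j <= k)%N -> ub k c -> ub j c.
Proof.
move=> jk [H1 [M M0 H2]]; split; first by move=> h oh; exact: Ck_le (H1 _ oh).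
by exists M => // h s x oh sj; apply: H2 => //; exact: leq_trans jk.
Qed.
Lemma ub_pd k i c : ub k.+1 c -> ub k (fun h => pd i (c h)).
Proof. by move=> /ubS[]. Qed.
Lemma ub_ext k c d : (forall h, ok h -> c h = d h) -> ub k c -> ub k d.
Proof.
move=> cd [H1 [M M0 H2]]; split; first by move=> h oh; rewrite -cd//; exact: H1.
by exists M => // h s x oh sk; rewrite -cd//; exact: H2.
Qed.
Lemma ub_add k c d : ub k c -> ub k d -> ub k (fun h => c h + d h).
Proof.
elim: k c d => [|k IH] c d Hc Hd.
  have [/ub0[c1 [M M0 c2]] /ub0[d1 [N N0 d2]]] := (Hc, Hd); apply/ub0; split.
    by move=> h oh x; apply: continuousD; [exact: c1|exact: d1].
  exists (M + N); first exact: addr_ge0.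
  by move=> h x oh; rewrite (le_trans (ler_normD _ _))// lerD ?c2 ?d2.
have [[M M0 c2] [N N0 d2]] := (ub_bd Hc, ub_bd Hd); apply/ubS; split.
- by move=> h oh; apply: CkD; exact: ub_Ck.
- exists (M + N); first exact: addr_ge0.
  by move=> h x oh; rewrite (le_trans (ler_normD _ _))// lerD ?c2 ?d2.
- move=> i; apply: (ub_ext _ (IH _ _ (ub_pd i Hc) (ub_pd i Hd))) => h oh.
  by rewrite pdD1//; [exact: Ck_le (ub_Ck Hc oh)|exact: Ck_le (ub_Ck Hd oh)].
Qed.
Lemma ub_mul k c d : ub k c -> ub k d -> ub k (fun h => c h * d h).
Proof.
elim: k c d => [|k IH] c d Hc Hd.
  have [/ub0[c1 [M M0 c2]] /ub0[d1 [N N0 d2]]] := (Hc, Hd); apply/ub0; split.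
    by move=> h oh x; apply: continuousM; [exact: c1|exact: d1].
  exists (M * N); first exact: mulr_ge0.
  by move=> h x oh; rewrite normrM ler_pM ?c2 ?d2.
have [[M M0 c2] [N N0 d2]] := (ub_bd Hc, ub_bd Hd); apply/ubS; split.
- by move=> h oh; apply: CkM; exact: ub_Ck.
- exists (M * N); first exact: mulr_ge0.
  by move=> h x oh; rewrite normrM ler_pM ?c2 ?d2.
- move=> i; apply: ub_ext (ub_add (IH _ _ (ub_pd i Hc) (ub_le (leqnSn k) Hd))
    (IH _ _ (ub_le (leqnSn k) Hc) (ub_pd i Hd))) => h oh.
  by rewrite pdM1//; [exact: Ck_le (ub_Ck Hc oh)|exact: Ck_le (ub_Ck Hd oh)].
Qed.
Lemma ub_cst k (a : R -> R) (M : R) : 0 <= M -> (forall h, ok h -> `|a h| <= M) ->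
  ub k (fun h => cst (a h)).
Proof.
move=> M0 aM; split; first by move=> h oh; exact: Ck_cst.
exists M => // h s x oh _; have [->|s0] := eqVneq s [::]; first exact: aM.
rewrite (_ : partials s _ = cst 0) /= ?normr0//.
case/lastP: s s0 => [//|s i _]; rewrite partials_rcons pd_cst.
by elim: s => [//|j s IH]; rewrite partials_cons IH pd_cst.
Qed.
Lemma ub_scale k a c : ub k c -> ub k (fun h => a *: c h).
Proof. by move=> Hc; apply: (ub_mul (ub_cst k (a := cst a) (normr_ge0 a) _) Hc). Qed.
Lemma ub_sum k (F : 'I_n -> R -> V -> R) : (forall i, ub k (F i)) -> ub k (fun h => \sum_i F i h).
Proof.
move=> H; elim: (index_enum _) => [|i r IH].
  by apply: ub_ext (ub_cst k (a := cst 0) (lexx 0) _) => [h _|h _]; rewrite ?big_nil ?normr0.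
by apply: ub_ext (ub_add (H i) IH) => h _; rewrite big_cons.
Qed.
Lemma ub_dv k v c : ub k.+1 c -> ub k (fun h => dv v (c h)).
Proof. by move=> Hc; apply: ub_sum => i; apply: ub_scale; exact: ub_pd. Qed.

Lemma ub_kc k f : kc k f -> ub k (fun=> f).
Proof.
elim: k f => [|k IH] f kf; have [L cf] := kc_cc kf.
  have [M M0 fM] := cc_bounded cf.
  by apply/ub0; split; [move=> h _; case: cf|exists M].
have [M M0 fM] := cc_bounded cf; apply/ubS; split; first by move=> h _; case: kf.
  by exists M.
by move=> i; apply: IH; exact: kc_pd.
Qed.

(** Operators bounded from $H^a$ to $H^b$ uniformly in the step. The class is stable under sums,
    composition and multiplication by [ub] coefficients, so a commutator is estimated by exhibiting
    a formula for it. *)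
Definition ob a b (T : R -> (V -> R) -> V -> R) :=
  (forall h f, ok h -> kc a f -> kc b (T h f)) /\
  exists2 C, 0 <= C & forall h f, ok h -> kc a f -> Nk b (T h f) <= C * Nk a f.

Lemma ob_kc a b T h f : ob a b T -> ok h -> kc a f -> kc b (T h f).
Proof. by case=> H _; exact: H. Qed.
Lemma ob_ext a b T T' : (forall h f, ok h -> kc a f -> T h f = T' h f) -> ob a b T -> ob a b T'.
Proof.
move=> TT [H1 [C C0 H2]]; split; first by move=> h f oh kf; rewrite -TT//; exact: H1.
by exists C => // h f oh kf; rewrite -TT//; exact: H2.
Qed.
Lemma ob_comp a b e T T' : ob a b T -> ob b e T' -> ob a e (fun h f => T' h (T h f)).
Proof.
move=> [H1 [C C0 H2]] [H1' [C' C0' H2']]; split.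
  by move=> h f oh kf; apply: H1' => //; exact: H1.
exists (C' * C); first exact: mulr_ge0.
move=> h f oh kf; rewrite (le_trans (H2' _ _ oh (H1 _ _ oh kf)))// -mulrA ler_wpM2l//.
exact: H2.
Qed.
Lemma ob_add a b T T' : ob a b T -> ob a b T' -> ob a b (fun h f => T h f + T' h f).
Proof.
move=> [H1 [C C0 H2]] [H1' [C' C0' H2']]; split.
  by move=> h f oh kf; apply: kcD; [exact: H1|exact: H1'].
exists (C + C'); first exact: addr_ge0.
move=> h f oh kf; rewrite (le_trans (NkD (H1 _ _ oh kf) (H1' _ _ oh kf)))// mulrDl.
by rewrite lerD ?H2 ?H2'.
Qed.
Lemma ob_scale a b (e : R -> R) M T : 0 <= M -> (forall h, ok h -> `|e h| <= M) -> ob a b T ->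
  ob a b (fun h f => e h *: T h f).
Proof.
move=> M0 eM [H1 [C C0 H2]]; split; first by move=> h f oh kf; apply: kcZ; exact: H1.
exists (M * C); first exact: mulr_ge0.
move=> h f oh kf; rewrite NkZ; last exact: H1.
by rewrite -mulrA ler_pM ?Nk_ge0 ?eM ?H2.
Qed.
Lemma ob_opp a b T : ob a b T -> ob a b (fun h f => - T h f).
Proof.
move=> H; apply: ob_ext (ob_scale (e := cst (-1)) ler01 _ H) => [h f _ _|h _].
  by rewrite scaleN1r.
by rewrite /= normrN1.
Qed.
Lemma ob0 a b : ob a b (fun _ _ => 0).
Proof.
split; first by move=> *; exact: kc0.
exists 0 => // h f _ _; rewrite mul0r -(scaler0 _ 0) NkZ ?normr0 ?mul0r//; exact: kc0.
Qed.
Lemma ob_sum a b (I : Type) (r : seq I) (T : I -> R -> (V -> R) -> V -> R) :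
  (forall i, ob a b (T i)) -> ob a b (fun h f => \sum_(i <- r) T i h f).
Proof.
move=> H; elim: r => [|i r IH].
  by apply: ob_ext (ob0 a b) => h f _ _; rewrite big_nil.
by apply: ob_ext (ob_add (H i) IH) => h f _ _; rewrite big_cons.
Qed.
Lemma ob_le a a' b b' T : (a <= a')%N -> (b' <= b)%N -> ob a b T -> ob a' b' T.
Proof.
move=> aa bb [H1 [C C0 H2]]; split.
  by move=> h f oh kf; apply: kc_le bb _; apply: H1 => //; exact: kc_le kf.
exists C => // h f oh kf; rewrite (le_trans (Nk_le _ bb))//.
rewrite (le_trans (H2 _ _ oh (kc_le aa kf)))// ler_wpM2l//; exact: Nk_le.
Qed.
Lemma ob_pd i a : ob a.+1 a (fun _ f => pd i f).
Proof.
split; first by move=> h f _; exact: kc_pd.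
by exists 1 => // h f _ kf; rewrite mul1r; exact: Nk_pd.
Qed.
Lemma ob_dv v a : ob a.+1 a (fun _ f => dv v f).
Proof.
apply: ob_sum => i; apply: (@ob_scale _ _ (fun=> v ord0 i) `|v ord0 i|) => //; exact: ob_pd.
Qed.
Lemma ob_S a b T : (forall h f, ok h -> kc a f -> kc b.+1 (T h f)) -> ob a 0 T ->
  (forall i, ob a b (fun h f => pd i (T h f))) -> ob a b.+1 T.
Proof.
move=> H1 [_ [C C0 H2]] H3; split => //.
have /all_sig2[N N0 HN] i : {N | 0 <= N & forall h f, ok h -> kc a f ->
    Nk b (pd i (T h f)) <= N * Nk a f}.
  by apply: cid2; case: (H3 i).
exists (C + \sum_i N i); first by rewrite addr_ge0// sumr_ge0.
move=> h f oh kf /=; rewrite mulrDl lerD ?(H2 _ _ oh kf)//.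
by rewrite mulr_suml; apply: ler_sum => i _; exact: HN.
Qed.
Lemma ob_mul b c : ub b c -> ob b b (fun h f => c h * f).
Proof.
elim: b c => [|b IH] c Hc.
  split; first by move=> h f oh kf; apply: kcM kf; exact: ub_Ck oh.
  have [M M0 cM] := ub_bd Hc; exists M => // h f oh kf /=.
  apply: nrm_mulb; [|by move=> x; exact: cM|exact: kc_sq kf].
  by apply: continuous_measurable_rV; apply/Ck0; exact: ub_Ck oh.
apply: ob_S.
- by move=> h f oh kf; apply: kcM kf; exact: ub_Ck oh.
- have H0 : ob b.+1 b (fun h f => c h * f).
    by apply: ob_le (IH _ (ub_le (leqnSn b) Hc)).
  exact: ob_le H0.
- move=> i; apply: ob_ext (ob_add (ob_le _ _ (IH _ (ub_pd i Hc)))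
    (ob_comp (ob_pd i b) (IH _ (ub_le (leqnSn b) Hc)))) => // h f oh kf.
  by rewrite pdM1//; [exact: Ck_le (ub_Ck Hc oh)|exact: Ck_le kf.1].
Qed.

End flow.

(** * Tangential flows *)

Section flow.
Context {R : realType} {n : nat}.
Local Notation V := 'rV[R]_n.
Implicit Types (f g : V -> R) (x v p : V).

Lemma Ck_trans k b f : Ck k f -> Ck k (f \o trans b).
Proof.
move=> Hf; rewrite (_ : trans b = shear b 0 (cst 0)); first by apply: Ck_shear Hf _; exact: Ck_cst.
by apply/funext => x; rewrite /trans /shear scaler0 addr0.
Qed.

Lemma pd_trans i b f : pd i (f \o trans b) = pd i f \o trans b.
Proof. by apply/funext => x; exact: derive_shiftE. Qed.

(** Order zero is left out: a defining function of the boundary grows linearly although its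
    derivatives are bounded. *)
Definition bdp k g := exists2 M, 0 <= M & forall s x, (0 < size s <= k)%N -> `|partials s g x| <= M.

Lemma bdp_pd k i g : bdp k.+1 g -> bdp k (pd i g).
Proof.
move=> [M M0 H]; exists M => // s x /andP[s0 sk]; rewrite -partials_rcons; apply: H.
by rewrite size_rcons.
Qed.

Lemma bdp_le j k g : (j <= k)%N -> bdp k g -> bdp j g.
Proof.
by move=> jk [M M0 H]; exists M => // s x /andP[s0 sj]; apply: H; rewrite s0 (leq_trans sj).
Qed.

Lemma bdp_dv v g : bdp 1 g -> exists2 M, 0 <= M & forall x, `|dv v g x| <= M.
Proof.
move=> [M M0 H]; exists (\sum_i `|v ord0 i| * M); first by apply: sumr_ge0 => i _; exact: mulr_ge0.
move=> x; rewrite /dv fct_sumE (le_trans (ler_norm_sum _ _ _))//; apply: ler_sum => i _.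
by rewrite fctE /GRing.scale /= normrM ler_wpM2l//; exact: (H [:: i]).
Qed.

Lemma ub_dif p k g : Ck k.+1 g -> bdp k.+1 g ->
  ub k (fun h => h^-1 *: (g - (g \o trans (h *: p)))).
Proof.
have B (f : V -> R) : Ck 1 f -> bdp 1 f -> exists2 M, 0 <= M & forall h x, ok h ->
    `|(h^-1 *: (f - (f \o trans (h *: p)))) x| <= M.
  move=> Hf /(bdp_dv p)[M M0 HM]; exists M => // h x [h0 _].
  have [xi _ E] := MVT_C1 x p h Hf.
  rewrite -[X in `|X|]/(h^-1 * (f x - f (x + h *: p))) -opprB E.
  by rewrite mulrN normrN mulKf.
elim: k g => [|k IH] g Hg bg.
  apply/ub0; split; last exact: B.
  move=> h _; apply/Ck0/CkZ/CkB; first exact: Ck_le Hg.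
  by apply: Ck_trans; exact: Ck_le Hg.
apply/ubS; split.
- move=> h _; apply/CkZ/CkB; first exact: Ck_le Hg.
  by apply: Ck_trans; exact: Ck_le Hg.
- by apply: B; [exact: Ck_le Hg|exact: bdp_le bg].
- move=> i; apply: ub_ext (IH (pd i g) (Ck_pd i Hg) (bdp_pd i bg)) => h _.
  have H1 : Ck 1 g by exact: Ck_le Hg.
  have H2 := Ck_trans (h *: p) H1.
  by rewrite pdZ1 ?pdB1 ?pd_trans//; exact: CkB.
Qed.

(* [q = 0], [rho = cst 0] is allowed: it gives plain translations, for interior points. *)
Definition flat (rho : V -> R) (q : V) := [/\ Ck 4 rho, bdp 4 rho &
  forall x t v, rho (x + t *: q + v) - rho (x + t *: q) = rho (x + v) - rho x].

Variables (rho : V -> R) (q : V).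
Hypothesis Hflat : flat rho q.
Let Hrho : Ck 4 rho. Proof. by case: Hflat. Qed.
Let Hrho1 : Ck 1 rho. Proof. exact: Ck_le Hrho. Qed.
Let brho : bdp 4 rho. Proof. by case: Hflat. Qed.
Let brho1 : bdp 1 rho. Proof. exact: bdp_le brho. Qed.

Lemma pd_flat i x t : pd i rho (x + t *: q) = pd i rho x.
Proof.
have [_ _ H] := Hflat.
rewrite -[LHS]/((pd i rho \o trans (t *: q)) x) -pd_trans.
have -> : rho \o trans (t *: q) = rho + cst (rho (t *: q) - rho 0).
  apply/funext => y; rewrite /= /trans fctE /=.
  have := H 0 t y; rewrite !add0r addrC => E.
  rewrite [y + _]addrC -[LHS](subrK (rho (t *: q))) E; ring.
rewrite pdD1//; last exact: Ck_cst.
by rewrite pd_cst fctE /= addr0.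
Qed.

Lemma dv_flat v x t : dv v rho (x + t *: q) = dv v rho x.
Proof. by rewrite /dv !fct_sumE; apply: eq_bigr => i _; rewrite !fctE pd_flat. Qed.

Section oneflow.
Variable p : V.

(** The multiple of [q] that compensates the change of [rho] caused by the step $hp$. *)
Definition th (h : R) x := rho x - rho (x + h *: p).
Definition Sflow (h : R) : V -> V := shear (h *: p) q (th h).
Local Notation S := Sflow.
Definition ftau (h : R) f := f \o S h.
Local Notation tau := ftau.
Definition Dquo (h : R) f : V -> R := h^-1 *: (f \o S h - f).
Local Notation D := Dquo.
Definition Xder f : V -> R := dv p f - dv p rho * dv q f.
Local Notation X := Xder.

Lemma th_flat h x t : th h (x + t *: q) = th h x.
Proof. by have [_ _ H] := Hflat; rewrite /th -opprB H opprB. Qed.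

Lemma S_flat h x t : S h (x + t *: q) = S h x + t *: q.
Proof. by rewrite /Sflow /shear th_flat (addrAC x) (addrAC _ (t *: q)). Qed.

Lemma S0 : S 0 = id.
Proof. by apply/funext => x; rewrite /Sflow /shear /th scale0r addr0 subrr scale0r addr0. Qed.

(** The compensation is constant along [q], so the compensations of successive steps telescope and
    the maps form a one-parameter group. *)
Lemma S_add h k x : S h (S k x) = S (h + k) x.
Proof.
have H : th h (S k x) = th h (x + k *: p) by exact: th_flat.
have E : x + (h + k) *: p = x + k *: p + h *: p by rewrite scalerDl (addrC (h *: p)) addrA.
rewrite -[S h (S k x)]/(S k x + h *: p + th h (S k x) *: q) H.
rewrite -[S k x]/(x + k *: p + th k x *: q).
rewrite -[RHS]/(x + (h + k) *: p + th (h + k) x *: q) /th E.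
by rewrite (addrAC _ _ (h *: p)) -[LHS]addrA -scalerDl addrA subrK.
Qed.

Lemma SK h x : S h (S (- h) x) = x.
Proof. by rewrite S_add subrr S0. Qed.
Lemma SNK h x : S (- h) (S h x) = x.
Proof. by rewrite S_add addNr S0. Qed.

Lemma Ck_th k h : (k <= 4)%N -> Ck k (th h).
Proof.
by move=> k4; apply: CkB; [exact: Ck_le Hrho|apply: (@Ck_trans _ (h *: p)); exact: Ck_le Hrho].
Qed.
Lemma Ck_tau k h f : (k <= 4)%N -> Ck k f -> Ck k (tau h f).
Proof. by move=> k4 Hf; apply: Ck_shear => //; exact: Ck_th. Qed.

Lemma continuous_S h : continuous (S h).
Proof. by apply: continuous_shear; exact: (Ck_cont (Ck_th h (leq0n 4))). Qed.

Let mth h : measurable_fun [set: V] (th h).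
Proof. by apply: continuous_measurable_rV; exact: (Ck_cont (Ck_th h (leq0n 4))). Qed.
Let th1 h x t : th h (x + t *: q) = th h x + (1 - 1) * t.
Proof. by rewrite subrr mul0r addr0 th_flat. Qed.
Let tauE h f : tau h f = (f \o trans (h *: p)) \o (fun x => x + th h x *: q).
Proof. by apply/funext => x; rewrite /ftau /Sflow /shear /= /trans addrAC. Qed.

Lemma sq_tau h f : sq f -> sq (tau h f).
Proof.
by move=> sf; rewrite tauE; apply: (sq_shear (oner_neq0 R) (mth h) (th1 h)); exact: sq_trans.
Qed.
Lemma ip_tau h f g : sq f -> sq g -> ip (tau h f) (tau h g) = ip f g.
Proof.
move=> sf sg; have sf' := sq_trans (h *: p) sf; have sg' := sq_trans (h *: p) sg.
rewrite -[RHS](ip_trans (h *: p))// -(ip_shear (oner_neq0 R) (mth h) (th1 h) sf' sg').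
by rewrite normr1 mul1r !tauE.
Qed.
Lemma nrm_tau h f : sq f -> nrm (tau h f) = nrm f.
Proof. by move=> sf; rewrite /nrm ip_tau. Qed.

Lemma tau_add h k f : tau h (tau k f) = tau (h + k) f.
Proof. by apply/funext => x; rewrite /ftau /= S_add addrC. Qed.
Lemma tau0 f : tau 0 f = f.
Proof. by apply/funext => x; rewrite /ftau /= S0. Qed.
Lemma tauD h f g : tau h (f + g) = tau h f + tau h g. Proof. by []. Qed.
Lemma sq_D h f : sq f -> sq (D h f).
Proof. by move=> sf; apply: sqZ; apply: sqB => //; exact: sq_tau. Qed.

(** Discrete integration by parts: composition with the flow is unitary, with inverse the flow at
    $-h$. *)
Lemma ip_D h f g : sq f -> sq g -> ip (D h f) g = - ip f (D (- h) g).
Proof.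
move=> sf sg; have stf := sq_tau h sf; have stg := sq_tau (- h) sg.
rewrite /Dquo ipZl ?ipBl//; last exact: sqB.
rewrite ipZr ?ipBr//; last exact: sqB.
rewrite -(ip_tau h sf stg) tau_add subrr tau0 invrN; ring.
Qed.

Definition dq i (h : R) : V -> R := h^-1 *: pd i (th h).
(** The commutator of [pd i] with the quotient [D h]. The quotient by [h] hidden in [dq] stays
    bounded in $C^2$ because [rho] has bounded derivatives up to order 4, so this is a first-order
    operator uniformly in [h]. *)
Definition Kcom i (h : R) f : V -> R := dq i h * tau h (dv q f).
Local Notation K := Kcom.

Lemma ub_dq i : ub 2 (dq i).
Proof.
have H := @ub_dif p 2 (pd i rho) (Ck_pd i Hrho) (bdp_pd i brho).
apply: (@ub_ext _ _ _ _ (dq i) _ H) => h _.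
rewrite /dq; congr (_ *: _).
rewrite -[th h]/(rho - (rho \o trans (h *: p))) pdB1 ?pd_trans//; exact: Ck_trans.
Qed.

Lemma pd_tau i h f : h != 0 -> Ck 1 f -> pd i (tau h f) = tau h (pd i f) + h *: K i h f.
Proof.
move=> h0 Hf; rewrite /ftau pd_shear//; last exact: Ck_th.
by congr (_ + _); rewrite /Kcom /dq; apply/funext => x; rewrite !fctE /GRing.scale /= mulrA mulVKf.
Qed.

Lemma pd_D i h f : h != 0 -> Ck 1 f -> pd i (D h f) = D h (pd i f) + K i h f.
Proof.
move=> h0 Hf; have Ht := Ck_tau h le1_4 Hf.
rewrite /Dquo -/(tau h f) pdZ1 ?pdB1//; last exact: CkB.
rewrite pd_tau// addrAC scalerDr; congr (_ + _).
by rewrite scalerA mulVf// scale1r.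
Qed.

(** With the base point $x$ fixed, the orbit $r \mapsto S_r x$ is the image of the line $x+rp$ under
    the shear of displacement $\rho(x)-\rho$. The mean value theorem on that line, applied to [g]
    composed with the shear, gives the claim. *)
Lemma MVT_flow g x s : Ck 1 g ->
  exists2 xi, `|xi| <= `|s| & g (S s x) - g x = s * X g (S xi x).
Proof.
move=> Hg; pose t0 := - rho + cst (rho x).
have Ht : Ck 1 t0 by apply: CkD; [exact: CkN|exact: Ck_cst].
pose gt := g \o shear 0 q t0; have Hgt : Ck 1 gt by exact: Ck_shear.
have gtE r : gt (x + r *: p) = g (S r x).
  rewrite -[LHS]/(g (x + r *: p + 0 + (- rho (x + r *: p) + rho x) *: q)).
  by rewrite addr0 [- _ + _]addrC.
have gx : gt x = g x by have := gtE 0; rewrite scale0r addr0 S0.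
have [xi xis] := MVT_C1 x p s Hgt; rewrite gtE gx => ->.
exists xi => //; congr (_ * _).
have E v : dv v gt = (dv v g) \o shear 0 q t0 + dv v t0 * ((dv q g) \o shear 0 q t0).
  rewrite {1}/dv /gt; under eq_bigr do rewrite pd_shear// scalerDr.
  rewrite big_split /=; congr (_ + _); apply/funext => y.
    by rewrite /dv /= !fct_sumE.
  by rewrite /dv !fctE !fct_sumE mulr_suml; apply: eq_bigr => i _; rewrite !fctE /GRing.scale /= mulrA.
have E2 : S xi x = shear 0 q t0 (x + xi *: p).
  rewrite -[RHS]/(x + xi *: p + 0 + (- rho (x + xi *: p) + rho x) *: q).
  by rewrite addr0 [- _ + _]addrC.
have E3 : dv p t0 = - dv p rho.
  rewrite /t0 dvD ?dvN//; [|exact: CkN|exact: Ck_cst].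
  have -> : dv p (cst (rho x)) = 0 :> (V -> R).
    by rewrite /dv big1// => i _; rewrite pd_cst; apply/funext => y; rewrite !fctE scaler0.
  by rewrite addr0.
rewrite E E3 E2 -[LHS]/(dv p g (shear 0 q t0 (x + xi *: p)) + - dv p rho (x + xi *: p) * dv q g (shear 0 q t0 (x + xi *: p))) -E2.
rewrite -[RHS]/(dv p g (S xi x) - dv p rho (S xi x) * dv q g (S xi x)).
have -> : dv p rho (S xi x) = dv p rho (x + xi *: p) by rewrite /Sflow /shear dv_flat.
ring.
Qed.

Lemma S_disp : exists2 B, 0 <= B & forall h x, `|S h x - x| <= `|h| * B.
Proof.
have [M M0 HM] := bdp_dv p brho1.
exists (`|p| + M * `|q|); first by rewrite addr_ge0// mulr_ge0.
move=> h x; rewrite /Sflow /shear addrAC (addrC x) addrK mulrDr.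
rewrite (le_trans (ler_normD _ _))// lerD ?normrZ// mulrA ler_wpM2r//.
have [xi _ E] := MVT_C1 x p h Hrho1.
by rewrite /th -opprB normrN E normrM ler_wpM2l.
Qed.

Lemma kc_tau k h f : (k <= 4)%N -> kc k f -> kc k (tau h f).
Proof.
move=> k4 [Hf [L bf]]; split; first exact: Ck_tau.
have [B B0 HB] := S_disp; exists (L + `|h| * B) => x Lx; apply: bf.
have := lerB_dist x (x - S h x); rewrite opprB addrCA subrr addr0.
apply: lt_le_trans; rewrite ltrBrDr; apply: le_lt_trans Lx; rewrite lerD2l distrC; exact: HB.
Qed.

Lemma kc_D k h f : (k <= 4)%N -> kc k f -> kc k (D h f).
Proof. by move=> k4 kf; apply: kcZ; apply: kcB => //; exact: kc_tau. Qed.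

Lemma bs_D B L h f : (forall h x, `|S h x - x| <= `|h| * B) -> `|h| <= 1 -> 0 <= B ->
  bs L f -> bs (L + B) (D h f).
Proof.
move=> HB h1 B0 bf x Lx; rewrite -[LHS]/(h^-1 * (f (S h x) - f x)).
rewrite (bf x) ?(bf (S h x)) ?subrr ?mulr0//; last by apply: le_lt_trans Lx; rewrite lerDl.
have := lerB_dist x (x - S h x); rewrite opprB addrCA subrr addr0.
apply: lt_le_trans; rewrite ltrBrDr; apply: le_lt_trans Lx; rewrite lerD2l distrC.
by rewrite (le_trans (HB h x))// ler_piMl.
Qed.

Lemma kc_X k f : (k <= 3)%N -> kc k.+1 f -> kc k (X f).
Proof.
move=> k3 kf; apply: kcB; first exact: kc_dv.
by apply: kcM; [exact: Ck_dv (Ck_le _ Hrho)|exact: kc_dv].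
Qed.

Lemma bs_X L f : bs L f -> bs L (X f).
Proof. by move=> bf; apply: bs_add; [exact: bs_dv|apply: bs_opp; apply: bs_mull; exact: bs_dv]. Qed.

(** [X] is the generator of the flow; the mean value theorem and the uniform continuity of [X f]
    give uniform convergence within a fixed ball. *)
Lemma D_lim f : kc 1 f -> forall e, 0 < e -> exists2 d, 0 < d &
  forall s, s != 0 -> `|s| < d -> nrm (D s f - X f) <= e.
Proof.
move=> kf e e0; have [Hf [L bf]] := kf; have [B B0 HB] := S_disp.
have [C C0 HC] := @nrm_sup_bound R n (L + B).
have C1 : 0 < C + 1 by rewrite ltr_wpDl.
have kX := kc_X (leq0n 3) kf.
have [d d0 Hd] := cc_unif (conj (Ck_cont kX.1) (bs_X bf)) (divr_gt0 e0 C1).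
have B1 : 0 < B + 1 by rewrite ltr_wpDl.
exists (Num.min 1 (d / (B + 1))); first by rewrite lt_min ltr01 divr_gt0.
move=> s s0; rewrite lt_min => /andP[s1 sd].
have : nrm (D s f - X f) <= C * (e / (C + 1)).
  apply: HC; first by apply: sqB; [exact: sq_D (kc_sq kf)|exact: kc_sq kX].
  - apply: bs_add; first by apply: bs_D => //; exact: ltW.
    by apply: bs_opp; apply: bs_le (bs_X bf); rewrite lerDl.
  - by rewrite divr_ge0// ltW.
  - move=> x; have [xi xis E] := MVT_flow x s Hf.
    rewrite -[(D s f - X f) x]/(s^-1 * (f (S s x) - f x) - X f x) E mulKf//.
    apply/ltW/Hd; rewrite (le_lt_trans (HB _ _))//.
    rewrite (@le_lt_trans _ _ (`|s| * (B + 1)))//; last by rewrite -ltr_pdivlMr.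
    by rewrite ler_pM// lerDl.
move=> /le_trans; apply; rewrite mulrCA ger_pMr// ler_pdivrMr// mul1r lerDl//.
Qed.

(* Averages along the flow turn [X f] into the quotient [D h f] without integration. *)
Definition favg (N : nat) (h : R) f : V -> R :=
  N.+1%:R^-1 *: \sum_(j < N.+1) tau (h * j%:R / N.+1%:R) f.
Local Notation avg := favg.

Lemma D_telescope N h f : h != 0 -> D h f = avg N h (D (h / N.+1%:R) f).
Proof.
move=> h0; apply/funext => x; rewrite -[LHS]/(h^-1 * (f (S h x) - f x)).
rewrite -[RHS]/(N.+1%:R^-1 * ((\sum_(j < N.+1) tau (h * j%:R / N.+1%:R) (D (h / N.+1%:R) f)) x)) fct_sumE.
have N0 : N.+1%:R != 0 :> R by rewrite pnatr_eq0.
pose F j := f (S (h * j%:R / N.+1%:R) x).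
rewrite (eq_bigr (fun j : 'I_N.+1 => (h / N.+1%:R)^-1 * (F j.+1 - F j))); last first.
  move=> j _; rewrite -[LHS]/((h / N.+1%:R)^-1 * (f (S (h / N.+1%:R) (S (h * j%:R / N.+1%:R) x)) - f (S (h * j%:R / N.+1%:R) x))) S_add /F.
  congr (_ * (f (S _ x) - _)); rewrite -[j.+1%:R]natr1; field.
  by rewrite addrC natr1 N0.
rewrite -mulr_sumr -(big_mkord xpredT (fun j => F j.+1 - F j)) telescope_sumr//.
rewrite /F mulr0 mul0r S0 mulfK//.
field; by rewrite h0 addrC natr1 N0.
Qed.

Lemma sq_avg N h f : sq f -> sq (avg N h f).
Proof. by move=> sf; apply: sqZ; apply: sq_sum => j _; exact: sq_tau. Qed.

Lemma nrm_avg N h f : sq f -> nrm (avg N h f) <= nrm f.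
Proof.
move=> sf; rewrite /favg nrmZ; last by apply: sq_sum => j _; exact: sq_tau.
rewrite ger0_norm ?invr_ge0// mulrC ler_pdivrMr ?ltr0n//.
apply: (le_trans (nrm_sum _ _)); first by move=> j _; exact: sq_tau.
by under eq_bigr do rewrite nrm_tau//; rewrite sumr_const card_ord mulr_natr.
Qed.

Lemma avgB N h f g : avg N h (f - g) = avg N h f - avg N h g.
Proof.
rewrite /favg -scalerBr; congr (_ *: _); rewrite -sumrB; exact: eq_bigr.
Qed.

Lemma avg_lim f h : h != 0 -> kc 1 f -> tends0 (fun N => nrm (D h f - avg N h (X f))).
Proof.
move=> h0 kf e e0; have [d d0 Hd] := D_lim kf e0.
have h1 : 0 < `|h| + 1 by rewrite ltr_wpDl.
have [N NP] := @tends0_inv R (d / (`|h| + 1)) (divr_gt0 d0 h1).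
exists N => k Nk; have sf := kc_sq kf; have sX := kc_sq (kc_X (leq0n 3) kf).
rewrite (D_telescope k)// -avgB (le_trans (nrm_avg _ _ _))//; first by apply: sqB => //; exact: sq_D.
apply: Hd; first by rewrite mulf_neq0// invr_eq0 pnatr_eq0.
have := NP k Nk; rewrite ler_pdivlMr ?ltr_wpDl// => H; apply: lt_le_trans H.
by rewrite normrM [`|_^-1|]ger0_norm ?invr_ge0// mulrC ltr_pM2l ?invr_gt0 ?ltr0n// ltrDl.
Qed.

Lemma nrm_D h f : h != 0 -> kc 1 f -> nrm (D h f) <= nrm (X f).
Proof.
move=> h0 kf; apply: (tends0_lim (avg_lim h0 kf)) => N.
have sD := sq_D h (kc_sq kf); have sX := kc_sq (kc_X (leq0n 3) kf).
have sA := sq_avg N h sX.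
rewrite -{1}(subrK (avg N h (X f)) (D h f)) addrC (le_trans (nrmD _ _))//; first exact: sqB.
by rewrite lerD2r; exact: nrm_avg.
Qed.

End oneflow.

End flow.

(** * Commutators of quotients with derivatives *)

Section commutators.
Context {R : realType} {n : nat}.
Local Notation V := 'rV[R]_n.
Implicit Types (f g : V -> R) (x v : V) (c : R -> V -> R) (T : R -> (V -> R) -> V -> R).

Definition lap f : V -> R := \sum_i pd i (pd i f).

Lemma kc_lap k f : kc k.+2 f -> kc k (lap f).
Proof. by move=> kf; apply: kc_sum => i; do 2 apply: kc_pd. Qed.

Lemma nrm_lap_le f : kc 2 f -> nrm (lap f) <= Nk 2 f.
Proof.
move=> kf; apply: (le_trans (nrm_sum _ _)); first by move=> i _; apply: (@kc_sq _ _ 0); do 2 apply: kc_pd.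
apply: (@le_trans _ _ (\sum_i Nk 1 (pd i f))); last by rewrite /= lerDr nrm_ge0.
apply: ler_sum => i _; apply: (le_trans (nrm_Nk 0 _)); exact: Nk_pd.
Qed.

Variables (rho : V -> R) (q p : V).
Hypothesis Hflat : flat rho q.
Local Notation S := (Sflow rho q p).
Local Notation tau := (ftau rho q p).
Local Notation D := (Dquo rho q p).
Local Notation X := (Xder rho q p).
Local Notation K := (Kcom rho q p).
Local Notation dq := (dq rho p).

Lemma ub_tau k c : (k <= 3)%N -> ub k c -> ub k (fun h => tau h (c h)).
Proof.
elim: k c => [|k IH] c k3 Hc.
  have /ub0[c1 [M M0 c2]] := Hc; apply/ub0; split.
    by move=> h oh x; apply: continuous_comp; [exact: continuous_S|exact: c1].
  by exists M => // h x oh; exact: c2.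
have [M M0 c2] := ub_bd Hc; apply/ubS; split.
- by move=> h oh; apply: Ck_tau => //; [lia|exact: ub_Ck Hc oh].
- by exists M => // h x oh; exact: c2.
- move=> i.
  have H1 := IH _ (ltnW k3) (ub_pd i Hc).
  have H2 := ub_mul (ub_cst k (a := id) ler01 (fun h (oh : ok h) => oh.2))
    (ub_mul (ub_le (_ : (k <= 2)%N) (ub_dq Hflat p i)) (IH _ (ltnW k3) (ub_dv q Hc))).
  apply: ub_ext (ub_add H1 (H2 _)) => [h oh|]; last by lia.
  by rewrite (pd_tau Hflat)//; [case: oh|exact: Ck_le (ub_Ck Hc oh)].
Qed.

Lemma ub_D k c : (k <= 2)%N -> ub k.+1 c -> ub k (fun h => D h (c h)).
Proof.
elim: k c => [|k IH] c k3 Hc.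
  apply/ub0; split.
    move=> h oh; apply/Ck0/CkZ/CkB; last exact: Ck_le (ub_Ck Hc oh).
    by apply: Ck_tau => //; exact: Ck_le (ub_Ck Hc oh).
  have [_ b _] := Hflat; have [M M0 HM] := bdp_dv p (bdp_le le1_4 b).
  have [N1 N10 H1] := ub_bd (ub_dv p Hc); have [N2 N20 H2] := ub_bd (ub_dv q Hc).
  exists (N1 + M * N2); first by rewrite addr_ge0// mulr_ge0.
  move=> h x oh; have [h0 _] := oh.
  have [xi _] := MVT_flow Hflat p x h (Ck_le le1_1 (ub_Ck Hc oh)).
  rewrite -[X in `|X|]/(h^-1 * (c h (S h x) - c h x)) => ->; rewrite mulKf//.
  rewrite -[Xder _ _ _ _ _]/(dv p (c h) (S xi x) - dv p rho (S xi x) * dv q (c h) (S xi x)).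
  by rewrite (le_trans (ler_normB _ _))// lerD ?H1// normrM ler_pM ?H2.
have [M M0 c2] := ub_bd (IH c (ltnW k3) (ub_le (leqnSn _) Hc)); apply/ubS; split.
- move=> h oh; apply/CkZ/CkB; last exact: Ck_le (ub_Ck Hc oh).
  by apply: Ck_tau => //; [lia|exact: Ck_le (ub_Ck Hc oh)].
- by exists M => // h x oh; exact: c2.
- move=> i.
  have H1 := IH _ (ltnW k3) (ub_pd i Hc).
  have H2 := ub_mul (ub_le (ltnW k3) (ub_dq Hflat p i))
    (@ub_tau k _ (leq_trans (ltnW k3) (leqnSn 2)) (ub_le (leqnSn k) (ub_dv q Hc))).
  apply: ub_ext (ub_add H1 H2) => h oh.
  by rewrite (pd_D Hflat)//; [case: oh|exact: Ck_le (ub_Ck Hc oh)].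
Qed.

Lemma ob_tau k : (k <= 3)%N -> ob k k tau.
Proof.
elim: k => [|k IH] k3.
  split; first by move=> h f _; exact: kc_tau.
  by exists 1 => // h f _ kf; rewrite mul1r /= nrm_tau//; exact: kc_sq kf.
apply: ob_S.
- by move=> h f _; apply: kc_tau => //; lia.
- exact: ob_le (IH (ltnW k3)).
- move=> i; have H1 := ob_comp (ob_pd i k) (IH (ltnW k3)).
  have H2 := ob_comp (ob_comp (ob_dv q k) (IH (ltnW k3))) (ob_mul (ub_le (k3 : (k <= 2)%N) (ub_dq Hflat p i))).
  have H3 := ob_scale (e := id) ler01 (fun h (oh : ok h) => oh.2) H2.
  apply: ob_ext (ob_add H1 H3) => h f oh kf.
  by rewrite (pd_tau Hflat)//; [case: oh|exact: Ck_le kf.1].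
Qed.

Lemma ob_K k i : (k <= 2)%N -> ob k.+1 k (K i).
Proof.
move=> k2; have H := ob_comp (ob_comp (ob_dv q k) (ob_tau (leq_trans k2 (leqnSn 2))))
  (ob_mul (ub_le k2 (ub_dq Hflat p i))).
by apply: ob_ext H.
Qed.

Lemma ob_D k : (k <= 3)%N -> ob k.+1 k D.
Proof.
elim: k => [|k IH] k3.
  split; first by move=> h f _ kf; apply: kc_D => //; exact: kc_le kf.
  have H : ob 1 0 (fun _ f => X f).
    have [r4 b _] := Hflat; have [M M0 HM] := bdp_dv p (bdp_le le1_4 b).
    have u : @ub R n 0 (fun=> dv p rho).
      by apply/ub0; split; [move=> _ _; exact: (Ck_cont (Ck_dv p r4))|exists M].
    apply: ob_add; first exact: ob_dv.
    by apply: ob_opp; exact: ob_comp (ob_dv q 0) (ob_mul u).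
  have [_ [C C0 HC]] := H; exists C => // h f oh kf; have [h0 _] := oh.
  exact: (le_trans (nrm_D Hflat p h0 kf) (HC h f oh kf)).
apply: ob_S.
- by move=> h f _ kf; apply: (kc_D Hflat) => //; [lia|exact: kc_le kf].
- exact: ob_le (IH (ltnW k3)).
- move=> i; have H := ob_add (ob_comp (ob_pd i k.+1) (IH (ltnW k3))) (ob_le _ (leqnn _) (ob_K i k3)).
  apply: ob_ext (H _) => // h f oh kf.
  by rewrite (pd_D Hflat)//; [case: oh|exact: Ck_le kf.1].
Qed.

Lemma D_sum (I : Type) (r : seq I) (F : I -> V -> R) h :
  D h (\sum_(i <- r) F i) = \sum_(i <- r) D h (F i).
Proof.
apply/funext => x; rewrite -[LHS]/(h^-1 * ((\sum_(i <- r) F i) (S h x) - (\sum_(i <- r) F i) x)) !fct_sumE.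
by rewrite -sumrB mulr_sumr.
Qed.

(** The quotient falls on the coefficient of [K], or it passes through [dv q] at the price of a
    combination of the operators [K j]. Either way one derivative is lost, not two. *)
Lemma ob_DK i k : (k <= 1)%N -> ob k.+1 k (fun h f => D h (K i h f) - K i h (D h f)).
Proof.
move=> k1; have k2 : (k <= 2)%N by lia.
have k3 : (k <= 3)%N by lia.
have u1 := ub_D k2 (ub_le (_ : (k.+1 <= 2)%N) (ub_dq Hflat p i)).
have H1 := ob_comp (ob_comp (ob_comp (ob_dv q k) (ob_tau k3)) (ob_tau k3)) (ob_mul (u1 k1)).
have H2 : ob k.+1 k (fun h f => \sum_j q ord0 j *: K j h f).
  apply: ob_sum => j; apply: (@ob_scale _ _ _ _ (fun=> q ord0 j) `|q ord0 j|) => //.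
  exact: (ob_K j k2).
have H3 := ob_comp (ob_comp H2 (ob_tau k3)) (ob_mul (ub_le k2 (ub_dq Hflat p i))).
have H4 := ob_add H1 (ob_opp H3).
apply: ob_ext H4 => h f oh kf; have [h0 _] := oh.
have E : dv q (D h f) = D h (dv q f) + \sum_j q ord0 j *: K j h f.
  rewrite {1}/dv; under eq_bigr do rewrite (pd_D Hflat p _ h0 (Ck_le (isT : (1 <= k.+1)%N) kf.1)) scalerDr.
  rewrite big_split /=; congr (_ + _); rewrite /dv D_sum; apply: eq_bigr => j _.
  apply/funext => x; rewrite -[LHS]/(q ord0 j * (h^-1 * (pd j f (S h x) - pd j f x))).
  rewrite -[RHS]/(h^-1 * (q ord0 j * pd j f (S h x) - q ord0 j * pd j f x)); ring.
apply/funext => x; rewrite /Kcom E.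
set s := \sum_j _; set g := dv q f.
rewrite -[LHS]/(h^-1 * (dq i h (S h x) - dq i h x) * g (S h (S h x)) - dq i h x * s (S h x)).
rewrite -[RHS]/(h^-1 * (dq i h (S h x) * g (S h (S h x)) - dq i h x * g (S h x)) -
   dq i h x * (h^-1 * (g (S h (S h x)) - g (S h x)) + s (S h x))).
ring.
Qed.

(** The commutator of the Laplacian with [D h], see [lap_D]; it has order 2. *)
Definition Pcom (h : R) f : V -> R := \sum_i (pd i (K i h f) + K i h (pd i f)).
Local Notation P := Pcom.

Lemma lap_D h f : ok h -> kc 3 f -> lap (D h f) = D h (lap f) + P h f.
Proof.
move=> oh kf; have [h0 _] := oh.
rewrite /lap /Pcom D_sum -big_split /=; apply: eq_bigr => i _.
have k1 : Ck 1 f by exact: Ck_le kf.1.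
have kp : kc 2 (pd i f) by exact: kc_pd.
rewrite (pd_D Hflat)// pdD1 ?(pd_D Hflat)//; first by rewrite addrAC addrA.
- exact: Ck_le kp.1.
- exact: (kc_D Hflat p h le1_4 (kc_le le1_2 kp)).1.
- exact: (ob_kc (ob_K i le1_2) oh (kc_le _ kf)).1.
Qed.

Lemma K_add i h f g : Ck 1 f -> Ck 1 g -> K i h (f + g) = K i h f + K i h g.
Proof. by move=> Hf Hg; rewrite /Kcom dvD// tauD mulrDr. Qed.

Lemma ob_P : ob 2 0 P.
Proof.
apply: ob_sum => i; apply: ob_add.
  exact: ob_comp (ob_K i le1_2) (ob_pd i 0).
exact: ob_comp (ob_pd i 1) (ob_K i le0_2).
Qed.

(** Commuting [D h] with [P h] costs no derivative beyond the two of [P h]. Moving [D h] past each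
    [pd i] produces a product of two operators [K i], hence the two such products subtracted in
    [T]. *)
Lemma DP_bound : exists2 C, 0 <= C &
  forall h f, ok h -> kc 4 f -> nrm (D h (P h f) - P h (D h f)) <= C * Nk 2 f.
Proof.
pose L i h f := D h (K i h f) - K i h (D h f).
pose T h f := \sum_i (pd i (L i h f) + L i h (pd i f) - (K i h (K i h f) + K i h (K i h f))).
have HT : ob 2 0 T.
  have HK i : ob 2 0 (fun h f => K i h (K i h f)).
    exact: ob_comp (ob_K i le1_2) (ob_K i le0_2).
  apply: ob_sum => i; apply: ob_add; last by apply: ob_opp; exact: ob_add.
  apply: ob_add; first exact: ob_comp (ob_DK i le1_1) (ob_pd i 0).
  exact: ob_comp (ob_pd i 1) (ob_DK i le0_1).
have [_ [C C0 HC]] := HT; exists C => // h f oh kf; have [h0 _] := oh.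
rewrite (_ : _ - _ = T h f); first by apply: HC => //; exact: kc_le kf.
rewrite /Pcom D_sum -sumrB /T; apply: eq_bigr => i _.
have kK : kc 2 (K i h f) by apply: (ob_kc (ob_K i le2_2) oh); exact: kc_le kf.
have kp : kc 3 (pd i f) by exact: kc_pd.
have kKp : kc 2 (K i h (pd i f)) by exact: (ob_kc (ob_K i le2_2) oh).
have kD : kc 3 (D h f) by exact: (ob_kc (ob_D le3_3) oh).
have kDp : kc 2 (D h (pd i f)) by exact: (ob_kc (ob_D le2_3) oh).
have c1 m g : kc m.+1 g -> Ck 1 g by move=> [Hg _]; exact: Ck_le Hg.
have kKD : kc 2 (K i h (D h f)) by exact: (ob_kc (ob_K i le2_2) oh).
have kDK : kc 1 (D h (K i h f)) by exact: (ob_kc (ob_D le1_3) oh).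
have DD a b : D h (a + b) = D h a + D h b.
  apply/funext => x; rewrite -[LHS]/(h^-1 * ((a (S h x) + b (S h x)) - (a x + b x))).
  by rewrite -[RHS]/(h^-1 * (a (S h x) - a x) + h^-1 * (b (S h x) - b x)); ring.
rewrite DD (pd_D Hflat p i h0 (c1 _ _ kf)) (K_add i h (c1 _ _ kDp) (c1 _ _ kK)).
rewrite /L (pdB1 i (c1 _ _ kDK) (c1 _ _ kKD)) (pd_D Hflat p i h0 (c1 _ _ kK)).
by apply/funext => x; rewrite !fctE; ring.
Qed.

End commutators.

(** * Poincaré inequality and coercivity of the Laplacian *)

Section coercivity.
Context {R : realType} {n : nat}.
Local Notation V := 'rV[R]_n.
Implicit Types (f g : V -> R) (x v p : V).

Lemma partials_cst s (a : R) : s != [::] -> partials s (cst a : V -> R) = cst 0.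
Proof.
case/lastP: s => [//|s i _]; rewrite partials_rcons pd_cst.
by elim: s => [//|j s IH]; rewrite partials_cons IH pd_cst.
Qed.

(** In this degenerate case the flow consists of translations, so every result on flows specialises
    to ordinary difference quotients. *)
Lemma flat0 : flat (cst 0 : V -> R) 0.
Proof.
split; [exact: Ck_cst| |by move=> x t v].
exists 0 => // s x; case: s => [//|i s] _.
by rewrite partials_cst// normr0.
Qed.

Lemma S_flat0 p h x : Sflow (cst 0) 0 p h x = x + h *: p.
Proof. by rewrite /Sflow /shear scaler0 addr0. Qed.

Lemma tau_flat0 p h f : ftau (cst 0) 0 p h f = f \o trans (h *: p).
Proof. by apply/funext => x; rewrite /ftau /= S_flat0. Qed.

Lemma dv_cst v (a : R) : dv v (cst a) = 0 :> (V -> R).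
Proof. by rewrite /dv big1// => i _; rewrite pd_cst; apply/funext => y; rewrite fctE scaler0. Qed.

Lemma X_flat0 p f : Xder (cst 0) 0 p f = dv p f.
Proof. by rewrite /Xder dv_cst mul0r subr0. Qed.

(** A translation by more than the diameter $2L$ makes [f] and its translate orthogonal, so $\|f\|$
    is at most the norm of their difference, which the quotient bound estimates by the
    derivative. *)
Lemma poincare L i f : 0 <= L -> kc 1 f -> bs L f -> nrm f <= (2 * L + 1) * nrm (pd i f).
Proof.
move=> L0 kf bf; pose h := 2 * L + 1.
have h0 : 0 < h by rewrite ltr_wpDl// mulr_ge0.
have sf := kc_sq kf; have st := sq_trans (h *: e_ i) sf.
have := nrm_D flat0 (e_ i) (lt0r_neq0 h0) kf; rewrite X_flat0 dv_e.
rewrite /Dquo -/(ftau (cst 0) 0 (e_ i) h f) tau_flat0 nrmZ ?ger0_norm ?invr_ge0 ?(ltW h0)//; last exact: sqB.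
rewrite mulrC ler_pdivrMr// [_ * h]mulrC; apply: le_trans.
rewrite -ler_sqr ?nnegrE ?nrm_ge0// !nrm_sq.
have c0 : ip (f \o trans (h *: e_ i)) f = 0.
  transitivity (ip (0 : V -> R) f); last exact: ip0l.
  apply: eq_Rintegral => x _.
  rewrite [X in _ = X * _]/(0 : R) mul0r /=.
  have [xL|xL] := ltP L `|x|; first by rewrite (bf x)// mulr0.
  rewrite (bf (trans _ _)) ?mul0r// /trans.
  have : h <= `|h *: (e_ i : V)|.
    by have := coord_le_norm (h *: e_ i : V) i; rewrite !mxE !eqxx mulr1 ger0_norm// ltW.
  have := lerB_dist (h *: e_ i) (- x); rewrite opprK normrN [h *: e_ i + x]addrC.
  by move: (`|h *: _|) (`|_ + _|) => a b; rewrite /h; lra.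
rewrite ipBl ?ipBr//; last exact: sqB.
rewrite (ipC f _) c0 -(nrm_sq f) -(nrm_sq (f \o _)) nrm_trans//.
have := sqr_ge0 (nrm f); lra.
Qed.

Lemma energy_grad f : kc 2 f -> \sum_i nrm (pd i f) ^+ 2 = - ip (lap f) f.
Proof.
move=> kf; have [Hf [L bf]] := kf.
rewrite ip_suml; last 2 first.
- by move=> i _; apply: (@kc_sq _ _ 0); do 2 apply: kc_pd.
- exact: kc_sq kf.
rewrite -sumrN; apply: eq_bigr => i _; have kp := kc_pd i kf.
have H : ip (pd i f) (pd i f) = - ip f (pd i (pd i f)).
  by apply: (@ip_byparts_pd _ _ i L) => //; [exact: Ck_le Hf|exact: kp.1].
by rewrite nrm_sq H ipC.
Qed.

Lemma energy_hess f : kc 3 f -> \sum_i \sum_j nrm (pd j (pd i f)) ^+ 2 = nrm (lap f) ^+ 2.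
Proof.
move=> kf; have [Hf [L bf]] := kf.
have s2 i j : sq (pd j (pd i f)) by apply: (@kc_sq _ _ 1); do 2 apply: kc_pd.
rewrite nrm_sq /lap ip_suml//; last by apply: sq_sum => i _.
apply: eq_bigr => i _; rewrite ip_sumr//; apply: eq_bigr => j _.
have kp k : kc 2 (pd k f) by exact: kc_pd.
have kpp k l : kc 1 (pd k (pd l f)) by exact: kc_pd.
have H1 : ip (pd j (pd i f)) (pd j (pd i f)) = - ip (pd i f) (pd j (pd j (pd i f))).
  by apply: (@ip_byparts_pd _ _ j L); [exact: Ck_le (kp i).1|exact: (kpp j i).1|exact: bs_pd].
have H2 : ip (pd i (pd i f)) (pd j (pd j f)) = - ip (pd i f) (pd i (pd j (pd j f))).
  by apply: (@ip_byparts_pd _ _ i L); [exact: Ck_le (kp i).1|exact: (kpp j j).1|exact: bs_pd].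
have E : pd j (pd j (pd i f)) = pd i (pd j (pd j f)).
  have E1 := schwarz j i (Ck_le le2_3 Hf).
  have E2 := schwarz j i (kp j).1.
  exact: (etrans (f_equal (pd j) E1) E2).
apply: etrans (nrm_sq _) _; apply: etrans H1 _; apply: etrans _ (esym H2).
exact: (f_equal (fun g => - ip (pd i f) g) E).
Qed.

End coercivity.

Section coercive.
Context {R : realType} {n : nat}.
Local Notation V := 'rV[R]_n.+1.

Lemma le_term (I : finType) (F : I -> R) i : (forall j, 0 <= F j) -> F i <= \sum_j F j.
Proof. by move=> F0; rewrite (bigD1 i)//= lerDl sumr_ge0. Qed.

(** Integration by parts gives $\|d_0 f\|^2 \le \|\Delta f\|\,\|f\|$ and the Poincaré inequality
    bounds $\|f\|$ by $\|d_0 f\|$, so one factor cancels. The Hessian has exactly the norm of the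
    Laplacian by [energy_hess]. *)
Lemma coercive L : 0 <= L -> exists2 C, 0 <= C &
  forall f : V -> R, kc 3 f -> bs L f -> Nk 2 f <= C * nrm (lap f).
Proof.
move=> L0; pose h := 2 * L + 1; have h0 : 0 <= h by rewrite addr_ge0// mulr_ge0.
exists (h ^+ 2 + (h + n.+1%:R) *+ n.+1).
  by rewrite addr_ge0 ?sqr_ge0// mulrn_wge0// addr_ge0.
move=> f kf bf; have k2 : kc 2 f by exact: kc_le kf.
have k1 : kc 1 f by exact: kc_le kf.
set e := nrm (lap f); have e0 : 0 <= e by exact: nrm_ge0.
have G : \sum_i nrm (pd i f) ^+ 2 <= e * nrm f.
  rewrite energy_grad//; have := ip_CS (kc_sq (kc_lap kf)) (kc_sq kf).
  by rewrite ler_norml => /andP[+ _]; rewrite lerNl.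
have G1 i : nrm (pd i f) ^+ 2 <= e * nrm f.
  by apply: le_trans G; rewrite (bigD1 i)//= lerDl sumr_ge0// => j _; exact: sqr_ge0.
have P0 := poincare ord0 L0 k1 bf.
have D0 : nrm (pd ord0 f) <= h * e.
  have := G1 ord0; have := nrm_ge0 (pd ord0 f); move: P0; rewrite -/h.
  move: (nrm (pd ord0 f)) (nrm f) => d m P0 d0 H.
  have [->|dn] := eqVneq d 0; first exact: mulr_ge0.
  have dp : 0 < d by rewrite lt_neqAle eq_sym dn.
  rewrite -(ler_pM2l dp); apply: le_trans H _.
  by rewrite (_ : d * (h * e) = e * (h * d)) ?ler_wpM2l//; ring.
have F0 : nrm f <= h ^+ 2 * e by apply: (le_trans P0); rewrite expr2 -mulrA ler_wpM2l.
have D1 i : nrm (pd i f) <= h * e.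
  rewrite -ler_sqr ?nnegrE ?nrm_ge0 ?mulr_ge0//; apply: (le_trans (G1 i)).
  by rewrite (_ : (h * e) ^+ 2 = e * (h ^+ 2 * e)) ?ler_wpM2l//; ring.
have D2 i j : nrm (pd j (pd i f)) <= e.
  rewrite -ler_sqr ?nnegrE ?nrm_ge0// -(energy_hess kf).
  apply: le_trans (le_term (F := fun k => nrm (pd k (pd i f)) ^+ 2) j _) _ => [k|].
    exact: sqr_ge0.
  apply: (le_term (F := fun l => \sum_k nrm (pd k (pd l f)) ^+ 2) i) => l.
  by apply: sumr_ge0 => k _; exact: sqr_ge0.
rewrite /= mulrDl lerD//.
apply: (@le_trans _ _ (\sum_(i < n.+1) ((h + n.+1%:R) * e))).
  apply: ler_sum => i _; rewrite mulrDl; apply: lerD; first exact: D1.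
  apply: (@le_trans _ _ (\sum_(j < n.+1) e)); first by apply: ler_sum => j _; exact: D2.
  by rewrite sumr_const card_ord mulr_natl.
by rewrite sumr_const card_ord mulrnAl.
Qed.

End coercive.

Opaque pd.

(** * Tangential regularity *)

Section energy.
Context {R : realType} {n : nat}.
Local Notation V := 'rV[R]_n.
Implicit Types (f g phi psi v chi : V -> R) (T : R -> (V -> R) -> V -> R).

Lemma ok1 : ok (1 : R). Proof. by split; rewrite ?oner_neq0 ?normr1. Qed.

Definition en f g := ip (lap f) (lap g).

Lemma NkN k f : kc k f -> Nk k (- f) = Nk k f.
Proof. by move=> kf; rewrite -scaleN1r NkZ// normrN1 mul1r. Qed.
Lemma NkB k f g : kc k f -> kc k g -> Nk k (f - g) <= Nk k f + Nk k g.
Proof. by move=> kf kg; rewrite -(NkN kg); apply: NkD => //; exact: kcN. Qed.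

Lemma ob_bd a b T : ob a b T -> exists2 C, 0 <= C & forall h f, ok h -> kc a f ->
  Nk b (T h f) <= C * Nk a f.
Proof. by case. Qed.

Lemma ip_bound f g (A B A' B' : R) : sq f -> sq g -> nrm f <= A * B -> nrm g <= A' * B' ->
  0 <= A * B -> `|ip f g| <= A * A' * (B * B').
Proof.
move=> sf sg fA gA AB; apply: (le_trans (ip_CS sf sg)).
apply: le_trans (ler_pM (nrm_ge0 f) (nrm_ge0 g) fA gA) _.
by rewrite (_ : A * B * (A' * B') = A * A' * (B * B'))//; ring.
Qed.

Lemma nrm_lap f : kc 2 f -> nrm (lap f) <= 1 * Nk 2 f.
Proof. by rewrite mul1r; exact: nrm_lap_le. Qed.

Variables (rho : V -> R) (q p : V).
Hypothesis Hflat : flat rho q.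
Local Notation tau := (ftau rho q p).
Local Notation D := (Dquo rho q p).
Local Notation K := (Kcom rho q p).
Local Notation P := (Pcom rho q p).

Lemma Dh_bound k : (k <= 3)%N -> exists2 C, 0 <= C &
  forall h f, ok h -> kc k f -> Nk k (D h f) <= C * Nk k f / `|h|.
Proof.
move=> k3; have [_ [C C0 HC]] := ob_tau p Hflat k3; exists (C + 1); first exact: addr_ge0.
move=> h f oh kf; have kt : kc k (tau h f) by apply: (kc_tau Hflat) => //; lia.
rewrite /Dquo NkZ; last exact: kcB.
rewrite mulrC normfV ler_wpM2r ?invr_ge0//.
apply: (le_trans (NkB kt kf)); rewrite mulrDl mul1r lerD2r; exact: HC.
Qed.

Lemma en_D h v psi : ok h -> kc 3 v -> kc 3 psi ->
  en (D h v) psi = - en v (D (- h) psi) + (ip (P h v) (lap psi) + ip (lap v) (P (- h) psi)).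
Proof.
move=> oh kv kpsi; have ohN := okN oh.
have sl : sq (lap v) by exact: kc_sq (kc_lap kv).
have slp : sq (lap psi) by exact: kc_sq (kc_lap kpsi).
have sP : sq (P h v) by apply: (@kc_sq _ _ 0); exact: (ob_kc (ob_P p Hflat) oh (kc_le _ kv)).
have sPp : sq (P (- h) psi) by apply: (@kc_sq _ _ 0); exact: (ob_kc (ob_P p Hflat) ohN (kc_le _ kpsi)).
have sD : sq (D h (lap v)) by exact: sq_D.
have sDp : sq (D (- h) (lap psi)) by exact: sq_D.
rewrite /en (lap_D p Hflat oh kv) ipDl// (lap_D p Hflat ohN kpsi) ipDr// ip_D//.
by ring.
Qed.

(** A quotient changes sides in the energy form up to an error controlled by $H^2$ norms alone. *)
Lemma en_D_bound : exists2 C, 0 <= C & forall h v psi, ok h -> kc 3 v -> kc 3 psi ->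
  `|en (D h v) psi + en v (D (- h) psi)| <= C * (Nk 2 v * Nk 2 psi).
Proof.
have [C C0 HC] := ob_bd (ob_P p Hflat).
exists (C * 1 + 1 * C); first by rewrite mulr1 mul1r addr_ge0.
move=> h v psi oh kv kpsi; rewrite en_D// addrAC addNr add0r.
have k2 := kc_le le2_3 kv; have k2p := kc_le le2_3 kpsi.
have sP : sq (P h v) by apply: (@kc_sq _ _ 0); exact: (ob_kc (ob_P p Hflat) oh).
have sPp : sq (P (- h) psi) by apply: (@kc_sq _ _ 0); exact: (ob_kc (ob_P p Hflat) (okN oh)).
apply: (le_trans (ler_normD _ _)); rewrite mulrDl; apply: lerD.
  apply: ip_bound => //; [exact: kc_sq (kc_lap kpsi)|exact: HC|exact: nrm_lap|].
  by rewrite mulr_ge0// Nk_ge0.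
apply: ip_bound => //; [exact: kc_sq (kc_lap kv)|exact: nrm_lap|exact: (HC _ _ (okN oh))|].
by rewrite mul1r Nk_ge0.
Qed.

(** Applying [en_D_bound] with [D (- h) psi] in the second argument would leave the $H^2$ norm of
    that quotient on the right. The error terms are instead moved back onto [v] by [ip_D], with
    [DP_bound] for the commutators, and only the plain norm of [psi] remains. *)
Lemma en_DD_bound : exists2 C, 0 <= C & forall h v psi, ok h -> kc 4 v -> kc 4 psi ->
  `|en (D h v) (D (- h) psi) + en v (D (- h) (D (- h) psi))| <=
   C * ((Nk 2 v + Nk 2 (D h v)) * Nk 2 psi).
Proof.
have [C C0 HC] := ob_bd (ob_P p Hflat); have [C' C'0 HC'] := DP_bound p Hflat.
exists ((C + C') * 1 + C * C + ((1 + C) * C + 1 * C')).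
  by rewrite !addr_ge0// ?mulr_ge0// ?addr_ge0.
move=> h v psi oh kv kpsi; have ohN := okN oh.
have kv3 := kc_le le3_4 kv; have kp3 := kc_le le3_4 kpsi.
have kv2 := kc_le le2_4 kv; have kp2 := kc_le le2_4 kpsi.
have kDv : kc 3 (D h v) by exact: (ob_kc (ob_D p Hflat le3_3) oh).
have kDp : kc 3 (D (- h) psi) by exact: (ob_kc (ob_D p Hflat le3_3) ohN).
have kDv2 := kc_le le2_3 kDv; have kDp2 := kc_le le2_3 kDp.
have sP g k : kc 2 g -> ok k -> sq (P k g).
  by move=> kg ok'; apply: (@kc_sq _ _ 0); exact: (ob_kc (ob_P p Hflat) ok').
have sl g : kc 2 g -> sq (lap g) by move=> kg; exact: kc_sq (kc_lap (k := 0) kg).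
rewrite en_D// addrAC addNr add0r.
set N := Nk 2 v + Nk 2 (D h v); have N0 : 0 <= N by rewrite addr_ge0 ?Nk_ge0.
have vN : Nk 2 v <= N by rewrite lerDl Nk_ge0.
have DvN : Nk 2 (D h v) <= N by rewrite lerDr Nk_ge0.
apply: (le_trans (ler_normD _ _)); rewrite mulrDl; apply: lerD.
  rewrite (lap_D p Hflat ohN kp3) (ipDr (sq_D Hflat p (- h) (sl _ kp2)) (sP _ _ kp2 ohN) (sP _ _ kv2 oh)).
  have -> : ip (P h v) (D (- h) (lap psi)) = - ip (D h (P h v)) (lap psi).
    by rewrite (ip_D Hflat p h (sP _ _ kv2 oh) (sl _ kp2)) opprK.
  apply: (le_trans (ler_normD _ _)); rewrite normrN mulrDl; apply: lerD.
    apply: ip_bound; [by apply: (sq_D Hflat); exact: (sP _ _ kv2 oh)|exact: (sl _ kp2)| |exact: (nrm_lap kp2)|].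
      rewrite -{1}[D h (P h v)](subrK (P h (D h v))).
      have s1 := sP _ _ kDv2 oh.
      have s2 : sq (D h (P h v) - P h (D h v)) by apply: (sqB _ s1); apply: (sq_D Hflat); exact: (sP _ _ kv2 oh).
      apply: (le_trans (nrmD s2 s1)); rewrite addrC mulrDl; apply: lerD.
        exact: (le_trans (HC _ _ oh kDv2) (ler_wpM2l C0 DvN)).
      exact: (le_trans (HC' _ _ oh kv) (ler_wpM2l C'0 vN)).
    by rewrite mulr_ge0// addr_ge0.
  apply: ip_bound; [exact: (sP _ _ kv2 oh)|exact: (sP _ _ kp2 ohN)| |exact: (HC _ _ ohN kp2)|exact: mulr_ge0].
  exact: (le_trans (HC _ _ oh kv2) (ler_wpM2l C0 vN)).
have s1 : sq (D (- h) (P (- h) psi)) by apply: (sq_D Hflat); exact: (sP _ _ kp2 ohN).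
have s2 : sq (D (- h) (P (- h) psi) - P (- h) (D (- h) psi)) by apply: (sqB s1); exact: (sP _ _ kDp2 ohN).
have -> : P (- h) (D (- h) psi) = D (- h) (P (- h) psi) - (D (- h) (P (- h) psi) - P (- h) (D (- h) psi)).
  by rewrite opprB addrCA subrr addr0.
rewrite (ipBr s1 s2 (sl _ kv2)).
have -> : ip (lap v) (D (- h) (P (- h) psi)) = - ip (D h (lap v)) (P (- h) psi).
  by rewrite (ip_D Hflat p h (sl _ kv2) (sP _ _ kp2 ohN)) opprK.
apply: (le_trans (ler_normB _ _)); rewrite normrN mulrDl; apply: lerD.
  apply: ip_bound; [by apply: (sq_D Hflat); exact: (sl _ kv2)|exact: (sP _ _ kp2 ohN)| |exact: (HC _ _ ohN kp2)|].
    have -> : D h (lap v) = lap (D h v) - P h v by rewrite (lap_D p Hflat oh kv3) addrK.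
    apply: (le_trans (nrmB (sl _ kDv2) (sP _ _ kv2 oh))); rewrite mulrDl; apply: lerD.
      exact: (le_trans (nrm_lap kDv2) (ler_wpM2l ler01 DvN)).
    exact: (le_trans (HC _ _ oh kv2) (ler_wpM2l C0 vN)).
  by rewrite mulr_ge0// addr_ge0.
apply: ip_bound; [exact: (sl _ kv2)|exact: s2| |exact: (HC' _ _ ohN kpsi)|by rewrite mul1r].
exact: (le_trans (nrm_lap kv2) (ler_wpM2l ler01 vN)).
Qed.

Variable zeta : V -> R.
Hypothesis kz : forall k, kc k zeta.
Let ubz k : @ub R n k (fun=> zeta). Proof. exact: ub_kc. Qed.

(** The commutator of the Laplacian with multiplication by [zeta], of first order. *)
Definition gz f := \sum_i (2 *: pd i zeta) * pd i f + lap zeta * f.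

Lemma lapM f : Ck 2 f -> lap (zeta * f) = zeta * lap f + gz f.
Proof.
move=> Hf; have H1 : Ck 1 f by exact: Ck_le Hf.
have z1 k : Ck k zeta by case: (kz k).
rewrite /lap /gz mulr_sumr mulr_suml -!big_split /=; apply: eq_bigr => i _.
have H2 := Ck_pd i Hf; have z2 := Ck_pd i (z1 2%N).
rewrite (pdM1 i (z1 1%N) H1) pdD1; [|exact: CkM|exact: CkM].
rewrite (pdM1 i z2 H1) (pdM1 i (z1 1%N) H2).
move: (pd i (pd i f)) (pd i (pd i zeta)) (pd i f) (pd i zeta) => A B C E.
by apply/funext => x; rewrite !fctE /GRing.scale /=; ring.
Qed.

Let kpz k i : kc k (pd i zeta). Proof. exact: kc_pd. Qed.
Let kz2 k i : kc k (2 *: pd i zeta). Proof. exact: kcZ. Qed.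
Let klz k : kc k (lap zeta). Proof. exact: kc_lap. Qed.

Lemma ob_gz k : ob k.+1 k (fun _ f => gz f).
Proof.
apply: ob_add.
  by apply: ob_sum => i; exact: ob_comp (ob_pd i k) (ob_mul (ub_kc (kz2 k i))).
exact: ob_le (ob_mul (ub_kc (klz k))).
Qed.

Lemma gz_D k : (k <= 1)%N -> ob k.+1 k (fun h f => gz (D h f) - D h (gz f)).
Proof.
move=> k1; have k2 : (k <= 2)%N by lia.
have k3 : (k <= 3)%N by lia.
have H1 : ob k.+1 k (fun h f => \sum_i ((2 *: pd i zeta) * K i h f - D h (2 *: pd i zeta) * tau h (pd i f))).
  apply: ob_sum => i; apply: ob_add.
    exact: ob_comp (ob_K p Hflat i k2) (ob_mul (ub_kc (kz2 k i))).
  apply: ob_opp; apply: ob_comp (ob_comp (ob_pd i k) (ob_tau p Hflat k3)) (ob_mul _).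
  exact: (ub_D p Hflat k2 (ub_kc (kz2 k.+1 i))).
have H2 : ob k.+1 k (fun h f => D h (lap zeta) * tau h f).
  apply: ob_comp (ob_mul (ub_D p Hflat k2 (ub_kc (klz k.+1)))).
  by apply: ob_le (ob_tau p Hflat k3).
apply: ob_ext (ob_add H1 (ob_opp H2)) => h f oh kf; have [h0 _] := oh.
have DD a b : D h (a + b) = D h a + D h b.
  apply/funext => x; rewrite -[LHS]/(h^-1 * ((a (Sflow rho q p h x) + b (Sflow rho q p h x)) - (a x + b x))).
  by rewrite -[RHS]/(h^-1 * (a (Sflow rho q p h x) - a x) + h^-1 * (b (Sflow rho q p h x) - b x)); ring.
have DM a b : D h (a * b) = a * D h b + D h a * tau h b.
  apply/funext => x; rewrite -[LHS]/(h^-1 * ((a (Sflow rho q p h x) * b (Sflow rho q p h x)) - (a x * b x))).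
  by rewrite -[RHS]/(a x * (h^-1 * (b (Sflow rho q p h x) - b x)) + h^-1 * (a (Sflow rho q p h x) - a x) * b (Sflow rho q p h x)); ring.
have S1 : \sum_i ((2 *: pd i zeta) * K i h f - D h (2 *: pd i zeta) * tau h (pd i f)) =
    \sum_i (2 *: pd i zeta) * pd i (D h f) - \sum_i D h ((2 *: pd i zeta) * pd i f).
  rewrite -sumrB; apply: eq_bigr => i _.
  rewrite (DM (2 *: pd i zeta) (pd i f)) (pd_D Hflat p i h0 (Ck_le (isT : (1 <= k.+1)%N) kf.1)).
  move: (D h (pd i f)) (K i h f) (D h (2 *: pd i zeta)) (tau h (pd i f)) (2 *: pd i zeta) => A B C E F.
  by apply/funext => x; rewrite !fctE; ring.
have -> : D h (gz f) = \sum_i D h ((2 *: pd i zeta) * pd i f) +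
    (lap zeta * D h f + D h (lap zeta) * tau h f) by rewrite /gz DD D_sum DM.
rewrite S1 /gz; move: (\sum_i D h _) (\sum_i _) (lap zeta * _) (D h _ * _) => A B C E.
by apply/funext => x; rewrite !fctE; ring.
Qed.

Definition cz phi chi := en (zeta * phi) chi - en phi (zeta * chi).

(** The second-order terms containing [zeta] cancel. In what remains an integration by parts leaves
    only first derivatives of [chi], so that [chi] may itself contain a difference quotient. *)
Lemma czE phi chi : kc 2 phi -> kc 2 chi ->
  cz phi chi = - \sum_i ip (pd i (gz phi)) (pd i chi) - ip (lap phi) (gz chi).
Proof.
move=> kp kx; have z k : Ck k zeta by case: (kz k).
have sl g : kc 2 g -> sq (lap g) by move=> kg; exact: kc_sq (kc_lap (k := 0) kg).
have kg g : kc 2 g -> kc 1 (gz g) by move=> kg; exact: (ob_kc (ob_gz 1) ok1 kg).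
have sz g : sq g -> sq (zeta * g).
  by have [zz [L bz]] := kz 0; move=> sg; apply: sqM_bs bz sg; exact: Ck_cont zz.
rewrite /cz /en (lapM kp.1) (lapM kx.1) ipDl; [|exact: (sz _ (sl _ kp))|exact: (kc_sq (kg _ kp))|exact: sl].
rewrite ipDr; [|exact: (sz _ (sl _ kx))|exact: (kc_sq (kg _ kx))|exact: sl].
rewrite ip_mull opprD addrACA subrr add0r; congr (_ - _).
rewrite /lap ip_sumr; last 2 first.
- by move=> i _; apply: (@kc_sq _ _ 0); do 2 apply: kc_pd.
- exact: (kc_sq (kg _ kp)).
rewrite -sumrN; apply: eq_bigr => i _.
have [L bL] := (kg _ kp).2; have kpx := kc_pd i kx.
rewrite -[LHS]opprK; congr (- _); apply: esym.
exact: (ip_byparts_pd i (kg _ kp).1 kpx.1 bL).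
Qed.

Lemma sum_le_const (F : 'I_n -> R) c : (forall i, F i <= c) -> \sum_i F i <= n%:R * c.
Proof.
move=> Fc; apply: (@le_trans _ _ (\sum_(i < n) c)); first by apply: ler_sum => i _; exact: Fc.
by rewrite sumr_const card_ord mulr_natl.
Qed.

Lemma cz_bound : exists2 C, 0 <= C & forall phi chi, kc 2 phi -> kc 2 chi ->
  `|cz phi chi| <= C * (Nk 2 phi * Nk 1 chi).
Proof.
have [C C0 HC] := ob_bd (ob_gz 1); have [C' C'0 HC'] := ob_bd (ob_gz 0).
exists (n%:R * C + C'); first by rewrite addr_ge0// mulr_ge0.
move=> phi chi kp kx; have kg := ob_kc (ob_gz 1) ok1 kp.
have kx1 := kc_le le1_2 kx.
rewrite czE//; apply: (le_trans (ler_normB _ _)); rewrite normrN mulrDl; apply: lerD.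
  apply: (le_trans (ler_norm_sum _ _ _)); rewrite -mulrA; apply: sum_le_const => i.
  apply: (le_trans (ip_CS (kc_sq (kc_pd i kg)) (kc_sq (kc_pd i kx)))).
  rewrite mulrA; apply: (ler_pM (nrm_ge0 _) (nrm_ge0 _)); last exact: (Nk_pd 0).
  exact: (le_trans (Nk_pd 0 i _) (HC _ _ ok1 kp)).
apply: (le_trans (ip_CS (kc_sq (kc_lap (k := 0) kp)) (kc_sq (ob_kc (ob_gz 0) ok1 kx1)))).
rewrite mulrCA; apply: (ler_pM (nrm_ge0 _) (nrm_ge0 _)); last exact: (HC' _ _ ok1 kx1).
exact: nrm_lap_le.
Qed.

Lemma D_pd_gz : exists2 C, 0 <= C & forall h v i, ok h -> kc 3 v ->
  nrm (D h (pd i (gz v))) <= C * (Nk 2 v + Nk 2 (D h v)).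
Proof.
have [C1 C10 H1] := ob_bd (ob_gz 1); have [C2 C20 H2] := ob_bd (gz_D le1_1).
have /all_sig2[C3 C30 H3] i : {C | 0 <= C & forall h f, ok h -> kc 2 f -> Nk 0 (K i h (gz f)) <= C * Nk 2 f}.
  apply: cid2; have [_ [C C0 HC]] := ob_comp (ob_gz 1) (ob_K p Hflat i le0_2).
  by exists C.
have S0 : 0 <= \sum_i C3 i by exact: sumr_ge0.
exists (C1 + C2 + \sum_i C3 i); first by rewrite !addr_ge0.
move=> h v i oh kv; have [h0 _] := oh; have kv2 := kc_le le2_3 kv.
set N := Nk 2 v + _.
have vN : Nk 2 v <= N by rewrite lerDl Nk_ge0.
have DvN : Nk 2 (D h v) <= N by rewrite lerDr Nk_ge0.
have kg : kc 2 (gz v) by exact: (ob_kc (ob_gz 2) ok1 kv).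
have kD : kc 2 (D h v) by exact: (ob_kc (ob_D p Hflat le2_3) oh).
have kgD : kc 1 (gz (D h v)) by exact: (ob_kc (ob_gz 1) ok1 kD).
have kC : kc 1 (gz (D h v) - D h (gz v)) by exact: (ob_kc (gz_D le1_1) oh kv2).
have kK : kc 0 (K i h (gz v)).
  exact: (ob_kc (ob_K p Hflat i le0_2) oh (kc_le le1_2 kg)).
have -> : D h (pd i (gz v)) = pd i (gz (D h v)) - pd i (gz (D h v) - D h (gz v)) - K i h (gz v).
  rewrite -(pdB1 i kgD.1 kC.1) opprB addrCA subrr addr0.
  by rewrite (pd_D Hflat p i h0 (Ck_le le1_2 kg.1)) addrK.
apply: (le_trans (nrmB (sqB (kc_sq (kc_pd i kgD)) (kc_sq (kc_pd i kC))) (kc_sq kK))).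
rewrite mulrDl; apply: lerD.
  apply: (le_trans (nrmB (kc_sq (kc_pd i kgD)) (kc_sq (kc_pd i kC)))); rewrite mulrDl; apply: lerD.
    exact: (le_trans (Nk_pd 0 i _) (le_trans (H1 _ _ ok1 kD) (ler_wpM2l C10 DvN))).
  exact: (le_trans (Nk_pd 0 i _) (le_trans (H2 _ _ oh kv2) (ler_wpM2l C20 vN))).
apply: (le_trans (H3 i _ _ oh kv2)); apply: (le_trans (ler_wpM2l (C30 i) vN)).
apply: ler_wpM2r; first by rewrite addr_ge0 ?Nk_ge0.
by rewrite (bigD1 i)//= lerDl sumr_ge0.
Qed.

(** The quotient on [chi] is moved onto [v], so one more quotient is accommodated than in
    [cz_bound]; [T2] uses this. *)
Lemma cz_D_bound : exists2 C, 0 <= C & forall h v chi, ok h -> kc 3 v -> kc 3 chi ->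
  `|cz v (D h chi)| <= C * ((Nk 2 v + Nk 2 (D (- h) v)) * Nk 1 chi).
Proof.
have [C1 C10 H1] := D_pd_gz; have [C2 C20 H2] := ob_bd (ob_gz 1).
have /all_sig2[C3 C30 H3] i : {C | 0 <= C & forall h f, ok h -> kc 1 f -> Nk 0 (K i h f) <= C * Nk 1 f}.
  by apply: cid2; have [_ [C C0 HC]] := ob_K p Hflat i le0_2; exists C.
have S0 : 0 <= \sum_i C3 i by exact: sumr_ge0.
have [C4 C40 H4] := ob_bd (ob_P p Hflat); have [C5 C50 H5] := ob_bd (ob_gz 0).
have [C6 C60 H6] := ob_bd (gz_D le0_1).
exists (n%:R * (C1 + C2 * (\sum_i C3 i)) + ((1 + C4) * C5 + C6)).
  by rewrite !addr_ge0// ?mulr_ge0// ?addr_ge0// mulr_ge0.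
move=> h v chi oh kv kx; have ohN := okN oh; have [h0 _] := oh.
set N := Nk 2 v + _.
have vN : Nk 2 v <= N by rewrite lerDl Nk_ge0.
have DvN : Nk 2 (D (- h) v) <= N by rewrite lerDr Nk_ge0.
have N0 : 0 <= N by exact: le_trans (Nk_ge0 _ _) vN.
have kv2 := kc_le le2_3 kv; have kx1 := kc_le le1_3 kx.
have kDx : kc 2 (D h chi) by exact: (ob_kc (ob_D p Hflat le2_3) oh).
have kDv : kc 2 (D (- h) v) by exact: (ob_kc (ob_D p Hflat le2_3) ohN).
have kg : kc 1 (gz v) by exact: (ob_kc (ob_gz 1) ok1 kv2).
have kgx : kc 0 (gz chi) by exact: (ob_kc (ob_gz 0) ok1 kx1).
have sl : sq (lap v) by exact: kc_sq (kc_lap (k := 0) kv2).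
rewrite (czE kv2 kDx); apply: (le_trans (ler_normB _ _)); rewrite normrN mulrDl; apply: lerD.
  apply: (le_trans (ler_norm_sum _ _ _)); rewrite -mulrA; apply: sum_le_const => i.
  have sA := kc_sq (kc_pd i kg); have sx := kc_sq (kc_pd i (kc_le le1_3 kx)).
  have kK : kc 0 (K i h chi) by exact: (ob_kc (ob_K p Hflat i le0_2) oh kx1).
  rewrite (pd_D Hflat p i h0 kx1.1) (ipDr (sq_D Hflat p h sx) (kc_sq kK) sA).
  have -> : ip (pd i (gz v)) (D h (pd i chi)) = - ip (D (- h) (pd i (gz v))) (pd i chi).
    by rewrite (ip_D Hflat p (- h) sA sx) !opprK.
  apply: (le_trans (ler_normD _ _)); rewrite normrN mulrDl; apply: lerD.
    apply: (le_trans (ip_CS (sq_D Hflat p (- h) sA) sx)); rewrite mulrA.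
    apply: (ler_pM (nrm_ge0 _) (nrm_ge0 _)); last exact: (Nk_pd 0).
    exact: (H1 _ _ i ohN kv).
  apply: (le_trans (ip_CS sA (kc_sq kK))); rewrite mulrACA.
  apply: (ler_pM (nrm_ge0 _) (nrm_ge0 _)).
    exact: (le_trans (Nk_pd 0 i _) (le_trans (H2 _ _ ok1 kv2) (ler_wpM2l C20 vN))).
  apply: (le_trans (H3 i _ _ oh kx1)); apply: ler_wpM2r; first exact: Nk_ge0.
  by rewrite (bigD1 i)//= lerDl sumr_ge0.
have kC : kc 0 (gz (D h chi) - D h (gz chi)) by exact: (ob_kc (gz_D le0_1) oh kx1).
have sDg := sq_D Hflat p h (kc_sq kgx).
rewrite -[gz (D h chi)](subrK (D h (gz chi))) (ipDr (kc_sq kC) sDg sl) addrC.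
have -> : ip (lap v) (D h (gz chi)) = - ip (D (- h) (lap v)) (gz chi).
  by rewrite (ip_D Hflat p (- h) sl (kc_sq kgx)) !opprK.
apply: (le_trans (ler_normD _ _)); rewrite normrN mulrDl; apply: lerD.
  apply: (le_trans (ip_CS (sq_D Hflat p (- h) sl) (kc_sq kgx))); rewrite mulrACA.
  apply: (ler_pM (nrm_ge0 _) (nrm_ge0 _)); last exact: (H5 _ _ ok1 kx1).
  have -> : D (- h) (lap v) = lap (D (- h) v) - P (- h) v by rewrite (lap_D p Hflat ohN kv) addrK.
  have kP : kc 0 (P (- h) v) by exact: (ob_kc (ob_P p Hflat) ohN kv2).
  apply: (le_trans (nrmB (kc_sq (kc_lap (k := 0) kDv)) (kc_sq kP))); rewrite mulrDl mul1r.
  apply: lerD; first exact: (le_trans (nrm_lap_le kDv) DvN).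
  exact: (le_trans (H4 _ _ ohN kv2) (ler_wpM2l C40 vN)).
apply: (le_trans (ip_CS sl (kc_sq kC))); rewrite mulrCA.
apply: (ler_pM (nrm_ge0 _) (nrm_ge0 _)); last exact: (H6 _ _ oh kx1).
exact: (le_trans (nrm_lap_le kv2) vN).
Qed.

End energy.

(** * First and second tangential quotients *)

Section tangential.
Context {R : realType} {n : nat}.
Local Notation V := 'rV[R]_n.+1.
Implicit Types (f g phi psi v chi : V -> R).

(** Absorption: the energy estimate is linear in the norm [N] to be bounded, and coercivity bounds
    [N] by the energy [e]. *)
Lemma quad (e N C M : R) : 0 <= e -> 0 <= C -> 0 <= M -> e ^+ 2 <= M * N -> N <= C * e ->
  N <= C * C * M.
Proof.
move=> e0 C0 M0 H NC; apply: (le_trans NC); rewrite -mulrA ler_wpM2l//.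
have [->|en0] := eqVneq e 0; first exact: mulr_ge0.
have ep : 0 < e by rewrite lt_neqAle eq_sym en0.
rewrite -(ler_pM2r ep) -expr2; apply: (le_trans H).
by rewrite (_ : C * M * e = M * (C * e)) ?ler_wpM2l//; ring.
Qed.

Lemma le_each (K x S : R) : 0 <= K -> x <= S -> K * x <= K * S.
Proof. by move=> K0; exact: ler_wpM2l. Qed.

Lemma bd_l (K x N Z y : R) : 0 <= K -> 0 <= N -> x <= Z * y -> K * (x * N) <= K * Z * (y * N).
Proof. by move=> K0 N0 H; rewrite -mulrA ler_wpM2l// mulrA ler_wpM2r. Qed.
Lemma bd_r (K y x Z N : R) : 0 <= K -> 0 <= y -> x <= Z * N -> K * (y * x) <= K * Z * (y * N).
Proof. by move=> K0 y0 H; rewrite -mulrA ler_wpM2l// mulrCA ler_wpM2l. Qed.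
Lemma bd_f (F x Z c m C N : R) : 0 <= F -> 0 <= Z -> x <= Z * c -> c <= m -> m <= C * N ->
  F * x <= Z * C * (F * N).
Proof.
move=> F0 Z0 xc cm mN; rewrite mulrCA ler_wpM2l//; apply: (le_trans xc).
by rewrite -mulrA ler_wpM2l// (le_trans cm).
Qed.
Lemma bd_e (e l w Z y C N H : R) : 0 <= e -> 0 <= Z -> l <= w -> w <= Z * y -> y <= C * N / H ->
  e * l <= Z * C * (e / H * N).
Proof.
move=> e0 Z0 lw wy yN; rewrite (_ : Z * C * (e / H * N) = e * (Z * (C * N / H))); last by ring.
by rewrite ler_wpM2l// (le_trans lw)// (le_trans wy)// ler_wpM2l.
Qed.

Lemma combine (e2 s t c d i b1 b2 b3 b4 K1 K2 K3 K4 F P E N : R) :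
  e2 = s -> `|s + t| <= b1 -> t = c + d -> `|c| <= b2 -> `|d - i| <= b4 -> `|i| <= b3 ->
  b1 <= K1 * (P * N) -> b2 <= K2 * (P * N) -> b3 <= K3 * (F * N) -> b4 <= K4 * (E * N) ->
  0 <= K1 -> 0 <= K2 -> 0 <= K3 -> 0 <= K4 -> 0 <= F -> 0 <= P -> 0 <= E -> 0 <= N ->
  e2 <= (K1 + K2 + K3 + K4) * (F + P + E) * N.
Proof.
move=> -> + tE; rewrite tE !ler_norml => /andP[_ A1] /andP[A2 _] /andP[A3 _] /andP[A4 _] B1 B2 B3 B4.
move=> k1 k2 k3 k4 F0 P0 E0 N0.
have x0 : 0 <= P * N by exact: mulr_ge0.
have y0 : 0 <= F * N by exact: mulr_ge0.
have z0 : 0 <= E * N by exact: mulr_ge0.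
rewrite -mulrA (_ : (F + P + E) * N = P * N + F * N + E * N); last by ring.
move: (P * N) (F * N) (E * N) x0 y0 z0 B1 B2 B3 B4 => x y z x0 y0 z0 B1 B2 B3 B4.
have hx : x <= x + y + z by lra.
have hy : y <= x + y + z by lra.
have hz : z <= x + y + z by lra.
have := le_each k1 hx; have := le_each k2 hx; have := le_each k3 hy; have := le_each k4 hz.
rewrite !mulrDl; move: (K1 * _) (K2 * _) (K3 * _) (K4 * _) (K1 * x) (K2 * x) (K3 * y) (K4 * z) B1 B2 B3 B4.
by move=> *; lra.
Qed.

Lemma bd_ee (x y C N H : R) : 0 <= C -> 0 <= H -> x <= C * y / H -> y <= C * N / H ->
  x <= C * C * N / (H * H).
Proof.
move=> C0 H0 xy yN; rewrite invfM; apply: (le_trans xy).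
rewrite (_ : C * C * N * (H^-1 * H^-1) = C * (C * N / H) / H); last by ring.
by rewrite ler_wpM2r ?invr_ge0// ler_wpM2l.
Qed.
Lemma bd_chain (s t u b b' : R) : `|s + t| <= b -> `|t + u| <= b' -> `|s + - u| <= b + b'.
Proof.
move=> H1 H2; rewrite (_ : s + - u = (s + t) - (t + u)); last by ring.
by rewrite (le_trans (ler_normB _ _))// lerD.
Qed.
Lemma bd_2 (a b v N Z P W W' : R) : 0 <= a -> 0 <= b -> 0 <= Z -> 0 <= N -> 0 <= P -> 0 <= W -> 0 <= W' ->
  v <= Z * P -> a * (W * N) + b * ((v + W) * N) <= (a + b * (Z + 1)) * ((P + W + W') * N).
Proof.
move=> a0 b0 Z0 N0 P0 W0 W'0 vP; rewrite [leRHS]mulrDl; apply: lerD.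
  by rewrite ler_wpM2l// ler_wpM2r// addrAC lerDr addr_ge0.
apply: bd_l => //; rewrite mulrDl mul1r; apply: lerD; last by rewrite addrAC lerDr addr_ge0.
by apply: (le_trans vP); rewrite ler_wpM2l// -addrA lerDl addr_ge0.
Qed.
Lemma bd_3 (c d v x N Z P W W' : R) : 0 <= c -> 0 <= d -> 0 <= Z -> 0 <= N -> 0 <= P -> 0 <= W -> 0 <= W' ->
  0 <= v -> v <= Z * P -> x <= d * N -> c * ((v + W') * x) <= c * d * (Z + 1) * ((P + W + W') * N).
Proof.
move=> c0 d0 Z0 N0 P0 W0 W'0 v0 vP xN; apply: (le_trans (bd_r c0 (addr_ge0 v0 W'0) xN)).
apply: bd_l => //; first exact: mulr_ge0.
rewrite mulrDl mul1r; apply: lerD; last by rewrite lerDr addr_ge0.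
by apply: (le_trans vP); rewrite ler_wpM2l// -addrA lerDl addr_ge0.
Qed.

Lemma lapE f x : lap f x = \sum_i pd i (pd i f) x.
Proof. by rewrite /lap fct_sumE. Qed.

Lemma lap_local f g (U : set V) x : open U -> (forall y, U y -> f y = g y) -> U x ->
  lap f x = lap g x.
Proof.
move=> oU fg Ux; rewrite (lapE f) (lapE g); apply: eq_bigr => i _.
exact: (partials_local [:: i; i] oU fg Ux).
Qed.

Variables (rho : V -> R) (q p : V).
Hypothesis Hflat : flat rho q.
Local Notation D := (Dquo rho q p).

Variables (zeta zeta' : V -> R).
Hypothesis kz : forall k, kc k zeta.
Hypothesis kz' : forall k, kc k zeta'.
(** A local way of saying that [zeta'] is 1 near the support of [zeta]. *)
Hypothesis Hloc : forall x, (exists2 U, open U /\ U x & forall y, U y -> zeta' y = 1) \/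
  (exists2 U, open U /\ U x & forall y, U y -> zeta y = 0).

Lemma zeta_mul phi : zeta * (zeta' * phi) = zeta * phi.
Proof.
apply/funext => x; rewrite !fctE.
have [[U [_ Ux] H]|[U [_ Ux] H]] := Hloc x; rewrite (H x Ux); first by rewrite mul1r.
by rewrite !mul0r.
Qed.

(** Lets [cz_D_bound] act on a cut-off of [phi], whose quotient [T1] controls. *)
Lemma cz_local phi chi : cz zeta phi chi = cz zeta (zeta' * phi) chi.
Proof.
rewrite /cz zeta_mul; apply: (f_equal (fun t => en (zeta * phi) chi - t)).
rewrite /en; apply: eq_Rintegral => x _.
have [[U [oU Ux] H]|[U [oU Ux] H]] := Hloc x.
  apply: (f_equal (fun t => t * lap (zeta * chi) x)); apply: (lap_local oU _ Ux) => y Uy.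
  by rewrite -[RHS]/(zeta' y * phi y) H// mul1r.
have E : lap (zeta * chi) x = 0.
  apply: etrans (_ : lap (cst 0) x = 0).
    by apply: (lap_local oU _ Ux) => y Uy; rewrite -[LHS]/(zeta y * chi y) H// mul0r.
  rewrite lapE big1// => i _.
  by rewrite -[pd i _]/(partials [:: i; i] (cst 0)) partials_cst.
apply: etrans (f_equal (fun t => lap phi x * t) E) _.
apply: etrans _ (esym (f_equal (fun t => lap (zeta' * phi) x * t) E)).
exact: etrans (mulr0 _) (esym (mulr0 _)).
Qed.

Lemma zeta_bs : exists2 L, 0 <= L & bs L zeta.
Proof. by have [_ [L bz]] := kz 0; exists `|L| => //; apply: bs_le bz; exact: ler_norm. Qed.

(** Nirenberg's method: the equation is tested with [psi], one quotient is moved across the energy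
    form, and coercivity absorbs the result. Since [phi] solves the equation only up to [e], the
    residual meets the $H^2$ norm of [psi], one quotient too many, and costs the term [e / |h|]. *)
Lemma T1 : exists2 C, 0 <= C & forall h phi f e, ok h -> kc 4 phi -> sq f -> 0 <= e ->
  (let psi := zeta * D (- h) (D h (zeta * phi)) in `|en phi psi - ip f psi| <= e * nrm (lap psi)) ->
  Nk 2 (D h (zeta * phi)) <= C * (nrm f + Nk 2 phi + e / `|h|).
Proof.
have [L L0 bz] := zeta_bs; have [B B0 HB] := S_disp Hflat p.
have [Cc Cc0 Hc] := @coercive R n (L + B) (addr_ge0 L0 B0).
have [CA CA0 HA] := en_D_bound p Hflat.
have [C1 C10 H1] := cz_bound kz.
have [CD CD0 HD] := ob_bd (ob_D p Hflat le1_3).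
have [Z0 Z00 HZ0] := ob_bd (ob_mul (ub_kc (kz 0))).
have [Z2 Z20 HZ2] := ob_bd (ob_mul (ub_kc (kz 2))).
have [Ct Ct0 Ht] := Dh_bound p Hflat le2_3.
pose C := CA * Z2 + C1 * CD + Z0 * CD + Z2 * Ct.
have C0 : 0 <= C by rewrite !addr_ge0// mulr_ge0.
exists (Cc * Cc * C); first by rewrite !mulr_ge0.
move=> h phi f e oh kp sf e0; cbv zeta.
set v := zeta * phi; set psi := D h v; set chi := D (- h) psi => Hres.
have z k : Ck k zeta by case: (kz k).
have kv : kc 4 v by exact: kcM.
have kpsi : kc 4 psi by exact: (kc_D Hflat).
have kchi : kc 4 chi by exact: (kc_D Hflat).
have kzc : kc 4 (zeta * chi) by exact: kcM.
have ohN := okN oh; have [h0 h1] := oh.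
rewrite -mulrA; apply: (@quad (nrm (lap psi))).
- exact: nrm_ge0.
- exact: Cc0.
- apply: mulr_ge0 => //; apply: addr_ge0; last by rewrite divr_ge0.
  by apply: addr_ge0; [exact: nrm_ge0|exact: Nk_ge0].
- set N := Nk 2 psi; have N0 : 0 <= N by exact: Nk_ge0.
  have A1 : `|en psi psi + en v chi| <= CA * (Nk 2 v * N).
    exact: (HA _ _ _ oh (kc_le le3_4 kv) (kc_le le3_4 kpsi)).
  have E : en v chi = cz zeta phi chi + en phi (zeta * chi) by rewrite /cz subrK.
  have kp2 := kc_le le2_4 kp; have kps2 := kc_le le2_4 kpsi.
  have kx2 := kc_le le2_4 kchi; have kx0 := kc_le le0_4 kchi.
  have A2 : Nk 2 v <= Z2 * Nk 2 phi := HZ2 _ _ ok1 kp2.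
  have A3 : `|cz zeta phi chi| <= C1 * (Nk 2 phi * Nk 1 chi) := H1 _ _ kp2 kx2.
  have A4 : Nk 1 chi <= CD * N := HD _ _ ohN kps2.
  have A5 : nrm (zeta * chi) <= Z0 * nrm chi := HZ0 _ _ ok1 kx0.
  have A6 : nrm chi <= Nk 1 chi := nrm_Nk 1 chi.
  have A7 : nrm (lap (zeta * chi)) <= Nk 2 (zeta * chi) := nrm_lap_le (kc_le le2_4 kzc).
  have A8 : Nk 2 (zeta * chi) <= Z2 * Nk 2 chi := HZ2 _ _ ok1 kx2.
  have A9 : Nk 2 chi <= Ct * N / `|h| by have := Ht _ _ ohN kps2; rewrite normrN.
  have A10 := ip_CS sf (kc_sq kzc).
  have A11 : nrm (lap psi) ^+ 2 = en psi psi by rewrite nrm_sq.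
  have F0 := nrm_ge0 f; have P0 := Nk_ge0 2 phi.
  have B1 := bd_l CA0 N0 A2; have B2 := bd_r C10 P0 A4.
  have B3 := bd_f F0 Z00 A5 A6 A4; have B4 := bd_e e0 Z20 A7 A8 A9.
  apply: (combine A11 A1 E A3 Hres A10 B1 B2 B3 B4 _ _ _ _ F0 P0 _ N0); try exact: mulr_ge0.
- apply: Hc; first exact: kc_le kpsi.
  apply: (bs_D HB) => //; exact: bs_mulr.
Qed.

(** The same with two quotients on each side. The cut-off commutator then needs a first quotient of
    [zeta' * phi], with the larger cut-off, and the residual costs $e/|h|^2$. *)
Lemma T2 : exists2 C, 0 <= C & forall h phi f e, ok h -> kc 4 phi -> sq f -> 0 <= e ->
  (let psi := zeta * D (- h) (D (- h) (D h (D h (zeta * phi)))) in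
   `|en phi psi - ip f psi| <= e * nrm (lap psi)) ->
  Nk 2 (D h (D h (zeta * phi))) <= C * (nrm f +
    (Nk 2 phi + Nk 2 (D h (zeta * phi)) + Nk 2 (D h (zeta' * phi))) + e / (`|h| * `|h|)).
Proof.
have [L L0 bz] := zeta_bs; have [B B0 HB] := S_disp Hflat p.
have [Cc Cc0 Hc] := @coercive R n (L + B + B) (addr_ge0 (addr_ge0 L0 B0) B0).
have [CA CA0 HA] := en_D_bound p Hflat; have [CB CB0 HBB] := en_DD_bound p Hflat.
have [C1 C10 H1] := cz_D_bound p Hflat kz.
have [CD CD0 HD] := ob_bd (ob_D p Hflat le1_3).
have [CE CE0 HE] := ob_bd (ob_D p Hflat le0_3).
have [Z0 Z00 HZ0] := ob_bd (ob_mul (ub_kc (kz 0))).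
have [Z2 Z20 HZ2] := ob_bd (ob_mul (ub_kc (kz 2))).
have [Y2 Y20 HY2] := ob_bd (ob_mul (ub_kc (kz' 2))).
have [Ct Ct0 Ht] := Dh_bound p Hflat le2_3.
pose K1 := CA + CB * (Z2 + 1); pose K2 := C1 * CD * (Y2 + 1).
pose C := K1 + K2 + Z0 * CE * CD + Z2 * (Ct * Ct).
have K10 : 0 <= K1 by rewrite addr_ge0// mulr_ge0// addr_ge0.
have K20 : 0 <= K2 by rewrite !mulr_ge0// addr_ge0.
have K30 : 0 <= Z0 * CE * CD by rewrite !mulr_ge0.
have K40 : 0 <= Z2 * (Ct * Ct) by rewrite !mulr_ge0.
have C0 : 0 <= C := addr_ge0 (addr_ge0 (addr_ge0 K10 K20) K30) K40.
exists (Cc * Cc * C); first by rewrite !mulr_ge0.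
move=> h phi f e oh kp sf e0; cbv zeta.
set v := zeta * phi; set v' := zeta' * phi; set w := D h v; set psi := D h w.
set chi1 := D (- h) psi; set chi := D (- h) chi1 => Hres.
have z k : Ck k zeta by case: (kz k).
have kv : kc 4 v by exact: kcM.
have kv' : kc 4 v' by apply: kcM => //; case: (kz' 4).
have kw : kc 4 w by exact: (kc_D Hflat).
have kpsi : kc 4 psi by exact: (kc_D Hflat).
have kchi1 : kc 4 chi1 by exact: (kc_D Hflat).
have kchi : kc 4 chi by exact: (kc_D Hflat).
have kzc : kc 4 (zeta * chi) by exact: kcM.
have ohN := okN oh; have [h0 h1] := oh.
set W' := Nk 2 (D h v').
have P0 := Nk_ge0 2 phi; have W0 : 0 <= Nk 2 w := Nk_ge0 2 w.
have W'0 : 0 <= W' := Nk_ge0 2 _.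
set Q := Nk 2 phi + Nk 2 w + W'; have Q0 : 0 <= Q := addr_ge0 (addr_ge0 P0 W0) W'0.
have F0 := nrm_ge0 f.
have E0 : 0 <= e / (`|h| * `|h|) by rewrite divr_ge0// mulr_ge0.
rewrite -mulrA; apply: (@quad (nrm (lap psi))).
- exact: nrm_ge0.
- exact: Cc0.
- by apply: mulr_ge0 => //; do 2 apply: addr_ge0 => //.
- set N := Nk 2 psi; have N0 : 0 <= N by exact: Nk_ge0.
  have kp2 := kc_le le2_4 kp; have kps2 := kc_le le2_4 kpsi.
  have kx2 := kc_le le2_4 kchi; have kx0 := kc_le le0_4 kchi.
  have kx12 := kc_le le2_4 kchi1; have kx11 := kc_le le1_4 kchi1.
  have A1 : `|en psi psi + en w chi1| <= CA * (Nk 2 w * N) :=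
    HA _ _ _ oh (kc_le le3_4 kw) (kc_le le3_4 kpsi).
  have A1' : `|en w chi1 + en v chi| <= CB * ((Nk 2 v + Nk 2 w) * N) := HBB _ _ _ oh kv kpsi.
  have E : - en v chi = - cz zeta v' chi + - en phi (zeta * chi).
    by rewrite -opprD -cz_local /cz subrK.
  have A2 : Nk 2 v <= Z2 * Nk 2 phi := HZ2 _ _ ok1 kp2.
  have A2' : Nk 2 v' <= Y2 * Nk 2 phi := HY2 _ _ ok1 kp2.
  have A3 : `|cz zeta v' chi| <= C1 * ((Nk 2 v' + W') * Nk 1 chi1).
    have := H1 _ _ _ ohN (kc_le le3_4 kv') (kc_le le3_4 kchi1).
    by rewrite opprK.
  have A4 : Nk 1 chi1 <= CD * N := HD _ _ ohN kps2.
  have A4' : nrm chi <= CE * Nk 1 chi1 := HE _ _ ohN kx11.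
  have A5 : nrm (zeta * chi) <= Z0 * nrm chi := HZ0 _ _ ok1 kx0.
  have A7 : nrm (lap (zeta * chi)) <= Nk 2 (zeta * chi) := nrm_lap_le (kc_le le2_4 kzc).
  have A8 : Nk 2 (zeta * chi) <= Z2 * Nk 2 chi := HZ2 _ _ ok1 kx2.
  have A9 : Nk 2 chi1 <= Ct * N / `|h| by have := Ht _ _ ohN kps2; rewrite normrN.
  have A9' : Nk 2 chi <= Ct * Nk 2 chi1 / `|h| by have := Ht _ _ ohN kx12; rewrite normrN.
  have A10 := ip_CS sf (kc_sq kzc).
  have A11 : nrm (lap psi) ^+ 2 = en psi psi by rewrite nrm_sq.
  have V0 := Nk_ge0 2 v; have V'0 := Nk_ge0 2 v'; have X0 := Nk_ge0 1 chi1.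
  have A9'' : Nk 2 chi <= (Ct * Ct) * N / (`|h| * `|h|).
    exact: (bd_ee Ct0 (normr_ge0 h) A9' A9).
  have D1 : `|en psi psi + - en v chi| <= CA * (Nk 2 w * N) + CB * ((Nk 2 v + Nk 2 w) * N).
    exact: (bd_chain A1 A1').
  have D2 : `|- en phi (zeta * chi) - - ip f (zeta * chi)| <= e * nrm (lap (zeta * chi)).
    by rewrite -opprD normrN.
  have B1 : CA * (Nk 2 w * N) + CB * ((Nk 2 v + Nk 2 w) * N) <= K1 * (Q * N).
    exact: (bd_2 CA0 CB0 Z20 N0 P0 W0 W'0 A2).
  have B2 : C1 * ((Nk 2 v' + W') * Nk 1 chi1) <= K2 * (Q * N).
    exact: (bd_3 C10 CD0 Y20 N0 P0 W0 W'0 V'0 A2' A4).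
  have B3 : nrm f * nrm (zeta * chi) <= Z0 * CE * CD * (nrm f * N).
    apply: (bd_f F0 (mulr_ge0 Z00 CE0) _ (lexx (Nk 1 chi1)) A4).
    by rewrite -mulrA; apply: (le_trans A5); rewrite ler_wpM2l.
  have B4 := bd_e e0 Z20 A7 A8 A9''.
  rewrite -(normrN (ip f _)) in A10; rewrite -normrN in A3.
  exact: (combine A11 D1 E A3 D2 A10 B1 B2 B3 B4).
- apply: Hc; first exact: kc_le kpsi.
  by apply: (bs_D HB) => //; apply: (bs_D HB) => //; exact: bs_mulr.
Qed.

End tangential.

(** * Compact supports *)

Section support.
Context {R : realType} {n : nat}.
Local Notation V := 'rV[R]_n.
Implicit Types (f g : V -> R) (O : set V).

(** Compact support in [O], encoded by a uniform margin [d] to the complement and a bound [L]: both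
    are easily followed through flows, shifts and mollification. *)
Definition csupp O f := exists d L, 0 < d /\
  forall x, f x != 0 -> `|x| <= L /\ forall y, `|x - y| < d -> O y.

Definition tc k O f := Ck k f /\ csupp O f.

Lemma csupp_sub O O' f : O `<=` O' -> csupp O f -> csupp O' f.
Proof.
move=> OO [d [L [d0 H]]]; exists d, L; split => // x fx.
by have [xL Hy] := H x fx; split => // y /Hy /OO.
Qed.

Lemma csupp_le O f g : (forall x, g x != 0 -> f x != 0) -> csupp O f -> csupp O g.
Proof. by move=> fg [d [L [d0 H]]]; exists d, L; split => // x /fg /H. Qed.

Lemma csuppM O f g : csupp O g -> csupp O (f * g).
Proof.
by apply: csupp_le => x; rewrite -[(f * g) x]/(f x * g x) mulf_eq0 negb_or => /andP[].
Qed.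

Lemma csuppZ O a f : csupp O f -> csupp O (a *: f).
Proof.
by apply: csupp_le => x; rewrite -[(a *: f) x]/(a * f x) mulf_eq0 negb_or => /andP[].
Qed.

Lemma csuppN O f : csupp O f -> csupp O (- f).
Proof. by apply: csupp_le => x; rewrite -[(- f) x]/(- (f x)) oppr_eq0. Qed.

Lemma csuppD O f g : csupp O f -> csupp O g -> csupp O (f + g).
Proof.
move=> [d [L [d0 H]]] [d' [L' [d'0 H']]]; exists (Num.min d d'), (Num.max L L').
split; first by rewrite lt_min d0.
move=> x fgx; have [fx|fx] := eqVneq (f x) 0.
  have gx : g x != 0 by apply: contra fgx => /eqP gx; rewrite -[(f + g) x]/(f x + g x) fx gx addr0.
  have [xL Hy] := H' x gx; split; first by rewrite le_max xL orbT.
  by move=> y; rewrite lt_min => /andP[_ /Hy].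
have [xL Hy] := H x fx; split; first by rewrite le_max xL.
by move=> y; rewrite lt_min => /andP[/Hy].
Qed.

Lemma csupp_bs O f : csupp O f -> exists L, bs L f.
Proof.
move=> [d [L [_ H]]]; exists L => x Lx; apply/eqP; apply: contraT => /H[].
by rewrite leNgt Lx.
Qed.

Lemma tc_kc k O f : tc k O f -> kc k f.
Proof. by move=> [Hf /csupp_bs]. Qed.

Lemma csupp_cut (x0 : V) s s' O z f : s < s' -> (forall x, s <= `|x - x0| -> z x = 0) ->
  csupp O f -> csupp (O `&` [set y | `|y - x0| < s']) (z * f).
Proof.
move=> ss zx [d [L [d0 H]]]; exists (Num.min d (s' - s)), L; split.
  by rewrite lt_min d0 subr_gt0.
move=> x; rewrite -[(z * f) x]/(z x * f x) mulf_eq0 negb_or => /andP[zx0 fx].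
have [xL Hy] := H x fx; split => // y; rewrite lt_min => /andP[/Hy Oy xy]; split => //=.
have xs : `|x - x0| < s by rewrite ltNge; apply: contra zx0 => /zx->.
rewrite -(subrK x y) -addrA (le_lt_trans (ler_normD _ _))//.
rewrite distrC in xy; lra.
Qed.

Lemma lip_bdp f : Ck 1 f -> bdp 1 f -> exists2 M, 0 <= M & forall x y, `|f x - f y| <= M * `|x - y|.
Proof.
move=> Hf [M M0 HM]; exists (\sum_(i < n) M); first exact: sumr_ge0.
move=> x y; have [xi _] := MVT_C1 y (x - y) 1 Hf.
rewrite scale1r mul1r addrCA subrr addr0 => ->.
rewrite /dv fct_sumE mulr_suml (le_trans (ler_norm_sum _ _ _))//; apply: ler_sum => i _.
rewrite fctE /GRing.scale /= normrM mulrC ler_pM//; last exact: coord_le_norm.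
exact: (HM [:: i]).
Qed.

End support.

(** * Supports and limits along the flow *)

Section flow_more.
Context {R : realType} {n : nat}.
Local Notation V := 'rV[R]_n.
Implicit Types (f g v : V -> R).
Variables (rho : V -> R) (q : V).
Hypothesis Hflat : flat rho q.
Local Notation S := (Sflow rho q).
Local Notation tau := (ftau rho q).
Local Notation D := (Dquo rho q).
Local Notation X := (Xder rho q).
Local Notation K := (Kcom rho q).

Lemma S_lip p h : exists2 M, 0 <= M & forall x y, `|S p h x - S p h y| <= M * `|x - y|.
Proof.
have [r4 b4 _] := Hflat.
have [M M0 HM] := lip_bdp (Ck_le le1_4 r4) (bdp_le le1_4 b4).
exists (1 + (M + M) * `|q|); first by rewrite addr_ge0// mulr_ge0// addr_ge0.
move=> x y; rewrite /Sflow /shear /th.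
have -> : x + h *: p + (rho x - rho (x + h *: p)) *: q -
    (y + h *: p + (rho y - rho (y + h *: p)) *: q) =
    (x - y) + ((rho x - rho y) - (rho (x + h *: p) - rho (y + h *: p))) *: q.
  by apply/rowP => j; rewrite !mxE; ring.
rewrite (le_trans (ler_normD _ _))// mulrDl mul1r lerD2l normrZ mulrAC ler_wpM2r//.
rewrite (le_trans (ler_normB _ _))// mulrDl lerD ?HM//.
by have := HM (x + h *: p) (y + h *: p); rewrite opprD addrACA subrr addr0.
Qed.

(** Invariance of [O] is available only inside the ball of radius [R0], so the supports are kept in
    slightly growing balls around [x0]. *)
Lemma csupp_flow (x0 : V) R0 s s' p h O f B :
  (forall h x, `|S p h x - x| <= `|h| * B) -> s + `|h| * B <= s' -> s' <= R0 -> 0 <= B ->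
  (forall x, `|x - x0| < R0 -> `|S p (- h) x - x0| < R0 -> O x -> O (S p (- h) x)) ->
  csupp (O `&` [set y | `|y - x0| < s]) f -> csupp (O `&` [set y | `|y - x0| < s']) (tau p h f).
Proof.
move=> HB hs sR B0 HO [d [L [d0 H]]]; have [M M0 HM] := S_lip p h.
have M1 : 0 < M + 1 by rewrite ltr_wpDl.
exists (d / (M + 1)), (L + `|h| * B); split; first exact: divr_gt0.
move=> x fx; have [xL Hy] := H _ fx; split.
  rewrite -(subrK (S p h x) x) addrC (le_trans (ler_normD _ _))// lerD// distrC; exact: HB.
move=> y xy.
have {}xy : `|S p h x - S p h y| < d.
  rewrite (le_lt_trans (HM _ _))// (@le_lt_trans _ _ ((M + 1) * `|x - y|))//.
    by rewrite ler_wpM2r// lerDl.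
  by rewrite mulrC -ltr_pdivlMr.
have [Oy /= ys] := Hy _ xy.
have yE : S p (- h) (S p h y) = y by exact: SNK.
have ys' : `|y - x0| < s'.
  rewrite -(subrK (S p h y) y) -addrA (le_lt_trans (ler_normD _ _))//.
  have H1 : `|y - S p h y| <= `|h| * B by rewrite distrC; exact: HB.
  by rewrite [ltLHS]addrC; exact: (lt_le_trans (ltr_leD ys H1) hs).
split => //=; rewrite -yE; apply: HO => //.
  rewrite (lt_le_trans ys)// (le_trans _ sR)// (le_trans _ hs)// lerDl mulr_ge0//.
by rewrite yE (lt_le_trans ys').
Qed.

Lemma csupp_D (x0 : V) R0 s s' p h O f B :
  (forall h x, `|S p h x - x| <= `|h| * B) -> s + `|h| * B <= s' -> s' <= R0 -> 0 <= B ->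
  (forall x, `|x - x0| < R0 -> `|S p (- h) x - x0| < R0 -> O x -> O (S p (- h) x)) ->
  csupp (O `&` [set y | `|y - x0| < s]) f -> csupp (O `&` [set y | `|y - x0| < s']) (D p h f).
Proof.
move=> HB hs sR B0 HO sf; apply: csuppZ; apply: csuppD; first exact: (csupp_flow HB hs sR B0 HO sf).
apply: csuppN; apply: csupp_sub sf => y [Oy /= ys]; split => //=.
by rewrite (lt_le_trans ys)// (le_trans _ hs)// lerDl mulr_ge0.
Qed.

Lemma dv_tau w p h f : Ck 1 f ->
  dv w (tau p h f) = tau p h (dv w f) + dv w (th rho p h) * tau p h (dv q f).
Proof.
move=> Hf; rewrite {1}/dv /ftau.
have Ht : Ck 1 (th rho p h) by exact: (Ck_th Hflat).
under eq_bigr do rewrite pd_shear// scalerDr.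
rewrite big_split /=; congr (_ + _); apply/funext => x.
  by rewrite /dv /= !fct_sumE.
by rewrite /dv !fctE !fct_sumE mulr_suml; apply: eq_bigr => i _; rewrite !fctE /GRing.scale /= mulrA.
Qed.

Lemma dv_th w p h : dv w (th rho p h) = dv w rho - (dv w rho \o trans (h *: p)).
Proof.
have [r4 _ _] := Hflat; have r1 := Ck_le le1_4 r4.
rewrite {1}/dv -[th rho p h]/(rho - (rho \o trans (h *: p))).
under eq_bigr do rewrite (pdB1 _ r1 (Ck_trans (h *: p) r1)) pd_trans scalerBr.
rewrite sumrB; congr (_ - _); apply/funext => x; by rewrite /dv /= !fct_sumE.
Qed.

(** The tangential fields commute with all tangential flows, because the derivatives of [rho] do not
    change along [q]. *)
Lemma X_tau p' p h f : Ck 1 f -> X p' (tau p h f) = tau p h (X p' f).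
Proof.
move=> Hf; rewrite /Xder !dv_tau// !dv_th.
have H (w : V) x : dv w rho (S p h x) = dv w rho (trans (h *: p) x).
  by rewrite /Sflow /shear (dv_flat Hflat).
have H0 x : dv q rho (trans (h *: p) x) = dv q rho x.
  have [_ _ fl] := Hflat; have [r4 _ _] := Hflat; have r1 := Ck_le le1_4 r4.
  have E y : dv q rho y = 'D_q rho y by exact: (esym (f_equal (fun g => g y) (dvE q r1))).
  rewrite !E /derive; congr (lim _); apply: (congr1 (fun F : R -> R => F @ 0^')); apply/funext => t /=.
  congr (_ *: _); have := fl x t (h *: p); rewrite /trans.
  have -> : t *: q + (x + h *: p) = x + t *: q + h *: p by rewrite addrCA addrA.
  have -> : t *: q + x = x + t *: q by rewrite addrC.
  by move: (rho (x + t *: q + h *: p)) (rho (x + t *: q)) (rho (x + h *: p)) (rho x) => a b c d; lra.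
apply/funext => x.
rewrite -[LHS]/((dv p' f (S p h x) + (dv p' rho x - dv p' rho (trans (h *: p) x)) * dv q f (S p h x)) -
  dv p' rho x * (dv q f (S p h x) + (dv q rho x - dv q rho (trans (h *: p) x)) * dv q f (S p h x))).
rewrite -[RHS]/(dv p' f (S p h x) - dv p' rho (S p h x) * dv q f (S p h x)) H H0; ring.
Qed.

Lemma XB p f g : Ck 1 f -> Ck 1 g -> X p (f - g) = X p f - X p g.
Proof.
move=> Hf Hg; have E w : dv w (f - g) = dv w f - dv w g by rewrite dvD ?dvN//; exact: CkN.
by rewrite /Xder !E; apply/funext => x; rewrite !fctE; ring.
Qed.

Lemma XZ p a f : Ck 1 f -> X p (a *: f) = a *: X p f.
Proof.
move=> Hf; rewrite /Xder !dvZ//; apply/funext => x; rewrite !fctE /GRing.scale /=; ring.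
Qed.

Lemma X_D p' p h f : Ck 1 f -> X p' (D p h f) = D p h (X p' f).
Proof.
move=> Hf; rewrite /Dquo XZ; last by apply: CkB => //; exact: (Ck_tau Hflat p h le1_4 Hf).
by rewrite XB ?X_tau//; exact: (Ck_tau Hflat p h le1_4 Hf).
Qed.

(** The outer quotient is bounded by [nrm_D] on the error [D f - X f]; since [X] commutes with [D],
    that error is small even after applying [X]. *)
Lemma DD_lim p f : kc 2 f -> forall e, 0 < e -> exists2 d, 0 < d &
  forall s, s != 0 -> `|s| < d -> nrm (D p s (D p s f) - X p (X p f)) <= e.
Proof.
move=> kf e e0; have k1 : kc 1 f := kc_le le1_2 kf.
have kX : kc 1 (X p f) by exact: (kc_X Hflat).
have [d d0 Hd] := D_lim Hflat p kX (divr_gt0 e0 (ltr0n _ 2)).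
exists d => // s s0 sd; have H := Hd s s0 sd.
have kDf : kc 1 (D p s f) by exact: (kc_D Hflat).
have kB : kc 1 (D p s f - X p f) by exact: kcB.
have kXX : kc 0 (X p (X p f)) by exact: (kc_X Hflat).
have kDX : kc 0 (D p s (X p f)) by apply: (kc_D Hflat) => //; exact: kc_le kX.
have E : D p s (D p s f) - X p (X p f) = D p s (D p s f - X p f) + (D p s (X p f) - X p (X p f)).
  rewrite addrA; congr (_ - _); apply/funext => x.
  set g := D p s f; set k := X p f.
  rewrite -[RHS]/(s^-1 * ((g (S p s x) - k (S p s x)) - (g x - k x)) + s^-1 * (k (S p s x) - k x)).
  by rewrite -[LHS]/(s^-1 * (g (S p s x) - g x)); ring.
have s1 := kc_sq (kc_D Hflat p s le1_4 kB); have s2 := kc_sq (kcB kDX kXX).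
rewrite E (splitr e); apply: (le_trans (nrmD s1 s2)); apply: lerD => //.
apply: (le_trans (nrm_D Hflat p s0 kB)).
by rewrite (XB p kDf.1 kX.1) (X_D p p s k1.1).
Qed.

Definition nb f (a : R) := sq f /\ nrm f <= a.
Lemma nbD f g a b : nb f a -> nb g b -> nb (f + g) (a + b).
Proof. by move=> [sf fa] [sg gb]; split; [exact: sqD|exact: (le_trans (nrmD sf sg) (lerD fa gb))]. Qed.
Lemma nbB f g a b : nb f a -> nb g b -> nb (f - g) (a + b).
Proof. by move=> [sf fa] [sg gb]; split; [exact: sqB|exact: (le_trans (nrmB sf sg) (lerD fa gb))]. Qed.

Lemma nrm_X_bound p : exists2 C, 0 <= C & forall f, kc 1 f -> nrm (X p f) <= C * Nk 1 f.
Proof.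
have [r4 b _] := Hflat; have [M M0 HM] := bdp_dv p (bdp_le le1_4 b).
have u : @ub R n 0 (fun=> dv p rho).
  by apply/ub0; split; [move=> _ _; exact: (Ck_cont (Ck_dv p r4))|exists M].
have H : ob 1 0 (fun _ f => X p f).
  apply: ob_add; first exact: ob_dv.
  by apply: ob_opp; exact: ob_comp (ob_dv q 0) (ob_mul u).
have [C C0 HC] := ob_bd H; exists C => // f kf; exact: (HC _ _ ok1 kf).
Qed.

Lemma hess_num (C1 C2 C3 C4 C5 M0 M1 M2 : R) : 0 <= C1 -> 0 <= C2 -> 0 <= C3 -> 0 <= C4 -> 0 <= C5 ->
  0 <= M0 -> 0 <= M1 -> 0 <= M2 ->
  M1 + C1 * M0 + C2 * M0 <= (1 + C1 + C1 + C2 + C2 + C3 + C4 + C4 + C5) * (M0 + M1) /\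
  M2 + C1 * M1 + C2 * M1 + (C1 * M1 + C3 * M0 + C4 * M0) + (C2 * M1 + C4 * M0 + C5 * M0) <=
    (1 + C1 + C1 + C2 + C2 + C3 + C4 + C4 + C5) * (M0 + M1 + M2).
Proof.
move=> c1 c2 c3 c4 c5 m0 m1 m2.
have p10 : 0 <= C1 * M0 by rewrite mulr_ge0.
have p11 : 0 <= C1 * M1 by rewrite mulr_ge0.
have p12 : 0 <= C1 * M2 by rewrite mulr_ge0.
have p20 : 0 <= C2 * M0 by rewrite mulr_ge0.
have p21 : 0 <= C2 * M1 by rewrite mulr_ge0.
have p22 : 0 <= C2 * M2 by rewrite mulr_ge0.
have p30 : 0 <= C3 * M0 by rewrite mulr_ge0.
have p31 : 0 <= C3 * M1 by rewrite mulr_ge0.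
have p32 : 0 <= C3 * M2 by rewrite mulr_ge0.
have p40 : 0 <= C4 * M0 by rewrite mulr_ge0.
have p41 : 0 <= C4 * M1 by rewrite mulr_ge0.
have p42 : 0 <= C4 * M2 by rewrite mulr_ge0.
have p50 : 0 <= C5 * M0 by rewrite mulr_ge0.
have p51 : 0 <= C5 * M1 by rewrite mulr_ge0.
have p52 : 0 <= C5 * M2 by rewrite mulr_ge0.
clear -m0 m1 m2 p10 p11 p12 p20 p21 p22 p30 p31 p32 p40 p41 p42 p50 p51 p52.
split; lra.
Qed.

(** Transfers the quotients from [v] in $H^2$ to its second derivatives in $L^2$; every commutator
    met on the way is bounded by the $H^2$ norms of lower quotients. *)
Lemma D_hess p a b : exists2 C, 0 <= C & forall h v, ok h -> kc 4 v ->
  nrm (D p h (pd a (pd b v))) <= C * (Nk 2 v + Nk 2 (D p h v)) /\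
  nrm (D p h (D p h (pd a (pd b v)))) <= C * (Nk 2 v + Nk 2 (D p h v) + Nk 2 (D p h (D p h v))).
Proof.
have [C1 C10 H1] := ob_bd (ob_comp (ob_K p Hflat b le1_2) (ob_pd a 0)).
have [C2 C20 H2] := ob_bd (ob_comp (ob_pd b 1) (ob_K p Hflat a le0_2)).
have [C3 C30 H3] := ob_bd (ob_comp (ob_DK p Hflat b le1_1) (ob_pd a 0)).
have [C4 C40 H4] := ob_bd (ob_comp (ob_K p Hflat b le1_2) (ob_K p Hflat a le0_2)).
have [C5 C50 H5] := ob_bd (ob_comp (ob_pd b 1) (ob_DK p Hflat a le0_1)).
pose C := 1 + C1 + C1 + C2 + C2 + C3 + C4 + C4 + C5.
exists C; first by rewrite /C; lra.
move=> h v oh kv; have [h0 _] := oh.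
have kv2 := kc_le le2_4 kv; have kv3 := kc_le le3_4 kv.
set w := D p h v; set z := D p h w.
have kw : kc 4 w by exact: (kc_D Hflat). have kw2 := kc_le le2_4 kw.
have kz : kc 4 z by exact: (kc_D Hflat). have kz2 := kc_le le2_4 kz.
have DB f g : D p h (f - g) = D p h f - D p h g.
  apply/funext => x; rewrite -[LHS]/(h^-1 * ((f (S p h x) - g (S p h x)) - (f x - g x))).
  by rewrite -[RHS]/(h^-1 * (f (S p h x) - f x) - h^-1 * (g (S p h x) - g x)); ring.
have Dpd i f : Ck 1 f -> D p h (pd i f) = pd i (D p h f) - K p i h f.
  by move=> Hf; rewrite (pd_D Hflat p i h0 Hf) addrK.
have c1 m f : kc m.+1 f -> Ck 1 f by move=> [Hf _]; exact: Ck_le Hf.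
have E1 : D p h (pd b v) = pd b w - K p b h v by exact: (Dpd b _ (c1 _ _ kv)).
have E2 : D p h (pd b w) = pd b z - K p b h w by exact: (Dpd b _ (c1 _ _ kw)).
have kK f : kc 3 f -> kc 2 (K p b h f) by move=> kf; exact: (ob_kc (ob_K p Hflat b le2_2) oh kf).
have kw3 := kc_le le3_4 kw.
have F1 : D p h (pd a (pd b v)) = pd a (pd b w) - pd a (K p b h v) - K p a h (pd b v).
  by rewrite (Dpd a _ (c1 _ _ (kc_pd b kv))) E1 (pdB1 a (c1 _ _ (kc_pd b kw)) (c1 _ _ (kK _ kv3))).
have G1 : nrm (pd a (pd b w)) <= Nk 2 w by exact: (le_trans (Nk_pd 0 a _) (Nk_pd 1 b _)).
have G1' : nrm (pd a (pd b z)) <= Nk 2 z by exact: (le_trans (Nk_pd 0 a _) (Nk_pd 1 b _)).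
have s2 f : kc 2 f -> sq (pd a (pd b f)) by move=> kf; exact: (kc_sq (kc_pd a (kc_pd b kf))).
have sK f : kc 3 f -> sq (pd a (K p b h f)) by move=> kf; exact: (kc_sq (kc_pd a (kK _ kf))).
have sKb f : kc 2 f -> sq (K p a h (pd b f)).
  by move=> kf; exact: (kc_sq (ob_kc (ob_K p Hflat a le0_2) oh (kc_pd b kf))).
have N0 := Nk_ge0 2 v; have N1 := Nk_ge0 2 w; have N2 := Nk_ge0 2 z.
move: (Nk 2 v) (Nk 2 w) (Nk 2 z) (H1 _ _ oh kv2) (H1 _ _ oh kw2) (H2 _ _ oh kv2) (H2 _ _ oh kw2) (H3 _ _ oh kv2)
  (H4 _ _ oh kv2) (H5 _ _ oh kv2) G1 G1' N0 N1 N2 => M0 M1 M2 h1v h1w h2v h2w h3 h4 h5 g1 g1' N0 N1 N2.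
have [U1 U2] := hess_num C10 C20 C30 C40 C50 N0 N1 N2.
have n1 : nb (pd a (pd b w)) M1 by split; [exact: s2|].
have n1' : nb (pd a (pd b z)) M2 by split; [exact: s2|].
have n2 : nb (pd a (K p b h v)) (C1 * M0) by split; [exact: sK|].
have n2' : nb (pd a (K p b h w)) (C1 * M1) by split; [exact: sK|].
have n3 : nb (K p a h (pd b v)) (C2 * M0) by split; [exact: sKb|].
have n3' : nb (K p a h (pd b w)) (C2 * M1) by split; [exact: sKb|].
split; first by rewrite F1; have [_ H] := nbB (nbB n1 n2) n3; exact: (le_trans H U1).
have kL : kc 1 (D p h (K p b h v) - K p b h w).
  exact: (ob_kc (ob_DK p Hflat b le1_1) oh kv2).
have n4 : nb (pd a (D p h (K p b h v) - K p b h w)) (C3 * M0) by split; [exact: (kc_sq (kc_pd a kL))|].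
have n5 : nb (K p a h (K p b h v)) (C4 * M0).
  by split; [exact: (kc_sq (ob_kc (ob_K p Hflat a le0_2) oh (kc_le le1_2 (kK _ kv3))))|].
have n6 : nb (D p h (K p a h (pd b v)) - K p a h (D p h (pd b v))) (C5 * M0).
  by split; [exact: (kc_sq (ob_kc (ob_DK p Hflat a le0_1) oh (kc_pd b kv2)))|].
have KB f g : Ck 1 f -> Ck 1 g -> K p a h (f - g) = K p a h f - K p a h g.
  move=> Hf Hg; have E : dv q (f - g) = dv q f - dv q g by rewrite (dvD q Hf (CkN Hg)) (dvN q Hg).
  rewrite /Kcom E.
  by apply/funext => x; rewrite !fctE -[LHS]/(dq rho p a h x * (dv q f (S p h x) - dv q g (S p h x))) mulrBr.
have Q1 : D p h (pd a (pd b w)) = pd a (pd b z) - pd a (K p b h w) - K p a h (pd b w).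
  have Q1a := Dpd a (pd b w) (c1 _ _ (kc_pd b kw)).
  have Q1b := pdB1 a (c1 _ _ (kc_pd b kz)) (c1 _ _ (kK _ kw3)).
  exact: (etrans Q1a (f_equal (fun g => g - K p a h (pd b w)) (etrans (f_equal (pd a) E2) Q1b))).
have Q2 : D p h (pd a (K p b h v)) = pd a (K p b h w) + pd a (D p h (K p b h v) - K p b h w) - K p a h (K p b h v).
  rewrite (Dpd a _ (c1 _ _ (kK _ kv3))); congr (_ - _).
  by rewrite -(pdD1 a (c1 _ _ (kK _ kw3)) (c1 _ _ kL)) addrCA subrr addr0.
have Q3 : D p h (K p a h (pd b v)) = K p a h (pd b w) - K p a h (K p b h v) +
    (D p h (K p a h (pd b v)) - K p a h (D p h (pd b v))).
  by rewrite E1 (KB _ _ (c1 _ _ (kc_pd b kw)) (c1 _ _ (kK _ kv3))) addrCA subrr addr0.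
rewrite F1 !DB Q1 Q2 Q3.
have [_ H] := nbB (nbB (nbB (nbB n1' n2') n3') (nbB (nbD n2' n4) n5)) (nbD (nbB n3' n5) n6).
exact: (le_trans H U2).
Qed.

End flow_more.

(** * Charts *)

Section chart.
Context {R : realType} {n : nat}.
Local Notation V := 'rV[R]_n.
Implicit Types (f g phi psi v chi : V -> R).

(** Interior and boundary points share one notion. At an interior point the flow is a translation
    and every direction counts as tangential; at a boundary point [O] is locally the set where [rho]
    is positive. *)
Definition chart (O : set V) (x0 : V) (R0 : R) (rho : V -> R) (q : V) :=
  [/\ 0 < R0, flat rho q &
    [/\ q = 0, rho = cst 0 & forall x, `|x - x0| < R0 -> O x] \/
    ((forall x t, rho (x + t *: q) = rho x + t) /\
     (forall x, `|x - x0| < R0 -> (O x <-> 0 < rho x)))].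

Lemma rho_S (rho : V -> R) (q p x : V) (h : R) : (forall (x : V) (t : R), rho (x + t *: q) = rho x + t) -> rho (Sflow rho q p h x) = rho x.
Proof. by move=> H; rewrite /Sflow /shear H /th addrC subrK. Qed.

Lemma chart_inv (O : set V) x0 R0 (rho : V -> R) (q p x : V) (h : R) : chart O x0 R0 rho q -> `|x - x0| < R0 ->
  `|Sflow rho q p h x - x0| < R0 -> O x -> O (Sflow rho q p h x).
Proof.
move=> [_ _ [[_ _ H]|[H1 H2]]] xR SR Ox; first exact: H.
by apply/(H2 _ SR); rewrite rho_S//; exact/(H2 _ xR).
Qed.

Lemma ip_cut (z : V -> R) phi chi a b (U : set V) : open U -> (forall x, U x -> z x = 1) ->
  (forall x, chi x != 0 -> U x) -> ip (pd a (pd b (z * phi))) chi = ip (pd a (pd b phi)) chi.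
Proof.
move=> oU zU cU; apply: eq_Rintegral => x _.
have [cx|cx] := eqVneq (chi x) 0.
  exact: (etrans (etrans (f_equal (fun t => pd a (pd b (z * phi)) x * t) cx) (mulr0 _))
    (esym (etrans (f_equal (fun t => pd a (pd b phi) x * t) cx) (mulr0 _)))).
apply: (f_equal (fun t => t * chi x)).
apply: (pd_local a oU _ (cU x cx)) => y Uy; apply: (pd_local b oU _ Uy) => w Uw.
by rewrite -[LHS]/(z w * phi w) zU// mul1r.
Qed.

End chart.

(** * Tangential bounds for the limit *)

Section tangential_limit.
Context {R : realType} {n : nat}.
Local Notation V := 'rV[R]_n.+1.
Implicit Types (f g psi v chi : V -> R).
Variables (O : set V) (x0 : V) (R0 : R) (rho : V -> R) (q : V).
Hypothesis Hchart : chart O x0 R0 rho q.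
Variables (phi : nat -> V -> R) (eps : nat -> R) (f : V -> R) (M : R) (a b : 'I_n.+1) (u : V -> R).
Hypothesis Hphi : forall k, tc 4 O (phi k).
Hypothesis HM : forall k, Nk 2 (phi k) <= M.
Hypothesis eps0 : forall k, 0 <= eps k.
Hypothesis epsl : tends0 eps.
Hypothesis sf : sq f.
Hypothesis Hres : forall k psi, tc 4 O psi -> `|en (phi k) psi - ip f psi| <= eps k * nrm (lap psi).
Hypothesis su : sq u.
Hypothesis ul : tends0 (fun k => nrm (pd a (pd b (phi k)) - u)).
Variable p : V.
Local Notation D := (Dquo rho q p).
Local Notation X := (Xder rho q p).

Let Hflat : flat rho q. Proof. by case: Hchart. Qed.
Let R00 : 0 < R0. Proof. by case: Hchart. Qed.
Let kphi k : kc 4 (phi k). Proof. exact: tc_kc (Hphi k). Qed.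
Let M0 : 0 <= M. Proof. exact: le_trans (Nk_ge0 2 (phi 0%N)) (HM 0). Qed.

Lemma small_step : exists B h0, [/\ 0 <= B, 0 < h0, h0 <= 1,
  (forall h x, `|Sflow rho q p h x - x| <= `|h| * B) & forall h : R, `|h| <= h0 -> `|h| * B <= R0 / 128].
Proof.
have [B B0 HB] := S_disp Hflat p; exists B.
have B1 : 0 < B + 1 by rewrite ltr_wpDl.
have r0 : 0 < R0 / 128 / (B + 1) by rewrite !divr_gt0.
exists (Num.min 1 (R0 / 128 / (B + 1))); split => //.
- by rewrite lt_min ltr01.
- by rewrite ge_min lexx.
- move=> h; rewrite le_min => /andP[_ hB].
  apply: (@le_trans _ _ (`|h| * (B + 1))); first by rewrite ler_wpM2l// lerDl.
  by rewrite -ler_pdivlMr.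
Qed.

Section cutoffs.
Variables (B h0 : R).
Hypothesis B0 : 0 <= B.
Hypothesis h01 : h0 <= 1.
Hypothesis HB : forall h x, `|Sflow rho q p h x - x| <= `|h| * B.
Hypothesis Hh0 : forall h : R, `|h| <= h0 -> `|h| * B <= R0 / 128.
Variable z : V -> R.
Hypothesis kz : forall k, kc k z.
Hypothesis zout : forall x, R0 / 2 <= `|x - x0| -> z x = 0.

(** Support radius after [j] quotients, each step moving points by at most $R_0/128$. The cut-offs
    vanish beyond $R_0/2$, and the four quotients of [T2] stay well below $R_0$. *)
Let r (j : nat) : R := 5 / 8 * R0 + j%:R * (R0 / 128).
Let Dj (j : nat) g := csupp (O `&` [set y | `|y - x0| < r j]) g.

Lemma Dj0 k : Dj 0 (z * phi k).
Proof.
have [_ c] := Hphi k; apply: (@csupp_cut _ _ _ (R0 / 2)) c => //.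
by rewrite /r mul0r addr0; move: R00; lra.
Qed.

Lemma DjS j h g : (j < 4)%N -> `|h| <= h0 -> Dj j g -> Dj j.+1 (D h g).
Proof.
move=> j4 hh; have Hh := Hh0 hh; apply: (csupp_D Hflat HB (R0 := R0)) => //.
- by rewrite /r -natr1; lra.
- have : (j.+1%:R : R) <= 4 by rewrite ler_nat.
  rewrite /r => j4'; have : j.+1%:R * (R0 / 128) <= 4 * (R0 / 128).
    by rewrite ler_wpM2r// divr_ge0// ltW.
  by move: R00; lra.
- by move=> x xR SR; apply: (chart_inv Hchart).
Qed.

Lemma tc_Dj k g : kc k g -> Dj 2 g \/ Dj 4 g -> tc k O (z * g).
Proof.
move=> [Hg _] H; split; first by apply: CkM => //; case: (kz k).
by apply: csuppM; case: H; apply: csupp_sub => y [].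
Qed.

Lemma T1_phi : exists2 C, 0 <= C & forall h k, ok h -> `|h| <= h0 ->
  Nk 2 (D h (z * phi k)) <= C * (nrm f + M + eps k / `|h|).
Proof.
have [C C0 HC] := T1 p Hflat kz; exists C => // h k oh hh.
have kv : kc 4 (z * phi k) by apply: kcM => //; case: (kz 4).
apply: le_trans (HC h (phi k) f (eps k) oh (kphi k) sf (eps0 k) _) _.
  apply: Hres; apply: tc_Dj; first by do 2 apply: (kc_D Hflat) => //.
  left; apply: DjS => //; first by rewrite normrN.
  by apply: DjS => //; exact: Dj0.
by rewrite ler_wpM2l// lerD2r lerD2l; exact: HM.
Qed.

End cutoffs.

(** The quotients of the approximations are bounded by a constant plus a multiple of [eps k] that
    depends on the step. The index goes to infinity first, then the step goes to 0. *)
Lemma tangential_bound : exists2 C, 0 <= C & forall psi, kc 2 psi ->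
  (forall x, psi x != 0 -> `|x - x0| <= R0 / 32) ->
  `|ip u (X psi)| <= C * nrm psi /\ `|ip u (X (X psi))| <= C * nrm psi.
Proof.
have [B [h0 [B0 h00 h01 HB Hh0]]] := small_step.
have plat r : 0 < r -> 2 * r <= R0 / 2 -> exists z : V -> R, [/\ forall k, kc k z,
    forall x, `|x - x0| <= r -> z x = 1, forall x, 2 * r <= `|x - x0| -> z x = 0 &
    forall x, R0 / 2 <= `|x - x0| -> z x = 0].
  move=> r0 rR; have [z [z1 _ z2 z3 _]] := plateau_ex x0 r0; exists z; split => //.
    move=> k; split; first exact: z1.
    exists (`|x0| + 2 * r) => x Lx; apply: z3.
    have := lerB_dist x x0; lra.
  by move=> x xR; apply: z3; exact: le_trans xR.
(* Two quotients of [psi] have support within $R_0/32 + 2R_0/128 < R_0/16$, where [z] is 1. The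
   second cut-off [z'] is 1 up to $R_0/4$, beyond the radius $R_0/8$ where [z] vanishes. *)
have [z [kz z1 z2 z3]] : exists z : V -> R, [/\ forall k, kc k z,
    forall x, `|x - x0| <= R0 / 16 -> z x = 1, forall x, 2 * (R0 / 16) <= `|x - x0| -> z x = 0 &
    forall x, R0 / 2 <= `|x - x0| -> z x = 0] by apply: plat; move: R00; lra.
have [z' [kz' z1' z2' z3']] : exists z : V -> R, [/\ forall k, kc k z,
    forall x, `|x - x0| <= R0 / 4 -> z x = 1, forall x, 2 * (R0 / 4) <= `|x - x0| -> z x = 0 &
    forall x, R0 / 2 <= `|x - x0| -> z x = 0] by apply: plat; move: R00; lra.
have oball (r : R) : open [set x : V | `|x - x0| < r].
  rewrite (_ : [set x | _] = ball x0 r); first exact: ball_open.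
  by apply/seteqP; split => x; rewrite -ball_normE /= distrC.
have Hloc x : (exists2 U, open U /\ U x & forall y, U y -> z' y = 1) \/
    (exists2 U, open U /\ U x & forall y, U y -> z y = 0).
  have [xr|xr] := ltP `|x - x0| (R0 / 4).
    left; exists [set y | `|y - x0| < R0 / 4] => // y /= yr; apply: z1'; exact: ltW.
  right; exists [set y | `|y - x| < R0 / 8].
    split; last by rewrite /= subrr normr0; move: R00; lra.
    rewrite (_ : [set y | _] = ball x (R0 / 8)); first exact: ball_open.
    by apply/seteqP; split => y; rewrite -ball_normE /= distrC.
  move=> y /= yr; apply: z2; have := lerB_dist (x - x0) (x - y).
  have -> : x - x0 - (x - y) = y - x0 by apply/rowP => j; rewrite !mxE; ring.
  by rewrite [`|x - y|]distrC; lra.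
have [C1 C10 H1] := T1_phi B0 HB Hh0 kz z3.
have [C1' C1'0 H1'] := T1_phi B0 HB Hh0 kz' z3'.
have [C2 C20 H2] := T2 p Hflat kz kz' Hloc.
have [C3 C30 H3] := D_hess Hflat p a b.
have [Z2 Z20 HZ2] := ob_bd (ob_mul (ub_kc (kz 2))).
have F0 : 0 <= nrm f by exact: nrm_ge0.
pose A1 := C1 * (nrm f + M); pose A1' := C1' * (nrm f + M).
pose A2 := C2 * (nrm f + (M + A1 + A1')).
pose A := C3 * (Z2 * M + A1 + A2).
have A10 : 0 <= A1 by rewrite mulr_ge0// addr_ge0.
have A1'0 : 0 <= A1' by rewrite mulr_ge0// addr_ge0.
have A20 : 0 <= A2 by apply: mulr_ge0 => //; apply: addr_ge0 => //; do 2 apply: addr_ge0 => //.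
have A0 : 0 <= A by apply: mulr_ge0 => //; apply: addr_ge0 => //; apply: addr_ge0 => //; exact: mulr_ge0.
have main h : ok h -> `|h| <= h0 -> exists2 G, 0 <= G & forall k,
    nrm (D h (pd a (pd b (z * phi k)))) <= A + G * eps k /\
    nrm (D h (D h (pd a (pd b (z * phi k))))) <= A + G * eps k.
  move=> oh hh; have [hn0 _] := oh.
  have h0' : 0 < `|h|^-1 by rewrite invr_gt0 normr_gt0.
  pose G1 := C1 / `|h|; pose G1' := C1' / `|h|.
  pose G2 := C2 * (G1 + G1' + (`|h| * `|h|)^-1).
  have G10 : 0 <= G1 by rewrite divr_ge0.
  have G1'0 : 0 <= G1' by rewrite divr_ge0.
  have G20 : 0 <= G2 by rewrite mulr_ge0// !addr_ge0// invr_ge0 mulr_ge0.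
  exists (C3 * (G1 + G2)); first by apply: mulr_ge0 => //; exact: addr_ge0.
  move=> k; set v := z * phi k.
  have kv : kc 4 v by apply: kcM => //; case: (kz 4).
  have B1 : Nk 2 (D h v) <= A1 + G1 * eps k.
    apply: (le_trans (H1 h k oh hh)); rewrite /A1 /G1 mulrDr lerD2l.
    by rewrite mulrA mulrAC.
  have B1' : Nk 2 (D h (z' * phi k)) <= A1' + G1' * eps k.
    apply: (le_trans (H1' h k oh hh)); rewrite /A1' /G1' mulrDr lerD2l.
    by rewrite mulrA mulrAC.
  have B2 : Nk 2 (D h (D h v)) <= A2 + G2 * eps k.
    apply: le_trans (H2 h (phi k) f (eps k) oh (kphi k) sf (eps0 k) _) _.
      apply: Hres; apply: (tc_Dj kz); first by do 4 apply: (kc_D Hflat) => //.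
      have hhN : `|- h| <= h0 by rewrite normrN.
      right; do 2 (apply: (DjS B0 HB Hh0) => //).
      by do 2 (apply: (DjS B0 HB Hh0) => //); exact: Dj0.
    have HMk := HM k.
    have -> : A2 + G2 * eps k = C2 * (nrm f + (M + (A1 + G1 * eps k) + (A1' + G1' * eps k)) + eps k / (`|h| * `|h|)).
      by rewrite /A2 /G2; ring.
    rewrite ler_wpM2l// lerD2r lerD2l; apply: lerD => //; exact: lerD.
  have B0' : Nk 2 v <= Z2 * M.
    apply: (le_trans (HZ2 _ _ ok1 (kc_le le2_4 (kphi k)))).
    by rewrite ler_wpM2l.
  have [E1 E2] := H3 h v oh kv.
  have -> : A + C3 * (G1 + G2) * eps k = C3 * (Z2 * M + (A1 + G1 * eps k) + (A2 + G2 * eps k)).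
    by rewrite /A; ring.
  have P2 : 0 <= A2 + G2 * eps k by rewrite addr_ge0// mulr_ge0.
  split; [apply: (le_trans E1)|apply: (le_trans E2)]; rewrite ler_wpM2l//.
    by apply: (le_trans (lerD B0' B1)); rewrite lerDl.
  by apply: lerD => //; exact: lerD.
(* Limit in the index for a fixed step: the factor [G] may blow up with the step but multiplies
   [eps k]. *)
have lim_k chi psi (G : R) : 0 <= G -> sq chi ->
    (forall k, `|ip (pd a (pd b (z * phi k))) chi| <= (A + G * eps k) * nrm psi) ->
    (forall x, chi x != 0 -> `|x - x0| < R0 / 16) -> `|ip u chi| <= A * nrm psi.
  move=> G0 sc Hk cx.
  apply: (tends0_lim (u := fun k => G * nrm psi * eps k + nrm chi * nrm (pd a (pd b (phi k)) - u))).
    apply: tends0D; apply: tends0Z => //; last exact: nrm_ge0.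
    by rewrite mulr_ge0// nrm_ge0.
  move=> k; have sp : sq (pd a (pd b (phi k))) := kc_sq (kc_pd a (kc_pd b (kphi k))).
  have E : ip u chi = ip (pd a (pd b (z * phi k))) chi - ip (pd a (pd b (phi k)) - u) chi.
    have Ec := ip_cut (phi k) a b (oball (R0 / 16)) (fun x (xr : `|x - x0| < R0 / 16) => z1 x (ltW xr)) cx.
    have Xr (t s : R) : s = t - (t - s) by ring.
    by rewrite Ec (ipBl sp su sc); exact: Xr.
  rewrite E (le_trans (ler_normB _ _))//; have := Hk k; have := ip_CS (sqB sp su) sc.
  move: (nrm (_ - _)) (nrm chi) (nrm psi) `|ip (pd a (pd b (z * phi k))) chi| `|ip (_ - _) chi| => x1 x2 x3 x4 x5.
  by move=> i1 i2; rewrite addrA; apply: lerD; [apply: (le_trans i2); rewrite le_eqVlt; apply/orP; left; apply/eqP; ring|rewrite mulrC].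
exists A => // psi kpsi psx; have spsi := kc_sq kpsi.
have suppD s g c : `|s| <= h0 -> (forall x, g x != 0 -> `|x - x0| <= c) ->
    forall x, D s g x != 0 -> `|x - x0| <= c + R0 / 128.
  move=> sh gc x; rewrite -[D s g x]/(s^-1 * (g (Sflow rho q p s x) - g x)) => Dx.
  have [gx|gx] := eqVneq (g x) 0; last by apply: (le_trans (gc x gx)); rewrite lerDl divr_ge0// ltW.
  have gS : g (Sflow rho q p s x) != 0 by apply: contra Dx => /eqP->; rewrite gx subrr mulr0.
  have := gc _ gS; have := le_trans (HB s x) (Hh0 s sh); rewrite distrC => i1 i2.
  by rewrite -(subrK (Sflow rho q p s x) x) -addrA addrC (le_trans (ler_normD _ _))// addrC lerD// addrC.
have step1 s : s != 0 -> `|s| <= h0 -> `|ip u (D s psi)| <= A * nrm psi /\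
    `|ip u (D s (D s psi))| <= A * nrm psi.
  move=> s0 sh; have oN : ok (- s) by split; rewrite ?oppr_eq0// normrN (le_trans sh).
  have shN : `|- s| <= h0 by rewrite normrN.
  have [G G0 HG] := main _ oN shN.
  have sv k : sq (pd a (pd b (z * phi k))).
    by apply: (@kc_sq _ _ 2); do 2 apply: kc_pd; apply: kcM => //; case: (kz 4).
  have sD := sq_D Hflat p s spsi.
  have d1 := suppD s psi _ sh psx; have d2 := suppD s _ _ sh d1.
  have R01 := R00.
  split.
    apply: (lim_k _ psi G) => //.
      move=> k; have := HG k => -[Hk _].
      have -> : ip (pd a (pd b (z * phi k))) (D s psi) = - ip (D (- s) (pd a (pd b (z * phi k)))) psi.
        by rewrite (ip_D Hflat p (- s) (sv k) spsi) !opprK.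
      rewrite normrN; apply: (le_trans (ip_CS (sq_D Hflat p (- s) (sv k)) spsi)).
      by rewrite ler_wpM2r ?nrm_ge0.
    by move=> x /d1 H; apply: le_lt_trans H _; lra.
  apply: (lim_k _ psi G) => //; first exact: sq_D.
    move=> k; have := HG k => -[_ Hk].
    have sD1 := sq_D Hflat p (- s) (sv k).
    have -> : ip (pd a (pd b (z * phi k))) (D s (D s psi)) = ip (D (- s) (D (- s) (pd a (pd b (z * phi k))))) psi.
      by rewrite (ip_D Hflat p (- s) sD1 spsi) opprK (ip_D Hflat p (- s) (sv k) sD) !opprK.
    apply: (le_trans (ip_CS (sq_D Hflat p (- s) sD1) spsi)).
    by rewrite ler_wpM2r ?nrm_ge0.
  by move=> x /d2 H; apply: le_lt_trans H _; lra.
(* Limit in the step: the constant [A] no longer depends on it. *)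
have fin (g : R -> V -> R) chi : sq chi -> (forall s, sq (g s)) -> (forall s, s != 0 -> `|s| <= h0 -> `|ip u (g s)| <= A * nrm psi) ->
    (forall e, 0 < e -> exists2 d, 0 < d & forall s, s != 0 -> `|s| < d -> nrm (g s - chi) <= e) ->
    `|ip u chi| <= A * nrm psi.
  move=> sc sg Hg Hl; apply/ler_addgt0Pr => e e0.
  have u1 : 0 < nrm u + 1 by rewrite ltr_wpDl// nrm_ge0.
  have [d d0 Hd] := Hl _ (divr_gt0 e0 u1).
  pose s := Num.min h0 (d / 2).
  have s0 : 0 < s by rewrite lt_min h00 divr_gt0.
  have sh : `|s| <= h0 by rewrite gtr0_norm// ge_min lexx.
  have sd : `|s| < d by rewrite gtr0_norm// gt_min ltr_pdivrMr// ltr_pMr// ltr1n orbT.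
  have -> : ip u chi = ip u (g s) - ip u (g s - chi) by rewrite ipBr// opprB addrCA subrr addr0.
  rewrite (le_trans (ler_normB _ _))// lerD ?Hg ?gt_eqF//.
  apply: (le_trans (ip_CS su (sqB (sg s) sc))).
  apply: (@le_trans _ _ (nrm u * (e / (nrm u + 1)))); first by rewrite ler_wpM2l ?nrm_ge0// Hd// gt_eqF.
  by rewrite mulrCA ger_pMr// ler_pdivrMr// mul1r lerDl.
have kX : kc 1 (X psi) by exact: (kc_X Hflat).
split.
  apply: (fin (fun s => D s psi)) => //; [exact: kc_sq kX|by move=> s; exact: sq_D| |].
    by move=> s s0 sh; case: (step1 s s0 sh).
  by apply: (D_lim Hflat); exact: kc_le kpsi.
apply: (fin (fun s => D s (D s psi))); first exact: kc_sq (kc_X Hflat p le0_3 kX).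
- by move=> s; do 2 apply: sq_D => //.
- by move=> s s0 sh; case: (step1 s s0 sh).
- exact: (DD_lim Hflat).
Qed.

End tangential_limit.

(** * Density of test functions *)

Section density.
Context {R : realType} {n : nat}.
Local Notation V := 'rV[R]_n.
Local Notation vol := (@vol R n).
Implicit Types (f g c phi psi z : V -> R) (O : set V).

Lemma nrm_dct f (c : nat -> V -> R) (M : R) : sq f -> (forall k, measurable_fun [set: V] (c k)) ->
  (forall k x, `|c k x| <= M) -> (forall x, exists N, forall k, (N <= k)%N -> c k x = 0) ->
  tends0 (fun k => nrm (c k * f)).
Proof.
move=> sf mc cM c0 e e0.
have sc k : sq (c k * f) by apply: (sq_mulb (mc k) (cM k)).
have M0 : 0 <= M by exact: le_trans (normr_ge0 _) (cM 0%N 0).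
pose g (k : nat) x := ((c k * f) x ^+ 2)%:E.
have mg k : measurable_fun [set: V] (g k).
  by apply/measurable_EFinP; apply: measurable_funX; exact: sq_mble.
have ig : vol.-integrable setT (fun x => ((M *: f) x ^+ 2)%:E).
  have [_ H] := sqZ M sf; apply: eq_integrable H => // x _.
have g0 : {ae vol, forall x, setT x -> g ^~ x @ \oo --> (cst 0%E : V -> \bar R) x}.
  apply: aeW => x _; apply: cvg_near_cst; have [N NP] := c0 x.
  exists N => // k /= Nk; rewrite /g -[(c k * f) x]/(c k x * f x) NP// mul0r expr0n//.
have gle : {ae vol, forall x k, setT x -> (`|g k x| <= ((M *: f) x ^+ 2)%:E)%E}.
  apply: aeW => x k _; rewrite /g abse_EFin lee_fin ger0_norm ?sqr_ge0//.
  rewrite -[(c k * f) x]/(c k x * f x) -[(M *: f) x]/(M * f x) !exprMn ler_wpM2r ?sqr_ge0//.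
  by rewrite -[c k x ^+ 2]real_normK ?num_real// ler_sqr ?nnegrE.
have [_ _] := @dominated_convergence _ _ _ vol setT measurableT g (cst 0%E) _ mg (measurable_cst _) g0 ig gle.
rewrite integral0 => /fine_cvgP[_] /cvgrPdist_le /(_ (e ^+ 2) (exprn_gt0 2 e0)) [N _ NP].
exists N => k Nk; have := NP k Nk.
rewrite sub0r normrN /= /g -(ip_EFin (sc k)) /= -nrm_sq ger0_norm ?sqr_ge0//.
by rewrite ler_sqr ?nnegrE ?nrm_ge0// ltW.
Qed.

Definition Ind (A : set V) : V -> R := \1_A.

Lemma Ind1 A x : A x -> Ind A x = 1.
Proof. by move=> Ax; rewrite /Ind indicE mem_set. Qed.
Lemma Ind0 A x : ~ A x -> Ind A x = 0.
Proof. by move=> Ax; rewrite /Ind indicE memNset. Qed.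
Lemma Ind_le A x : `|Ind A x| <= 1.
Proof. by rewrite /Ind indicE; case: (_ \in _); rewrite ?normr1 ?normr0. Qed.
Lemma measurable_Ind A : measurable A -> measurable_fun [set: V] (Ind A).
Proof. exact: measurable_indic. Qed.
Lemma sq_Ind A f : measurable A -> sq f -> sq (Ind A * f).
Proof. by move=> mA; apply: sq_mulb (measurable_Ind mA) (Ind_le A). Qed.

(** Allowing a subset [I] of the coordinates puts the whole space and single half-spaces into this
    intersection-stable generator of the sigma-algebra. *)
Definition orthant (I : {set 'I_n}) (b : 'I_n -> R) : set V := [set x | forall i, i \in I -> x ord0 i < b i].

Definition orthants : set (set V) := [set A | exists I b, A = orthant I b].

Lemma orthants_setI : setI_closed orthants.
Proof.
move=> _ _ [I [b ->]] [J [c ->]].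
exists (I :|: J), (fun i => if i \in I then (if i \in J then Num.min (b i) (c i) else b i) else c i).
apply/seteqP; split => x /=.
  move=> [HI HJ] i; rewrite inE => /orP iIJ.
  case: ifPn => [iI|iI]; last by apply: HJ; case: iIJ => // H; rewrite H in iI.
  case: ifPn => iJ; last exact: HI.
  by rewrite lt_min HI// HJ.
move=> H; split => i iI.
  have := H i; rewrite inE iI => /(_ isT); case: ifPn => // _; by rewrite lt_min => /andP[].
have := H i; rewrite inE iI orbT => /(_ isT); case: ifPn => // _; by rewrite lt_min => /andP[].
Qed.

Lemma measurable_sub_orthants (A : set V) : measurable A -> <<s orthants >> A.
Proof.
move: A; apply: smallest_sub; first exact: smallest_sigma_algebra.
apply: (big_ind (fun X => X `<=` <<s orthants >>)); first exact: sub0set.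
  by move=> X Y HX HY A [/HX|/HY].
move=> i _ B [C mC <-]; rewrite setTI.
pose H := [set Y : set R | <<s orthants >> ((fun x : V => x ord0 i) @^-1` Y)].
suff : <<s (@RGenInftyO.G R) >> `<=` H.
  apply; move: mC; by rewrite RGenInftyO.measurableE.
apply: smallest_sub.
  split.
  - by rewrite /H /mkset preimage_set0; exact: sigma_algebra0.
  - move=> Y HY; rewrite /H /mkset.
    rewrite (_ : _ @^-1` _ = ~` ((fun x : V => x ord0 i) @^-1` Y)); first exact: sigma_algebraC.
    by apply/seteqP; split => x /= => [[]|].
  - by move=> F HF; rewrite /H /mkset preimage_bigcup; exact: sigma_algebra_bigcup.
move=> _ [b ->]; apply: sub_sigma_algebra; exists [set i]%SET, (fun=> b).
apply/seteqP; split => x /=; rewrite in_itv /=.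
  by move=> xb j; rewrite inE => /eqP->.
by apply; rewrite inE.
Qed.

Lemma measurable_orthant I b : measurable (orthant I b).
Proof.
rewrite (_ : orthant I b = \bigcap_(i in [set i | i \in I]) [set x : V | x ord0 i < b i]); last first.
  by apply/seteqP; split => x H i; exact: H.
apply: fin_bigcap_measurable; first exact: finite_finset.
move=> i _; have := @measurable_coord_rV R n i.
move=> /(_ measurableT `]-oo, b i[%classic (measurable_itv _)); rewrite setTI.
by rewrite (_ : _ @^-1` _ = [set x : V | x ord0 i < b i])//; apply/seteqP; split => x /=; rewrite in_itv.
Qed.

Definition orthstep (k : nat) (I : {set 'I_n}) b (x : V) : R :=
  \prod_(i <- enum I) sstep (k%:R * (b i - x ord0 i)).

Lemma Coo_orthstep k I b : Coo (orthstep k I b).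
Proof.
apply: Coo_prod => i m; apply: Ck_sstep.
apply: (@CkZ _ _ _ k%:R (cst (b i) - (fun x : V => x ord0 i))).
by apply: CkB; [exact: Ck_cst|exact: Coo_coord].
Qed.

Lemma orthstep_bound k I b x : 0 <= orthstep k I b x <= 1.
Proof.
rewrite /orthstep; apply: (big_ind (fun t => 0 <= t <= 1)); first by rewrite ler01 lexx.
  by move=> s t /andP[s0 s1] /andP[t0 t1]; rewrite mulr_ge0//= mulr_ile1.
by move=> i _; rewrite sstep_ge0 sstep_le1.
Qed.

Lemma orthstep_lim I b x : exists N, forall k, (N <= k)%N -> orthstep k I b x = Ind (orthant I b) x.
Proof.
have [H|H] := pselect (orthant I b x); last first.
  have [i iI xb] : exists2 i, i \in I & b i <= x ord0 i.
    apply: contrapT => H2; apply: H => i iI; rewrite ltNge; apply/negP => xb; apply: H2.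
    by exists i.
  exists 0%N => k _; rewrite (Ind0 H) /orthstep (big_rem i) /=; last by rewrite mem_enum.
  by rewrite sstep0 ?mul0r// mulr_ge0_le0// subr_le0.
exists (\sum_(i in I) Num.bound ((b i - x ord0 i)^-1))%N => k Nk.
rewrite (Ind1 H) /orthstep big1_seq// => i /andP[_]; rewrite mem_enum => iI.
have d0 : 0 < b i - x ord0 i by rewrite subr_gt0; exact: H.
apply: sstep1; have i0 : 0 <= (b i - x ord0 i)^-1 by rewrite invr_ge0 ltW.
rewrite -[leLHS](mulVf (lt0r_neq0 d0)) (ler_pM2r d0).
rewrite (le_trans (ltW (archi_boundP i0)))// ler_nat (leq_trans _ Nk)//.
by rewrite (bigD1 i)//= leq_addr.
Qed.

Section vanishing.
Variables (G : V -> R) (L : R).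
Hypothesis sG : sq G.
Hypothesis bG : bs L G.
Hypothesis HG : forall phi, Coo phi -> ip G phi = 0.

(** The integral of $cG$: zero for smooth [c] by hypothesis, hence for indicators of orthants by
    dominated convergence, and then for all measurable sets by a monotone class argument. *)
Let J c := ip (c * G) (boxind L).

Let JD (c d : V -> R) M N : measurable_fun [set: V] c -> (forall x, `|c x| <= M) ->
  measurable_fun [set: V] d -> (forall x, `|d x| <= N) -> J (c - d) = J c - J d.
Proof.
move=> mc cM md dN; rewrite /J -ipBl; [|exact: sq_mulb cM sG|exact: sq_mulb dN sG|exact: sq_boxind].
by congr ip; rewrite mulrBl.
Qed.

Let Jlim (c : nat -> V -> R) (d : V -> R) M : (forall k, measurable_fun [set: V] (c k)) ->
  (forall k x, `|c k x| <= M) -> measurable_fun [set: V] d -> (forall x, `|d x| <= M) ->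
  (forall x, exists N, forall k, (N <= k)%N -> c k x = d x) -> (forall k, J (c k) = 0) -> J d = 0.
Proof.
move=> mc cM md dM cd Jc.
have H : tends0 (fun k => nrm ((d - c k) * G)).
  apply: (@nrm_dct _ _ (M + M)) => //.
  - by move=> k; apply: measurable_funB.
  - by move=> k x; apply: (le_trans (ler_normB _ _)); rewrite lerD.
  - by move=> x; have [N NP] := cd x; exists N => k /NP E; rewrite -[LHS]/(d x - c k x) E subrr.
have B0 := nrm_ge0 (@boxind R n L).
apply/eqP; rewrite -normr_eq0 eq_le normr_ge0 andbT.
apply: (tends0_lim (tends0Z B0 H)) => k; rewrite add0r.
have sdc : sq ((d - c k) * G).
  apply: (sq_mulb (M := M + M)) => //; first exact: measurable_funB.
  by move=> x; apply: (le_trans (ler_normB _ _)); rewrite lerD.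
have -> : J d = ip ((d - c k) * G) (boxind L).
  by rewrite -/(J (d - c k)) (JD md dM (mc k) (cM k)) Jc subr0.
by rewrite [leRHS]mulrC; apply: ip_CS => //; exact: sq_boxind.
Qed.

Lemma J_smooth phi : Coo phi -> J phi = 0.
Proof.
move=> Hp; rewrite -(HG Hp) /J; apply: eq_Rintegral => x _.
rewrite -[(phi * G) x]/(phi x * G x).
have [xL|xL] := leP `|x| L; first by rewrite boxind1// mulr1 mulrC.
by rewrite bG// mulr0 !mul0r.
Qed.

Lemma J_measurable A : measurable A -> J (Ind A) = 0.
Proof.
move=> mA; pose H := [set A : set V | measurable A /\ J (Ind A) = 0].
suff : <<s orthants >> `<=` H by move=> /(_ A (measurable_sub_orthants mA))[].
apply: lambda_system_subset => //; first exact: orthants_setI.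
- split => //.
  + split => //; have -> : Ind setT = orthstep 0 finset.set0 (fun=> 0).
      by apply/funext => x; rewrite Ind1// /orthstep enum_set0 big_nil.
    by apply: J_smooth; exact: Coo_orthstep.
  + move=> B C CB [mB JB] [mC JC]; split; first exact: measurableD.
    have -> : Ind (B `\` C) = Ind B - Ind C.
      apply/funext => x; rewrite -[RHS]/(Ind B x - Ind C x).
      have [Cx|Cx] := pselect (C x).
        by rewrite (Ind1 Cx) (Ind1 (CB _ Cx)) subrr Ind0// => -[].
      rewrite (Ind0 Cx) subr0; have [Bx|Bx] := pselect (B x); first by rewrite (Ind1 Bx) Ind1.
      by rewrite (Ind0 Bx) Ind0// => -[].
    by rewrite (JD (measurable_Ind mB) (Ind_le B) (measurable_Ind mC) (Ind_le C)) JB JC subrr.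
  + move=> F ndF HF; split; first by apply: bigcup_measurable => k _; case: (HF k).
    apply: (@Jlim (fun k => Ind (F k)) _ 1).
    * by move=> k; apply: measurable_Ind; case: (HF k).
    * by move=> k; exact: Ind_le.
    * by apply: measurable_Ind; apply: bigcup_measurable => k _; case: (HF k).
    * exact: Ind_le.
    * move=> x; have [[N _ FN]|nF] := pselect ((\bigcup_k F k) x).
        exists N => k Nk; rewrite !Ind1//; first by exists N.
        by move: FN; apply/subsetPset; exact: ndF.
      by exists 0%N => k _; rewrite !Ind0// => Fx; apply: nF; exists k.
    * by move=> k; case: (HF k).
- move=> _ [I [b ->]]; split; first exact: measurable_orthant.
  apply: (@Jlim (fun k => orthstep k I b) _ 1).
  + by move=> k; apply: continuous_measurable_rV; exact: (Ck_cont (Coo_orthstep k I b 0)).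
  + by move=> k x; have /andP[a0 a1] := orthstep_bound k I b x; rewrite ger0_norm.
  + by apply: measurable_Ind; exact: measurable_orthant.
  + exact: Ind_le.
  + exact: orthstep_lim.
  + by move=> k; apply: J_smooth; exact: Coo_orthstep.
Qed.

(** The difference of [J] on the set where [G] is nonnegative and on its complement is the integral
    of $|G|$. *)
Lemma vanishing : nrm G = 0.
Proof.
pose A := [set x | 0 <= G x].
have mA : measurable A.
  rewrite (_ : A = setT `&` G @^-1` `[0, +oo[%classic).
    by apply: (sq_mble sG) => //; exact: measurable_itv.
  by rewrite setTI; apply/seteqP; split => x /=; rewrite in_itv /= andbT.
have E : ip (fun x => `|G x|) (boxind L) = 0.
  rewrite (_ : ip _ _ = J (Ind A) - J (Ind (~` A))).
    by rewrite !J_measurable ?subrr//; exact: measurableC.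
  rewrite -(JD (measurable_Ind mA) (Ind_le A) (measurable_Ind (measurableC mA)) (Ind_le _)).
  apply: eq_Rintegral => x _; congr (_ * _).
  rewrite -[RHS]/((Ind A x - Ind (~` A) x) * G x).
  have [Gx|Gx] := pselect (A x).
    by rewrite (Ind1 Gx) Ind0 ?subr0 ?mul1r ?ger0_norm// => /(_ Gx).
  rewrite (Ind0 Gx) Ind1// sub0r mulN1r ltr0_norm//.
  by rewrite ltNge; apply/negP.
have iG : vol.-integrable setT (EFin \o G).
  have := sqM sG (@sq_boxind R n L); apply: eq_integrable => // x _.
  by rewrite (bs_mul_boxind (lexx L) bG).
have Gae : {ae vol, forall x, G x = 0}.
  suff : (\int[vol]_x `|(EFin \o G) x|)%E = 0%E.
    move=> /(ae_eq_integral_abs vol measurableT (measurable_int _ iG)).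
    by apply: filterS => x /(_ I) []; rewrite /=; case.
  have fin : (\int[vol]_x `|(EFin \o G) x|)%E \is a fin_num.
    by move/integrableP : iG => [_]; rewrite ge0_fin_numE// integral_ge0.
  rewrite -(fineK fin); congr EFin; rewrite -E /ip /Rintegral; congr fine.
  apply: eq_integral => x _ /=; congr EFin.
  have [xL|xL] := leP `|x| L; first by rewrite boxind1// mulr1.
  by rewrite bG// normr0 mul0r.
by rewrite -(nrm0 (n := n)); apply: nrm_ae => //; exact: sq0.
Qed.

End vanishing.

(** Finitely many plateaus cover [K]; they are combined by $w + (1-w)z$, which stays in $[0,1]$ and
    is 1 wherever one of the two is. The radius $3r$ inside [O] leaves a margin $r$ beyond a plateau
    supported within $2r$. *)
Lemma cut_compact O (K : set V) : open O -> compact K -> K `<=` O ->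
  exists z, [/\ Coo z, csupp O z, forall x, 0 <= z x <= 1 & forall x, K x -> z x = 1].
Proof.
move=> oO cK KO.
have /choice[r rP] : forall x, exists r, K x -> 0 < r /\ forall y, `|x - y| < 3 * r -> O y.
  move=> x; have [Kx|nK] := pselect (K x); last by exists 0.
  have /nbhs_ballP[e /= e0 He] : nbhs x O by apply: open_nbhs_nbhs; split => //; exact: KO.
  exists (e / 3) => _; split; first by rewrite divr_gt0.
  by move=> y xy; apply: He; rewrite -ball_normE /= mulrC divfK in xy *.
have Hs (s : seq V) : (forall x, x \in s -> K x) -> exists z, [/\ Coo z, csupp O z,
    forall x, 0 <= z x <= 1 & forall x y, x \in s -> `|y - x| <= r x -> z y = 1].
  elim: s => [_|x s IH sK].
    exists (cst 0); split => //; first by move=> m; exact: Ck_cst.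
    - by exists 1, 0; split => // x; rewrite eqxx.
    - by move=> x; rewrite lexx ler01.
  have [z [z1 z2 z3 z4]] := IH (fun y ys => sK y (mem_behead (s := x :: s) ys)).
  have [r0 Or] := rP x (sK x (mem_head x s)).
  have [w [w1 w2 w3 w4 _]] := plateau_ex x r0.
  exists (w + (cst 1 - w) * z); split.
  - by move=> m; apply: CkD => //; apply: CkM => //; apply: CkB => //; exact: Ck_cst.
  - apply: csuppD; last exact: csuppM.
    exists (r x), (`|x| + 2 * r x); split => // y wy.
    have yx : `|y - x| < 2 * r x by rewrite ltNge; apply: contra wy => /w4->.
    split; first by have := lerB_dist y x; lra.
    move=> t yt; apply: Or; have := ler_distD y x t; rewrite (distrC x y); lra.
  - move=> y; rewrite -[(w + (cst 1 - w) * z) y]/(w y + (1 - w y) * z y).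
    by have := w2 y; have := z3 y; nra.
  - move=> a y; rewrite -[(w + (cst 1 - w) * z) y]/(w y + (1 - w y) * z y) inE.
    move=> /predU1P[->|as'] ya; first by rewrite w3// subrr mul0r addr0.
    by rewrite (z4 a)// mulr1 addrC subrK.
have : cover_compact K by rewrite -compact_cover.
move=> /(_ V K (fun x => [set y | `|y - x| < r x]))[].
- move=> x Kx; rewrite (_ : [set y | _] = ball x (r x)); first exact: ball_open.
  by apply/seteqP; split => y; rewrite -ball_normE /= distrC.
- move=> x Kx; exists x => //=; rewrite subrr normr0; by case: (rP x Kx).
move=> D DK KD; have [x xD|z [z1 z2 z3 z4]] := Hs (finmap.enum_fset D).
  by have := DK x; rewrite inE; apply.
exists z; split => // y /KD[x xD /= yx]; apply: (z4 x) => //; exact: ltW.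
Qed.

Lemma cut_seq O : open O -> exists z : nat -> V -> R, [/\ forall k, Coo (z k), forall k, csupp O (z k),
  forall k x, 0 <= z k x <= 1 & forall x, O x -> exists N, forall k, (N <= k)%N -> z k x = 1].
Proof.
move=> oO; pose K (k : nat) := [set x : V | `|x| <= k%:R /\ forall y, `|x - y| < k.+1%:R^-1 -> O y].
have KO k : K k `<=` O by move=> x [_]; apply; rewrite subrr normr0 invr_gt0.
have cK k : compact (K k).
  apply: bounded_closed_compact.
    by exists k%:R; split => // M kM x [xk _] /=; rewrite (le_trans xk)// ltW.
  rewrite -[K k]setCK closedC openE => x nK.
  have [xk|xk] := ltP k%:R `|x|.
    apply: (filterS _ (open_nbhs_nbhs (conj (@open_norm_gt R n k%:R) xk))) => y /= ky [yk _].
    by move: yk; rewrite leNgt ky.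
  have [y xy nO] : exists2 y, `|x - y| < k.+1%:R^-1 & ~ O y.
    apply: contrapT => H; apply: nK; split => // y xy; apply: contrapT => nO; apply: H; exists y => //.
  apply/nbhs_ballP; exists (k.+1%:R^-1 - `|x - y|); first by rewrite /= subr_gt0.
  move=> t; rewrite -ball_normE /= => xt [_ H]; apply: nO; apply: H.
  by rewrite (le_lt_trans (ler_distD x t y))// -ltrBrDr distrC.
have /choice[z zP] k := cut_compact oO (cK k) (@KO k).
exists z; split; try by move=> k; case: (zP k).
move=> x Ox; have /nbhs_ballP[e /= e0 He] : nbhs x O by exact: open_nbhs_nbhs.
exists (maxn (Num.bound `|x|) (Num.bound e^-1)) => k; rewrite geq_max => /andP[k1 k2].
case: (zP k) => _ _ _; apply; split.
  rewrite (le_trans (ltW (archi_boundP (normr_ge0 x))))// ler_nat//.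
move=> y xy; apply: He; rewrite -ball_normE /=; apply: (lt_le_trans xy).
have e1 : 0 <= e^-1 by rewrite invr_ge0 ltW.
rewrite -[leRHS]invrK lef_pV2 ?posrE ?invr_gt0//.
by rewrite (le_trans (ltW (archi_boundP e1)))// ler_nat (leq_trans k2).
Qed.

Lemma fundamental O e : open O -> sq e -> (forall phi, Coo phi -> csupp O phi -> ip e phi = 0) ->
  nrm (Ind O * e) = 0.
Proof.
move=> oO se He; have [z [z1 z2 z3 z4]] := cut_seq oO.
have mO : measurable O by exact: open_measurable_rV.
have mz k : measurable_fun [set: V] (z k) by apply: continuous_measurable_rV; exact: (Ck_cont (z1 k 0)).
have zb k x : `|z k x| <= 1 by have /andP[a0 a1] := z3 k x; rewrite ger0_norm.
have sz k : sq (z k * e) := sq_mulb (mz k) (zb k) se.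
have Z k : nrm (z k * e) = 0.
  have [L bz] := csupp_bs (z2 k); apply: (@vanishing _ L) => //; first exact: bs_mulr.
  move=> phi Hp; rewrite ip_mull; apply: He; first by move=> m; apply: CkM => //; exact: z1.
  by rewrite mulrC; exact: csuppM.
have H : tends0 (fun k => nrm ((Ind O - z k) * e)).
  apply: (@nrm_dct _ _ 2) => //.
  - by move=> k; apply: measurable_funB => //; exact: measurable_Ind.
  - by move=> k x; apply: (le_trans (ler_normB _ _)); have := Ind_le O x; have := zb k x; lra.
  - move=> x; have [Ox|nO] := pselect (O x).
      have [N NP] := z4 x Ox; exists N => k Nk.
      by rewrite -[LHS]/(Ind O x - z k x) Ind1// NP// subrr.
    exists 0%N => k _; rewrite -[LHS]/(Ind O x - z k x) Ind0// sub0r.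
    apply/eqP; rewrite oppr_eq0; apply: contraT => zx; have [d [L [d0 Hz]]] := z2 k.
    by case: nO; apply: (Hz x zx).2; rewrite subrr normr0.
apply/eqP; rewrite eq_le nrm_ge0 andbT; apply: (tends0_lim H) => k; rewrite add0r.
have sI := sq_Ind mO se.
have s1 : sq ((Ind O - z k) * e) by rewrite mulrBl; exact: sqB.
rewrite (_ : Ind O * e = (Ind O - z k) * e + z k * e); last by rewrite -mulrDl subrK.
by apply: (le_trans (nrmD s1 (sz k))); rewrite Z addr0.
Qed.

Lemma Ind_id O f : (forall x, ~ O x -> f x = 0) -> Ind O * f = f.
Proof.
move=> f0; apply/funext => x; rewrite -[LHS]/(Ind O x * f x).
by have [Ox|nO] := pselect (O x); [rewrite Ind1// mul1r|rewrite f0// mulr0].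
Qed.

Lemma csupp_out O f x : csupp O f -> ~ O x -> f x = 0.
Proof.
move=> [d [L [d0 H]]] nO; apply/eqP; apply: contraT => fx; case: nO.
by apply: (H x fx).2; rewrite subrr normr0.
Qed.

(** Riesz on the test functions gives a limit [g] of test functions with the same inner products as
    [f]. It equals [f] on [O] by [fundamental], and vanishes outside as a limit of functions that
    do. *)
Lemma density O f : open O -> sq f -> (forall x, ~ O x -> f x = 0) ->
  exists2 phi : nat -> V -> R, (forall k, Coo (phi k) /\ csupp O (phi k)) &
    tends0 (fun k => nrm (phi k - f)).
Proof.
move=> oO sf f0; pose P : set (V -> R) := [set phi | Coo phi /\ csupp O phi].
have P0 : P 0 by split; [move=> m; exact: (Ck_cst m 0)|exists 1, 0; split => // x; rewrite eqxx].
have PD t u v : P u -> P v -> P (t *: u + v).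
  move=> [u1 u2] [v1 v2]; split; first by move=> m; apply: CkD => //; exact: CkZ.
  by apply: csuppD => //; exact: csuppZ.
have Psq u : P u -> sq u by move=> [u1 /csupp_bs u2]; apply: (@kc_sq _ _ 0); split => //; exact: (u1 0%N).
have [||g [sg lg [phi Pphi phig]]] := @L2_riesz R n P (fun u => ip f u) (nrm f) P0 PD Psq.
- by move=> t u v /Psq su /Psq sv; rewrite ipDr ?ipZr//; exact: sqZ.
- by move=> u /Psq su; exact: ip_CS.
have mO : measurable O by exact: open_measurable_rV.
have mC : measurable (~` O) by exact: measurableC.
exists phi => // .
have g0 : nrm (Ind (~` O) * g) = 0.
  apply/eqP; rewrite eq_le nrm_ge0 andbT; apply: (tends0_lim phig) => k; rewrite add0r.
  have sB := sqB (Psq _ (Pphi k)) sg.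
  apply: (@le_trans _ _ (nrm (Ind (~` O) * (phi k - g)))); last first.
    rewrite -[leRHS]mul1r; apply: nrm_mulb => //; [exact: measurable_Ind|exact: Ind_le].
  rewrite -(nrmN (sq_Ind mC sg)) (_ : - _ = Ind (~` O) * (phi k - g))//.
  rewrite mulrBr (_ : Ind (~` O) * phi k = 0) ?sub0r//.
  apply/funext => x; rewrite -[LHS]/(Ind (~` O) x * phi k x).
  have [Ox|nO] := pselect (O x); first by rewrite Ind0 ?mul0r// => /(_ Ox).
  by rewrite (csupp_out (Pphi k).2 nO) mulr0.
have fg0 : nrm (Ind O * (f - g)) = 0.
  apply: fundamental => //; first exact: sqB.
  move=> u u1 u2; have Pu : P u by split.
  by rewrite ipBl// ?lg ?subrr//; exact: Psq.
move=> e e0; have [N NP] := phig e e0; exists N => k Nk; apply: le_trans (NP k Nk).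
have spg := sqB (Psq _ (Pphi k)) sg.
have sfg := sqB sf sg.
rewrite (_ : phi k - f = (phi k - g) - (Ind O * (f - g) - Ind (~` O) * g)).
  apply: (le_trans (nrmB spg (sqB (sq_Ind mO sfg) (sq_Ind mC sg)))); rewrite gerDl.
  by apply: (le_trans (nrmB (sq_Ind mO sfg) (sq_Ind mC sg))); rewrite fg0 g0 addr0.
apply/funext => x.
rewrite -[LHS]/(phi k x - f x) -[RHS]/((phi k x - g x) - (Ind O x * (f x - g x) - Ind (~` O) x * g x)).
have [Ox|nO] := pselect (O x).
  by rewrite Ind1// Ind0 => [|/(_ Ox)//]; ring.
by rewrite Ind0// Ind1// f0//; ring.
Qed.

Lemma dual_norm O f C : open O -> sq f -> (forall x, ~ O x -> f x = 0) -> 0 <= C ->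
  (forall phi, Coo phi -> csupp O phi -> `|ip f phi| <= C * nrm phi) -> nrm f <= C.
Proof.
move=> oO sf f0 C0 Hf; have [phi phiP phif] := density oO sf f0.
have sp k : sq (phi k).
  by have [p1 /csupp_bs p2] := phiP k; apply: (@kc_sq _ _ 0); split => //; exact: (p1 0%N).
have H : nrm f ^+ 2 <= C * nrm f.
  apply: (tends0_lim (tends0Z (addr_ge0 C0 (nrm_ge0 f)) phif)) => k.
  have -> : nrm f ^+ 2 = ip f (phi k) - ip f (phi k - f).
    by rewrite ipBr// nrm_sq opprB addrCA subrr addr0.
  have := Hf _ (phiP k).1 (phiP k).2; have := ip_CS sf (sqB (sp k) sf).
  have : nrm (phi k) <= nrm (phi k - f) + nrm f.
    by rewrite -{1}(subrK f (phi k)); apply: nrmD => //; exact: sqB.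
  rewrite !ler_norml => i1 /andP[i2 _] /andP[_ i3].
  have := ler_wpM2l C0 i1.
  move: (ip f (phi k)) (ip f (phi k - f)) (nrm (phi k - f)) (nrm f) (nrm (phi k)) i2 i3 => a b c d e; lra.
have [f00|f00] := eqVneq (nrm f) 0; first by rewrite f00.
have fp : 0 < nrm f by rewrite lt_neqAle eq_sym f00 nrm_ge0.
by rewrite -(ler_pM2r fp) -expr2.
Qed.

End density.

(** * Smooth approximation of $C^2$ functions *)

Section mollification.
Context {R : realType} {n : nat}.
Local Notation V := 'rV[R]_n.
Implicit Types (f g phi psi z : V -> R) (O : set V).

Lemma vol_box_gt0 m (k : R) : 0 < k -> (0 < vol m [set x : 'rV[R]_m | forall i, (`|x ord0 i| <= k)%R])%E.
Proof.
move=> k0; elim: m => [|m IH]; rewrite /vol /=.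
  by rewrite diracE mem_set ?lte01// => -[].
rewrite /pushforward.
rewrite (_ : _ @^-1` _ = [set x : 'rV[R]_m | forall i, `|x ord0 i| <= k] `*` `[(- k), k]).
  rewrite product_measure1E; [|exact: (vol_box_lty m k).1|exact: measurable_itv].
  apply: mule_gt0 => //.
  have := @lebesgue_measure_itv R `[(- k), k]%R; rewrite /= => H.
  rewrite [X in (_ < X)%E]H lte_fin; have -> : - k < k by lra.
  by rewrite -EFinD lte_fin; lra.
apply/seteqP; split => [[x t] /= H|[x t] /= [H1]].
  split => [i|]; first by have := H (rshift 1 i : 'I_(1 + m)); rewrite cons_rVr.
  by have := H (lshift m ord0 : 'I_(1 + m)); rewrite cons_rVl in_itv/= ler_norml.
rewrite in_itv/= => H2 i; case: (split_ordP (i : 'I_(1 + m))) => j ->.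
  by rewrite cons_rVl ler_norml.
by rewrite cons_rVr.
Qed.

Lemma bump_ex (r : R) : 0 < r -> r <= 1 -> exists eta : V -> R, [/\ Coo eta, forall x, 0 <= eta x,
  forall x, r <= `|x| -> eta x = 0 & ip eta (boxind 1) = 1].
Proof.
move=> r0 r1; have h0 : 0 < r / 2 by rewrite divr_gt0.
have [z [z1 z2 z3 z4 _]] := @plateau_ex R n 0 (r / 2) h0.
have zr x : r <= `|x| -> z x = 0 by move=> xr; apply: z4; rewrite subr0 mulrC divfK.
have cz : cc 1 z.
  split; first exact: (Ck_cont (z1 0%N)).
  by move=> x xr; apply: zr; rewrite ltW// (le_lt_trans r1).
have sz := cc_sq cz; have sB := @sq_boxind R n.
pose m := ip z (boxind 1).
have m0 : 0 < m.
  have := vol_box_gt0 n h0; have [mB Boo] := @vol_box_lty R n (r / 2).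
  move: mB Boo; set B := [set x | _] => mB Boo B0.
  have E : (ip (@boxind R n (r / 2)) (boxind (r / 2)))%:E = vol n B.
    rewrite ip_EFin// (eq_integral (fun x => (boxind (r / 2) x)%:E)).
      by rewrite integral_indic// setIT.
    by move=> x _; rewrite /boxind indicE; case: (_ \in _); rewrite ?expr1n ?expr0n.
  have : 0 < ip (@boxind R n (r / 2)) (boxind (r / 2)) by rewrite -lte_fin E.
  move=> /lt_le_trans; apply; apply: le_Rintegral => //.
  - exact: (sqM (sB _) (sB _)).
  - exact: (sqM sz (sB _)).
  move=> x _; rewrite {1 2}/boxind indicE.
  case: (boolP (x \in _)) => [|_]; last first.
    by rewrite mul0r mulr_ge0 ?(andP (z2 x)).1// /boxind indicE; case: (_ \in _).
  rewrite inE /= => xB; have xr : `|x| <= r / 2 by apply: norm_le_coord => //; exact: ltW.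
  by rewrite z3 ?subr0// boxind1 ?mulr1// (le_trans xr)//; lra.
exists (m^-1 *: z); split.
- by move=> k; exact: CkZ.
- by move=> x; rewrite mulr_ge0 ?invr_ge0 ?(ltW m0) ?(andP (z2 x)).1.
- by move=> x /zr E; rewrite -[LHS]/(m^-1 * z x) E mulr0.
- by rewrite ipZl ?mulVf ?gt_eqF//; exact: sB.
Qed.

Lemma ip_le f g h : sq f -> sq g -> sq h -> (forall x, f x * g x <= f x * h x) -> ip f g <= ip f h.
Proof.
by move=> sf sg sh H; apply: le_Rintegral => //; [exact: (sqM sf sg)|exact: (sqM sf sh)].
Qed.

Lemma corr_zero eta phi L x : bs 1 eta -> bs L phi -> L + 1 < `|x| -> corr eta phi x = 0.
Proof.
move=> be bp Lx; rewrite /corr.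
apply: etrans (_ : ip (0 : V -> R) (0 : V -> R) = 0); last exact: ip0l.
rewrite /ip; apply: eq_Rintegral => y _; rewrite [RHS]mulr0.
have [yL|yL] := ltP L `|y|; first by rewrite (bp y yL) mulr0.
rewrite [X in X * _](be (y - x)) ?mul0r//.
by have := lerB_dist x y; rewrite distrC; lra.
Qed.

Lemma corr_close eta (r : R) phi e : Coo eta -> (forall x, 0 <= eta x) ->
  (forall x, r <= `|x| -> eta x = 0) -> r <= 1 -> ip eta (boxind 1) = 1 -> sq phi -> 0 <= e ->
  (forall x y, `|x - y| < r -> `|phi x - phi y| <= e) -> forall x, `|corr eta phi x - phi x| <= e.
Proof.
move=> He e0 er r1 eB sp e00 Hphi x.
have ce : cc 1 eta.
  split; first exact: (Ck_cont (He 0%N)).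
  by move=> y yr; apply: er; rewrite ltW// (le_lt_trans r1).
have se := cc_sq ce; have sB := @sq_boxind R n 1.
have st := sq_trans (- x) se; have stB := sq_trans (- x) sB.
have E : ip (eta \o trans (- x)) (boxind 1 \o trans (- x)) = 1 by rewrite ip_trans.
have -> : corr eta phi x - phi x =
    ip (eta \o trans (- x)) (phi - phi x *: (boxind 1 \o trans (- x))).
  by rewrite /corr ipBr ?ipZr ?E ?mulr1//; exact: sqZ.
have sd : sq (phi - phi x *: (boxind 1 \o trans (- x))) by apply: sqB => //; exact: sqZ.
have Ee : ip (eta \o trans (- x)) (e *: (boxind 1 \o trans (- x))) = e by rewrite ipZr// E mulr1.
have key y : `|(eta \o trans (- x)) y * (phi - phi x *: (boxind 1 \o trans (- x))) y| <=
    (eta \o trans (- x)) y * (e *: (boxind 1 \o trans (- x))) y.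
  rewrite normrM ger0_norm; last exact: e0.
  have [yx|yx] := ltP `|y - x| r; last first.
    have E0 : (eta \o trans (- x)) y = 0 by exact: er.
    by rewrite E0 !mul0r.
  rewrite ler_wpM2l//; first exact: e0.
  rewrite -[X in `|X|]/(phi y - phi x * boxind 1 (y - x)) -[leRHS]/(e * boxind 1 (y - x)).
  by rewrite boxind1 ?mulr1 ?Hphi// ltW// (lt_le_trans yx).
rewrite ler_norml; apply/andP; split; rewrite -{1}Ee.
  rewrite -ipNr//; last exact: sqZ.
  apply: ip_le => //; first by apply: sqN; exact: sqZ.
  move=> y; have := key y; rewrite ler_norml => /andP[+ _].
  by rewrite -[(- (e *: _)) y]/(- ((e *: (boxind 1 \o trans (- x))) y)) mulrN.
apply: ip_le => //; first exact: sqZ.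
by move=> y; apply: le_trans (key y); exact: ler_norm.
Qed.

Lemma Nk2_le f (e : R) : kc 2 f -> nrm f <= e -> (forall i, nrm (pd i f) <= e) ->
  (forall i j, nrm (pd j (pd i f)) <= e) -> Nk 2 f <= (1 + n%:R * (1 + n%:R)) * e.
Proof.
move=> kf H0 H1 H2; rewrite /= mulrDl mul1r; apply: lerD => //.
have sc (F : 'I_n -> R) c : (forall i, F i <= c) -> \sum_i F i <= n%:R * c.
  move=> Fc; apply: (@le_trans _ _ (\sum_(i < n) c)); first by apply: ler_sum => i _; exact: Fc.
  by rewrite sumr_const card_ord mulr_natl.
rewrite -mulrA; apply: (sc (fun i => nrm (pd i f) + \sum_j nrm (pd j (pd i f)))) => i.
by rewrite mulrDl mul1r; apply: lerD; [exact: H1|apply: sc => j; exact: H2].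
Qed.

(** The mollification radius lies below the moduli of continuity of [phi] and its derivatives up to
    order 2, and below half the support margin so that the support stays in [O]. *)
Lemma smooth_approx O phi e : tc 2 O phi -> 0 < e ->
  exists chi, [/\ Coo chi, csupp O chi & Nk 2 (chi - phi) <= e].
Proof.
move=> tphi e_gt0; have kphi := tc_kc tphi; have [Hphi [d [L [d0 Hd]]]] := tphi.
have bphi : bs L phi.
  by move=> x Lx; apply/eqP; apply: contraT => /Hd[]; rewrite leNgt Lx.
have [C C0 HC] := @nrm_sup_bound R n (L + 1).
pose N : R := 1 + n%:R * (1 + n%:R).
have N0 : 0 < N by rewrite ltr_wpDr// mulr_ge0// addr_ge0.
pose e1 := e / (N * (C + 1)).
have C1 : 0 < C + 1 by rewrite ltr_wpDl.
have e10 : 0 < e1 by rewrite divr_gt0// mulr_gt0.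
have kp i := kc_pd i kphi; have kpp i j := kc_pd j (kp i).
have cu f : kc 0 f -> exists2 t, 0 < t & forall x y, `|x - y| < t -> `|f x - f y| <= e1.
  move=> kf; have [M cf] := kc_cc kf; have [t t0 Ht] := cc_unif cf e10.
  by exists t => // x y /Ht /ltW.
have [t0 t00 Ht0] := cu _ (kc_le le0_2 kphi).
have /all_sig2[t1 t10 Ht1] i : {t | 0 < t & forall x y, `|x - y| < t -> `|pd i phi x - pd i phi y| <= e1}.
  by apply: cid2; exact: cu (kc_le le0_1 (kp i)).
have /all_sig2[t2 t20 Ht2] (ij : 'I_n * 'I_n) : {t | 0 < t & forall x y, `|x - y| < t ->
    `|pd ij.2 (pd ij.1 phi) x - pd ij.2 (pd ij.1 phi) y| <= e1}.
  by apply: cid2; exact: cu (kpp _ _).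
pose r := \big[Num.min/Num.min (Num.min t0 1) (d / 2)]_i t1 i.
pose r' := \big[Num.min/r]_ij t2 ij.
have r0 : 0 < r.
  rewrite /r; apply: (big_ind (fun x => 0 < x)).
  - by rewrite !lt_min t00 ltr01 divr_gt0.
  - by move=> x y x0 y0; rewrite lt_min x0.
  - by move=> i _; exact: t10.
have r'0 : 0 < r'.
  rewrite /r'; apply: (big_ind (fun x => 0 < x)) => //.
  by move=> x y x0 y0; rewrite lt_min x0.
have rm : r <= Num.min (Num.min t0 1) (d / 2) by exact: bigmin_le_id.
have r'r : r' <= r by exact: bigmin_le_id.
have := le_trans r'r rm; rewrite !le_min => /andP[/andP[rt0 r1] rd].
have rt1 i : r' <= t1 i by apply: (le_trans r'r); exact: bigmin_le_cond.
have rt2 ij : r' <= t2 ij by exact: bigmin_le_cond.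
have [eta [h1 h2 h3 h4]] := bump_ex r'0 r1.
have be : bs 1 eta by move=> x x1; apply: h3; rewrite ltW// (le_lt_trans r1).
have sphi := kc_sq kphi.
pose chi := corr eta phi.
have Cchi : Coo chi by exact: (Coo_corr h1 be).
have schi : csupp O chi.
  exists (d / 2), (L + 1); split; first by rewrite divr_gt0.
  move=> x cx.
  have [y ye yp] : exists2 y, eta (y - x) != 0 & phi y != 0.
    apply: contrapT => H; move/eqP: cx; apply; rewrite /chi /corr.
    apply: etrans (_ : ip (0 : V -> R) (0 : V -> R) = 0); last exact: ip0l.
    rewrite /ip; apply: eq_Rintegral => y _; rewrite [RHS]mulr0.
    have [ye|ye] := eqVneq (eta (y - x)) 0; first by rewrite [X in X * _]ye mul0r.
    have [yp|yp] := eqVneq (phi y) 0; first by rewrite yp mulr0.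
    by case: H; exists y.
  have yx : `|y - x| < r' by rewrite ltNge; apply: contra ye => /h3->.
  have [yL Hy] := Hd y yp; split.
    have := lerB_dist x y; rewrite distrC; lra.
  move=> w xw; apply: Hy; have := ler_distD x y w; lra.
exists chi; split => //.
have bchi : bs (L + 1) (chi - phi).
  apply: bs_add; last by apply: bs_opp; apply: bs_le bphi; rewrite lerDl.
  move=> x Lx; apply: (corr_zero be bphi Lx).
have c1 : Ck 1 phi by exact: Ck_le Hphi.
have e1p i : pd i (chi - phi) = corr eta (pd i phi) - pd i phi.
  by rewrite (pdB1 i (Cchi 1%N) c1) (corr_pd_swap i (h1 1%N) be c1 bphi).
have e2p i j : pd j (pd i (chi - phi)) = corr eta (pd j (pd i phi)) - pd j (pd i phi).
  have Hc : Ck 1 (corr eta (pd i phi)) by apply: (Coo_corr h1 be); exact: kc_sq (kp i).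
  rewrite e1p (pdB1 j Hc (kp i).1).
  by rewrite (corr_pd_swap j (h1 1%N) be (kp i).1 (bs_pd i bphi)).
have kd : kc 2 (chi - phi) by split; [apply: CkB => //; exact: Cchi|exists (L + 1)].
have fin g : sq g -> bs (L + 1) g -> (forall x, `|g x| <= e1) -> nrm g <= (C + 1) * e1.
  move=> sg bg gb; apply: (le_trans (HC g sg bg e1 (ltW e10) gb)).
  by rewrite ler_wpM2r ?(ltW e10)// lerDl.
apply: (@le_trans _ _ (N * ((C + 1) * e1))); last first.
  by rewrite mulrA /e1 mulrC divfK// mulf_neq0 ?gt_eqF.
have cl f : sq f -> (forall x y, `|x - y| < r' -> `|f x - f y| <= e1) ->
    forall x, `|(corr eta f - f) x| <= e1.
  move=> sf Hf x; exact: (corr_close h1 h2 h3 r1 h4 sf (ltW e10) Hf).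
apply: Nk2_le => //.
- apply: fin => //; first exact: kc_sq kd.
  by apply: cl => // x y xy; apply: Ht0; exact: lt_le_trans xy rt0.
- move=> i; apply: fin; [exact: kc_sq (kc_pd i kd)|exact: bs_pd|].
  rewrite e1p; apply: cl; first exact: kc_sq (kp i).
  by move=> x y xy; apply: Ht1; exact: lt_le_trans xy (rt1 i).
- move=> i j; apply: fin; [exact: kc_sq (kc_pd j (kc_pd i kd))|by do 2 apply: bs_pd|].
  rewrite e2p; apply: cl; first exact: kc_sq (kpp i j).
  by move=> x y xy; apply: (Ht2 (i, j)); exact: lt_le_trans xy (rt2 (i, j)).
Qed.

End mollification.

Lemma W0_alg (R : realFieldType) (a1 a2 a3 a4 a5 a6 a7 a8 a9 b1 b2 b3 b4 b5 F d r z p : R) :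
  z * r * b4 = a5 - a6 * F -> z * b2 = a3 - 2 * a4 + a9 * p ->
  z * b1 = a1 - 2 * a2 + (2 * a7 - a8) * p - 2 * (d * r * F) ->
  z * b1 = z * (b2 + b3 * F + r * b4 + r * b4 + r * r * b5) ->
  z * (r * r) * b5 = a1 - (2 * a2 + a3 - 2 * a4 + 2 * a5) + (2 * a7 - a8 - a9) * p +
    (2 * a6 - 2 * (d * r) - z * b3) * F.
Proof.
move=> E1 E2 E3 E4.
have -> : z * (r * r) * b5 = z * b1 - z * b2 - z * b3 * F - 2 * (z * r * b4) by rewrite E4; ring.
by rewrite E1 E2 E3; ring.
Qed.

Lemma W0_tri (R : realFieldType) (a b c d A B C N : R) : `|a| <= A * N -> `|b| <= B * N -> `|c| <= C * N ->
  `|2 * a + b - 2 * c + 2 * d| <= (2 * A + B + 2 * C) * N + 2 * `|d|.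
Proof.
move=> ha hb hc; apply: (le_trans (ler_normD _ _)); rewrite normrM (ger0_norm (ler0n R 2)) lerD2r.
apply: (le_trans (ler_normB _ _)); rewrite normrM (ger0_norm (ler0n R 2)).
have := ler_normD (2 * a) b; rewrite normrM (ger0_norm (ler0n R 2)).
rewrite !mulrDl -!mulrA; move: (A * N) (B * N) (C * N) ha hb hc => x y z; lra.
Qed.
Lemma W0_tri2 (R : realFieldType) (a b c A B C N S : R) : `|a| <= A * N -> `|b| <= B * N + S -> `|c| <= C * N ->
  `|a - b + c| <= (A + B + C) * N + S.
Proof.
move=> ha hb hc; apply: (le_trans (ler_normD _ _)); have := ler_normB a b.
by rewrite !mulrDl; move: (A * N) (B * N) (C * N) ha hb hc => x y z; lra.
Qed.
Lemma W1_tri (R : realFieldType) (x C N S CS M t B : R) : 0 <= C -> 0 <= CS -> 0 <= B -> 0 <= N -> 0 <= M ->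
  x <= C * N + S + t -> S <= CS * M -> t <= B * M -> x <= (C + (CS + B)) * (N + M).
Proof.
move=> C0 CS0 B0 N0 M0 hx hS ht.
have p1 : 0 <= C * M by exact: mulr_ge0. have p2 : 0 <= CS * N by exact: mulr_ge0.
have p3 : 0 <= B * N by exact: mulr_ge0.
by rewrite mulrDr !mulrDl; lra.
Qed.

Local Notation "'bounded' psi 'in' P , e" :=
  (exists2 C, 0 <= C & forall psi, P psi -> `|e| <= C * nrm psi)
  (at level 200, psi name, P at level 69, e at level 99).

(** * Tangential and normal derivatives near the boundary *)

Section halfspace.
Context {R : realType} {n : nat}.
Local Notation V := 'rV[R]_n.
Implicit Types (f g phi psi b : V -> R) (O : set V) (i j m : 'I_n).

Lemma tcM k O b f : Ck k b -> tc k O f -> tc k O (b * f).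
Proof. by move=> Hb [Hf cf]; split; [exact: CkM|exact: csuppM]. Qed.
Lemma tc_le k' k O f : (k' <= k)%N -> tc k O f -> tc k' O f.
Proof. by move=> jk [Hf cf]; split => //; exact: Ck_le Hf. Qed.

Lemma csupp_pd O i f : csupp O f -> csupp O (pd i f).
Proof.
move=> [d [L [d0 H]]]; exists (d / 2), (L + d); split; first by rewrite divr_gt0.
move=> x px; have [y yx fy] : exists2 y, `|x - y| < d / 2 & f y != 0.
  apply: contrapT => Hn; move/eqP: px; apply.
  have oU : open [set y | `|x - y| < d / 2].
    by rewrite (_ : [set y | _] = ball x (d / 2)); [exact: ball_open|rewrite -ball_normE].
  have -> : pd i f x = pd i (cst 0) x.
    apply: (pd_local i oU) => [y /= yx|]; last by rewrite /= subrr normr0 divr_gt0.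
    by apply/eqP; apply: contraT => fy; case: Hn; exists y.
  by rewrite pd_cst.
have [yL Hy] := H y fy; split; first by have := lerB_dist x y; lra.
by move=> w xw; apply: Hy; have := ler_distD x y w; rewrite (distrC y x); lra.
Qed.

Lemma csupp_sum O (I : Type) (r : seq I) (F : I -> V -> R) :
  (forall k, csupp O (F k)) -> csupp O (\sum_(k <- r) F k).
Proof.
move=> H; elim: r => [|k r IH].
  by rewrite big_nil; exists 1, 0; split => // x; rewrite eqxx.
by rewrite big_cons; exact: csuppD.
Qed.

Lemma csupp_dv O v f : csupp O f -> csupp O (dv v f).
Proof. by move=> cf; apply: csupp_sum => i; apply: csuppZ; exact: csupp_pd. Qed.

Lemma tc_dv k O v f : tc k.+1 O f -> tc k O (dv v f).
Proof. by move=> [Hf cf]; split; [exact: Ck_dv|exact: csupp_dv]. Qed.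

Lemma dv_schwarz v i f : Ck 2 f -> dv v (pd i f) = pd i (dv v f).
Proof.
move=> Hf; rewrite /dv pd_sum; last by move=> j; apply: CkZ; exact: Ck_pd.
by apply: eq_bigr => j _; rewrite pdZ1 ?(schwarz i j Hf)//; exact: Ck_pd.
Qed.

Variables (rho : V -> R) (q : V).
Hypothesis Hflat : flat rho q.
Hypothesis Hq1 : forall x t, rho (x + t *: q) = rho x + t.
Local Notation X := (Xder rho q).
Local Notation Q := (dv q).
Local Notation tau := (ftau rho q).
Local Notation D := (Dquo rho q).
Local Notation S := (Sflow rho q).
Local Notation avg := (favg rho q).
Let Hrho : Ck 4 rho. Proof. by case: Hflat. Qed.
Let r1 : Ck 1 rho. Proof. exact: Ck_le Hrho. Qed.

Lemma Q_rho : Q rho = cst 1.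
Proof.
apply/funext => x; rewrite -dvE// /derive.
apply: cvg_lim => //; apply: cvg_near_cst; near=> h.
rewrite /= [h *: q + x]addrC Hq1 addrC addKr /GRing.scale /= mulVf//; near: h; exact: nbhs_dnbhs_neq.
Unshelve. all: by end_near. Qed.

Lemma Q_pd_rho i : Q (pd i rho) = 0.
Proof. by rewrite dv_schwarz ?Q_rho ?pd_cst//; exact: Ck_le Hrho. Qed.

Lemma Ck_X p k f : (k <= 3)%N -> Ck k.+1 f -> Ck k (X p f).
Proof.
move=> k3 Hf; apply: CkB; first exact: Ck_dv.
by apply: CkM; [exact: Ck_dv (Ck_le _ Hrho)|exact: Ck_dv].
Qed.

Lemma csupp_X O p f : csupp O f -> csupp O (X p f).
Proof.
by move=> cf; apply: csuppD; [exact: csupp_dv|apply: csuppN; apply: csuppM; exact: csupp_dv].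
Qed.

Lemma XD p f g : Ck 1 f -> Ck 1 g -> X p (f + g) = X p f + X p g.
Proof.
move=> Hf Hg; rewrite /Xder (dvD p Hf Hg) (dvD q Hf Hg).
by apply/funext => x; rewrite !fctE; ring.
Qed.

Lemma XM p f g : Ck 1 f -> Ck 1 g -> X p (f * g) = X p f * g + f * X p g.
Proof.
move=> Hf Hg; rewrite /Xder (dvM p Hf Hg) (dvM q Hf Hg).
by apply/funext => x; rewrite !fctE; ring.
Qed.

Lemma X_sum p (I : Type) (r : seq I) (F : I -> V -> R) : (forall k, Ck 1 (F k)) ->
  X p (\sum_(k <- r) F k) = \sum_(k <- r) X p (F k).
Proof.
move=> H; elim: r => [|k r IH].
  by rewrite !big_nil -(scaler0 _ 0) XZ ?scale0r//; exact: (Ck_cst 1 0).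
by rewrite !big_cons XD ?IH//; exact: Ck_sum.
Qed.

Lemma X_avg p' p N h f : Ck 1 f -> X p' (avg p N h f) = avg p N h (X p' f).
Proof.
move=> Hf; have Ht s : Ck 1 (tau p s f) by exact: (Ck_tau Hflat).
rewrite /favg XZ; last by apply: Ck_sum => i.
by rewrite X_sum//; congr (_ *: _); apply: eq_bigr => j _; rewrite X_tau.
Qed.

Lemma avg_bound_lim p h f g B u : h != 0 -> kc 1 f -> sq g -> tends0 u ->
  (forall N, `|ip g (avg p N h (X p f))| <= B + u N) -> `|ip g (D p h f)| <= B.
Proof.
move=> hn0 kf sg u0 HN.
have sX : sq (X p f) := kc_sq (kc_X Hflat p le0_3 kf).
have lim := avg_lim Hflat p hn0 kf.
apply: (tends0_lim (tends0D u0 (tends0Z (nrm_ge0 g) lim))) => N.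
have sA : sq (avg p N h (X p f)) := sq_avg Hflat p N h sX.
have sD : sq (D p h f) := sq_D Hflat p h (kc_sq kf).
have -> : ip g (D p h f) = ip g (avg p N h (X p f)) + ip g (D p h f - avg p N h (X p f)).
  by rewrite -(ipDr sA (sqB sD sA) sg) addrC subrK.
rewrite addrA; apply: (le_trans (ler_normD _ _)); apply: lerD; first exact: HN.
by apply: ip_CS => //; exact: sqB.
Qed.

Lemma avg_bound p h f g B : h != 0 -> kc 1 f -> sq g ->
  (forall N, `|ip g (avg p N h (X p f))| <= B) -> `|ip g (D p h f)| <= B.
Proof.
move=> hn0 kf sg HN; apply: (avg_bound_lim hn0 kf sg (@tends0_const0 R)) => N.
by rewrite addr0.
Qed.

Local Notation Xm m := (X (e_ m)).

Lemma pdE m f : pd m f = Xm m f + pd m rho * Q f.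
Proof. by rewrite /Xder !dv_e subrK. Qed.

Lemma XmE m f : Xm m f = pd m f - pd m rho * Q f.
Proof. by rewrite /Xder !dv_e. Qed.

Lemma X_Q m f : Ck 2 f -> Xm m (Q f) = Q (Xm m f).
Proof.
move=> Hf; have H1 := Ck_dv q Hf; have Hp := Ck_pd m Hf.
have Hr : Ck 1 (pd m rho) := Ck_le le1_3 (Ck_pd m Hrho).
rewrite !XmE (dvD q Hp (CkN (CkM Hr H1))) (dvN q (CkM Hr H1)) (dvM q Hr H1) Q_pd_rho mul0r add0r.
by rewrite dv_schwarz.
Qed.

(** From $d_m = X_m + (d_m\rho) d_q$ applied twice: the coefficients $d_m\rho$ are constant along
    [q] and $X_m$ commutes with $d_q$. *)
Lemma pdpdE i j f : Ck 2 f -> pd i (pd j f) = Xm i (Xm j f) + Xm i (pd j rho) * Q f +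
  pd j rho * Xm i (Q f) + pd i rho * Xm j (Q f) + pd i rho * pd j rho * Q (Q f).
Proof.
move=> Hf; have H1 := Ck_dv q Hf; have HX : Ck 1 (Xm j f) by exact: Ck_X.
have Hr : Ck 1 (pd j rho) := Ck_le le1_3 (Ck_pd j Hrho).
have H2 := CkM Hr H1.
rewrite [pd j f](pdE j f) [LHS](pdE i) (XD _ HX H2) (dvD q HX H2) (XM _ Hr H1) (dvM q Hr H1) Q_pd_rho mul0r add0r.
rewrite -(X_Q j Hf); move: (Xm i (Xm j f)) (Xm i (pd j rho)) (Q f) (pd j rho) (Xm i (Q f)) (pd i rho) => A B F r E s.
by apply/funext => x; rewrite !fctE; ring.
Qed.

(** The squared gradient of [rho], which is the coefficient of $d_q^2$ in the Laplacian; it cannot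
    vanish since $d_q\rho = 1$. *)
Definition cc2 : V -> R := \sum_m pd m rho * pd m rho.

Lemma cc2_neq0 x : cc2 x != 0.
Proof.
apply/negP => /eqP; rewrite /cc2 fct_sumE => H.
have Z m : pd m rho x = 0.
  apply/eqP; rewrite -sqrf_eq0 expr2; apply/eqP.
  have P0 k : 0 <= (pd k rho * pd k rho) x by rewrite -[X in _ <= X]/(pd k rho x * pd k rho x) -expr2 sqr_ge0.
  by have /eqP := H; rewrite psumr_eq0// => /allP /(_ m (mem_index_enum m)) /eqP.
have : Q rho x = 0 by rewrite /dv fct_sumE big1// => i _; rewrite fctE Z scaler0.
by rewrite Q_rho /= => /eqP; rewrite oner_eq0.
Qed.

Lemma Ck_cc2 : Ck 3 cc2.
Proof. by apply: Ck_sum => m _; apply: CkM; exact: Ck_pd. Qed.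

Section localized.
Variables (x0 : V) (R1 s : R) (zeta : V -> R) (g : V -> R).
Hypothesis sR : s < R1.
Hypothesis kz : forall k, kc k zeta.
Hypothesis zout : forall x, s <= `|x - x0| -> zeta x = 0.
Hypothesis sg : sq g.
Let Pos := [set x | 0 < rho x].
Let U := Pos `&` [set x | `|x - x0| < R1].
Hypothesis H1 : forall m, bounded psi in tc 2 U, ip g (Xm m psi).
Hypothesis H2 : forall i m, bounded psi in tc 2 U, ip g (Xm i (Xm m psi)).
Hypothesis H3 : bounded psi in tc 2 U, ip g (lap psi).

(** The cut-off divided by the coefficient of $d_q^2$ in the Laplacian. It is only $C^3$, which
    bounds the order of every coefficient formed from it. *)
Definition z3 : V -> R := zeta * (fun x => (cc2 x)^-1).

Lemma Ck_z3 : Ck 3 z3.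
Proof. by apply: CkM; [case: (kz 3)|apply: Ck_inv; [exact: cc2_neq0|exact: Ck_cc2]]. Qed.

Definition vanish f := forall x, s < `|x - x0| -> f x = 0.

Lemma vanish_pd i f : vanish f -> vanish (pd i f).
Proof.
move=> f0 x xr; have oU : open [set y : V | s < `|y - x0|].
  have -> : [set y | s < `|y - x0|] = (fun y => y + (- x0)) @^-1` [set y : V | s < `|y|] by [].
  apply: (@open_comp _ _ (fun y : V => y - x0)); last exact: open_norm_gt.
  by move=> y _; exact: (@continuous_trans R n (- x0)).
have -> : pd i f x = pd i (cst 0) x by apply: (pd_local i oU) => // y /f0.
by rewrite pd_cst.
Qed.
Lemma vanishM f b : vanish f -> vanish (f * b).
Proof. by move=> f0 x xr; rewrite -[LHS]/(f x * b x) f0// mul0r. Qed.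
Lemma vanishZ a f : vanish f -> vanish (a *: f).
Proof. by move=> f0 x xr; rewrite -[LHS]/(a * f x) f0// mulr0. Qed.
Lemma vanishN f : vanish f -> vanish (- f).
Proof. by move=> f0 x xr; rewrite -[LHS]/(- f x) f0// oppr0. Qed.
Lemma vanishD f b : vanish f -> vanish b -> vanish (f + b).
Proof. by move=> f0 b0 x xr; rewrite -[LHS]/(f x + b x) f0// b0// addr0. Qed.
Lemma vanish_sum (F : 'I_n -> V -> R) : (forall i, vanish (F i)) -> vanish (\sum_i F i).
Proof. by move=> H x xr; rewrite fct_sumE big1// => i _; exact: H. Qed.
Lemma vanish_dv v f : vanish f -> vanish (dv v f).
Proof. by move=> f0; apply: vanish_sum => i; apply: vanishZ; exact: vanish_pd. Qed.
Lemma vanish_X p f : vanish f -> vanish (X p f).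
Proof.
move=> f0; apply: vanishD; first exact: vanish_dv.
by apply: vanishN; rewrite mulrC; apply: vanishM; exact: vanish_dv.
Qed.

Definition cutf k b := Ck k b /\ vanish b.

Lemma cutf_kc k b : cutf k b -> kc k b.
Proof.
move=> [Hb b0]; split => //; exists (`|x0| + s) => x Lx; apply: b0.
by have := lerB_dist x x0; lra.
Qed.
Lemma cutf_le k' k b : (k' <= k)%N -> cutf k b -> cutf k' b.
Proof. by move=> jk [Hb b0]; split => //; exact: Ck_le Hb. Qed.
Lemma cutf_pd k i b : cutf k.+1 b -> cutf k (pd i b).
Proof. by move=> [Hb b0]; split; [exact: Ck_pd|exact: vanish_pd]. Qed.
Lemma cutf_X k p b : (k <= 3)%N -> cutf k.+1 b -> cutf k (X p b).
Proof. by move=> k3 [Hb b0]; split; [exact: Ck_X|exact: vanish_X]. Qed.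
Lemma cutfM k b f : cutf k b -> Ck k f -> cutf k (b * f).
Proof. by move=> [Hb b0] Hf; split; [exact: CkM|exact: vanishM]. Qed.
Lemma cutfD k b f : cutf k b -> cutf k f -> cutf k (b + f).
Proof. by move=> [Hb b0] [Hf f0]; split; [exact: CkD|exact: vanishD]. Qed.
Lemma cutfZ k a b : cutf k b -> cutf k (a *: b).
Proof. by move=> [Hb b0]; split; [exact: CkZ|exact: vanishZ]. Qed.
Lemma cutfN k b : cutf k b -> cutf k (- b).
Proof. by move=> [Hb b0]; split; [exact: CkN|exact: vanishN]. Qed.
Lemma cutf_sum k (F : 'I_n -> V -> R) : (forall i, cutf k (F i)) -> cutf k (\sum_i F i).
Proof. by move=> H; split; [apply: Ck_sum => i _; case: (H i)|apply: vanish_sum => i; case: (H i)]. Qed.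

Lemma cutf_bd k b : cutf k b -> exists2 M, 0 <= M & forall x, `|b x| <= M.
Proof. by move=> /cutf_kc/kc_cc[L /cc_bounded]. Qed.

Lemma cutf_z3 : cutf 3 z3.
Proof.
split; first exact: Ck_z3.
by apply: vanishM => x xs; apply: zout; exact: ltW.
Qed.

Lemma cutf_tc k b f : cutf k b -> tc k Pos f -> tc k U (b * f).
Proof.
move=> [Hb b0] [Hf cf]; split; first exact: CkM.
have sm : (s + R1) / 2 < R1 by move: sR; lra.
apply: (csupp_cut sm) cf => x xs; apply: b0; apply: lt_le_trans xs; move: sR; lra.
Qed.

Definition W0alpha : V -> R := \sum_m (2 *: Xm m (pd m z3) - pd m (pd m z3) - Xm m (Xm m z3)).
Definition W0beta : V -> R := \sum_m (2 *: Xm m (z3 * pd m rho) - 2 *: (pd m z3 * pd m rho) -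
  z3 * Xm m (pd m rho)).

(* [lap] solved for [Q (Q phi)]: the other terms are tangential or of first order. *)
Lemma W0 phi : Ck 2 phi -> zeta * Q (Q phi) = lap (z3 * phi) -
  \sum_m (2 *: Xm m (pd m z3 * phi) + Xm m (Xm m (z3 * phi)) - 2 *: Xm m (Xm m z3 * phi) +
     2 *: Xm m (z3 * pd m rho * Q phi)) + W0alpha * phi + W0beta * Q phi.
Proof.
move=> Hp; have Hz := Ck_z3; have z1 := Ck_le le1_3 Hz; have z2 := Ck_le le2_3 Hz.
have p1 : Ck 1 phi by exact: Ck_le Hp.
have -> : zeta * Q (Q phi) = \sum_m z3 * (pd m rho * pd m rho) * Q (Q phi).
  rewrite -mulr_suml -mulr_sumr -/cc2 /z3; congr (_ * _).
  apply/funext => x; rewrite -[RHS]/(zeta x * (cc2 x)^-1 * cc2 x) mulfVK//; exact: cc2_neq0.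
rewrite /lap /W0alpha /W0beta !mulr_suml -sumrB -!big_split /=; apply: eq_bigr => m _.
have dz1 : Ck 1 (pd m z3) by exact: (Ck_le le1_2 (Ck_pd m Hz)).
have X1 : Ck 1 (Xm m z3) by apply: Ck_X => //.
have Xp : Ck 1 (Xm m phi) by apply: Ck_X.
have rm : Ck 1 (pd m rho) := Ck_le le1_3 (Ck_pd m Hrho).
have Q1 : Ck 1 (Q phi) := Ck_dv q Hp.
have zr : Ck 1 (z3 * pd m rho) by exact: CkM.
have dp1 : Ck 1 (pd m phi) := Ck_pd m Hp.
have L1 x : z3 x * pd m (pd m phi) x = pd m (pd m (z3 * phi)) x - 2 * Xm m (pd m z3 * phi) x +
    (2 * Xm m (pd m z3) x - pd m (pd m z3) x) * phi x - 2 * (pd m z3 x * pd m rho x * Q phi x).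
  rewrite (pdM1 m z1 p1) (pdD1 m (CkM dz1 p1) (CkM z1 dp1)) (pdM1 m dz1 p1) (pdM1 m z1 dp1) (XM _ dz1 p1).
  have := f_equal (fun F => F x) (pdE m phi); rewrite !fctE.
  move: (pd m (pd m phi) x) (pd m (pd m z3) x) (Xm m (pd m z3) x) (pd m z3 x) (Xm m phi x) (pd m rho x) (pd m phi x) => A B C E F G H ->.
  ring.
have L2 x : z3 x * Xm m (Xm m phi) x = Xm m (Xm m (z3 * phi)) x - 2 * Xm m (Xm m z3 * phi) x +
    Xm m (Xm m z3) x * phi x.
  rewrite (XM _ X1 p1) (XM _ z1 p1) (XD _ (CkM X1 p1) (CkM z1 Xp)) (XM _ X1 p1) (XM _ z1 Xp) !fctE.
  move: (Xm m (Xm m phi) x) (Xm m (Xm m z3) x) (Xm m z3 x) (Xm m phi x) => A B C E; ring.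
have L3 x : z3 x * pd m rho x * Xm m (Q phi) x = Xm m (z3 * pd m rho * Q phi) x -
    Xm m (z3 * pd m rho) x * Q phi x.
  rewrite (XM _ zr Q1) !fctE; move: (Xm m (Q phi) x) (Xm m (z3 * pd m rho) x) => A B; ring.
apply/funext => x.
exact: (W0_alg (L3 x) (L2 x) (L1 x) (f_equal (fun F => z3 x * F x) (pdpdE m m Hp))).
Qed.

Lemma bd_cut T k b : (2 <= k)%N -> (bounded psi in tc 2 U, ip g (T psi)) ->
  cutf k b -> bounded phi in tc k Pos, ip g (T (b * phi)).
Proof.
move=> k2 [C C0 HC] cb; have [M M0 HM] := cutf_bd cb.
exists (C * M); first exact: mulr_ge0.
move=> phi tp; have tb : tc 2 U (b * phi) := tc_le k2 (cutf_tc cb tp).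
apply: (le_trans (HC _ tb)); rewrite -mulrA ler_wpM2l//; apply: nrm_mulb => //.
  by apply: continuous_measurable_rV; exact: (Ck_cont cb.1).
exact: kc_sq (tc_kc tp).
Qed.

Lemma bd_mul b f : cutf 0 b -> sq f -> `|ip g (b * f)| <= nrm (b * g) * nrm f.
Proof.
move=> cb sf; rewrite -ip_mull; have [M M0 HM] := cutf_bd cb; apply: ip_CS => //.
by apply: (sq_mulb _ HM) => //; apply: continuous_measurable_rV; exact: (Ck_cont cb.1).
Qed.

Lemma cutf_beta : cutf 2 W0beta.
Proof.
have cz := cutf_z3; apply: cutf_sum => m.
have cr : Ck 3 (pd m rho) := Ck_pd m Hrho; have cr2 := Ck_le le2_3 cr.
apply: cutfD; last first.
  by apply: cutfN; apply: cutfM; [exact: cutf_le cz|exact: Ck_X].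
apply: cutfD; first by apply: cutfZ; apply: cutf_X => //; exact: cutfM.
by apply: cutfN; apply: cutfZ; apply: cutfM => //; exact: cutf_pd.
Qed.

(** The mixed and first-order normal terms are left as they are: [W1], [W2] and [normal_QQ] each
    estimate them differently. *)
Lemma W0_bound : exists2 C, 0 <= C & forall phi, tc 3 Pos phi ->
  `|ip (zeta * g) (Q (Q phi))| <= C * nrm phi +
    \sum_m (2 * `|ip g (Xm m (z3 * pd m rho * Q phi))|) + `|ip g (W0beta * Q phi)|.
Proof.
have [C1 C10 B1] := bd_cut (T := lap) le2_3 H3 cutf_z3.
have cz := cutf_z3; have czl := cutf_le le2_3 cz.
have cd m : cutf 2 (pd m z3) by exact: cutf_pd.
have cX m : cutf 2 (Xm m z3) by exact: cutf_X.
have /all_sig2[C2 C20 B2] m : {C | 0 <= C & forall phi, tc 3 Pos phi -> `|ip g (Xm m (pd m z3 * phi))| <= C * nrm phi}.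
  apply: cid2; have [C C0 HC] := bd_cut le2_2 (H1 m) (cd m).
  by exists C => // phi tp; apply: HC; exact: tc_le tp.
have /all_sig2[C3 C30 B3] m : {C | 0 <= C & forall phi, tc 3 Pos phi -> `|ip g (Xm m (Xm m (z3 * phi)))| <= C * nrm phi}.
  apply: cid2; have [C C0 HC] := bd_cut (T := fun f => Xm m (Xm m f)) le2_3 (H2 m m) cz.
  by exists C.
have /all_sig2[C4 C40 B4] m : {C | 0 <= C & forall phi, tc 3 Pos phi -> `|ip g (Xm m (Xm m z3 * phi))| <= C * nrm phi}.
  apply: cid2; have [C C0 HC] := bd_cut le2_2 (H1 m) (cX m).
  by exists C => // phi tp; apply: HC; exact: tc_le tp.
have ca : cutf 0 W0alpha.
  apply: cutf_sum => m; apply: cutfD; last by apply: cutfN; apply: cutf_X => //; exact: cutf_le (cX m).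
  apply: cutfD; last by apply: cutfN; apply: cutf_pd; exact: cutf_le (cd m).
  by apply: cutfZ; apply: cutf_X => //; exact: cutf_le (cd m).
pose CS := \sum_m (2 * C2 m + C3 m + 2 * C4 m).
have CS0 : 0 <= CS by apply: sumr_ge0 => m _; rewrite !addr_ge0// mulr_ge0.
exists (C1 + CS + nrm (W0alpha * g)); first by rewrite !addr_ge0// nrm_ge0.
move=> phi tp; have Hp := tp.1; have p2 : Ck 2 phi := Ck_le le2_3 Hp.
have kp := tc_kc tp; have sp := kc_sq kp; have N0 := nrm_ge0 phi.
have kz3 := cutf_kc cz.
have kQ : kc 2 (Q phi) by exact: kc_dv.
have s1 : sq (lap (z3 * phi)) by apply: (@kc_sq _ _ 1); apply: kc_lap; apply: kcM => //; exact: cz.1.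
have kM b f k : cutf k b -> kc k f -> kc k (b * f) by move=> [Hb _]; exact: kcM.
have sX m f : kc 1 f -> sq (Xm m f) by move=> kf; exact: (kc_sq (kc_X Hflat (e_ m) le0_3 kf)).
have kp2 := kc_le le2_3 kp.
have k2 m : kc 1 (pd m z3 * phi) by exact: kc_le (kM _ _ _ (cd m) kp2).
have k3 m : kc 1 (Xm m (z3 * phi)) by apply: (kc_X Hflat) => //; exact: kc_le (kM _ _ _ cz kp).
have k4 m : kc 1 (Xm m z3 * phi) by exact: kc_le (kM _ _ _ (cX m) kp2).
have k5 m : kc 1 (z3 * pd m rho * Q phi).
  by apply: kc_le (kM _ _ 2%N _ kQ) => //; apply: cutfM czl _; exact: (Ck_le le2_3 (Ck_pd m Hrho)).
pose T m := 2 *: Xm m (pd m z3 * phi) + Xm m (Xm m (z3 * phi)) - 2 *: Xm m (Xm m z3 * phi) +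
     2 *: Xm m (z3 * pd m rho * Q phi).
have sT m : sq (T m).
  apply: sqD; last by apply: sqZ; exact: sX.
  by apply: sqB; [apply: sqD; [apply: sqZ; exact: sX|exact: sX]|apply: sqZ; exact: sX].
have sa : sq (W0alpha * phi) := kc_sq (kM _ _ _ ca (kc_le (leq0n 3) kp)).
have cb := cutf_le (leq0n 2) cutf_beta.
have sb : sq (W0beta * Q phi) := kc_sq (kM _ _ _ cb (kc_le (leq0n 2) kQ)).
have sS : sq (\sum_m T m) by apply: sq_sum => m _; exact: sT.
rewrite ip_mull (W0 p2) -/(T _) (ipDr (sqD (sqB s1 sS) sa) sb sg) (ipDr (sqB s1 sS) sa sg) (ipBr s1 sS sg).
rewrite (@ip_sumr _ _ _ _ predT _ _ (fun m _ => sT m) sg).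
apply: (le_trans (ler_normD _ _)); rewrite lerD2r.
have Sm : `|\sum_m ip g (T m)| <= CS * nrm phi + \sum_m (2 * `|ip g (Xm m (z3 * pd m rho * Q phi))|).
  rewrite /CS mulr_suml -big_split /=; apply: (le_trans (ler_norm_sum _ _ _)); apply: ler_sum => m _.
  rewrite /T (ipDr (sqB (sqD (sqZ 2 (sX m _ (k2 m))) (sX m _ (k3 m))) (sqZ 2 (sX m _ (k4 m)))) (sqZ 2 (sX m _ (k5 m))) sg).
  rewrite (ipBr (sqD (sqZ 2 (sX m _ (k2 m))) (sX m _ (k3 m))) (sqZ 2 (sX m _ (k4 m))) sg).
  rewrite (ipDr (sqZ 2 (sX m _ (k2 m))) (sX m _ (k3 m)) sg).
  rewrite (ipZr 2 (sX m _ (k2 m)) sg) (ipZr 2 (sX m _ (k4 m)) sg) (ipZr 2 (sX m _ (k5 m)) sg).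
  by apply: W0_tri; [exact: (B2 m phi tp)|exact: (B3 m phi tp)|exact: (B4 m phi tp)].
have i1 := B1 phi tp; have i2 := bd_mul ca sp.
exact: (W0_tri2 i1 Sm i2).
Qed.

Lemma W1 : exists2 C, 0 <= C & forall phi, tc 3 Pos phi ->
  `|ip (zeta * g) (Q (Q phi))| <= C * (nrm phi + nrm (Q phi)).
Proof.
have [C C0 HC] := W0_bound.
have cz := cutf_le le2_3 cutf_z3.
have cr m : Ck 2 (pd m rho) := Ck_le le2_3 (Ck_pd m Hrho).
have /all_sig2[C2 C20 B2] m : {C | 0 <= C & forall psi, tc 2 Pos psi -> `|ip g (Xm m (z3 * pd m rho * psi))| <= C * nrm psi}.
  by apply: cid2; exact: (bd_cut le2_2 (H1 m) (cutfM cz (cr m))).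
pose CS := \sum_m 2 * C2 m.
have CS0 : 0 <= CS by apply: sumr_ge0 => m _; rewrite mulr_ge0.
exists (C + (CS + nrm (W0beta * g))); first by rewrite !addr_ge0// nrm_ge0.
move=> phi tp; have tQ : tc 2 Pos (Q phi) by exact: tc_dv.
have cb := cutf_le (leq0n 2) cutf_beta.
have i2 := bd_mul cb (kc_sq (tc_kc tQ)).
have i1 : \sum_m (2 * `|ip g (Xm m (z3 * pd m rho * Q phi))|) <= CS * nrm (Q phi).
  by rewrite /CS mulr_suml; apply: ler_sum => m _; rewrite -(mulrA 2 (C2 m)); exact: (ler_wpM2l (ler0n R 2) (B2 m _ tQ)).
exact: (W1_tri C0 CS0 (nrm_ge0 _) (nrm_ge0 _) (nrm_ge0 _) (HC phi tp) i1 i2).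
Qed.

Lemma csupp_tau_Pos p h f : csupp Pos f -> csupp Pos (tau p h f).
Proof.
move=> [d [L [d0 Hf]]]; have [M M0 HM] := S_lip Hflat p h; have [B B0 HB] := S_disp Hflat p.
exists (d / (M + 1)), (L + `|h| * B); split; first by rewrite divr_gt0// ltr_wpDl.
move=> x fx; have [xL Hy] := Hf _ fx; split.
  by have := HB h x; have := lerB_dist x (S p h x); rewrite (distrC x); lra.
move=> y xy; rewrite /Pos /= -(rho_S p y h Hq1); apply: Hy; apply: (le_lt_trans (HM x y)).
rewrite -(@mulfVK _ (M + 1) _ d) ?gt_eqF ?ltr_wpDl//.
have P1 : 0 < M + 1 by rewrite ltr_wpDl.
move: xy; rewrite ltr_pdivlMr// mulrC mulrDl mul1r => xy; rewrite mulfVK ?gt_eqF//.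
by have := normr_ge0 (x - y); lra.
Qed.
Lemma tc_D_Pos p h k f : (k <= 4)%N -> tc k Pos f -> tc k Pos (D p h f).
Proof.
move=> k4 [Hf cf]; split; first by apply: CkZ; apply: CkB => //; exact: (Ck_tau Hflat).
by apply: csuppZ; apply: csuppD; [exact: csupp_tau_Pos|exact: csuppN].
Qed.
Lemma Q_tau p h f : Ck 1 f -> Q (tau p h f) = tau p h (Q f).
Proof.
move=> Hf; rewrite (dv_tau Hflat q p h Hf) (dv_th Hflat) Q_rho.
by rewrite (_ : cst 1 - _ = 0) ?mul0r ?addr0//; apply/funext => x; rewrite !fctE subrr.
Qed.
Lemma Q_D p h f : Ck 1 f -> Q (D p h f) = D p h (Q f).
Proof.
move=> Hf; have Ht := Ck_tau Hflat p h le1_4 Hf.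
have E := Q_tau p h Hf; rewrite /ftau in E Ht.
by rewrite /Dquo (dvZ _ _ (CkB Ht Hf)) (dvD _ Ht (CkN Hf)) (dvN _ Hf) E.
Qed.
Lemma D_mul p h b f : b * D p h f = D p h (b * f) - D p h b * tau p h f.
Proof.
apply/funext => x; rewrite /Dquo /ftau !fctE /GRing.scale /=.
move: (h^-1) (b x) (f x) (b (S p h x)) (f (S p h x)) => a b1 f1 b2 f2; ring.
Qed.

Let s1 := (s + R1) / 2.
Let s1E : s1 = (s + R1) / 2. Proof. by []. Qed.
Let ss1 : s < s1. Proof. by rewrite /s1; move: sR; lra. Qed.
Let s1R : s1 < R1. Proof. by rewrite /s1; move: sR; lra. Qed.

Lemma tc_cut1 k b f : cutf k b -> tc k Pos f -> tc k (Pos `&` [set x | `|x - x0| < s1]) (b * f).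
Proof.
move=> [Hb b0] [Hf cf]; split; first exact: CkM.
have sm : (s + s1) / 2 < s1 by move: ss1; lra.
apply: (csupp_cut sm) cf => x xs; apply: b0; apply: lt_le_trans xs; move: ss1; lra.
Qed.

Lemma step_ex p : exists2 h0, 0 < h0 & forall (h : R) x, `|h| <= h0 -> `|S p h x - x| < (s1 - s) / 2.
Proof.
have [B B0 HB] := S_disp Hflat p; have P1 : 0 < B + 1 by rewrite ltr_wpDl.
have P2 : 0 < s1 - s by rewrite subr_gt0.
exists ((s1 - s) / (B + 1) / 4); first by rewrite !divr_gt0.
move=> h x hh; apply: (le_lt_trans (HB h x)).
have H : `|h| * (B + 1) <= (s1 - s) / 4.
  by move: hh; rewrite mulrAC ler_pdivlMr.
by move: H P2 (normr_ge0 h); rewrite mulrDr mulr1; move: (`|h| * B) => u; lra.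
Qed.

Lemma avg_tc p h0 h N f : (forall (h : R) x, `|h| <= h0 -> `|S p h x - x| < (s1 - s) / 2) -> `|h| <= h0 ->
  tc 2 (Pos `&` [set x | `|x - x0| < s1]) f -> tc 2 U (avg p N h f).
Proof.
move=> Hh hh [Hf cf]; split.
  by apply: CkZ; apply: Ck_sum => j _; exact: (Ck_tau Hflat).
apply: csuppZ; apply: csupp_sum => j.
set t := _ / _; have th0 : `|t| <= h0.
  apply: le_trans hh; rewrite /t -mulrA normrM ler_piMr// ger0_norm ?divr_ge0//.
  by rewrite ler_pdivrMr ?ltr0Sn// mul1r ler_nat ltnW.
have c1 : csupp Pos (tau p t f) by apply: csupp_tau_Pos; apply: csupp_sub cf => x [].
have [d [L [d0 H]]] := c1; have R1s : 0 < (R1 - s1) by rewrite subr_gt0.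
have [d' [L' [d'0 H']]] := cf; have [M M0 HM] := S_lip Hflat p t.
exists (Num.min d ((s1 - s) / 2)), L; split; first by rewrite lt_min d0; move: ss1; lra.
move=> x fx; have [xL Hx] := H x fx; split => // y; rewrite lt_min => /andP[/Hx py xy]; split => //=.
have [_ /(_ (S p t x))] := H' _ fx; rewrite subrr normr0 => /(_ d'0)[_ /= h1].
have h2 := Hh t x th0; have h3 := ler_distD (S p t x) x x0; rewrite (distrC x) in h3.
have h4 := ler_distD x y x0; rewrite (distrC y) in h4.
rewrite (distrC y x0) in h4 *; rewrite (distrC y x) (distrC x x0) in h4; rewrite (distrC x (S p t x)) in h3.
move: s1E h1 h2 xy h3 h4; lra.
Qed.

(** [D] is a limit of averages of [X] along the flow. The averages enlarge the support, hence the
    smaller radius [s1], midway between [s] and [R1]. *)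
Lemma bdD p T : (forall psi, kc 2 psi -> kc 1 (T psi)) ->
  (forall N h psi, kc 2 psi -> T (avg p N h psi) = avg p N h (T psi)) ->
  (bounded psi in tc 2 U, ip g (X p (T psi))) ->
  exists2 C, 0 <= C & exists2 h0, 0 < h0 & forall h psi, ok h -> `|h| <= h0 ->
    tc 2 (Pos `&` [set x | `|x - x0| < s1]) psi -> `|ip g (D p h (T psi))| <= C * nrm psi.
Proof.
move=> kT aT [C C0 HC]; exists C => //; have [h0 h00 Hh] := step_ex p; exists h0 => // h psi [hn0 h1] hh tp.
have kp := tc_kc tp; have k1 := kT _ kp.
apply: (avg_bound hn0 k1 sg) => N.
have tN : tc 2 U (avg p N h psi) := avg_tc N Hh hh tp.
have -> : avg p N h (X p (T psi)) = X p (T (avg p N h psi)) by rewrite aT// X_avg//; exact: k1.1.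
apply: (le_trans (HC _ tN)); rewrite ler_wpM2l//; apply: (nrm_avg Hflat); exact: kc_sq kp.
Qed.

Lemma ub_cut p b : cutf 2 b -> exists2 M, 0 <= M & forall h x, ok h -> `|D p h b x| <= M.
Proof. by move=> cb; exact: (ub_bd (ub_D p Hflat le1_2 (ub_kc (cutf_kc cb)))). Qed.

Lemma Dcut p h0 h b f : (forall (h : R) x, `|h| <= h0 -> `|S p h x - x| < (s1 - s) / 2) -> `|h| <= h0 ->
  cutf 2 b -> tc 2 Pos f -> tc 2 U (D p h b * tau p h f).
Proof.
move=> Hh hh [Hb b0] [Hf cf]; split.
  apply: CkM; last exact: (Ck_tau Hflat).
  by apply: CkZ; apply: CkB => //; exact: (Ck_tau Hflat).
apply: (csupp_cut s1R) (csupp_tau_Pos p h cf) => x xs.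
have h2 := Hh h x hh; have h3 := ler_distD (S p h x) x x0; rewrite (distrC x) in h3.
have bx : b x = 0 by apply: b0; move: ss1 xs; lra.
have bS : b (S p h x) = 0.
  by apply: b0; move: ss1 h2 h3 xs; rewrite (distrC x0 x) (distrC x (S p h x)); lra.
by rewrite -[LHS]/(h^-1 * (b (S p h x) - b x)) bx bS subrr mulr0.
Qed.

(** No quotient of [psi] appears on the right: by the Leibniz rule [D_mul] the quotient is taken off
    [b * D psi], and the bound on $X_p T$ absorbs it. *)
Lemma mix p T b : (forall psi, kc 2 psi -> kc 1 (T psi)) ->
  (forall N h psi, kc 2 psi -> T (avg p N h psi) = avg p N h (T psi)) ->
  (forall h psi, kc 2 psi -> T (D p h psi) = D p h (T psi)) ->
  (forall psi psi', kc 2 psi -> kc 2 psi' -> T (psi - psi') = T psi - T psi') ->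
  (bounded psi in tc 2 U, ip g (X p (T psi))) ->
  (bounded psi in tc 2 U, ip g (T psi)) -> cutf 2 b ->
  exists2 C, 0 <= C & exists2 h0, 0 < h0 & forall h psi, ok h -> `|h| <= h0 ->
    tc 2 Pos psi -> `|ip g (T (b * D p h psi))| <= C * nrm psi.
Proof.
move=> kT aT DT BT HX [C2 C20 B2] cb.
have [C1 C10 [h1 h10 B1]] := bdD kT aT HX; have [h2 h20 Hh] := step_ex p.
have [M M0 HM] := cutf_bd cb; have [M' M'0 HM'] := ub_cut p cb.
exists (C1 * M + C2 * M'); first by rewrite addr_ge0// mulr_ge0.
exists (Num.min h1 h2); first by rewrite lt_min h10.
move=> h psi oh; rewrite le_min => /andP[hh1 hh2] tp; have sp := kc_sq (tc_kc tp).
have tb := tc_cut1 cb tp; have tD := Dcut Hh hh2 cb tp.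
have kb := tc_kc tb; have kD := tc_kc tD.
have kDb : kc 2 (D p h (b * psi)) by exact: (kc_D Hflat).
have sT f : kc 2 f -> sq (T f) by move=> kf; exact: kc_sq (kT _ kf).
rewrite D_mul (BT _ _ kDb kD) (ipBr (sT _ kDb) (sT _ kD) sg) (DT _ _ kb).
apply: (le_trans (ler_normB _ _)); rewrite mulrDl -(mulrA C1) -(mulrA C2); apply: lerD.
  apply: (le_trans (B1 h _ oh hh1 tb)); rewrite ler_wpM2l//; apply: nrm_mulb => //.
  by apply: continuous_measurable_rV; exact: (Ck_cont cb.1).
apply: (le_trans (B2 _ tD)); rewrite ler_wpM2l//.
rewrite -(nrm_tau Hflat p h sp); apply: nrm_mulb => //; last exact: (sq_tau Hflat).
  apply: continuous_measurable_rV; apply: (@Ck_cont _ _ 2); apply: CkZ; apply: CkB; last exact: cb.1.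
  by apply: (Ck_tau Hflat) => //; exact: cb.1.
by move=> x; exact: HM'.
Qed.

(** Putting [D chi] for [phi] in [W1] would produce the normal derivative of the quotient. By [mix]
    only that of [chi] itself occurs, which is the form the energy argument for the quotient of the
    extended function needs. *)
Lemma W2 l : exists2 C, 0 <= C & exists2 h0, 0 < h0 & forall h chi, ok h -> `|h| <= h0 -> tc 3 Pos chi ->
  `|ip (zeta * g) (Q (Q (D (e_ l) h chi)))| <= C * (nrm (D (e_ l) h chi) + nrm (Q chi)).
Proof.
have [C C0 HC] := W0_bound.
have cz := cutf_le le2_3 cutf_z3.
have cr m : Ck 2 (pd m rho) := Ck_le le2_3 (Ck_pd m Hrho).
have kX m psi : kc 2 psi -> kc 1 (Xm m psi) := kc_X Hflat (e_ m) le1_3.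
have aX m N h psi : kc 2 psi -> Xm m (avg (e_ l) N h psi) = avg (e_ l) N h (Xm m psi).
  by move=> kp; apply: X_avg; exact: (Ck_le le1_2 kp.1).
have DX m h psi : kc 2 psi -> Xm m (D (e_ l) h psi) = D (e_ l) h (Xm m psi).
  by move=> kp; apply: (X_D Hflat); exact: (Ck_le le1_2 kp.1).
have BX m psi psi' : kc 2 psi -> kc 2 psi' -> Xm m (psi - psi') = Xm m psi - Xm m psi'.
  by move=> kp kp'; apply: XB; [exact: (Ck_le le1_2 kp.1)|exact: (Ck_le le1_2 kp'.1)].
have /all_sig[Ch HCh] m : {Ch : R * R | [/\ 0 <= Ch.1, 0 < Ch.2 & forall h psi, ok h -> `|h| <= Ch.2 ->
    tc 2 Pos psi -> `|ip g (Xm m (z3 * pd m rho * D (e_ l) h psi))| <= Ch.1 * nrm psi]}.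
  apply: cid; have [Cm Cm0 [hm hm0 Hm]] := mix (kX m) (aX m) (DX m) (BX m) (H2 l m) (H1 m) (cutfM cz (cr m)).
  by exists (Cm, hm).
pose C2 m := (Ch m).1; pose h2 m := (Ch m).2.
have C20 m : 0 <= C2 m by case: (HCh m).
have h20 m : 0 < h2 m by case: (HCh m).
have B2 m : forall h psi, ok h -> `|h| <= h2 m -> tc 2 Pos psi ->
    `|ip g (Xm m (z3 * pd m rho * D (e_ l) h psi))| <= C2 m * nrm psi by case: (HCh m).
have H0 : bounded psi in tc 2 U, ip g psi.
  by exists (nrm g); [exact: nrm_ge0|move=> psi tp; apply: ip_CS => //; exact: kc_sq (tc_kc tp)].
have [C3 C30 [h3 h30 B3]] := @mix (e_ l) id W0beta (fun psi kp => kc_le le1_2 kp)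
  (fun _ _ _ _ => erefl) (fun _ _ _ => erefl) (fun _ _ _ _ => erefl) (H1 l) H0 cutf_beta.
pose CS := \sum_m 2 * C2 m.
have CS0 : 0 <= CS by apply: sumr_ge0 => m _; rewrite mulr_ge0.
exists (C + (CS + C3)); first by rewrite !addr_ge0.
exists (\big[Num.min/h3]_m h2 m).
  by apply: (big_ind (fun x => 0 < x)) => // x y x1 y1; rewrite lt_min x1.
move=> h chi oh hh tp; have tQ : tc 2 Pos (Q chi) by exact: tc_dv.
have hm m : `|h| <= h2 m by apply: le_trans hh _; rewrite (bigD1 m)//= ge_min lexx.
have hh3 : `|h| <= h3 by apply: le_trans hh _; exact: bigmin_le_id.
have tD := tc_D_Pos (e_ l) h le3_4 tp.
have := HC _ tD; rewrite (Q_D (e_ l) h (Ck_le le1_3 tp.1)) => i0.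
have i2 := B3 h _ oh hh3 tQ.
have i1 : \sum_m (2 * `|ip g (Xm m (z3 * pd m rho * D (e_ l) h (Q chi)))|) <= CS * nrm (Q chi).
  by rewrite /CS mulr_suml; apply: ler_sum => m _; rewrite -(mulrA 2 (C2 m)); exact: (ler_wpM2l (ler0n R 2) (B2 m h _ oh (hm m) tQ)).
exact: (W1_tri C0 CS0 C30 (nrm_ge0 _) (nrm_ge0 _) i0 i1 i2).
Qed.

End localized.

End halfspace.

(** * Normal regularity by reflection *)

Section reflection.
Context {R : realType} {n : nat}.
Local Notation V := 'rV[R]_n.
Implicit Types (f g phi psi b : V -> R) (O : set V).
Variables (rho : V -> R) (q : V).
Hypothesis Hflat : flat rho q.
Hypothesis Hq1 : forall x t, rho (x + t *: q) = rho x + t.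
Local Notation X := (Xder rho q).
Local Notation Q := (dv q).
Local Notation tau := (ftau rho q).
Local Notation D := (Dquo rho q).
Local Notation S := (Sflow rho q).
Local Notation avg := (favg rho q).
Let Hrho : Ck 4 rho. Proof. by case: Hflat. Qed.
Let Pos := [set x | 0 < rho x].

(** Reflection across the boundary along [q]: it multiplies [rho] by $-a$. *)
Definition mir (a : R) : V -> V := shear 0 q (fun x => - (1 + a) * rho x).

Lemma mirE a x : mir a x = x + (- (1 + a) * rho x) *: q.
Proof. by rewrite /mir /shear addr0. Qed.

Lemma rho_mir a x : rho (mir a x) = - a * rho x.
Proof. by rewrite mirE Hq1; ring. Qed.

Lemma mirK a x : a != 0 -> mir a^-1 (mir a x) = x.
Proof.
move=> a0; rewrite mirE rho_mir mirE -addrA -scalerDl.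
suff -> : - (1 + a) * rho x + - (1 + a^-1) * (- a * rho x) = 0 by rewrite scale0r addr0.
by field.
Qed.

Let Cth a k : (k <= 4)%N -> Ck k (fun x => - (1 + a) * rho x).
Proof. by move=> k4; exact: (CkZ (- (1 + a)) (Ck_le k4 Hrho)). Qed.

Lemma Ck_mir a k f : (k <= 4)%N -> Ck k f -> Ck k (f \o mir a).
Proof. by move=> k4 Hf; apply: Ck_shear => //; exact: Cth. Qed.

Lemma dv_mir w a f : Ck 1 f ->
  dv w (f \o mir a) = dv w f \o mir a - (1 + a) *: (dv w rho * (Q f \o mir a)).
Proof.
move=> Hf; rewrite {1}/dv /mir.
under eq_bigr do rewrite (pd_shear _ _ _ Hf (Cth a le1_4)) scalerDr.
rewrite big_split /=; congr (_ + _); apply/funext => x.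
  by rewrite /dv /= !fct_sumE.
rewrite /dv !fctE !fct_sumE /GRing.scale /= mulr_suml mulr_sumr -sumrN; apply: eq_bigr => i _.
rewrite !fctE /GRing.scale /=.
have -> : (fun x0 => - (1 + a) * rho x0) = - (1 + a) *: rho by [].
rewrite (pdZ1 _ _ (Ck_le le1_4 Hrho)) -[X in _ * (X * _)]/(- (1 + a) * pd i rho x).
by move: (pd i rho x) (w ord0 i) => u v; ring.
Qed.

Lemma Q_mir a f : Ck 1 f -> Q (f \o mir a) = - a *: (Q f \o mir a).
Proof.
move=> Hf; rewrite (dv_mir _ _ Hf) (Q_rho Hflat Hq1); apply/funext => x.
by rewrite !fctE /GRing.scale /=; ring.
Qed.

Lemma X_mir p a f : Ck 1 f -> X p (f \o mir a) = X p f \o mir a.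
Proof.
move=> Hf; rewrite /Xder (dv_mir _ _ Hf) (Q_mir _ Hf); apply/funext => x.
have E : dv p rho (mir a x) = dv p rho x by rewrite mirE (dv_flat Hflat).
rewrite -[RHS]/(dv p f (mir a x) - dv p rho (mir a x) * Q f (mir a x)) E.
by rewrite !fctE /GRing.scale /=; ring.
Qed.

Lemma mir_S a p h x : mir a (S p h x) = S p h (mir a x).
Proof. by rewrite !mirE (rho_S p x h Hq1) (S_flat Hflat). Qed.

Let mth a : measurable_fun [set: V] (fun x => - (1 + a) * rho x).
Proof. by apply: continuous_measurable_rV; exact: (Ck_cont (Cth a (leq0n 4))). Qed.
Let tha a x t : - (1 + a) * rho (x + t *: q) = - (1 + a) * rho x + (- a - 1) * t.
Proof. by rewrite Hq1; ring. Qed.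
Let mirF a : mir a = fun x => x + (- (1 + a) * rho x) *: q.
Proof. by apply/funext => x; rewrite mirE. Qed.

Lemma sq_mir a f : a != 0 -> sq f -> sq (f \o mir a).
Proof. by move=> a0 sf; rewrite mirF; apply: (sq_shear (a := - a)) => //; rewrite oppr_eq0. Qed.

Lemma nrm_mir a f : 1 <= a -> sq f -> nrm (f \o mir a) <= nrm f.
Proof.
move=> a1 sf; have a0 : - a != 0 by rewrite oppr_eq0 gt_eqF// (lt_le_trans ltr01).
rewrite -(nrm_shear a0 (mth a) (tha a) sf) normrN -mirF ler_peMl ?nrm_ge0//.
by rewrite -[leLHS]sqrtr1 ler_sqrt ?normr_ge0// ger0_norm// (le_trans ler01).
Qed.

Lemma bs_mir a L f : a != 0 -> bs L f -> exists L', bs L' (f \o mir a).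
Proof.
move=> a0 bf; have [_ brho _] := Hflat.
have [M M0 HM] := lip_bdp (Ck_le le1_4 Hrho) (bdp_le le1_4 brho).
exists (L + `|1 + a^-1| * (`|rho 0| + M * L) * `|q|) => x xL; apply/eqP/contraT => fx.
have yL : `|mir a x| <= L by rewrite leNgt; apply/negP => /bf; apply/eqP.
suff : `|x| <= L + `|1 + a^-1| * (`|rho 0| + M * L) * `|q| by rewrite leNgt xL.
rewrite -{1}(mirK x a0); move: (mir a x) yL => y yL; rewrite mirE.
apply: (le_trans (ler_normD _ _)); apply: lerD => //.
rewrite normrZ normrM normrN ler_wpM2r// ler_wpM2l//.
have := HM y 0; rewrite subr0 => h.
have h2 := ler_distD 0 (rho y) (rho 0); have h3 := lerB_dist (rho y) (rho 0).
have h4 : M * `|y| <= M * L by rewrite ler_wpM2l.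
move: h h3 h4; lra.
Qed.

(* The weights solve sum_j mc 0 j (- j - 1)^m = - 1 for m <= 3, so that [rf k f] and
   its derivatives along [q] vanish on {rho = 0} up to order 3 - k. *)
Definition mc (k : nat) (j : 'I_4) : R :=
  nth 0 [:: -10; 20; -15; 4] j * (- (j.+1%:R)) ^+ k.

Definition rf k f : V -> R := f + \sum_(j < 4) mc k j *: (f \o mir j.+1%:R).

Lemma mcS k j : mc k.+1 j = - j.+1%:R * mc k j.
Proof. by rewrite /mc exprS; ring. Qed.

Lemma mc_sum k : (k <= 3)%N -> \sum_j mc k j = -1.
Proof.
by case: k => [|[|[|[|k]]]]// _; rewrite /mc !big_ord_recl big_ord0 /= /bump /= ?addnS ?addn0 ?expr0 ?expr1 ?exprS /=; ring.
Qed.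

Lemma rfE k f x : rf k f x = f x + \sum_(j < 4) mc k j * f (mir j.+1%:R x).
Proof. by rewrite /rf !fctE fct_sumE. Qed.

Lemma Ck_rf k m f : (m <= 4)%N -> Ck m f -> Ck m (rf k f).
Proof.
move=> m4 Hf; apply: CkD => //; apply: Ck_sum => j _; apply: CkZ; exact: Ck_mir.
Qed.

Lemma kc_rf k m f : (m <= 4)%N -> kc m f -> kc m (rf k f).
Proof.
move=> m4 kf; apply: kcD => //; apply: kc_sum => j; apply: kcZ.
split; first exact: (Ck_mir _ m4 kf.1).
by have [L bL] := kf.2; apply: (bs_mir _ bL); rewrite pnatr_eq0.
Qed.

Lemma sq_rf k f : sq f -> sq (rf k f).
Proof.
by move=> sf; apply: sqD => //; apply: sq_sum => j _; apply: sqZ; apply: sq_mir; rewrite ?pnatr_eq0.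
Qed.

Lemma nrm_rf k : exists2 C, 0 <= C & forall f, sq f -> nrm (rf k f) <= C * nrm f.
Proof.
exists (1 + \sum_j `|mc k j|); first by rewrite addr_ge0// sumr_ge0.
move=> f sf; have sm j : sq (mc k j *: (f \o mir j.+1%:R)).
  by apply: sqZ; apply: sq_mir; rewrite ?pnatr_eq0.
have sS : sq (\sum_j mc k j *: (f \o mir j.+1%:R)) by apply: sq_sum => j _.
apply: (le_trans (nrmD sf sS)); rewrite mulrDl mul1r lerD2l.
apply: (le_trans (nrm_sum _ (fun j _ => sm j))); rewrite mulr_suml; apply: ler_sum => j _.
rewrite nrmZ; last by apply: sq_mir; rewrite ?pnatr_eq0.
by rewrite ler_wpM2l//; apply: nrm_mir => //; rewrite ler1n.
Qed.

Lemma rfD k f g : rf k (f + g) = rf k f + rf k g.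
Proof.
rewrite /rf addrACA -big_split /=; congr (_ + _); apply: eq_bigr => j _; by rewrite -scalerDr.
Qed.
Lemma rfZ k a f : rf k (a *: f) = a *: rf k f.
Proof.
rewrite /rf scalerDr scaler_sumr; congr (_ + _); apply: eq_bigr => j _.
by rewrite scalerA mulrC -scalerA.
Qed.

(** Differentiating along [q] multiplies the term with dilation $j+1$ by $-(j+1)$, which is the
    passage from the weights of index [k] to those of index $k+1$. *)
Lemma Q_rf k f : Ck 1 f -> Q (rf k f) = rf k.+1 (Q f).
Proof.
move=> Hf; have Hm j : Ck 1 (mc k j *: (f \o mir j.+1%:R)) by apply: CkZ; exact: Ck_mir.
rewrite /rf (dvD _ Hf); last by apply: Ck_sum => j _.
congr (_ + _).
transitivity (\sum_j Q (mc k j *: (f \o mir j.+1%:R))).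
  by rewrite /dv exchange_big /=; apply: eq_bigr => i _; rewrite pd_sum// scaler_sumr.
apply: eq_bigr => j _; rewrite dvZ ?Q_mir//; last exact: Ck_mir.
by rewrite scalerA mcS mulrC.
Qed.

Lemma X_rf p k f : Ck 1 f -> X p (rf k f) = rf k (X p f).
Proof.
move=> Hf; have Hm j : Ck 1 (mc k j *: (f \o mir j.+1%:R)) by apply: CkZ; exact: Ck_mir.
rewrite /rf (XD _ _ _ Hf); last by apply: Ck_sum => j _.
rewrite X_sum//; congr (_ + _); apply: eq_bigr => j _.
by rewrite XZ ?X_mir//; exact: Ck_mir.
Qed.

Lemma rf_D k p h f : rf k (D p h f) = D p h (rf k f).
Proof.
rewrite /Dquo rfZ; congr (_ *: _); rewrite -scaleN1r rfD rfZ scaleN1r; congr (_ - _).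
apply/funext => x; rewrite /rf !fctE !fct_sumE; congr (_ + _); apply: eq_bigr => j _.
by rewrite !fctE mir_S.
Qed.

Lemma rf_zero k f x : (k <= 3)%N -> rho x = 0 -> rf k f x = 0.
Proof.
move=> k3 rx; rewrite rfE.
under eq_bigr do rewrite mirE rx mulr0 scale0r addr0.
by rewrite -mulr_suml mc_sum// mulN1r subrr.
Qed.

(** The reflected points lie outside [Pos], so a function living in [Pos] is not altered there: the
    adjoint extends [G] without changing it on [Pos]. *)
Lemma rf_pos k f x : (forall y, ~ Pos y -> f y = 0) -> 0 < rho x -> rf k f x = f x.
Proof.
move=> f0 rx; rewrite rfE big1 ?addr0// => j _; rewrite f0 ?mulr0//.
by rewrite /Pos /= rho_mir mulNr oppr_gt0 => h; move: (mulr_gt0 (ltr0Sn R j) rx) h; lra.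
Qed.

Lemma open_Pos : open Pos.
Proof.
have -> : Pos = rho @^-1` [set y | 0 < y] by [].
by apply: open_comp; [move=> x _; exact: (Ck_cont Hrho)|exact: open_gt].
Qed.
Let mPos : measurable Pos. Proof. exact: open_measurable_rV open_Pos. Qed.

Let near_neg x : rho x < 0 -> exists2 U, open U /\ U x & forall y, U y -> ~ Pos y.
Proof.
move=> rx; exists (rho @^-1` [set y | y < 0]).
  by split=> //; apply: open_comp; [move=> y _; exact: (Ck_cont Hrho)|exact: open_lt].
by move=> y /= yn; rewrite /Pos /=; lra.
Qed.

Lemma Ind_cont f : continuous f -> (forall x, rho x = 0 -> f x = 0) -> continuous (Ind Pos * f).
Proof.
move=> cf f0; suff H (x : V) : (Ind Pos * f) @ x --> (Ind Pos * f) x by move=> x; exact: H.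
have [rx|rx|rx] := ltrgtP (rho x) 0.
- have [U [oU Ux] HU] := near_neg rx.
  have E : (Ind Pos * f) x = 0 by rewrite -[LHS]/(Ind Pos x * f x) Ind0 ?mul0r//; exact: HU.
  rewrite E; apply/(@cvgrPdist_le _ _ _ (nbhs x)) => e e0; apply: filterS (open_nbhs_nbhs (conj oU Ux)) => y Uy.
  rewrite -[(Ind Pos * f) y]/(Ind Pos y * f y) Ind0 ?mul0r ?subrr ?normr0 ?ltW//; exact: HU.
- have E : (Ind Pos * f) x = f x by rewrite -[LHS]/(Ind Pos x * f x) Ind1 ?mul1r.
  rewrite E; apply/(@cvgrPdist_le _ _ _ (nbhs x)) => e e0.
  have /(@cvgrPdist_le _ _ _ (nbhs x)) /(_ e e0) := cf x.
  apply: filterS2 (open_nbhs_nbhs (conj open_Pos (rx : Pos x))) => y py.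
  by rewrite -[X in _ -> `|_ - X| <= _]/(Ind Pos y * f y) Ind1 ?mul1r.
- have E : (Ind Pos * f) x = 0 by rewrite -[LHS]/(Ind Pos x * f x) f0// mulr0.
  rewrite E; apply/(@cvgrPdist_le _ _ _ (nbhs x)) => e e0.
  have := cf x; rewrite /continuous_at (f0 x rx) => /(@cvgrPdist_le _ _ _ (nbhs x)) /(_ e e0); apply: filterS => y.
  rewrite !sub0r !normrN; apply: le_trans; rewrite -[(Ind Pos * f) y]/(Ind Pos y * f y) normrM.
  by apply: ler_piMl => //; exact: Ind_le.
Qed.

(** At a boundary point the quotients of the extension by zero are dominated by those of [f], which
    tend to 0 there. *)
Lemma Ind_pd i f : Ck 1 f -> (forall x, rho x = 0 -> f x = 0) -> (forall x, rho x = 0 -> pd i f x = 0) ->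
  (forall x, derivable (Ind Pos * f) x (e_ i)) /\ pd i (Ind Pos * f) = Ind Pos * pd i f.
Proof.
move=> Hf f0 df0.
suff H x : is_derive x (e_ i) (Ind Pos * f) ((Ind Pos * pd i f) x).
  split=> [x|]; first by have := H x => -[].
  by apply/funext => x; have := H x => -[_].
have Hd : derivable f x (e_ i) by exact: Ck_derivable Hf.
have isd (l : R) : (fun h => h^-1 *: ((Ind Pos * f) (h *: e_ i + x) - (Ind Pos * f) x)) @ 0^' --> l ->
    is_derive x (e_ i) (Ind Pos * f) l.
  by move=> cl; split; [apply/cvg_ex; exists l|exact: cvg_lim].
apply: isd.
have cont_line : (fun h : R => h *: e_ i + x) @ 0^' --> x.
  apply: cvg_trans (_ : (fun h : R => h *: e_ i + x) @ nbhs 0 --> x).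
    by apply: cvg_app; exact: cvg_within.
  rewrite -[X in _ --> X]add0r; apply: cvgD; last exact: cvg_cst.
  by rewrite -[X in _ --> X](scale0r (e_ i)); apply: cvgZr_tmp; exact: cvg_id.
have df : (fun h => h^-1 *: (f (h *: e_ i + x) - f x)) @ 0^' --> pd i f x by exact: Hd.
have [rx|rx|rx] := ltrgtP (rho x) 0.
- have [U [oU Ux] HU] := near_neg rx.
  have Z y : U y -> (Ind Pos * f) y = 0 by move=> /HU ny; rewrite -[LHS]/(Ind Pos y * f y) Ind0// mul0r.
  have -> : (Ind Pos * pd i f) x = 0 by rewrite -[LHS]/(Ind Pos x * pd i f x) Ind0 ?mul0r//; exact: HU.
  apply: cvg_near_cst; near=> h; rewrite !Z ?subrr ?scaler0//.
  near: h; exact: (cont_line _ (open_nbhs_nbhs (conj oU Ux))).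
- have Z y : 0 < rho y -> (Ind Pos * f) y = f y by move=> py; rewrite -[LHS]/(Ind Pos y * f y) Ind1// mul1r.
  have -> : (Ind Pos * pd i f) x = pd i f x by rewrite -[LHS]/(Ind Pos x * pd i f x) Ind1 ?mul1r.
  apply: cvg_trans df; apply: near_eq_cvg; near=> h; rewrite !Z//.
  near: h; exact: (cont_line _ (open_nbhs_nbhs (conj open_Pos (rx : Pos x)))).
- have E y : rho y = 0 -> (Ind Pos * f) y = 0 by move=> ry; rewrite -[LHS]/(Ind Pos y * f y) f0// mulr0.
  have -> : (Ind Pos * pd i f) x = 0 by rewrite -[LHS]/(Ind Pos x * pd i f x) df0// mulr0.
  move: df; rewrite (df0 x rx) (f0 x rx) => df; apply/cvgrPdist_le => e e0.
  move/cvgrPdist_le : df => /(_ e e0); apply: filterS => h.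
  rewrite !sub0r !normrN (E x rx) !subr0 !normrZ; apply: le_trans; rewrite ler_wpM2l//.
  by apply: ler_piMl => //; exact: Ind_le.
Unshelve. all: by end_near. Qed.

Lemma pd_brf i k b f : Ck 1 b -> Ck 1 f -> pd i (b * rf k f) =
  pd i b * rf k f + (b * rf k (X (e_ i) f) + (b * pd i rho) * rf k.+1 (Q f)).
Proof.
move=> Hb Hf; have Hr := Ck_rf k le1_4 Hf.
rewrite (pdM1 i Hb Hr) (pdE rho q i (rf k f)) (X_rf _ _ Hf) (Q_rf _ Hf).
by apply/funext => x; rewrite !fctE; ring.
Qed.

(** A derivative of [b * rf k f] is a sum of terms of the same shape, the normal one with index
    $k+1$. All of them vanish on the boundary as long as the index is at most 3, which is the count
    $k+m \le 3$. *)
Lemma Ck_Ind m k b f : (k + m <= 3)%N -> Ck m b -> Ck m f -> Ck m (Ind Pos * (b * rf k f)).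
Proof.
elim: m k b f => [|m IH] k b f km Hb Hf.
  have k3 : (k <= 3)%N by lia.
  apply/Ck0; apply: Ind_cont; first by apply/Ck0; apply: CkM => //; exact: Ck_rf.
  by move=> x rx; rewrite -[LHS]/(b x * rf k f x) rf_zero// mulr0.
have k3 : (k <= 3)%N by lia. have k4 : (k.+1 <= 3)%N by lia.
have Hb1 := Ck_le (isT : (1 <= m.+1)%N) Hb; have Hf1 := Ck_le (isT : (1 <= m.+1)%N) Hf.
have H1 : Ck 1 (b * rf k f) by apply: CkM => //; exact: Ck_rf.
have Z x : rho x = 0 -> (b * rf k f) x = 0 by move=> rx; rewrite -[LHS]/(b x * rf k f x) rf_zero// mulr0.
have dZ i x : rho x = 0 -> pd i (b * rf k f) x = 0.
  move=> rx; rewrite (pd_brf i k Hb1 Hf1).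
  rewrite -[LHS]/(pd i b x * rf k f x + (b x * rf k (X (e_ i) f) x + (b x * pd i rho x) * rf k.+1 (Q f) x)).
  by rewrite !rf_zero// !mulr0 !addr0.
apply/CkS; split=> [|i x|i].
- by apply: Ind_cont => //; exact: Ck_cont H1.
- exact: (Ind_pd H1 Z (dZ i)).1.
rewrite (Ind_pd H1 Z (dZ i)).2 (pd_brf i k Hb1 Hf1) mulrDr [X in _ + X]mulrDr.
have m3 : (m <= 3)%N by lia.
have bm := Ck_le (leqnSn m) Hb.
have km1 : (k + m <= 3)%N by lia. have km2 : (k.+1 + m <= 3)%N by lia.
apply: CkD; first exact: (IH k (pd i b) f km1 (Ck_pd i Hb) (Ck_le (leqnSn m) Hf)).
apply: CkD; first exact: (IH k b (X (e_ i) f) km1 bm (Ck_X Hflat (e_ i) m3 Hf)).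
exact: (IH k.+1 (b * pd i rho) (Q f) km2 (CkM bm (Ck_le m3 (Ck_pd i Hrho))) (Ck_dv q Hf)).
Qed.

(** Maps functions on the whole space to functions vanishing outside [Pos]. Subtracting reflections
    makes the cut at the boundary smooth. *)
Definition ext_refl k f : V -> R := Ind Pos * rf k f.

Lemma kc_er m k f : (k + m <= 3)%N -> kc m f -> kc m (ext_refl k f).
Proof.
move=> km [Hf [L bL]]; have m4 : (m <= 4)%N by lia.
have [_ [L' bL']] := kc_rf k m4 (conj Hf (ex_intro _ L bL)); split; last by exists L'; exact: bs_mull.
rewrite /ext_refl (_ : rf k f = cst 1 * rf k f); last by apply/funext => x; rewrite -[RHS]/(1 * rf k f x) mul1r.
by apply: Ck_Ind => //; exact: Ck_cst.
Qed.

Lemma Q_er k f : (k <= 2)%N -> Ck 1 f -> Q (ext_refl k f) = ext_refl k.+1 (Q f).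
Proof.
move=> k2 Hf; rewrite /ext_refl -(Q_rf _ Hf).
have k3 : (k <= 3)%N by lia. have k4 : (k.+1 <= 3)%N by lia.
have H1 := Ck_rf k le1_4 Hf.
suff E i : pd i (Ind Pos * rf k f) = Ind Pos * pd i (rf k f).
  apply/funext => x; rewrite -[RHS]/(Ind Pos x * dv q (rf k f) x) /dv !fct_sumE mulr_sumr.
  apply: eq_bigr => i _; rewrite E -[LHS]/(q ord0 i * (Ind Pos x * pd i (rf k f) x)).
  by rewrite -[in RHS]/(q ord0 i * pd i (rf k f) x) mulrCA.
have e1 : rf k f = cst 1 * rf k f by apply/funext => x; rewrite -[RHS]/(1 * rf k f x) mul1r.
apply: (Ind_pd H1 _ _).2 => [x rx|x rx]; first exact: rf_zero.
rewrite {1}e1 (pd_brf i k (Ck_cst 1 1) Hf) pd_cst.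
rewrite -[LHS]/(0 * rf k f x + (1 * rf k (X (e_ i) f) x + (1 * pd i rho x) * rf k.+1 (Q f) x)).
by rewrite !rf_zero// !mulr0 !addr0.
Qed.

Lemma Ind_S p h x : Ind Pos (S p h x) = Ind Pos x.
Proof.
case: (pselect (Pos x)) => px; last by rewrite !Ind0// /Pos /= (rho_S p x h Hq1).
by rewrite !Ind1// /Pos /= (rho_S p x h Hq1).
Qed.

Lemma D_Ind p h f : D p h (Ind Pos * f) = Ind Pos * D p h f.
Proof.
apply/funext => x; rewrite -[LHS]/(h^-1 * (Ind Pos (S p h x) * f (S p h x) - Ind Pos x * f x)) Ind_S.
by rewrite -[RHS]/(Ind Pos x * (h^-1 * (f (S p h x) - f x))); ring.
Qed.

Lemma D_er k p h f : ext_refl k (D p h f) = D p h (ext_refl k f).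
Proof. by rewrite /ext_refl rf_D D_Ind. Qed.

Lemma sq_er k f : sq f -> sq (ext_refl k f).
Proof. by move=> sf; apply: sq_Ind => //; exact: sq_rf. Qed.

Lemma nrm_er k : exists2 C, 0 <= C & forall f, sq f -> nrm (ext_refl k f) <= C * nrm f.
Proof.
have [C C0 HC] := nrm_rf k; exists C => // f sf; apply: le_trans (HC f sf).
rewrite -[leRHS]mul1r; apply: nrm_mulb; [exact: measurable_Ind|exact: Ind_le|exact: sq_rf].
Qed.

(** Shifting along [q] lifts the support to where [rho] exceeds [e]; the Lipschitz bound on [rho]
    turns this into a margin. *)
Lemma shift_tc m f e : 0 < e -> Ck m f -> (exists L, bs L f) -> (forall x, ~ Pos x -> f x = 0) ->
  tc m Pos (f \o trans (- (e *: q))).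
Proof.
move=> e0 Hf [L bL] f0; split; first exact: Ck_trans.
have [_ brho _] := Hflat.
have [M M0 HM] := lip_bdp (Ck_le le1_4 Hrho) (bdp_le le1_4 brho).
have P1 : 0 < M + 1 by rewrite ltr_wpDl.
exists (e / (M + 1)), (L + `|- (e *: q)|); split; first by rewrite divr_gt0.
move=> x fx; split; first by rewrite leNgt; apply/negP => /(bs_trans (c := - (e *: q)) bL)/eqP; exact/negP.
move=> y xy; have px : Pos (x - e *: q) by apply: contrapT => np; move: fx; rewrite -[X in X != 0]/(f (x - e *: q)) f0// eqxx.
move: px; rewrite /Pos /= -scaleNr Hq1 => px; have h := HM x y.
have h2 : M * `|x - y| < e.
  move: xy; rewrite ltr_pdivlMr// mulrDr mulr1 mulrC; have := normr_ge0 (x - y); lra.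
by have := ler_norm (rho x - rho y); lra.
Qed.

Lemma tau0q h f : ftau (cst 0) 0 q h f = f \o trans (h *: q).
Proof. exact: tau_flat0. Qed.

Lemma nrm_shift h f : h != 0 -> kc 1 f -> nrm (f \o trans (h *: q) - f) <= `|h| * nrm (Q f).
Proof.
move=> h0 kf; have := nrm_D flat0 q h0 kf; rewrite X_flat0.
have -> : f \o trans (h *: q) - f = h *: Dquo (cst 0) 0 q h f.
  have := tau0q h f; rewrite /ftau /Dquo => ->; by rewrite scalerA mulfV// scale1r.
have sf := kc_sq kf; have sD : sq (Dquo (cst 0) 0 q h f) := sq_D flat0 q h sf.
by rewrite (nrmZ _ sD) => H; rewrite ler_wpM2l.
Qed.

End reflection.

(** * Further bounds for quotients and averages *)

Section flow_bounds.
Context {R : realType} {n : nat}.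
Local Notation V := 'rV[R]_n.
Implicit Types (f g phi psi b y : V -> R).
Variables (rho : V -> R) (q p : V).
Hypothesis Hflat : flat rho q.
Local Notation X := (Xder rho q p).
Local Notation D := (Dquo rho q p).
Local Notation S := (Sflow rho q p).
Local Notation avg := (favg rho q p).

Lemma D_B h f g : D h (f - g) = D h f - D h g.
Proof.
apply/funext => x; rewrite -[LHS]/(h^-1 * (f (S h x) - g (S h x) - (f x - g x))).
by rewrite -[RHS]/(h^-1 * (f (S h x) - f x) - h^-1 * (g (S h x) - g x)); ring.
Qed.

Lemma nrm_D_le h f : sq f -> nrm (D h f) <= `|h^-1| * 2 * nrm f.
Proof.
move=> sf; have st := sq_tau Hflat p h sf.
rewrite /Dquo (nrmZ _ (sqB st sf)) -mulrA ler_wpM2l//.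
apply: (le_trans (nrmB st sf)); rewrite (nrm_tau Hflat p h sf) mulrDl mul1r//.
Qed.

Lemma nrm_DN h f : sq f -> nrm (D (- h) f) = nrm (D h f).
Proof.
move=> sf; rewrite -(nrm_tau Hflat p (- h) (sq_D Hflat p h sf)); congr nrm.
apply/funext => x; rewrite -[RHS]/(h^-1 * (f (S h (S (- h) x)) - f (S (- h) x))) (SK Hflat).
by rewrite -[LHS]/((- h)^-1 * (f (S (- h) x) - f x)) invrN; ring.
Qed.

Lemma avg_D N h k f : avg N h (D k f) = D k (avg N h f).
Proof.
apply/funext => x; rewrite /favg /Dquo.
have E g z : (\sum_(j < N.+1) ftau rho q p (h * j%:R / N.+1%:R) g) z =
   \sum_(j < N.+1) g (S (h * j%:R / N.+1%:R) z) by rewrite fct_sumE.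
rewrite -[RHS]/(k^-1 * (N.+1%:R^-1 * (\sum_(j < N.+1) ftau rho q p (h * j%:R / N.+1%:R) f) (S k x)
  - N.+1%:R^-1 * (\sum_(j < N.+1) ftau rho q p (h * j%:R / N.+1%:R) f) x)).
rewrite -[LHS]/(N.+1%:R^-1 * (\sum_(j < N.+1) ftau rho q p (h * j%:R / N.+1%:R) (k^-1 *: (f \o S k - f))) x).
rewrite !E -mulrBr -sumrB mulrCA; congr (_ * _); rewrite mulr_sumr; apply: eq_bigr => j _.
rewrite -[LHS]/(k^-1 * (f (S k (S (h * j%:R / N.+1%:R) x)) - f (S (h * j%:R / N.+1%:R) x))).
by rewrite !(S_add Hflat) (addrC k).
Qed.

Lemma kc_avg m N h f : (m <= 4)%N -> kc m f -> kc m (avg N h f).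
Proof.
move=> m4 kf; apply: kcZ; apply: kc_sum => j; exact: (kc_tau Hflat).
Qed.

Lemma D_dual f g B : kc 1 f -> sq g -> (exists2 h0, 0 < h0 & forall h, ok h -> `|h| <= h0 -> `|ip g (D h f)| <= B) ->
  `|ip g (X f)| <= B.
Proof.
move=> kf sg [h0 h00 HB]; apply/ler_addgt0Pr => e e0.
have P1 : 0 < nrm g + 1 by rewrite ltr_wpDl// nrm_ge0.
have [d d0 Hd] := D_lim Hflat p kf (divr_gt0 e0 P1).
pose h := Num.min (Num.min h0 (d / 2)) 1.
have hp : 0 < h by rewrite !lt_min h00 ltr01 divr_gt0.
have oh : ok h by split; [rewrite gt_eqF|rewrite gtr0_norm// ge_min lexx orbT].
have hh : `|h| <= h0 by rewrite gtr0_norm// !ge_min lexx.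
have hd : `|h| < d.
  rewrite gtr0_norm// (le_lt_trans (y := d / 2))//; first by rewrite !ge_min lexx orbT.
  by rewrite ltr_pdivrMr// mulr2n mulrDr mulr1 ltrDl.
have sX : sq (X f) := kc_sq (kc_X Hflat p le0_3 kf).
have sD : sq (D h f) := sq_D Hflat p h (kc_sq kf).
have -> : ip g (X f) = ip g (D h f) - ip g (D h f - X f).
  by rewrite (ipBr sD sX sg); ring.
apply: (le_trans (ler_normB _ _)); apply: lerD; first exact: HB.
have i1 := ip_CS sg (sqB sD sX); apply: (le_trans i1).
have i2 := Hd h oh.1 hd; have N0 := nrm_ge0 g.
apply: (@le_trans _ _ (nrm g * (e / (nrm g + 1)))); first by rewrite ler_wpM2l.
by rewrite mulrCA ler_piMr ?(ltW e0)// ler_pdivrMr// mul1r; move: N0; lra.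
Qed.

End flow_bounds.

(** * The energy estimate on the whole space *)

Section energy_extension.
Context {R : realType} {n : nat}.
Local Notation V := 'rV[R]_n.
Implicit Types (f g phi psi b y : V -> R).
Variable q : V.
Local Notation Q := (dv q).
Local Notation D0 := (Dquo (cst 0) 0 q).
Local Notation avg0 := (favg (cst 0) 0 q).

Lemma sqr_bound (t C B : R) : 0 <= C -> 0 <= B -> 0 <= t -> t ^+ 2 <= C * (B + t) -> t <= C + B + 1.
Proof. by move=> C0 B0 t0 h; rewrite leNgt; apply/negP => H; nra. Qed.

Variables (y : V -> R) (T : (V -> R) -> V -> R) (B C K : R).
Hypothesis sy : sq y.
Hypothesis B0 : 0 <= B.
Hypothesis C0 : 0 <= C.
Hypothesis K0 : 0 <= K.
Hypothesis sT : forall f, sq f -> sq (T f).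
Hypothesis TD : forall f g, T (f - g) = T f - T g.
Hypothesis Tavg : forall N s f, T (avg0 N s f) = avg0 N s (T f).
Hypothesis TK : forall f, sq f -> nrm (T f) <= K * nrm f.
Hypothesis TB : nrm (T y) <= B.
(** Used with [T] the identity or a tangential quotient. The operator norm [K] of [T], which may
    blow up with the step, does not enter the final bound; only the bound [B] on [T y] does. *)
Hypothesis HQ : forall phi, kc 3 phi -> `|ip y (Q (Q phi))| <= C * (nrm (T phi) + nrm (Q phi)).

Lemma Q_avg0 N s f : Ck 1 f -> Q (avg0 N s f) = avg0 N s (Q f).
Proof. by move=> Hf; have := X_avg flat0 q q N s Hf; rewrite !X_flat0. Qed.

(** Translation quotients along [q] are averages of $d_q$, so the hypothesis on $d_q^2$ passes to
    second quotients. Quotients, unlike $d_q$, may be applied to [y]. *)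
Lemma energy_DD s phi : s != 0 -> kc 4 phi ->
  `|ip y (D0 s (D0 (- s) phi))| <= C * (nrm (T phi) + nrm (D0 s phi)).
Proof.
move=> s0 kp; have ms0 : - s != 0 by rewrite oppr_eq0.
have kp1 := kc_le le1_4 kp; have kp3 := kc_le le3_4 kp.
have kD : kc 1 (D0 (- s) phi) := kc_D flat0 q (- s) le1_4 kp1.
have lim := avg_lim flat0 q s0 kp1; rewrite X_flat0 in lim.
apply: (avg_bound_lim flat0 s0 kD sy (tends0Z C0 lim)) => M; rewrite X_flat0.
have kQ : kc 3 (Q phi) := kc_dv q kp.
have kA : kc 3 (avg0 M s (Q phi)) := kc_avg q flat0 M s le3_4 kQ.
have -> : Q (D0 (- s) phi) = D0 (- s) (Q phi) by have := X_D flat0 q q (- s) kp1.1; rewrite !X_flat0.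
rewrite (avg_D _ flat0).
apply: (avg_bound flat0 ms0 (kc_le le1_3 kA) sy) => N; rewrite X_flat0.
have k2 : kc 3 (avg0 M s phi) := kc_avg q flat0 M s le3_4 kp3.
have k3 : kc 3 (avg0 N (- s) (avg0 M s phi)) := kc_avg q flat0 N (- s) le3_4 k2.
have E1 : Q (avg0 N (- s) (avg0 M s phi)) = avg0 N (- s) (avg0 M s (Q phi)).
  by rewrite (Q_avg0 _ _ (Ck_le le1_3 k2.1)) (Q_avg0 _ _ kp1.1).
have E2 : avg0 N (- s) (Q (avg0 M s (Q phi))) = Q (Q (avg0 N (- s) (avg0 M s phi))).
  by rewrite E1 (Q_avg0 _ _ (Ck_le le1_3 kA.1)).
rewrite E2; apply: (le_trans (HQ k3)); rewrite -mulrDr ler_wpM2l// E1 !Tavg -addrA.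
have sTp := sT (kc_sq kp).
apply: lerD.
  apply: (le_trans (nrm_avg flat0 _ _ _ (sq_avg flat0 _ _ _ sTp))); exact: (nrm_avg flat0 _ _ _ sTp).
have sA := kc_sq kA; apply: (le_trans (nrm_avg flat0 _ _ _ sA)).
have sD := sq_D flat0 q s (kc_sq kp).
rewrite -{1}[avg0 M s (Q phi)](subKr (D0 s phi)); exact: (nrmB sD (sqB sD sA)).
Qed.

(** For [phi] close to [y] the previous lemma gives $t^2 \le C(B+t)$ with $t$ the norm of the
    quotient of [y]. Constants depending on [s] only multiply the distance from [phi] to [y], which
    tends to 0 with [s] fixed. *)
Lemma energy_bound s : s != 0 -> nrm (D0 s y) <= C + B + 1.
Proof.
move=> s0; apply: (sqr_bound C0 B0 (nrm_ge0 _)).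
have [phi Hphi lim] := @density R n setT y openT sy (fun x (nx : ~ setT x) => False_ind _ (nx I)).
have kp k : kc 4 (phi k) by case: (Hphi k) => ck cs; exact: tc_kc (conj (ck 4%N) cs).
have sp k := kc_sq (kp k).
pose K1 := `|s^-1| * 2; have K10 : 0 <= K1 by rewrite mulr_ge0.
have KK : 0 <= C * (K + K1) + nrm y * (`|s^-1| * 2 * (`|(- s)^-1| * 2)).
  by rewrite addr_ge0// !mulr_ge0 ?addr_ge0 ?nrm_ge0.
apply: (tends0_lim (tends0Z KK lim)) => k.
have sd : sq (phi k - y) := sqB (sp k) sy.
have sDp := sq_D flat0 q (- s) (sp k). have sDy := sq_D flat0 q (- s) sy.
have -> : nrm (D0 s y) ^+ 2 = - ip y (D0 s (D0 (- s) y)).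
  rewrite -(nrm_DN q flat0 s sy) nrm_sq; have := ip_D flat0 q (- s) sy sDy; rewrite opprK => -> //.
have E : ip y (D0 s (D0 (- s) y)) = ip y (D0 s (D0 (- s) (phi k))) - ip y (D0 s (D0 (- s) (phi k - y))).
  rewrite !D_B (ipBr (sq_D flat0 q s sDp) (sq_D flat0 q s sDy) sy); ring.
rewrite E opprB; apply: (le_trans (ler_norm _)); apply: (le_trans (ler_normB _ _)); rewrite addrC.
have i1 := energy_DD s0 (kp k).
have i2 : nrm (T (phi k)) <= B + K * nrm (phi k - y).
  have -> : T (phi k) = T y + T (phi k - y) by rewrite TD addrC subrK.
  by apply: (le_trans (nrmD (sT sy) (sT sd))); apply: lerD => //; exact: TK.
have i3 : nrm (D0 s (phi k)) <= nrm (D0 s y) + K1 * nrm (phi k - y).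
  have -> : D0 s (phi k) = D0 s y + D0 s (phi k - y) by rewrite D_B addrC subrK.
  apply: (le_trans (nrmD (sq_D flat0 q s sy) (sq_D flat0 q s sd))); rewrite lerD2l.
  exact: (nrm_D_le q flat0 s sd).
have i4 : `|ip y (D0 s (D0 (- s) (phi k - y)))| <= nrm y * (`|s^-1| * 2 * (`|(- s)^-1| * 2)) * nrm (phi k - y).
  have sDd := sq_D flat0 q (- s) sd.
  apply: (le_trans (ip_CS sy (sq_D flat0 q s sDd))); rewrite -mulrA ler_wpM2l ?nrm_ge0//.
  apply: (le_trans (nrm_D_le q flat0 s sDd)); rewrite -[leRHS]mulrA ler_wpM2l//.
  exact: (nrm_D_le q flat0 (- s) sd).
have i5 : C * (nrm (T (phi k)) + nrm (D0 s (phi k))) <= C * (B + nrm (D0 s y)) + C * (K + K1) * nrm (phi k - y).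
  rewrite -mulrA -mulrDr ler_wpM2l// mulrDl; move: i2 i3; lra.
rewrite mulrDl; apply: (le_trans (lerD (le_trans i1 i5) i4)); by rewrite addrA.
Qed.

Lemma energy_Q phi : kc 1 phi -> `|ip y (Q phi)| <= (C + B + 1) * nrm phi.
Proof.
move=> kp; rewrite -(X_flat0 q phi); apply: (D_dual flat0 kp sy); exists 1 => // h [h0 _] _.
have sp := kc_sq kp; rewrite ipC (ip_D flat0 q h sp sy) normrN.
have sD := sq_D flat0 q (- h) sy.
apply: (le_trans (ip_CS sp sD)); rewrite mulrC ler_wpM2r ?nrm_ge0//.
by apply: energy_bound; rewrite oppr_eq0.
Qed.

End energy_extension.

(** * Extension by duality and normal derivatives *)

Section extension.
Context {R : realType} {n : nat}.
Local Notation V := 'rV[R]_n.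
Implicit Types (f g phi psi b : V -> R).
Variables (rho : V -> R) (q : V).
Hypothesis Hflat : flat rho q.
Hypothesis Hq1 : forall x t, rho (x + t *: q) = rho x + t.
Local Notation X := (Xder rho q).
Local Notation Q := (dv q).
Local Notation D := (Dquo rho q).
Local Notation S := (Sflow rho q).
Local Notation avg := (favg rho q).
Local Notation avg0 := (favg (cst 0) 0 q).
Let Pos := [set x | 0 < rho x].
Let oPos : open Pos. Proof. exact: (open_Pos Hflat). Qed.
Variable G : V -> R.
Hypothesis sG : sq G.

Lemma dv_trans v c f : dv v (f \o trans c) = dv v f \o trans c.
Proof.
by apply/funext => x; rewrite /dv /= !fct_sumE; apply: eq_bigr => i _; rewrite !fctE pd_trans.
Qed.

Lemma S_trans p h t x : S p h (trans (t *: q) x) = trans (t *: q) (S p h x).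
Proof. exact: (S_flat Hflat). Qed.

Lemma D_trans p h t f : D p h (f \o trans (t *: q)) = D p h f \o trans (t *: q).
Proof.
apply/funext => x; rewrite -[RHS]/(h^-1 * (f (S p h (trans (t *: q) x)) - f (trans (t *: q) x))) S_trans.
by [].
Qed.

(** An extended test function vanishes outside [Pos] but its support may touch the boundary. It is
    shifted inwards along [q], where the hypothesis applies, and the shift tends to 0. *)
Lemma shift_lim (T : (V -> R) -> V -> R) F C : (forall t, T (F \o trans (t *: q)) = T F \o trans (t *: q)) ->
  kc 3 F -> kc 3 (T F) -> (forall x, ~ Pos x -> F x = 0) -> 0 <= C ->
  (forall chi, tc 3 Pos chi -> `|ip G (Q (Q (T chi)))| <= C * (nrm (T chi) + nrm (Q chi))) ->
  `|ip G (Q (Q (T F)))| <= C * (nrm (T F) + nrm (Q F)).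
Proof.
move=> HT kF kT F0 C0 HC.
have kH : kc 1 (Q (Q (T F))) by exact: kc_dv (kc_dv _ kT).
have K0 : 0 <= nrm G * nrm (Q (Q (Q (T F)))) by rewrite mulr_ge0 ?nrm_ge0.
apply: (tends0_lim (tends0Z K0 (@tends0_inv R))) => k.
have e0 : 0 < k.+1%:R^-1 :> R by rewrite invr_gt0 ltr0Sn.
have me0 : - k.+1%:R^-1 != 0 :> R by rewrite oppr_eq0 gt_eqF.
have := nrm_shift q me0 kH.
have := HC _ (shift_tc Hflat Hq1 e0 kF.1 kF.2 F0).
rewrite -scaleNr HT !dv_trans.
rewrite (nrm_trans _ (kc_sq kT)) (nrm_trans _ (kc_sq (kc_dv q kF))) normrN (gtr0_norm e0).
move: (k.+1%:R^-1) e0 me0 => e e0 me0 i1 i2; have sH := kc_sq kH; have sHt := sq_trans (- e *: q) sH.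
have -> : ip G (Q (Q (T F))) = ip G (Q (Q (T F)) \o trans (- e *: q)) - ip G (Q (Q (T F)) \o trans (- e *: q) - Q (Q (T F))).
  by rewrite (ipBr sHt sH sG); ring.
apply: (le_trans (ler_normB _ _)); apply: lerD => //.
apply: (le_trans (ip_CS sG (sqB sHt sH))); rewrite -mulrA ler_wpM2l ?nrm_ge0//.
by rewrite mulrC.
Qed.

Hypothesis HW1 : exists2 C, 0 <= C & forall phi, tc 3 Pos phi ->
  `|ip G (Q (Q phi))| <= C * (nrm phi + nrm (Q phi)).
Variable p : V.
Hypothesis HW2 : exists2 C, 0 <= C & exists2 h0, 0 < h0 & forall h chi, ok h -> `|h| <= h0 -> tc 3 Pos chi ->
  `|ip G (Q (Q (D p h chi)))| <= C * (nrm (D p h chi) + nrm (Q chi)).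
Hypothesis HW3 : bounded psi in tc 2 Pos, ip G (X p (X p psi)).

Let er := ext_refl rho q.
Let out k f x : ~ Pos x -> er k f x = 0.
Proof. by move=> nx; rewrite -[LHS]/(Ind Pos x * rf rho q k f x) Ind0// mul0r. Qed.

(** The extension of [G] to the whole space, as the adjoint of the reflection. The index 2 is chosen
    because two derivatives along [q] turn [er 0] into [er 2]. *)
Lemma ext_ex : exists2 w, sq w & forall f, sq f -> ip w f = ip G (er 2 f).
Proof.
have [C C0 HC] := nrm_er Hflat Hq1 2.
have [] := @L2_riesz R n (@sq R n) (fun f => ip G (er 2 f)) (nrm G * C) sq0.
- by move=> t u v su sv; apply: sqD => //; exact: sqZ.
- by [].
- move=> t u v su sv; rewrite /er /ext_refl rfD rfZ mulrDr.
  have E : Ind Pos * (t *: rf rho q 2 u) = t *: (Ind Pos * rf rho q 2 u).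
    by apply/funext => x; rewrite -[LHS]/(Ind Pos x * (t * rf rho q 2 u x)) mulrCA.
  have s1 := sq_er Hflat Hq1 2 su; have s2 := sq_er Hflat Hq1 2 sv.
  by rewrite E (ipDr (sqZ t s1) s2 sG) (ipZr t s1 sG).
- move=> u su; apply: (le_trans (ip_CS sG (sq_er Hflat Hq1 2 su))).
  by rewrite -mulrA ler_wpM2l ?nrm_ge0//; exact: HC.
by move=> w [sw Hw _]; exists w => // f sf; rewrite Hw.
Qed.

Lemma csupp_avg N h f : csupp Pos f -> csupp Pos (avg p N h f).
Proof. by move=> cf; apply: csuppZ; apply: csupp_sum => j; exact: (csupp_tau_Pos Hflat Hq1). Qed.

Lemma DD_bound : exists2 C, 0 <= C & forall h k psi, ok h -> ok k -> tc 2 Pos psi ->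
  `|ip G (D p h (D p k psi))| <= C * nrm psi.
Proof.
have [C C0 HC] := HW3; exists C => // h k psi oh kk tp.
have tA N s f : tc 2 Pos f -> tc 2 Pos (avg p N s f).
  by move=> [Hf cf]; split; [apply: CkZ; apply: Ck_sum => j _; exact: (Ck_tau Hflat)|exact: csupp_avg].
have H1 s f : ok s -> tc 2 Pos f -> `|ip G (D p s (X p f))| <= C * nrm f.
  move=> os tf; have kf := tc_kc tf; have kX := kc_X Hflat p le1_3 kf.
  apply: (avg_bound Hflat os.1 kX sG) => N.
  have -> : avg p N s (X p (X p f)) = X p (X p (avg p N s f)).
    rewrite (X_avg Hflat p p N s (Ck_le le1_2 kf.1)) (X_avg Hflat p p N s kX.1) //.
  apply: (le_trans (HC _ (tA N s f tf))); rewrite ler_wpM2l//; exact: (nrm_avg Hflat _ _ _ (kc_sq kf)).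
have kp := tc_kc tp; have sp := kc_sq kp.
have sD := sq_D Hflat p k sp; have sDG := sq_D Hflat p (- h) sG.
have E f : sq f -> ip G (D p h f) = - ip (D p (- h) G) f.
  by move=> sf; rewrite (ip_D Hflat p (- h) sG sf) !opprK.
rewrite (E _ sD) normrN; apply: (avg_bound Hflat kk.1 (kc_le le1_2 kp) sDG) => N.
have kA := tc_kc (tA N k psi tp); have kXA := kc_X Hflat p le1_3 kA.
rewrite -(X_avg Hflat p p N k (Ck_le le1_2 kp.1)) -normrN -(E _ (kc_sq kXA)).
apply: (le_trans (H1 h _ oh (tA N k psi tp))); rewrite ler_wpM2l//; exact: (nrm_avg Hflat _ _ _ sp).
Qed.

Lemma DDG_bound : exists2 C, 0 <= C & forall h k, ok h -> ok k ->
  nrm (Ind Pos * D p h (D p k G)) <= C.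
Proof.
have [C C0 HC] := DD_bound; exists C => // h k oh kk.
have sDk := sq_D Hflat p k sG; have sDD := sq_D Hflat p h sDk.
have mP : measurable Pos by exact: open_measurable_rV.
apply: (dual_norm oPos (sq_Ind mP sDD) _ C0) => [x nx|phi ck cs].
  by rewrite -[LHS]/(Ind Pos x * D p h (D p k G) x) Ind0// mul0r.
have tp : tc 2 Pos phi by split; [exact: ck|].
have sp := kc_sq (tc_kc tp); have sDp := sq_D Hflat p (- h) sp.
rewrite ip_mull Ind_id; last by move=> x; exact: csupp_out.
rewrite (ip_D Hflat p h sDk sp) (ip_D Hflat p k sG sDp) opprK.
by apply: HC => //; exact: okN.
Qed.

(** The hypotheses on [G] pass to [w] for test functions without support condition, since [er 0]
    brings these back to [Pos]. The energy estimate then applies to [w], and [w] agrees with [G]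
    when tested on [Pos]. *)
Lemma ext_normal : (bounded phi in tc 3 Pos, ip G (Q phi)) /\
  (bounded phi in tc 3 Pos, ip G (X p (Q phi))).
Proof.
have [w sw Hw] := ext_ex.
have [K K0 HK] := nrm_er Hflat Hq1 0; have [K' K'0 HK'] := nrm_er Hflat Hq1 1.
have [K2 K20 HK2] := nrm_rf Hflat Hq1 2.
have QQE phi : kc 3 phi -> er 2 (Q (Q phi)) = Q (Q (er 0 phi)).
  move=> kp; have p1 := Ck_le le1_3 kp.1; have q1 := Ck_le le1_2 (Ck_dv q kp.1).
  by rewrite /er (Q_er Hflat Hq1 le0_2 p1) (Q_er Hflat Hq1 le1_2 q1).
have sQQ phi : kc 3 phi -> sq (Q (Q phi)) by move=> kp; exact: kc_sq (kc_dv q (kc_dv q kp)).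
have res phi : sq phi -> (forall x, ~ Pos x -> phi x = 0) -> ip w phi = ip G phi.
  move=> sp p0; rewrite (Hw _ sp); congr ip; apply/funext => x.
  rewrite -[LHS]/(Ind Pos x * rf rho q 2 phi x); case: (pselect (Pos x)) => px.
    by rewrite Ind1// mul1r (rf_pos Hq1 _ p0).
  by rewrite Ind0// mul0r p0.
have ke phi : kc 3 phi -> kc 3 (er 0 phi) by exact: (kc_er Hflat Hq1 (isT : (0 + 3 <= 3)%N)).
have bE phi : kc 3 phi -> nrm (er 0 phi) <= K * nrm phi by move=> kp; exact: HK (kc_sq kp).
have bQE phi : kc 3 phi -> nrm (Q (er 0 phi)) <= K' * nrm (Q phi).
  move=> kp; rewrite /er (Q_er Hflat Hq1 le0_2 (Ck_le le1_3 kp.1)).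
  exact: HK' (kc_sq (kc_dv q kp)).
have KK0 : 0 <= K + K' by exact: addr_ge0.
have KKle (a b : R) : 0 <= a -> 0 <= b -> K * a + K' * b <= (K + K') * (a + b).
  by move=> a0 b0; rewrite mulrDl !mulrDr; have := mulr_ge0 K0 b0; have := mulr_ge0 K'0 a0; lra.
have W1w : exists2 C, 0 <= C & forall phi, kc 3 phi -> `|ip w (Q (Q phi))| <= C * (nrm phi + nrm (Q phi)).
  have [C C0 HC] := HW1; exists (C * (K + K')); first exact: mulr_ge0.
  move=> phi kp; rewrite (Hw _ (sQQ _ kp)) (QQE _ kp).
  have := @shift_lim id (er 0 phi) C (fun _ => erefl) (ke _ kp) (ke _ kp) (@out 0 phi) C0 HC.
  move/le_trans; apply; rewrite -mulrA ler_wpM2l//.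
  exact: (le_trans (lerD (bE _ kp) (bQE _ kp)) (KKle _ _ (nrm_ge0 _) (nrm_ge0 _))).
have W2w : exists2 C, 0 <= C & exists2 h0, 0 < h0 & forall h phi, ok h -> `|h| <= h0 -> kc 3 phi ->
    `|ip w (Q (Q (D p h phi)))| <= C * (nrm (D p h phi) + nrm (Q phi)).
  have [C C0 [h0 h00 HC]] := HW2; exists (C * (K + K')); first exact: mulr_ge0.
  exists h0 => // h phi oh hh kp.
  have kD : kc 3 (D p h phi) := kc_D Hflat p h le3_4 kp.
  have kDe : kc 3 (D p h (er 0 phi)) := kc_D Hflat p h le3_4 (ke _ kp).
  have DE : er 0 (D p h phi) = D p h (er 0 phi) := D_er Hflat Hq1 0 p h phi.
  rewrite (Hw _ (sQQ _ kD)) (QQE _ kD) DE.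
  have := @shift_lim (D p h) (er 0 phi) C (fun t => D_trans p h t (er 0 phi)) (ke _ kp) kDe (@out 0 phi) C0
    (fun chi => HC h chi oh hh).
  move/le_trans; apply; rewrite -mulrA ler_wpM2l//.
  have := bE _ kD; rewrite DE => i1.
  exact: (le_trans (lerD i1 (bQE _ kp)) (KKle _ _ (nrm_ge0 _) (nrm_ge0 _))).
have [C3 C30 H3] := DDG_bound.
have W3w : forall h k, ok h -> ok k -> nrm (D p h (D p k w)) <= C3 * K2.
  move=> h k oh kk; have sDk := sq_D Hflat p k sw; have sDD := sq_D Hflat p h sDk.
  apply: (dual_norm openT sDD (fun x (nx : ~ setT x) => False_ind _ (nx I)) (mulr_ge0 C30 K20)) => phi ck cs.
  have kp : kc 3 phi := tc_kc (conj (ck 3%N) cs).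
  have sp := kc_sq kp; have sDp := sq_D Hflat p (- h) sp.
  rewrite (ip_D Hflat p h sDk sp) (ip_D Hflat p k sw sDp) opprK (Hw _ (sq_D Hflat p (- k) sDp)).
  have sr := sq_rf Hflat Hq1 2 sp; have sDr := sq_D Hflat p (- h) sr.
  have sGDk := sq_D Hflat p k sG; have sGDD := sq_D Hflat p h sGDk.
  have mP : measurable Pos by exact: open_measurable_rV.
  have -> : ip G (er 2 (D p (- k) (D p (- h) phi))) = ip (Ind Pos * D p h (D p k G)) (rf rho q 2 phi).
    rewrite (ip_mull (Ind Pos)) /er /ext_refl !(rf_D Hflat Hq1) -2!(D_Ind Hq1).
    rewrite (ip_D Hflat p h sGDk (sq_Ind mP sr)) (ip_D Hflat p k sG) ?opprK//; exact: (sq_D Hflat p (- h) (sq_Ind mP sr)).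
  apply: (le_trans (ip_CS (sq_Ind mP sGDD) sr)); rewrite -mulrA; apply: ler_pM; rewrite ?nrm_ge0//.
    exact: H3.
  exact: HK2.
have W1e : bounded phi in kc 1, ip w (Q phi).
  have [C C0 HC] := W1w; exists (C + nrm w + 1); first by rewrite !addr_ge0 ?nrm_ge0.
  move=> phi kp; apply: (@energy_Q _ _ q w id (nrm w) C 1 sw (nrm_ge0 w) C0 ler01 _ _ _ _ _ HC phi kp) => //.
  by move=> f _; rewrite mul1r.
have W2e : bounded phi in kc 2, ip w (X p (Q phi)).
  have [C C0 [h0 h00 HC]] := W2w.
  exists (C + C3 * K2 + 1); first by rewrite !addr_ge0// mulr_ge0.
  move=> phi kp; have kQ : kc 1 (Q phi) := kc_dv q kp.
  apply: (D_dual Hflat kQ sw); exists h0 => // h oh hh.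
  have sD := sq_D Hflat p (- h) sw.
  have E f : sq f -> ip w (D p h f) = - ip (D p (- h) w) f.
    by move=> sf; rewrite (ip_D Hflat p (- h) sw sf) !opprK.
  rewrite (E _ (kc_sq kQ)) normrN.
  have K0' : 0 <= `|h^-1| * 2 by rewrite mulr_ge0.
  (* The energy estimate for the tangential quotient of [w]. Its own quotient is bounded by [W3w]
     uniformly in the step, so the limit in the step gives the mixed derivative. *)
  apply: (@energy_Q _ _ q (D p (- h) w) (D p h) (C3 * K2) C (`|h^-1| * 2) sD (mulr_ge0 C30 K20) C0 K0' _ _ _ _ _ _ phi (kc_le le1_2 kp)).
  - by move=> f sf; exact: (sq_D Hflat p h sf).
  - by move=> f g; exact: D_B.
  - move=> N s f; rewrite /favg; apply/funext => x.
    have E2 g z : (\sum_(j < N.+1) ftau (cst 0) 0 q (s * j%:R / N.+1%:R) g) z =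
      \sum_(j < N.+1) g (trans ((s * j%:R / N.+1%:R) *: q) z).
      by rewrite fct_sumE; apply: eq_bigr => j _; rewrite tau_flat0.
    rewrite -[LHS]/(h^-1 * (N.+1%:R^-1 * (\sum_(j < N.+1) ftau (cst 0) 0 q (s * j%:R / N.+1%:R) f) (S p h x)
      - N.+1%:R^-1 * (\sum_(j < N.+1) ftau (cst 0) 0 q (s * j%:R / N.+1%:R) f) x)).
    rewrite -[RHS]/(N.+1%:R^-1 * (\sum_(j < N.+1) ftau (cst 0) 0 q (s * j%:R / N.+1%:R) (D p h f)) x).
    rewrite !E2 -mulrBr -sumrB mulrCA; congr (_ * _); rewrite mulr_sumr; apply: eq_bigr => j _.
    by rewrite -S_trans.
  - by move=> f sf; exact: (nrm_D_le p Hflat h sf).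
  - by apply: W3w => //; exact: okN.
  - move=> f kf; have sQ := sQQ _ kf.
    have f1 := Ck_le le1_3 kf.1; have f2 := Ck_le le1_2 (Ck_dv q kf.1).
    rewrite -normrN -(E _ sQ) -(Q_D Hflat Hq1 p h f2) -(Q_D Hflat Hq1 p h f1).
    exact: HC.
have outd k f v : tc k Pos f -> forall x, ~ Pos x -> dv v f x = 0.
  by move=> [_ cf] x nx; exact: (csupp_out (csupp_dv v cf) nx).
split.
  have [C C0 HC] := W1e; exists C => // phi tp; have kp := tc_kc tp.
  rewrite -res; [exact: HC (kc_le le1_3 kp)|exact: kc_sq (kc_dv q kp)|exact: outd tp].
have [C C0 HC] := W2e; exists C => // phi tp; have kp := tc_kc tp.
rewrite -res; first exact: HC (kc_le le2_3 kp).
  exact: kc_sq (kc_X Hflat p le1_3 (kc_dv q kp)).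
by move=> x nx; apply: (csupp_out _ nx); apply: csupp_X; apply: csupp_dv; exact: tp.2.
Qed.

End extension.

(** * All second derivatives of a localised function *)

Section normal.
Context {R : realType} {n : nat}.
Local Notation V := 'rV[R]_n.
Implicit Types (f phi psi b : V -> R) (O : set V) (i j m : 'I_n).

(** Bounds proved for smooth test functions extend to $C^2$ ones by mollification, with the same
    constant. *)
Lemma tc2_ext O g T (K C : R) : sq g -> (forall f, kc 2 f -> sq (T f)) ->
  (forall f f', kc 2 f -> kc 2 f' -> T (f + f') = T f + T f' :> (V -> R)) -> 0 <= K -> 0 <= C ->
  (forall f, kc 2 f -> nrm (T f) <= K * Nk 2 f) ->
  (forall phi, Coo phi -> csupp O phi -> `|ip g (T phi)| <= C * nrm phi) ->
  forall phi, tc 2 O phi -> `|ip g (T phi)| <= C * nrm phi.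
Proof.
move=> sg sT TD K0 C0 TK HC phi tp; have kp := tc_kc tp.
have KK : 0 <= C + nrm g * K by rewrite addr_ge0// mulr_ge0 ?nrm_ge0.
apply: (tends0_lim (tends0Z KK (@tends0_inv R))) => k.
have e0 : 0 < k.+1%:R^-1 :> R by rewrite invr_gt0 ltr0Sn.
have [chi [ck cs Hchi]] := smooth_approx tp e0.
have kchi : kc 2 chi := tc_kc (conj (ck 2%N) cs).
have kd : kc 2 (phi - chi) := kcB kp kchi.
have Hd : Nk 2 (phi - chi) <= k.+1%:R^-1.
  by apply: le_trans Hchi; rewrite -opprB (NkN (kcB kchi kp)).
have -> : ip g (T phi) = ip g (T chi) + ip g (T (phi - chi)).
  by rewrite -(ipDr (sT _ kchi) (sT _ kd) sg) -TD// addrC subrK.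
apply: (le_trans (ler_normD _ _)).
have i1 := HC _ ck cs.
have i2 : nrm chi <= nrm phi + k.+1%:R^-1.
  have -> : chi = phi - (phi - chi) by rewrite subKr.
  apply: (le_trans (nrmB (kc_sq kp) (kc_sq kd))); rewrite lerD2l; apply: le_trans Hd; exact: nrm_Nk.
have i3 : `|ip g (T (phi - chi))| <= nrm g * K * k.+1%:R^-1.
  apply: (le_trans (ip_CS sg (sT _ kd))); rewrite -mulrA ler_wpM2l ?nrm_ge0//.
  by apply: (le_trans (TK _ kd)); rewrite ler_wpM2l.
have i4 := ler_wpM2l C0 i2; rewrite mulrDr in i4.
apply: (le_trans (lerD (le_trans i1 i4) i3)); by rewrite [leRHS]addrC mulrDl addrC addrA.
Qed.

Variables (rho : V -> R) (q : V).
Hypothesis Hflat : flat rho q.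
Hypothesis Hq1 : forall x t, rho (x + t *: q) = rho x + t.
Local Notation X := (Xder rho q).
Local Notation Q := (dv q).
Local Notation D := (Dquo rho q).
Local Notation Xm m := (X (e_ m)).
Let Hrho : Ck 4 rho. Proof. by case: Hflat. Qed.
Variables (x0 : V) (R1 s s0 : R) (zeta : V -> R) (g : V -> R).
Hypothesis sR : s < R1.
Hypothesis s0s : s0 <= s.
Hypothesis kz : forall k, kc k zeta.
Hypothesis zout : forall x, s <= `|x - x0| -> zeta x = 0.
Hypothesis zin : forall x, `|x - x0| < s0 -> zeta x = 1.
Hypothesis sg : sq g.
Let Pos := [set x | 0 < rho x].
Let U := Pos `&` [set x | `|x - x0| < R1].
Let U0 := Pos `&` [set x | `|x - x0| < s0].
Hypothesis H1 : forall m, bounded psi in tc 2 U, ip g (Xm m psi).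
Hypothesis H2 : forall i m, bounded psi in tc 2 U, ip g (Xm i (Xm m psi)).
Hypothesis H3 : bounded psi in tc 2 U, ip g (lap psi).
Let G := zeta * g.

Let sG : sq G.
Proof.
have [L bL] := (kz 0).2; apply: (sqM_bs _ bL) => //; exact: (Ck_cont (kz 0).1).
Qed.

Let HW3 l : bounded psi in tc 2 Pos, ip G (Xm l (Xm l psi)).
Proof.
have cz k : cutf x0 s k zeta.
  by split; [case: (kz k)|move=> x xs; apply: zout; exact: ltW].
have cX : cutf x0 s 2 (Xm l zeta) := cutf_X Hflat (e_ l) le2_3 (cz 3%N).
have cXX : cutf x0 s 0 (Xm l (Xm l zeta)).
  by apply: (cutf_X Hflat) => //; exact: (cutf_le le1_2 cX).
have [C1 C10 B1] := @bd_cut _ _ rho x0 R1 s g sR (fun f => Xm l (Xm l f)) 2 zeta isT (H2 l l) (cz 2%N).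
have [C2 C20 B2] := @bd_cut _ _ rho x0 R1 s g sR (Xm l) 2 _ isT (H1 l) cX.
exists (C1 + 2 * C2 + nrm (Xm l (Xm l zeta) * g)); first by rewrite !addr_ge0 ?mulr_ge0 ?nrm_ge0.
move=> psi tp; have kp := tc_kc tp; have p1 := Ck_le le1_2 kp.1.
have z1 := (kz 1).1; have X1 := Ck_le le1_2 cX.1.
have Xp : Ck 1 (Xm l psi) := Ck_X Hflat (e_ l) le1_3 kp.1.
have E : zeta * Xm l (Xm l psi) = Xm l (Xm l (zeta * psi)) - 2 *: Xm l (Xm l zeta * psi) + Xm l (Xm l zeta) * psi.
  rewrite (XM _ _ _ X1 p1) (XM _ _ _ z1 p1) (XD _ _ _ (CkM X1 p1) (CkM z1 Xp)) (XM _ _ _ X1 p1) (XM _ _ _ z1 Xp).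
  move: (Xm l (Xm l psi)) (Xm l (Xm l zeta)) (Xm l zeta) (Xm l psi) => A B C E.
  by apply/funext => x; rewrite !fctE /GRing.scale /=; ring.
have k1 : kc 2 (zeta * psi) := kcM (kz 2).1 kp.
have s1 : sq (Xm l (Xm l (zeta * psi))) := kc_sq (kc_X Hflat (e_ l) le0_3 (kc_X Hflat (e_ l) le1_3 k1)).
have k2 : kc 2 (Xm l zeta * psi) := kcM cX.1 kp.
have s2 : sq (Xm l (Xm l zeta * psi)) := kc_sq (kc_X Hflat (e_ l) le1_3 k2).
have s3 : sq (Xm l (Xm l zeta) * psi) := kc_sq (kcM cXX.1 (kc_le le0_2 kp)).
rewrite ip_mull E (ipDr (sqB s1 (sqZ 2 s2)) s3 sg) (ipBr s1 (sqZ 2 s2) sg) (ipZr 2 s2 sg).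
have i1 := B1 _ tp; have i2 := B2 _ tp; have i3 := bd_mul sg cXX (kc_sq kp).
apply: (le_trans (ler_normD _ _)); rewrite [leRHS]mulrDl; apply: lerD => //.
apply: (le_trans (ler_normB _ _)); rewrite normrM (ger0_norm (ler0n R 2)) [leRHS]mulrDl -(mulrA 2 C2).
by apply: lerD => //; exact: (ler_wpM2l (ler0n R 2) i2).
Qed.

Let HN l := @ext_normal R n rho q Hflat Hq1 G sG
  (W1 Hflat Hq1 sR kz zout sg H1 H2 H3) (e_ l)
  (W2 Hflat Hq1 sR kz zout sg H1 H2 H3 l) (HW3 l).

Let eqG f : (forall x, ~ U0 x -> f x = 0) -> ip g f = ip G f.
Proof.
move=> f0; rewrite ip_mull; congr ip; apply/funext => x; rewrite -[RHS]/(zeta x * f x).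
case: (pselect (U0 x)) => [[_ /= xs]|ux]; first by rewrite zin// mul1r.
by rewrite f0// mulr0.
Qed.

Let subP k f : tc k U0 f -> tc k Pos f.
Proof. by move=> [Hf cf]; split => //; apply: csupp_sub cf => x []. Qed.
Let subU k f : tc k U0 f -> tc k U f.
Proof.
move=> [Hf cf]; split => //; apply: csupp_sub cf => x [px /= xs]; split => //=.
by apply: lt_trans sR; apply: lt_le_trans xs s0s.
Qed.

Lemma normal_Q : bounded psi in tc 2 U0, ip g (Q psi).
Proof.
(* [ext_normal] is stated for one tangential direction, so a coordinate has to exist; in dimension
   zero the claim is trivial. *)
case: (pselect (exists l : 'I_n, True)) => [[l _]|nl]; last first.
  exists 0 => // psi _; have -> : Q psi = 0.
    by rewrite /dv big1// => i _; case: nl; exists i.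
  by rewrite ip0r normr0 mul0r.
have [[C C0 HC] _] := HN l; exists C => //.
have [K K0 HK] := ob_bd (ob_dv q 1).
apply: (tc2_ext (K := K) sg) => //.
- by move=> f kf; exact: kc_sq (kc_dv q kf).
- by move=> f f' [kf _] [kf' _]; apply: dvD; [exact: (Ck_le _ kf)|exact: (Ck_le _ kf')].
- by move=> f kf; apply: (le_trans (nrm_Nk 1 _)); exact: (HK 1 f (@ok1 R) kf).
move=> phi ck cs; have tp : tc 3 U0 phi by split.
rewrite eqG; first exact: HC (subP tp).
by move=> x nx; exact: (csupp_out (csupp_dv q cs) nx).
Qed.

Lemma normal_XQ l : bounded psi in tc 2 U0, ip g (Xm l (Q psi)).
Proof.
have [_ [C C0 HC]] := HN l; exists C => //.
have [K K0 HK] := ob_bd (ob_dv q 1); have [K' K'0 HK'] := nrm_X_bound Hflat (e_ l).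
apply: (tc2_ext (K := K' * K) sg) => //.
- by move=> f kf; exact: kc_sq (kc_X Hflat (e_ l) le0_3 (kc_dv q kf)).
- move=> f f' [kf _] [kf' _].
  rewrite (dvD q (Ck_le le1_2 kf) (Ck_le le1_2 kf')).
  by apply: XD; exact: Ck_dv.
- exact: mulr_ge0.
- move=> f kf; apply: (le_trans (HK' _ (kc_dv q kf))); rewrite -mulrA ler_wpM2l//.
  exact: (HK 1 f (@ok1 R) kf).
move=> phi ck cs; have tp : tc 3 U0 phi by split.
rewrite eqG; first exact: HC (subP tp).
by move=> x nx; apply: (csupp_out _ nx); apply: csupp_X; exact: csupp_dv.
Qed.

Lemma bd_pd k i : (k <= 4)%N -> forall t, (0 < size t <= 4)%N -> exists2 M, 0 <= M & forall x, `|partials t rho x| <= M.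
Proof. by move=> _ t st; case: Hflat => _ [M M0 HM] _; exists M => // x; exact: HM. Qed.

Let QM b f : Ck 1 b -> Ck 1 f -> Q b = 0 -> Q (b * f) = b * Q f.
Proof. by move=> Hb Hf b0; rewrite (dvM q Hb Hf) b0 mul0r add0r. Qed.

Let mulbd b (M : R) : (forall x, `|b x| <= M) -> continuous b -> forall f, sq f -> nrm (b * f) <= M * nrm f.
Proof. by move=> HM cb f sf; apply: nrm_mulb => //; exact: continuous_measurable_rV. Qed.

(** With first normal and mixed derivatives now controlled, the terms left open in [W0_bound] are
    bounded by $\|\psi\|$ alone, after the coefficient is moved inside $d_q$. The condition $d_q b =
    0$ lets [b] pass inside $d_q^2$ without commutators. *)
Lemma normal_QQ b M : Ck 3 b -> Q b = 0 -> 0 <= M -> (forall x, `|b x| <= M) ->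
  bounded psi in tc 3 U0, ip g (b * Q (Q psi)).
Proof.
move=> Hb Qb M0 HM.
have [C C0 HC] := W0_bound Hflat Hq1 sR kz zout sg H1 H2 H3.
have [C1 C10 B1] := normal_Q.
have cz := cutf_z3 Hflat Hq1 kz zout; have cz2 := cutf_le le2_3 cz.
have cr m : Ck 3 (pd m rho) := Ck_pd m Hrho.
have crz m := cutfM cz (cr m).
have /all_sig2[C2 C20 B2] m : {C | 0 <= C & forall psi, tc 2 U0 psi -> `|ip g (Xm m (Q psi))| <= C * nrm psi}.
  by apply: cid2; exact: normal_XQ.
have cQ m : cutf x0 s 2 (Q (z3 rho zeta * pd m rho)) by split; [exact: (Ck_dv q (crz m).1)|exact: (vanish_dv _ (crz m).2)].
have /all_sig2[C3 C30 B3] m : {C | 0 <= C & forall psi, tc 2 Pos psi -> `|ip g (Xm m (Q (z3 rho zeta * pd m rho) * psi))| <= C * nrm psi}.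
  by apply: cid2; exact: (@bd_cut _ _ rho x0 R1 s g sR (Xm m) 2 _ isT (H1 m) (cQ m)).
have /all_sig2[M2 M20 HM2] m : {M | 0 <= M & forall x, `|(z3 rho zeta * pd m rho) x| <= M}.
  by apply: cid2; exact: (cutf_bd (crz m)).
have cb := cutf_beta Hflat Hq1 kz zout.
have cQb : cutf x0 s 0 (Q (W0beta rho q zeta)).
  by split; [exact: (Ck_le le0_1 (Ck_dv q cb.1))|exact: (vanish_dv _ cb.2)].
have [M3 M30 HM3] := cutf_bd cb.
pose CS := \sum_m 2 * (C2 m * M2 m + C3 m).
pose CT := C + CS + (C1 * M3 + nrm (Q (W0beta rho q zeta) * g)).
have CS0 : 0 <= CS by apply: sumr_ge0 => m _; rewrite mulr_ge0// addr_ge0// mulr_ge0.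
have CT0 : 0 <= CT by rewrite !addr_ge0// ?mulr_ge0 ?nrm_ge0.
exists (CT * M); first exact: mulr_ge0.
move=> psi tp0; have p2 := Ck_le le2_3 tp0.1.
have -> : b * Q (Q psi) = Q (Q (b * psi)).
  rewrite (QM (Ck_le le1_3 Hb) (Ck_le le1_3 tp0.1) Qb).
  by rewrite (QM (Ck_le le1_3 Hb) (Ck_dv q p2) Qb).
have tp : tc 3 U0 (b * psi) := tcM Hb tp0.
suff : `|ip g (Q (Q (b * psi)))| <= CT * nrm (b * psi).
  move/le_trans; apply; rewrite -mulrA ler_wpM2l//.
  by apply: (mulbd HM (Ck_cont Hb)); exact: kc_sq (tc_kc tp0).
move: (b * psi) tp => phi tp {tp0 p2 psi}.
have tp2 := tc_le le2_3 tp; have sp := kc_sq (tc_kc tp).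
have p1 := Ck_le le1_3 tp.1; have p2 := tp2.1.
have cQQ : csupp U0 (Q (Q phi)) by exact: csupp_dv (csupp_dv _ tp.2).
rewrite eqG; last by move=> x nx; exact: (csupp_out cQQ nx).
have i0 := HC phi (subP tp); apply: (le_trans i0).
have N0 := nrm_ge0 phi.
have iS : \sum_m (2 * `|ip g (Xm m (z3 rho zeta * pd m rho * Q phi))|) <= CS * nrm phi.
  rewrite /CS mulr_suml; apply: ler_sum => m _; rewrite -(mulrA 2); apply: (ler_wpM2l (ler0n R 2)).
  have H := (crz m).1; have Hl := Ck_le le2_3 H; have Hl1 := Ck_le le1_3 H.
  have tz : tc 2 U0 (z3 rho zeta * pd m rho * phi) := tcM Hl tp2.
  have tQ : tc 2 U0 (Q (z3 rho zeta * pd m rho) * phi) := tcM (cQ m).1 tp2.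
  have E : z3 rho zeta * pd m rho * Q phi = Q (z3 rho zeta * pd m rho * phi) - Q (z3 rho zeta * pd m rho) * phi.
    by rewrite (dvM q Hl1 p1) addrAC subrr add0r.
  have c1 : Ck 1 (Q (z3 rho zeta * pd m rho * phi)) := Ck_dv q tz.1.
  have c2 : Ck 1 (Q (z3 rho zeta * pd m rho) * phi) := Ck_le le1_2 tQ.1.
  rewrite E (XB rho q _ c1 c2).
  have s1 : sq (Xm m (Q (z3 rho zeta * pd m rho * phi))) := kc_sq (kc_X Hflat (e_ m) le0_3 (kc_dv q (tc_kc tz))).
  have s2 : sq (Xm m (Q (z3 rho zeta * pd m rho) * phi)) := kc_sq (kc_X Hflat (e_ m) le1_3 (tc_kc tQ)).
  rewrite (ipBr s1 s2 sg); apply: (le_trans (ler_normB _ _)); rewrite [leRHS]mulrDl; apply: lerD.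
    apply: (le_trans (B2 m _ tz)); rewrite -(mulrA (C2 m)) ler_wpM2l//.
    by apply: (mulbd (HM2 m) (Ck_cont H)).
  exact: (B3 m _ (subP tp2)).
have iB : `|ip g (W0beta rho q zeta * Q phi)| <= (C1 * M3 + nrm (Q (W0beta rho q zeta) * g)) * nrm phi.
  have Hb1 := Ck_le le1_2 cb.1.
  have tz : tc 2 U0 (W0beta rho q zeta * phi) := tcM cb.1 tp2.
  have E : W0beta rho q zeta * Q phi = Q (W0beta rho q zeta * phi) - Q (W0beta rho q zeta) * phi.
    by rewrite (dvM q Hb1 p1) addrAC subrr add0r.
  have s1 := kc_sq (kc_dv q (tc_kc tz)).
  have s2 : sq (Q (W0beta rho q zeta) * phi) := kc_sq (kcM cQb.1 (kc_le le0_2 (tc_kc tp2))).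
  rewrite E (ipBr s1 s2 sg); apply: (le_trans (ler_normB _ _)); rewrite [leRHS]mulrDl; apply: lerD.
    apply: (le_trans (B1 _ tz)); rewrite -(mulrA C1) ler_wpM2l//.
    by apply: (mulbd HM3 (Ck_cont cb.1)).
  exact: (bd_mul sg cQb sp).
rewrite /CT !mulrDl in iB *; move: iS iB; lra.
Qed.

Lemma normal_pd i : bounded psi in tc 2 U0, ip g (pd i psi).
Proof.
have [C C0 HC] := normal_Q; have [C1 C10 B1] := H1 i.
have [M M0 HM] := bd_pd i le0_4 (t := [:: i]) isT.
exists (C1 + C * M); first by rewrite addr_ge0// mulr_ge0.
move=> psi tp; have kp := tc_kc tp; have p1 := Ck_le le1_2 tp.1.
have cr : Ck 2 (pd i rho) := Ck_le le2_3 (Ck_pd i Hrho).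
have tr : tc 2 U0 (pd i rho * psi) := tcM cr tp.
have E : pd i psi = Xm i psi + Q (pd i rho * psi).
  by rewrite (QM (Ck_le le1_2 cr) p1 (Q_pd_rho Hflat Hq1 i)) -pdE.
have s1 := kc_sq (kc_X Hflat (e_ i) le1_3 kp); have s2 := kc_sq (kc_dv q (tc_kc tr)).
rewrite E (ipDr s1 s2 sg); apply: (le_trans (ler_normD _ _)); rewrite mulrDl; apply: lerD.
  exact: B1 (subU tp).
apply: (le_trans (HC _ tr)); rewrite -mulrA ler_wpM2l//.
by apply: (mulbd HM (Ck_cont cr)); exact: kc_sq kp.
Qed.

(** Coefficients are moved inside the derivatives, being constant along [q], so that each term of
    the decomposition [pdpdE] is one of the controlled operators applied to a compactly supported
    function. *)
Lemma normal_pdpd i j : bounded psi in tc 2 U0, ip g (pd i (pd j psi)).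
Proof.
have [C C0 HC] := normal_Q; have [C2 C20 B2] := H2 i j.
have [Ci Ci0 Bi] := normal_XQ i; have [Cj Cj0 Bj] := normal_XQ j.
have [Mi Mi0 HMi] := bd_pd i le0_4 (t := [:: i]) isT.
have [Mj Mj0 HMj] := bd_pd i le0_4 (t := [:: j]) isT.
have [Mji Mji0 HMji] := bd_pd i le0_4 (t := [:: j; i]) isT.
have cr m : Ck 3 (pd m rho) := Ck_pd m Hrho.
have crr := CkM (cr i) (cr j).
have bM x : `|(pd i rho * pd j rho) x| <= Mi * Mj.
  by rewrite -[X in `|X|]/(pd i rho x * pd j rho x) normrM; apply: ler_pM => //; [exact: HMi|exact: HMj].
have Q0 : Q (pd i rho * pd j rho) = 0.
  have h m := Ck_le le1_3 (cr m).
  by rewrite (dvM q (h i) (h j)) !(Q_pd_rho Hflat Hq1) mul0r mulr0 addr0.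
have [C4 C40 B4] := normal_QQ crr Q0 (mulr_ge0 Mi0 Mj0) bM.
have HH := addr_ge0 (addr_ge0 (addr_ge0 (addr_ge0 C20 (mulr_ge0 Ci0 Mj0)) (mulr_ge0 Cj0 Mi0)) (mulr_ge0 C0 Mji0)) C40.
exists (C2 + Ci * Mj + Cj * Mi + C * Mji + C4); first exact: HH.
apply: (tc2_ext (K := 1) sg) => //.
- by move=> f kf; exact: kc_sq (kc_pd i (kc_pd j kf)).
- move=> f f' [kf _] [kf' _].
  rewrite (pdD1 j (Ck_le le1_2 kf) (Ck_le le1_2 kf')).
  by apply: pdD1; exact: Ck_pd.
- by move=> f kf; rewrite mul1r; apply: (le_trans (nrm_Nk 0 _)); apply: (le_trans (Nk_pd 0 i _)); exact: (Nk_pd 1 j f).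
move=> psi ck cs; have tp : tc 3 U0 psi by split.
have tp2 := tc_le le2_3 tp; have kp := tc_kc tp; have kp2 := tc_kc tp2; have sp := kc_sq kp.
have p1 := Ck_le le1_3 tp.1; have p2 := tp2.1.
have r2 m : Ck 2 (pd m rho) := Ck_le le2_3 (cr m).
have r1 m : Ck 1 (pd m rho) := Ck_le le1_3 (cr m).
have ra : Ck 2 (pd j (pd i rho)) := Ck_pd j (cr i).
have Xr m m' : Xm m (pd m' rho) = pd m (pd m' rho).
  by rewrite (XmE rho q) (Q_pd_rho Hflat Hq1) mulr0 subr0.
have Qa : Q (pd j (pd i rho)) = 0.
  have -> : Q (pd j (pd i rho)) = pd j (Q (pd i rho)) by exact: dv_schwarz (r2 i).
  by rewrite (Q_pd_rho Hflat Hq1) -[0]/(cst 0) pd_cst.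
have tj : tc 2 U0 (pd j rho * psi) := tcM (r2 j) tp2.
have ti : tc 2 U0 (pd i rho * psi) := tcM (r2 i) tp2.
have ta : tc 2 U0 (pd j (pd i rho) * psi) := tcM ra tp2.
have c1 : Ck 1 (Q psi) := Ck_dv q p2.
have E : pd i (pd j psi) = Xm i (Xm j psi) + Xm i (Q (pd j rho * psi)) + Xm j (Q (pd i rho * psi))
    - Q (pd j (pd i rho) * psi) + pd i rho * pd j rho * Q (Q psi).
  rewrite (QM (r1 j) p1 (Q_pd_rho Hflat Hq1 j)) (QM (r1 i) p1 (Q_pd_rho Hflat Hq1 i)).
  rewrite (QM (Ck_le le1_2 ra) p1 Qa) (XM _ _ _ (r1 j) c1) (XM _ _ _ (r1 i) c1).
  rewrite (pdpdE Hflat Hq1 i j p2) !Xr.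
  move: (pd i (pd j rho)) (pd j (pd i rho)) (Q psi) (Q (Q psi)) (Xm j (Q psi)) (Xm i (Q psi)) (Xm i (Xm j psi)) => *.
  by apply/funext => x; rewrite !fctE; ring.
have s1 : sq (Xm i (Xm j psi)) := kc_sq (kc_X Hflat (e_ i) le0_3 (kc_X Hflat (e_ j) le1_3 kp2)).
have s2 : sq (Xm i (Q (pd j rho * psi))) := kc_sq (kc_X Hflat (e_ i) le0_3 (kc_dv q (tc_kc tj))).
have s3 : sq (Xm j (Q (pd i rho * psi))) := kc_sq (kc_X Hflat (e_ j) le0_3 (kc_dv q (tc_kc ti))).
have s4 : sq (Q (pd j (pd i rho) * psi)) := kc_sq (kc_dv q (tc_kc ta)).
have s5 : sq (pd i rho * pd j rho * Q (Q psi)) := kc_sq (kcM (Ck_le le1_3 crr) (kc_dv q (kc_dv q kp))).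
rewrite E (ipDr (sqB (sqD (sqD s1 s2) s3) s4) s5 sg) (ipBr (sqD (sqD s1 s2) s3) s4 sg) (ipDr (sqD s1 s2) s3 sg) (ipDr s1 s2 sg).
have i1 := B2 _ (subU tp2).
have i2 : `|ip g (Xm i (Q (pd j rho * psi)))| <= Ci * Mj * nrm psi.
  by apply: (le_trans (Bi _ tj)); rewrite -mulrA ler_wpM2l//; exact: (mulbd HMj (Ck_cont (cr j))).
have i3 : `|ip g (Xm j (Q (pd i rho * psi)))| <= Cj * Mi * nrm psi.
  by apply: (le_trans (Bj _ ti)); rewrite -mulrA ler_wpM2l//; exact: (mulbd HMi (Ck_cont (cr i))).
have i4 : `|ip g (Q (pd j (pd i rho) * psi))| <= C * Mji * nrm psi.
  by apply: (le_trans (HC _ ta)); rewrite -mulrA ler_wpM2l//; exact: (mulbd HMji (Ck_cont ra)).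
have i5 := B4 _ tp.
do 4!(rewrite [leRHS]mulrDl;apply: (le_trans (ler_normD _ _)); rewrite ?normrN; apply: lerD => //).
Qed.

End normal.

Lemma polar_num (R : realFieldType) (a b c d A B C N : R) : `|a| <= A * N -> `|b| <= B * N -> `|c| <= C * N ->
  a = b + 2 * d + c -> `|d| <= (A + B + C) * N.
Proof.
move=> ha hb hc E; have -> : d = (a - b - c) / 2 by rewrite E; field.
rewrite !mulrDl; move: (A * N) (B * N) (C * N) ha hb hc => x y z.
rewrite !ler_norml => /andP[? ?] /andP[? ?] /andP[? ?]; apply/andP; split; lra.
Qed.

(** * Local regularity *)

Section local_regularity.
Context {R : realType} {n : nat}.
Local Notation V := 'rV[R]_n.+1.
Implicit Types (f g psi : V -> R) (i j a b : 'I_n.+1).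

Lemma X_add (rho : V -> R) (q p p' : V) f : Xder rho q (p + p') f = Xder rho q p f + Xder rho q p' f.
Proof. by rewrite /Xder !dv_addl mulrDl opprD addrACA. Qed.

(** The tangential estimate yields only repeated derivatives $X_p X_p$. The mixed ones follow by
    polarisation over $p = e_i$, $e_j$ and $e_i + e_j$, the fields commuting. *)
Lemma polar (rho : V -> R) (q : V) u (PP : set (V -> R)) : flat rho q -> sq u -> (forall psi, PP psi -> kc 2 psi) ->
  (forall p, exists2 C, 0 <= C & forall psi, PP psi -> `|ip u (Xder rho q p psi)| <= C * nrm psi /\
     `|ip u (Xder rho q p (Xder rho q p psi))| <= C * nrm psi) ->
  (forall i j psi, PP psi -> Xder rho q (e_ i) (Xder rho q (e_ j) psi) = Xder rho q (e_ j) (Xder rho q (e_ i) psi)) ->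
  forall i j, bounded psi in PP, ip u (Xder rho q (e_ i) (Xder rho q (e_ j) psi)).
Proof.
move=> Hf su kP HP HX i j; have [A A0 HA] := HP (e_ i + e_ j).
have [B B0 HB] := HP (e_ i); have [C C0 HC] := HP (e_ j).
exists (A + B + C); first by rewrite !addr_ge0.
move=> psi pp; apply: (polar_num (HA _ pp).2 (HB _ pp).2 (HC _ pp).2).
have k1 p : kc 1 (Xder rho q p psi) := kc_X Hf p le1_3 (kP _ pp).
have sX p p' : sq (Xder rho q p (Xder rho q p' psi)) := kc_sq (kc_X Hf p le0_3 (k1 p')).
rewrite X_add !(X_add _ _ (e_ i) (e_ j) psi) (XD rho q _ (k1 _).1 (k1 _).1) (XD rho q _ (k1 _).1 (k1 _).1).
rewrite (HX j i _ pp) (ipDr (sqD (sX _ _) (sX _ _)) (sqD (sX _ _) (sX _ _)) su) !(ipDr (sX _ _) (sX _ _) su).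
by rewrite mulr2n mulrDl mul1r !addrA.
Qed.

Lemma ip_lim (gk : nat -> V -> R) g h (c : R) v : (forall k, sq (gk k)) -> sq g -> sq h ->
  tends0 (fun k => nrm (gk k - g)) -> tends0 v -> (forall k, `|ip (gk k) h - c| <= v k) -> ip g h = c.
Proof.
move=> sk sg sh lim v0 H; apply/eqP; rewrite -subr_eq0 -normr_eq0 eq_le normr_ge0 andbT.
apply: (tends0_lim (tends0D (tends0Z (nrm_ge0 h) lim) v0)) => k; rewrite add0r.
have -> : ip g h - c = - ip (gk k - g) h + (ip (gk k) h - c) by rewrite (ipBl (sk k) sg sh); ring.
apply: (le_trans (ler_normD _ _)); rewrite normrN; apply: lerD => //.
by rewrite mulrC; apply: ip_CS => //; exact: sqB.
Qed.

Lemma ip_pd4 a b i f g : kc 4 f -> kc 4 g ->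
  ip (pd a (pd b f)) (pd i (pd i g)) = ip (pd i (pd i f)) (pd a (pd b g)).
Proof.
move=> [Hf [L bL]] [Hg _].
have B c d G : Ck 2 G -> ip (pd c (pd d f)) G = ip f (pd d (pd c G)).
  move=> HG; rewrite (ip_byparts_pd c (Ck_le le1_2 (Ck_pd d (Ck_le le3_4 Hf))) (Ck_le le1_2 HG) (bs_pd d bL)).
  by rewrite (ip_byparts_pd d (Ck_le le1_4 Hf) (Ck_pd c HG) bL) opprK.
have H3 c : Ck 3 (pd c g) := Ck_pd c Hg.
have H2 c d : Ck 2 (pd c (pd d g)) := Ck_pd c (H3 d).
have e1 : pd a (pd i (pd i g)) = pd i (pd i (pd a g)).
  exact: (etrans (schwarz a i (Ck_le le2_3 (H3 i))) (f_equal (pd i) (schwarz a i (Ck_le le2_4 Hg)))).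
have e2 : pd b (pd i (pd a g)) = pd i (pd a (pd b g)).
  exact: (etrans (schwarz b i (Ck_le le2_3 (H3 a))) (f_equal (pd i) (schwarz b a (Ck_le le2_4 Hg)))).
have e3 : pd b (pd i (pd i (pd a g))) = pd i (pd i (pd a (pd b g))).
  exact: (etrans (schwarz b i (H2 i a)) (f_equal (pd i) e2)).
exact: (etrans (B a b _ (H2 i i)) (etrans (f_equal (ip f) (etrans (f_equal (pd b) e1) e3)) (esym (B i i _ (H2 a b))))).
Qed.

Variables (O : set V) (phi : nat -> V -> R) (eps : nat -> R) (f : V -> R) (M : R).
Variable u : 'I_n.+1 -> 'I_n.+1 -> V -> R.
Hypothesis Hphi : forall k, tc 4 O (phi k).
Hypothesis HM : forall k, Nk 2 (phi k) <= M.
Hypothesis eps0 : forall k, 0 <= eps k.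
Hypothesis epsl : tends0 eps.
Hypothesis sf : sq f.
Hypothesis Hres : forall k psi, tc 4 O psi -> `|en (phi k) psi - ip f psi| <= eps k * nrm (lap psi).
Hypothesis su : forall a b, sq (u a b).
Hypothesis ul : forall a b, tends0 (fun k => nrm (pd a (pd b (phi k)) - u a b)).
Let W : V -> R := \sum_a u a a.
Let sW : sq W. Proof. by apply: sq_sum. Qed.
Let kphi k := tc_kc (Hphi k).
Let spp k a b : sq (pd a (pd b (phi k))). Proof. exact: kc_sq (kc_pd a (kc_pd b (kphi k))). Qed.

Lemma W_lim : tends0 (fun k => nrm (lap (phi k) - W)).
Proof.
apply: (tends0_le _ (tends0_sum (fun a => ul a a))) => k.
rewrite /lap /W -sumrB; apply: nrm_sum => a _; exact: sqB.
Qed.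

Lemma W_lap psi : tc 4 O psi -> ip W (lap psi) = ip f psi.
Proof.
move=> tp; have kp := tc_kc tp.
apply: (ip_lim (gk := fun k => lap (phi k)) _ sW _ W_lim (tends0Z (nrm_ge0 (lap psi)) epsl)).
- by move=> k; exact: kc_sq (kc_lap (kphi k)).
- exact: kc_sq (kc_lap kp).
by move=> k; rewrite mulrC; exact: Hres.
Qed.

(** Four integrations by parts on the approximations, then the limit. It transfers regularity from
    the Laplacian [W] to each second derivative. *)
Lemma u_lap a b psi : tc 4 O psi -> ip (u a b) (lap psi) = ip W (pd a (pd b psi)).
Proof.
move=> tp; have kp := tc_kc tp.
have sp := kc_sq (kc_pd a (kc_pd b kp)).
have slp : sq (lap psi) := kc_sq (kc_lap kp).
refine (ip_lim (fun k => spp k a b) (su a b) slp (ul a b) (tends0Z (nrm_ge0 (pd a (pd b psi))) W_lim) _) => k.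
have -> : ip (pd a (pd b (phi k))) (lap psi) = ip (lap (phi k)) (pd a (pd b psi)).
  transitivity (\sum_i ip (pd a (pd b (phi k))) (pd i (pd i psi))).
    exact: (ip_sumr _ (fun i _ => kc_sq (kc_pd i (kc_pd i kp))) (spp k a b)).
  transitivity (\sum_i ip (pd i (pd i (phi k))) (pd a (pd b psi))).
    by apply: eq_bigr => i _; exact: (ip_pd4 a b i (kphi k) kp).
  exact: (esym (ip_suml _ (fun i _ => spp k i i) sp)).
have sl := kc_sq (kc_lap (kphi k)).
by rewrite -(ipBl sl sW sp) mulrC; apply: ip_CS => //; exact: sqB.
Qed.

Let lapD g h : kc 2 g -> kc 2 h -> lap (g + h) = lap g + lap h.
Proof.
move=> [Hg _] [Hh _]; rewrite /lap -big_split; apply: eq_bigr => i _ /=.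
rewrite (pdD1 i (Ck_le le1_2 Hg) (Ck_le le1_2 Hh)).
exact: pdD1 (Ck_pd i Hg) (Ck_pd i Hh).
Qed.

Lemma lap_tc2 O' g C : O' `<=` O -> sq g -> 0 <= C ->
  (forall psi, tc 4 O psi -> tc 4 O' psi -> `|ip g (lap psi)| <= C * nrm psi) ->
  forall psi, tc 2 O' psi -> `|ip g (lap psi)| <= C * nrm psi.
Proof.
move=> sub sg C0 H; apply: (tc2_ext (K := 1) sg) => //.
- by move=> h kh; exact: kc_sq (kc_lap kh).
- by move=> h kh; exact: nrm_lap.
by move=> psi ck cs; apply: H; split => //; exact: csupp_sub cs.
Qed.

Let tb x0 R0 rho q (Hc : chart O x0 R0 rho q) a b p :=
  tangential_bound Hc Hphi HM eps0 epsl sf Hres (su a b) (ul a b) p.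

Lemma local_reg x0 R0 rho q : chart O x0 R0 rho q -> exists2 r, 0 < r & forall a b i j,
  exists2 C, 0 <= C & forall psi, tc 2 (O `&` [set x | `|x - x0| < r]) psi ->
    `|ip (u a b) (pd i psi)| <= C * nrm psi /\ `|ip (u a b) (pd i (pd j psi))| <= C * nrm psi.
Proof.
move=> Hc; have [R00 Hflat cases] := Hc; pose R1 := R0 / 32.
have R10 : 0 < R1 by rewrite divr_gt0.
have R1R : R1 <= R0 by rewrite /R1; lra.
pose PP := [set psi : V -> R | tc 2 (O `&` [set x | `|x - x0| < R1]) psi].
have kP psi : PP psi -> kc 2 psi by move=> pp; exact: tc_kc pp.
have HP a b p : exists2 C, 0 <= C & forall psi, PP psi -> `|ip (u a b) (Xder rho q p psi)| <= C * nrm psi /\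
     `|ip (u a b) (Xder rho q p (Xder rho q p psi))| <= C * nrm psi.
  have [C C0 HC] := tb Hc a b p; exists C => // psi pp; apply: HC => [|x px]; first exact: kP.
  by have [d [L [d0 H]]] := pp.2; have [_ /(_ x)] := H x px; rewrite subrr normr0 => /(_ d0)[_ /= /ltW].
case: cases => [[q0 rho0 _]|[Hq1 HO]].
  exists R1 => // a b i j; have H1 := HP a b (e_ i).
  have XE p h : Xder rho q p h = dv p h by rewrite q0 rho0 X_flat0.
  have H2 := polar Hflat (su a b) kP (HP a b) _ i j.
  have [C1 C10 B1] := H1.
  have [|C2 C20 B2] := H2.
    by move=> k l psi pp; rewrite !XE !dv_e; exact: schwarz (kP _ pp).1.
  exists (C1 + C2); first exact: addr_ge0.
  move=> psi pp; have [h1 _] := B1 _ pp; have h2 := B2 _ pp; rewrite !XE !dv_e in h1 h2.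
  have N0 := nrm_ge0 psi; have p1 := mulr_ge0 C10 N0; have p2 := mulr_ge0 C20 N0.
  rewrite mulrDl; split; [apply: (le_trans h1); rewrite lerDl//|apply: (le_trans h2); rewrite lerDr//].
have Pos r : r <= R0 -> O `&` [set x | `|x - x0| < r] = [set x | 0 < rho x] `&` [set x | `|x - x0| < r].
  move=> rR; apply/seteqP; split=> x [] /= h1 h2; split=> //=; have h3 := lt_le_trans h2 rR; exact/(HO x h3).
have HX i j psi : PP psi -> Xder rho q (e_ i) (Xder rho q (e_ j) psi) = Xder rho q (e_ j) (Xder rho q (e_ i) psi).
  move=> pp; have p2 := (kP _ pp).1; have r4 : Ck 4 rho by case: Hflat.
  have Xr k l : Xder rho q (e_ k) (pd l rho) = pd k (pd l rho).
    by rewrite (XmE rho q) (Q_pd_rho Hflat Hq1) mulr0 subr0.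
  have := schwarz i j p2; rewrite (pdpdE Hflat Hq1 i j p2) (pdpdE Hflat Hq1 j i p2) !Xr (schwarz i j (Ck_le le2_4 r4)).
  move: (Xder rho q (e_ i) (Xder rho q (e_ j) psi)) (Xder rho q (e_ j) (Xder rho q (e_ i) psi)) => A B.
  move: (Xder rho q (e_ i) (dv q psi)) (Xder rho q (e_ j) (dv q psi)) (pd j (pd i rho)) => E F G.
  move: (dv q (dv q psi)) (pd i rho) (pd j rho) => I J K; move: (dv q psi) => H.
  move=> e; apply/funext => x; have := f_equal (fun h => h x) e; rewrite !fctE => ex.
  have -> : A x = (A x + G x * H x + K x * E x + J x * F x + J x * K x * I x) - (G x * H x + K x * E x + J x * F x + J x * K x * I x) by ring.
  by rewrite ex; ring.
pose U r := [set x : V | 0 < rho x] `&` [set x | `|x - x0| < r].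
have H1 a b m : bounded psi in tc 2 (U R1), ip (u a b) (Xder rho q (e_ m) psi).
  by have [C C0 HC] := HP a b (e_ m); exists C => // psi; rewrite /U -Pos// => /HC[].
have H2 a b i m : bounded psi in tc 2 (U R1), ip (u a b) (Xder rho q (e_ i) (Xder rho q (e_ m) psi)).
  have [C C0 HC] := polar Hflat (su a b) kP (HP a b) HX i m.
  by exists C => // psi; rewrite /U -Pos// => /HC.
have cut r : 0 < r -> exists z : V -> R, [/\ forall k, kc k z, forall x, 2 * r <= `|x - x0| -> z x = 0 &
    forall x, `|x - x0| < r -> z x = 1].
  move=> r0; have [z [cz _ z1 z0 _]] := plateau_ex x0 r0; exists z; split => [k| |x xr] //.
  - split; first exact: cz.
    by exists (`|x0| + 2 * r) => x Lx; apply: z0; have := lerB_dist x x0; lra.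
  - exact: z1 (ltW xr).
have UO r : r <= R0 -> U r `<=` O by move=> rR x; rewrite /U -Pos// => -[].
have Wsum (T : (V -> R) -> V -> R) r : (forall psi, kc 2 psi -> sq (T psi)) ->
  (forall a b, bounded psi in tc 2 (U r), ip (u a b) (T psi)) ->
  bounded psi in tc 2 (U r), ip W (T psi).
  move=> sT HT; have /all_sig2[C C0 HC] a : {C | 0 <= C & forall psi, tc 2 (U r) psi -> `|ip (u a a) (T psi)| <= C * nrm psi}.
    exact: cid2 (HT a a).
  exists (\sum_a C a); first by apply: sumr_ge0.
  move=> psi tp; rewrite /W ip_suml//; last by apply: sT; exact: tc_kc tp.
  apply: (le_trans (ler_norm_sum _ _ _)); rewrite mulr_suml; apply: ler_sum => a _; exact: HC.
have sX1 m psi : kc 2 psi -> sq (Xder rho q (e_ m) psi).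
  by move=> kp; exact: kc_sq (kc_X Hflat (e_ m) le1_3 kp).
have sX2 i m psi : kc 2 psi -> sq (Xder rho q (e_ i) (Xder rho q (e_ m) psi)).
  by move=> kp; exact: kc_sq (kc_X Hflat (e_ i) le0_3 (kc_X Hflat (e_ m) le1_3 kp)).
pose r1 := R1 / 4; have r10 : 0 < r1 by rewrite divr_gt0.
have r1R : 2 * r1 < R1 by rewrite /r1; lra.
have r12 : r1 <= 2 * r1 by lra.
have r1R0 : r1 <= R0 by lra.
have [z [kz zo zi]] := cut _ r10.
have H3W : bounded psi in tc 2 (U R1), ip W (lap psi).
  exists (nrm f); first exact: nrm_ge0.
  apply: (lap_tc2 (UO _ R1R) sW (nrm_ge0 f)) => psi tp _; rewrite W_lap//.
  by apply: ip_CS => //; exact: kc_sq (tc_kc tp).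
have W1 m := Wsum _ R1 (sX1 m) (fun a b => H1 a b m).
have W2 i m := Wsum _ R1 (sX2 i m) (fun a b => H2 a b i m).
(* First round, for the Laplacian [W], whose own Laplacian the equation controls. *)
have NW := normal_pdpd Hflat Hq1 r1R r12 kz zo zi sW W1 W2 H3W.
pose r2 := r1 / 4; have r20 : 0 < r2 by rewrite divr_gt0.
have r2R : 2 * r2 < r1 by rewrite /r2; lra.
have r22 : r2 <= 2 * r2 by lra.
have [z' [kz' zo' zi']] := cut _ r20.
have Ule : U r1 `<=` U R1 by move=> x [px /= xr]; split => //=; lra.
have dn T g : (bounded psi in tc 2 (U R1), ip g (T psi)) ->
  bounded psi in tc 2 (U r1), ip g (T psi).
  by move=> [C C0 HC]; exists C => // psi [Hp cp]; apply: HC; split => //; exact: csupp_sub cp.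
exists r2 => // a b i j.
(* Second round, on the smaller ball: by [u_lap] the first round supplies the bound that the
   equation does not give for a single second derivative. *)
have H3u : bounded psi in tc 2 (U r1), ip (u a b) (lap psi).
  have [C C0 HC] := NW a b; exists C => //.
  apply: (lap_tc2 (UO _ r1R0) (su a b) C0) => psi tp tp'; rewrite u_lap//; apply: HC; exact: tc_le tp'.
have [C1 C10 B1] := normal_pd Hflat Hq1 r2R r22 kz' zo' zi' (su a b) (fun m => dn _ _ (H1 a b m)) (fun i m => dn _ _ (H2 a b i m)) H3u i.
have [C2 C20 B2] := normal_pdpd Hflat Hq1 r2R r22 kz' zo' zi' (su a b) (fun m => dn _ _ (H1 a b m)) (fun i m => dn _ _ (H2 a b i m)) H3u i j.
exists (C1 + C2); first exact: addr_ge0.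
have r2R0 : r2 <= R0 by lra.
move=> psi; rewrite Pos// => pp; have N0 := nrm_ge0 psi; have p1 := mulr_ge0 C10 N0; have p2 := mulr_ge0 C20 N0.
rewrite mulrDl; split; [apply: (le_trans (B1 _ pp)); rewrite lerDl//|apply: (le_trans (B2 _ pp)); rewrite lerDr//].
Qed.

End local_regularity.

(** * From local to global bounds *)

Section gluing.
Context {R : realType} {n : nat}.
Local Notation V := 'rV[R]_n.
Implicit Types (psi f : V -> R).

(** A partition of unity built one ball at a time: the piece $z\psi$ is handled locally, and
    $(1-z)\psi$ vanishes on the first ball, so the induction covers it with the remaining ones. *)
Lemma bound_glue (O : set V) (L0 : R) g (T : (V -> R) -> V -> R) : (forall x, O x -> `|x| <= L0) -> sq g ->
  (forall f, kc 2 f -> sq (T f)) ->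
  (forall f f', kc 2 f -> kc 2 f' -> T (f + f') = T f + T f') ->
  (forall x0, exists2 r, 0 < r & bounded psi in tc 2 (O `&` [set x | `|x - x0| < r]), ip g (T psi)) ->
  bounded psi in tc 2 O, ip g (T psi).
Proof.
move=> OL sg sT TD loc.
have T0 : ip g (T 0) = 0.
  have k0 : kc 2 (0 : V -> R) := kc0 2.
  by have := TD _ _ k0 k0; rewrite addr0 => /(f_equal (ip g)); rewrite (ipDr (sT _ k0) (sT _ k0) sg); lra.
have /choice[r Hr] := fun x => (let: ex_intro2 r r0 H := loc x in ex_intro (fun r => 0 < r /\ bounded psi in tc 2 (O `&` [set y | `|y - x| < r]), ip g (T psi)) r (conj r0 H)).
have r0 x : 0 < r x by case: (Hr x).
have Hs (s : seq V) : exists2 C, 0 <= C & forall psi, tc 2 O psi ->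
    (forall x, psi x != 0 -> exists2 t, t \in s & `|x - t| < r t / 4) -> `|ip g (T psi)| <= C * nrm psi.
  elim: s => [|t s [C C0 HC]].
    exists 0 => // psi tp H; have -> : psi = 0.
      apply/funext => x; apply/eqP/contraT => px; have [t] := H x px; by rewrite in_nil.
    by rewrite T0 normr0 mul0r.
  have [_ [C' C'0 HC']] := Hr t; have q0 : 0 < r t / 4 by rewrite divr_gt0.
  have [z [cz zb z1 z0 _]] := plateau_ex t q0.
  exists (C' + C); first exact: addr_ge0.
  move=> psi tp H; have sp := kc_sq (tc_kc tp).
  have tz : tc 2 (O `&` [set x | `|x - t| < r t]) (z * psi).
    split; first by apply: CkM => //; exact: tp.1.
    apply: (csupp_cut _ z0) tp.2; have := r0 t; lra.
  have c1z : Ck 2 (cst 1 - z) by apply: CkB => //; exact: Ck_cst.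
  have tz' : tc 2 O ((cst 1 - z) * psi) := tcM c1z tp.
  have E : psi = z * psi + (cst 1 - z) * psi by apply/funext => x; rewrite !fctE; ring.
  rewrite {1}E (TD _ _ (tc_kc tz) (tc_kc tz')) (ipDr (sT _ (tc_kc tz)) (sT _ (tc_kc tz')) sg).
  have nb (b : V -> R) : continuous b -> (forall x, `|b x| <= 1) -> nrm (b * psi) <= nrm psi.
    move=> cb b1; rewrite -[leRHS]mul1r; apply: nrm_mulb => //; exact: continuous_measurable_rV.
  apply: (le_trans (ler_normD _ _)); rewrite [leRHS]mulrDl; apply: lerD.
    apply: (le_trans (HC' _ tz)); rewrite ler_wpM2l//; apply: nb; first exact: (Ck_cont (cz 0)).
    by move=> x; have /andP[? ?] := zb x; rewrite ger0_norm.
  apply: (le_trans (HC _ tz' _)) => [x|].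
    rewrite -[((cst 1 - z) * psi) x]/((1 - z x) * psi x) mulf_eq0 negb_or => /andP[zx px].
    have [t'] := H x px; rewrite inE => /predU1P[->|ts] xt; last by exists t'.
    by move: zx; rewrite z1 ?subrr ?eqxx// ltW.
  rewrite ler_wpM2l//; apply: nb; first exact: (Ck_cont c1z).
  move=> x; have /andP[? ?] := zb x; rewrite -[(cst 1 - z) x]/(1 - z x) ger0_norm; lra.
have : cover_compact [set x : V | `|x| <= L0] by rewrite -compact_cover; exact: compact_cball.
move=> /(_ V setT (fun x => [set y | `|y - x| < r x / 4]))[].
- move=> x _; rewrite (_ : [set y | _] = ball x (r x / 4)); first exact: ball_open.
  by apply/seteqP; split => y; rewrite -ball_normE /= distrC.
- by move=> x _; exists x => //=; rewrite subrr normr0 divr_gt0.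
move=> D _ KD; have [C C0 HC] := Hs (finmap.enum_fset D).
exists C => // psi tp; apply: HC => // x px.
have Ox : O x by apply: contrapT => nx; move: px; rewrite (csupp_out tp.2 nx) eqxx.
by have [t tD /= xt] := KD x (OL x Ox); exists t.
Qed.

End gluing.

(* Composition with linear maps *)
Transparent pd.
Section linear_change.
Context {R : realType} {m n : nat}.
Local Notation V := 'rV[R]_m.
Local Notation W := 'rV[R]_n.
Variable L : V -> W.
Hypothesis LD : forall x y, L (x + y) = L x + L y.
Hypothesis LZ : forall (t : R) x, L (t *: x) = t *: L x.
Variable B : R.
Hypothesis B0 : 0 <= B.
Hypothesis LB : forall x, `|L x| <= B * `|x|.

Lemma lin_cont : continuous L.
Proof.
suff H (x : V) : L @ x --> L x by move=> x; exact: H.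
apply/(@cvgrPdist_le _ _ _ (nbhs x)) => e e0; apply/nbhs_ballP.
have P1 : 0 < B + 1 by rewrite ltr_wpDl.
exists (e / (B + 1)) => /=; first by rewrite divr_gt0.
move=> y; rewrite -ball_normE /= ltr_pdivlMr// => xy.
have -> : L x - L y = L (x - y) by rewrite LD -[- y]scaleN1r LZ scaleN1r.
apply: (le_trans (LB _)); move: xy (normr_ge0 (x - y)); rewrite mulrDr mulr1 mulrC; lra.
Qed.

Lemma Ck_lin_pd i (g : W -> R) x : Ck 1 g ->
  derivable (g \o L) x (e_ i) /\ pd i (g \o L) x = dv (L (e_ i)) g (L x).
Proof.
move=> Hg; have Hd : derivable g (L x) (L (e_ i)) by exact: C1_derivable.
have E : (fun h : R => h^-1 *: (((g \o L) \o shift x) (h *: e_ i) - (g \o L) x)) =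
  (fun h : R => h^-1 *: ((g \o shift (L x)) (h *: L (e_ i)) - g (L x))).
  by apply/funext => h; rewrite /= LD LZ.
split; first by rewrite /derivable E.
rewrite /pd -dvE// /derive E //.
Qed.

Lemma pd_lin i (g : W -> R) : Ck 1 g -> pd i (g \o L) = dv (L (e_ i)) g \o L.
Proof. by move=> Hg; apply/funext => x; exact: (Ck_lin_pd i x Hg).2. Qed.

Lemma Ck_lin k (g : W -> R) : Ck k g -> Ck k (g \o L).
Proof.
elim: k g => [|k IH] g Hg.
  apply/Ck0 => x; apply: continuous_comp; [exact: lin_cont|exact: (Ck_cont Hg)].
have Hg1 := Ck_le (isT : (1 <= k.+1)%N) Hg.
apply/CkS; split => [x|i x|i].
- apply: continuous_comp; [exact: lin_cont|exact: (Ck_cont Hg)].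
- exact: (Ck_lin_pd i x Hg1).1.
- by rewrite pd_lin//; apply: IH; exact: Ck_dv.
Qed.

(** The constant [c] is the contribution of the linear part of [rho] to its first derivatives. *)
Lemma lin_bdp k (g : W -> R) (c : R) : kc k g -> exists2 M, 0 <= M & forall s x, (size s <= k)%N ->
  `|partials s (cst c + (g \o L)) x| <= M.
Proof.
elim: k g c => [|k IH] g c kg.
  have [K cg] := kc_cc kg; have [M M0 HM] := cc_bounded cg.
  exists (`|c| + M); first by rewrite addr_ge0.
  move=> s x; rewrite leqn0 => /nilP->; apply: (le_trans (ler_normD _ _)); rewrite lerD2l; exact: HM.
have [K cg] := kc_cc kg; have [M M0 HM] := cc_bounded cg.
have /all_sig2[N N0 HN] i : {M | 0 <= M & forall s x, (size s <= k)%N ->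
    `|partials s (cst 0 + (dv (L (e_ i)) g \o L)) x| <= M}.
  by apply: cid2; apply: IH; exact: kc_dv.
exists (`|c| + M + \sum_i N i); first by rewrite !addr_ge0// sumr_ge0.
move=> s x; case/lastP: s => [_|s i].
  apply: (@le_trans _ _ (`|c| + M)); last by rewrite lerDl sumr_ge0.
  apply: (le_trans (ler_normD _ _)); rewrite lerD2l; exact: HM.
rewrite size_rcons ltnS => sk; rewrite partials_rcons.
have g1 := Ck_le (isT : (1 <= k.+1)%N) kg.1.
rewrite (pdD1 i (Ck_cst 1 c) (Ck_lin g1)) pd_cst (pd_lin i g1).
apply: (le_trans (HN i s x sk)); rewrite (bigD1 i)//=.
have P0 : 0 <= \sum_(j < m | j != i) N j by apply: sumr_ge0.
have := normr_ge0 c; move: M0 P0; lra.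
Qed.

End linear_change.
Opaque pd.

(** * Existence of charts *)

Section charts.
Context {R : realType} {n : nat}.
Local Notation V := 'rV[R]_n.+1.

Lemma interior_chart (O : set V) x0 : open O -> O x0 -> exists R0 rho q, chart O x0 R0 rho q.
Proof.
move=> oO Ox; have /nbhs_ballP[e /= e0 He] : nbhs x0 O by exact: open_nbhs_nbhs.
exists e, (cst 0), 0; split => //; first exact: flat0.
by left; split => // x xe; apply: He; rewrite -ball_normE /= distrC.
Qed.

(** In the rotated coordinates [rho] is the height above the graph, and [q] is the vertical unit
    vector transported back. *)
Lemma boundary_chart (O : set V) alpha x0 : of_class_Ckalpha 4 alpha O -> (closure O `\` O°) x0 ->
  exists R0 rho q, chart O x0 R0 rho q.
Proof.
move=> cO bx; have [A [r [gamma [AA r0 [Hg _] HO]]]] := cO x0 bx.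
pose l (x : V) := (x *m A) ord0 ord0.
pose L (x : V) : 'rV[R]_n := rsubmx (x *m A : 'rV_(1 + n)).
have LD x y : L (x + y) = L x + L y by rewrite /L mulmxDl linearD.
have LZ t x : L (t *: x) = t *: L x by rewrite /L -scalemxAl linearZ.
have lD x y : l (x + y) = l x + l y by rewrite /l mulmxDl mxE.
have lZ t x : l (t *: x) = t * l x by rewrite /l -scalemxAl mxE.
pose B := \sum_i \sum_j `|A i j|.
have B0 : 0 <= B by do 2!(apply: sumr_ge0 => ? _).
have cB (x : V) k : `|(x *m A) ord0 k| <= B * `|x|.
  rewrite mxE; apply: (le_trans (ler_norm_sum _ _ _)); rewrite /B mulr_suml; apply: ler_sum => i _.
  rewrite normrM mulrC; apply: ler_pM => //; last exact: coord_le_norm.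
  by rewrite (bigD1 k)//= lerDl sumr_ge0.
have LB x : `|L x| <= B * `|x|.
  apply: norm_le_coord => [|i]; first by rewrite mulr_ge0.
  by rewrite mxE; exact: cB.
have [z [cz _ z1 z0 _]] := plateau_ex (L x0) (@ltr01 R).
(* Cutting [gamma] off leaves the set unchanged near [x0] and makes the derivatives of [rho]
   globally bounded, as [flat] requires. *)
pose g := - (z * gamma).
have kg : kc 4 g.
  apply: kcN; split; first exact: CkM.
  exists (`|L x0| + 2) => y Ly; rewrite -[LHS]/(z y * gamma y) z0 ?mul0r//.
  by have := lerB_dist y (L x0); lra.
pose rho (x : V) := l x + g (L x).
pose q : V := e_ ord0 *m A^T.
have qA : q *m A = e_ ord0.
  by rewrite /q -mulmxA (mulmx1C AA) mulmx1.
have lq : l q = 1 by rewrite /l qA mxE !eqxx.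
have Lq : L q = 0.
  by rewrite /L qA; apply/rowP => j; rewrite !mxE eqxx.
have Hq1 x t : rho (x + t *: q) = rho x + t.
  by rewrite /rho lD lZ lq mulr1 LD LZ Lq scaler0 addr0 addrAC.
have lpd i x : is_derive x (e_ i) l (l (e_ i)).
  have E : (fun h : R => h^-1 *: ((l \o shift x) (h *: e_ i) - l x)) @ 0^' --> l (e_ i).
    apply: cvg_near_cst; near=> h; rewrite /= lD lZ addrK /GRing.scale /= mulKf//.
    near: h; exact: nbhs_dnbhs_neq.
  by split; [apply/cvg_ex; exists (l (e_ i))|exact: cvg_lim].
have pdl i : pd i l = cst (l (e_ i)) by apply/funext => x; have := lpd i x => -[].
have Cl0 : continuous l.
    suff H (x : V) : l @ x --> l x by move=> x; exact: H.
    apply/(@cvgrPdist_le _ _ _ (nbhs x)) => e e0; apply/nbhs_ballP.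
    have P1 : 0 < B + 1 by rewrite ltr_wpDl.
    exists (e / (B + 1)) => /=; first by rewrite divr_gt0.
    move=> y; rewrite -ball_normE /= ltr_pdivlMr// => xy.
    have -> : l x - l y = l (x - y) by rewrite lD -[- y]scaleN1r lZ mulN1r.
    apply: (le_trans (cB _ _)); move: xy (normr_ge0 (x - y)); rewrite mulrDr mulr1 mulrC; lra.
have Cl k : Ck k l.
  case: k => [|k]; first exact/Ck0.
  apply/CkS; split => [//|i x|i]; last by rewrite pdl; exact: Ck_cst.
  by have := lpd i x => -[].
have rE : rho = l + (g \o L) by [].
have Cr : Ck 4 rho by rewrite rE; apply: CkD => //; exact: (Ck_lin LD LZ B0 LB kg.1).
have g1 := Ck_le le1_4 kg.1.
have /all_sig2[N N0 HN] i : {M | 0 <= M & forall s x, (size s <= 3)%N ->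
    `|partials s (cst (l (e_ i)) + (dv (L (e_ i)) g \o L)) x| <= M}.
  by apply: cid2; apply: (lin_bdp LD LZ B0 LB); exact: kc_dv.
(* Within $(B+1)^{-1}$ of [x0] the horizontal coordinates move by at most 1, where the cut-off is
   1. *)
exists (Num.min r (B + 1)^-1), rho, q; split.
- by rewrite lt_min r0 invr_gt0 ltr_wpDl.
- split => //; last first.
    by move=> x t v; rewrite (addrAC x (t *: q) v) !Hq1; ring.
  exists (\sum_i N i); first exact: sumr_ge0.
  move=> s x; case/lastP: s => // s i; rewrite size_rcons /= ltnS => sk; rewrite partials_rcons.
  rewrite rE (pdD1 i (Cl 1%N) (Ck_lin LD LZ B0 LB g1)) pdl (pd_lin LD LZ i g1).
  apply: (le_trans (HN i s x sk)); rewrite (bigD1 i)//= lerDl; exact: sumr_ge0.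
right; split => // x; rewrite lt_min => /andP[xr xB].
have xb : ball x0 r x by rewrite -ball_normE /= distrC.
have Lx : `|L x - L x0| <= 1.
  have -> : L x - L x0 = L (x - x0) by rewrite LD -[- x0]scaleN1r LZ scaleN1r.
  apply: (le_trans (LB _)); move: xB; rewrite -[(B + 1)^-1]mul1r ltr_pdivlMr ?ltr_wpDl//.
  by have := normr_ge0 (x - x0); rewrite mulrDr mulr1 mulrC; lra.
rewrite (HO x xb) /rho -[g (L x)]/(- (z (L x) * gamma (L x))) z1// mul1r subr_gt0.
by [].
Unshelve. all: by end_near. Qed.

Lemma chart_ex (O : set V) alpha x0 : open O -> of_class_Ckalpha 4 alpha O -> closure O x0 ->
  exists R0 rho q, chart O x0 R0 rho q.
Proof.
move=> oO cO cx; case: (pselect (O x0)) => Ox; first exact: interior_chart.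
apply: (boundary_chart cO); split => //; by move/interior_subset.
Qed.

End charts.

(** * Sobolev functions and the two eigenvalue problems *)

Section sobolev.
Context {R : realType} {n : nat}.
Local Notation V := 'rV[R]_n.+1.
Local Notation vol := (@vol R n.+1).
Implicit Types (f g phi psi w : V -> R) (s : seq 'I_n.+1) (i j : 'I_n.+1).
Variable O : set V.
Hypothesis oO : open O.
Let mO : measurable O. Proof. exact: open_measurable_rV. Qed.
(** Extension by zero: functions on [O] enter the estimates through it, so the whole-space [ip] and
    [nrm] serve for the integrals over [O]. *)
Local Notation E f := (Ind O * f).

Lemma patch_Ind f : f \_ O = E f.
Proof.
apply/funext => x; rewrite /patch -[RHS]/(Ind O x * f x); case: ifPn => [|nx].
  by rewrite inE => Ox; rewrite Ind1// mul1r.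
by rewrite Ind0 ?mul0r// => Ox; move/negP: nx; apply; rewrite inE.
Qed.

Lemma E_E f : E (E f) = E f.
Proof.
apply/funext => x; rewrite -[LHS]/(Ind O x * (Ind O x * f x)) -[RHS]/(Ind O x * f x).
by case: (pselect (O x)) => Ox; [rewrite Ind1// !mul1r|rewrite Ind0// !mul0r].
Qed.

Lemma Rint_E f g : \int[lebesgue_rV n.+1]_(x in O) (f x * g x) = ip (E f) g.
Proof.
rewrite /ip Rintegral_mkcond; congr Rintegral; rewrite patch_Ind; apply/funext => x.
by rewrite -[LHS]/(Ind O x * (f x * g x)) mulrA.
Qed.

Lemma Rint_EE f g : \int[lebesgue_rV n.+1]_(x in O) (f x * g x) = ip (E f) (E g).
Proof. by rewrite Rint_E -(ip_mull (Ind O)) E_E. Qed.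

Lemma Lnorm_nrm f : sq f -> 'N[lebesgue_rV n.+1]_2%:E[EFin \o f]%E = (nrm f)%:E.
Proof.
move=> sf; rewrite unlock /nrm.
have -> : (\int[lebesgue_rV n.+1]_x (`|(EFin \o f) x| `^ 2))%E = (ip f f)%:E.
  rewrite (ip_EFin sf); apply: eq_integral => x _ /=.
  by rewrite powR_mulrn// real_normK// num_real.
by rewrite poweR_EFin powR12_sqrt// ip_ge0.
Qed.

Lemma L2P f : L2 O f <-> sq (E f).
Proof.
rewrite /L2 /mkset patch_Ind; split => [H|sf].
  have := H; rewrite inE => /andP[]; rewrite inE /= => mf _; apply: sqP => //.
  by have /integrableP[_] := Lfun2_integrable_sqr H; apply: le_lt_trans; apply: ge0_le_integral => //;
    do ?[by move=> x _; rewrite lee_fin sqr_ge0]; do ?[by move=> x _; exact: abse_ge0];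
    do ?[by move=> x _ /=; rewrite lee_fin ler_norm];
    do ?[by apply/measurable_EFinP; exact: measurable_funX];
    apply: measurableT_comp => //; apply/measurable_EFinP; exact: measurable_funX.
rewrite inE; apply/andP; split; first by rewrite inE /=; exact: sq_mble.
by rewrite inE /= /finite_norm (Lnorm_nrm sf) ltry.
Qed.

Lemma L2normE f : sq (E f) -> L2norm O f = (nrm (E f))%:E.
Proof. by move=> sf; rewrite /L2norm patch_Ind Lnorm_nrm. Qed.

Lemma eq_onE f g : eq_on O f g <-> {ae vol, forall x, E f x = E g x}.
Proof.
split; apply: filterS => x.
  move=> H; rewrite -[LHS]/(Ind O x * f x) -[RHS]/(Ind O x * g x).
  by case: (pselect (O x)) => Ox; [rewrite H|rewrite Ind0// !mul0r].
by move=> + Ox; rewrite -[LHS]/(Ind O x * f x) -[RHS]/(Ind O x * g x) Ind1// !mul1r.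
Qed.

Lemma nrm_ae0 f g : sq f -> sq g -> nrm (f - g) = 0 <-> {ae vol, forall x, f x = g x}.
Proof.
move=> sf sg; split => [H|H].
  by have := nrm_eq0 (sqB sf sg) H; apply: filterS => x /eqP; rewrite -[(f - g) x]/(f x - g x) subr_eq0 => /eqP.
rewrite -(nrm0 (R := R) (n := n.+1)); apply: nrm_ae; [exact: sqB|exact: sq0|].
by apply: filterS H => x; rewrite -[(f - g) x]/(f x - g x) => ->; rewrite subrr.
Qed.

Lemma eq_onP f g : sq (E f) -> sq (E g) -> eq_on O f g <-> nrm (E f - E g) = 0.
Proof. by move=> sf sg; rewrite eq_onE; split => /(nrm_ae0 sf sg). Qed.

Lemma test_funP phi : test_fun O phi <-> Coo phi /\ csupp O phi.
Proof.
split=> [[c [K [cK KO K0]]]|[c [d [L [d0 H]]]]].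
  split => //; have [z [_ cz _ z1]] := cut_compact oO cK KO; apply: csupp_le cz => x px.
  rewrite z1 ?oner_neq0//; apply: contrapT => nx; move: px; by rewrite K0// eqxx.
split => //; pose K := closure [set x | phi x != 0].
have near_supp x : K x -> exists2 y, phi y != 0 & `|y - x| < d.
  move=> Kx; have : nbhs x (ball x d) by apply: nbhsx_ballx.
  by move=> /Kx[y [/= py]]; rewrite -ball_normE /= => xy; exists y => //; rewrite distrC.
exists K; split.
- apply: (subclosed_compact _ (@compact_cball R n.+1 (L + d))); first exact: closed_closure.
  by move=> x /near_supp[y py yx] /=; have [yL _] := H y py; have := lerB_dist x y; rewrite distrC; lra.
- by move=> x /near_supp[y py yx]; have [_] := H y py; exact.
- by move=> x nx; apply/eqP/contraT => px; case: nx; exact: subset_closure.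
Qed.

Lemma Coo_partials s phi : Coo phi -> Coo (partials s phi).
Proof. by move=> c m; exact: Ck_partials (c _). Qed.

Lemma csupp_partials s phi : csupp O phi -> csupp O (partials s phi).
Proof. by elim: s => [//|i s IH] cs; rewrite partials_cons; apply: csupp_pd; exact: IH. Qed.

Definition test phi := Coo phi /\ csupp O phi.

Lemma test_partials s phi : test phi -> test (partials s phi).
Proof. by move=> [c cs]; split; [exact: Coo_partials|exact: csupp_partials]. Qed.

Lemma test_tc k phi : test phi -> tc k O phi.
Proof. by move=> [c cs]; split. Qed.

Lemma test_sq phi : test phi -> sq phi.
Proof. by move=> tp; exact: kc_sq (tc_kc (test_tc 0 tp)). Qed.

Lemma E_test phi : test phi -> E phi = phi.
Proof. by move=> [_ cs]; apply: Ind_id => x; exact: csupp_out. Qed.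

Lemma ipE f psi : test psi -> ip (E f) psi = ip f psi.
Proof. by move=> tp; rewrite ip_mull E_test. Qed.

Lemma weak_derivP s f g : is_weak_deriv O s f g <->
  forall phi, test phi -> ip (E f) (partials s phi) = (-1) ^+ size s * ip (E g) phi.
Proof.
by split => H phi /test_funP tp; have := H phi tp; rewrite !Rint_E.
Qed.

Lemma weak_uniq f g : sq f -> sq g -> (forall phi, test phi -> ip f phi = ip g phi) -> nrm (E f - E g) = 0.
Proof.
move=> sf sg H; have -> : E f - E g = E (f - g) by rewrite mulrBr.
apply: (fundamental oO (sqB sf sg)) => phi c cs.
have tp : test phi by split.
by rewrite (ipBl sf sg (test_sq tp)) H// subrr.
Qed.

Local Notation D s w := (E (weak_deriv O s w)).

(** [weak_deriv] is a choice with default value 0; membership in the Sobolev space makes the set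
    chosen from nonempty, so the value is a true weak derivative. *)
Lemma wd_spec k s w : sobolev O k w -> (size s <= k)%N -> sq (D s w) /\
  forall phi, test phi -> ip (E w) (partials s phi) = (-1) ^+ size s * ip (D s w) phi.
Proof.
move=> [_ H] sk; have [g Lg wg] := H s sk.
have [] : [set g | L2 O g /\ is_weak_deriv O s w g] (weak_deriv O s w).
  by apply: (@xgetPex _ _ [set g | L2 O g /\ is_weak_deriv O s w g]); exists g.
by move=> /L2P s1 /weak_derivP s2.
Qed.

Lemma wd_eq s w g : L2 O g -> is_weak_deriv O s w g -> nrm (E g - D s w) = 0.
Proof.
move=> Lg wg; have [] : [set g | L2 O g /\ is_weak_deriv O s w g] (weak_deriv O s w).
  by apply: (@xgetPex _ _ [set g | L2 O g /\ is_weak_deriv O s w g]); exists g.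
move=> /L2P s1 /weak_derivP s2; move/L2P in Lg; move/weak_derivP in wg.
rewrite -{1}(E_E g) -(E_E (weak_deriv O s w)); apply: weak_uniq => // phi tp.
have h := wg _ tp; rewrite s2// in h; apply: (mulfI _ (esym h)).
by rewrite signr_eq0.
Qed.

Lemma lap_wd w : E (laplacian O w) = \sum_i D [:: i; i] w.
Proof.
rewrite /laplacian -mulr_sumr; congr (_ * _); apply/funext => x; by rewrite fct_sumE.
Qed.

Lemma sob_le k k' w : (k <= k')%N -> sobolev O k' w -> sobolev O k w.
Proof. by move=> kk [Lw H]; split => // s sk; apply: H; exact: leq_trans kk. Qed.

Lemma sq_sob k w : sobolev O k w -> sq (E w).
Proof. by move=> [/L2P]. Qed.

Lemma sq_lap w : sobolev O 2 w -> sq (E (laplacian O w)).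
Proof.
move=> sw; rewrite lap_wd; apply: sq_sum => i _.
exact: (wd_spec sw (s := [:: i; i]) isT).1.
Qed.

Lemma wd_nil k w : sobolev O k w -> nrm (E w - D [::] w) = 0.
Proof.
move=> [Lw _]; apply: wd_eq => //; apply/weak_derivP => phi tp.
by rewrite mul1r.
Qed.

Lemma nrm_tri f g h : sq f -> sq g -> sq h -> nrm (f - h) <= nrm (f - g) + nrm (g - h).
Proof.
move=> sf sg sh; have -> : f - h = (f - g) + (g - h) by rewrite addrA subrK.
by apply: nrmD; exact: sqB.
Qed.

Lemma sob0_approx w : sobolev0 O 2 w -> exists phi : nat -> V -> R, (forall k, test (phi k)) /\
  forall k s, (size s <= 2)%N -> nrm (partials s (phi k) - D s w) <= k.+1%:R^-1.
Proof.
move=> [sw H]; have /choice[phi Hphi] : forall k : nat, exists phi, test phi /\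
    forall s, (size s <= 2)%N -> nrm (partials s phi - D s w) <= k.+1%:R^-1.
  move=> k; have e0 : 0 < k.+1%:R^-1 :> R by rewrite invr_gt0 ltr0Sn.
  have [phi /test_funP tp Hp] := H _ e0; exists phi; split => // s ss.
  have [s1 _] := wd_spec sw ss.
  have EE : E (partials s phi \- weak_deriv O s w) = partials s phi - D s w.
    by rewrite -{2}(E_test (test_partials s tp)) -mulrBr.
  have sE : sq (partials s phi - D s w) := sqB (test_sq (test_partials s tp)) s1.
  by have := Hp s ss; rewrite L2normE EE// lte_fin => /ltW.
by exists phi; split => [k|k]; [case: (Hphi k)|case: (Hphi k)].
Qed.

End sobolev.

Lemma cauchy_num (R : realFieldType) (a b c d e : R) : `|d - c| <= a -> `|e - c| <= b -> d - e <= a + b.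
Proof. by rewrite !ler_norml => /andP[? ?] /andP[? ?]; lra. Qed.

Lemma density_num (R : realFieldType) (a b c d e : R) : `|d| <= a -> `|e| <= b -> `|c - d - (c - e)| <= a + b.
Proof. by rewrite !ler_norml => /andP[? ?] /andP[? ?]; apply/andP; split; lra. Qed.

(** * Existence and $H^4$ regularity *)

Section existence_regularity.
Context {R : realType} {n : nat}.
Local Notation V := 'rV[R]_n.+1.
Local Notation vol := (@vol R n.+1).
Implicit Types (f g phi psi w : V -> R) (s : seq 'I_n.+1) (i j : 'I_n.+1).
Variable O : set V.
Hypothesis oO : open O.
Let mO : measurable O. Proof. exact: open_measurable_rV. Qed.
Local Notation E f := (Ind O * f).
Local Notation D s w := (E (weak_deriv O s w)).
Local Notation test := (test O).

Lemma test_byparts s phi psi : (size s <= 2)%N -> test phi -> test psi ->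
  ip phi (partials s psi) = (-1) ^+ size s * ip (partials s phi) psi.
Proof.
move=> ss tp tq; have [c [L bL]] := tc_kc (test_tc 2 tp); have c' := tq.1.
have c1 := Ck_le le1_2 c.
have B i g : Ck 1 g -> ip phi (pd i g) = - ip (pd i phi) g.
  by move=> Hg; rewrite (ip_byparts_pd i c1 Hg bL) opprK.
case: s ss => [|i [|j [|? ?]]]// _.
- by rewrite mul1r.
- by rewrite expr1 mulN1r; exact: (B i _ (c' 1%N)).
rewrite sqrrN expr1n mul1r.
have e1 : ip phi (partials [:: i; j] psi) = - ip (pd i phi) (pd j psi) := B i _ (Ck_pd j (c' 2%N)).
have e2 : ip (pd j (pd i phi)) psi = - ip (pd i phi) (pd j psi).
  exact: (ip_byparts_pd j (Ck_pd i c) (c' 1%N) (bs_pd i bL)).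
exact: (etrans e1 (etrans (esym e2) (f_equal (fun h => ip h psi) (schwarz j i c)))).
Qed.

Lemma nrm_E f : sq f -> nrm (E f) <= nrm f.
Proof.
move=> sf; rewrite -[leRHS]mul1r; apply: nrm_mulb => //; [exact: measurable_Ind|exact: Ind_le].
Qed.

(** The limits of the partial derivatives are the weak derivatives of the limit, by integration by
    parts on each term; the same sequence then shows membership in $H^2_0$. *)
Lemma sob0_build (phi : nat -> V -> R) (G : seq 'I_n.+1 -> V -> R) : (forall k, test (phi k)) ->
  (forall s, (size s <= 2)%N -> sq (G s) /\ tends0 (fun k => nrm (partials s (phi k) - G s))) ->
  exists2 w, sobolev0 O 2 w & forall s, (size s <= 2)%N -> tends0 (fun k => nrm (partials s (phi k) - D s w)).
Proof.
move=> tp HG; pose w := E (G [::]).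
have tps k s : test (partials s (phi k)) by exact: test_partials.
have sG s : (size s <= 2)%N -> sq (E (G s)) by move=> /HG[sg _]; exact: sq_Ind.
have GE s : (size s <= 2)%N -> tends0 (fun k => nrm (partials s (phi k) - E (G s))).
  move=> ss; have [sg lim] := HG s ss; apply: (tends0_le _ lim) => k.
  have st := test_sq (tps k s).
  rewrite -{1}(E_test (tps k s)) -mulrBr; apply: nrm_E; exact: sqB.
have wd s : (size s <= 2)%N -> is_weak_deriv O s w (G s).
  move=> ss; apply/(weak_derivP oO) => psi tq; rewrite /w E_E.
  have sq1 := test_sq tq; have sq2 := test_sq (test_partials s tq).
  apply: (ip_lim (fun k => test_sq (tp k)) (sG [::] isT) sq2 (GE [::] isT) (tends0Z (nrm_ge0 psi) (GE s ss))) => k.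
  rewrite (test_byparts ss (tp k) tq) -mulrBr normrMsign -(ipBl (test_sq (tps k s)) (sG s ss) sq1) [leRHS]mulrC.
  exact: (ip_CS (sqB (test_sq (tps k s)) (sG s ss)) sq1).
have LG s : (size s <= 2)%N -> L2 O (G s) by move=> ss; apply/(L2P O _); exact: sG.
have sw : sobolev O 2 w.
  split; first by apply/(L2P O _); rewrite /w E_E; exact: sG.
  by move=> s ss; exists (G s); [exact: LG|exact: wd].
have lim s : (size s <= 2)%N -> tends0 (fun k => nrm (partials s (phi k) - D s w)).
  move=> ss; apply: (tends0_le _ (GE s ss)) => k.
  have e0 := wd_eq oO (LG s ss) (wd s ss); have [sd _] := wd_spec oO sw ss.
  by have := nrm_tri (test_sq (tps k s)) (sG s ss) sd; rewrite e0 addr0.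
exists w => //; split => // e e0.
have L1 := lim [::] isT; have L2 := tends0_sum (fun i => lim [:: i] isT).
have L3 := tends0_sum (fun i => tends0_sum (fun j => lim [:: i; j] isT)).
have e2 : 0 < e / 2 by rewrite divr_gt0.
have [N HN] := tends0D (tends0D L1 L2) L3 e2; have := HN N (leqnn N).
set a := nrm _; set b := \sum_i _; set c := \sum_i _ => habc.
have a0 : 0 <= a by exact: nrm_ge0.
have b0 : 0 <= b by apply: sumr_ge0 => i _; exact: nrm_ge0.
have c0 : 0 <= c by apply: sumr_ge0 => i _; apply: sumr_ge0 => j _; exact: nrm_ge0.
exists (phi N); first by apply/(test_funP oO); exact: tp.
move=> s ss; have [sd _] := wd_spec oO sw ss; have st := test_sq (tps N s).
have EE : E (partials s (phi N) \- weak_deriv O s w) = partials s (phi N) - D s w.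
  by rewrite -{2}(E_test (tps N s)) -mulrBr.
rewrite L2normE EE; last exact: sqB.
rewrite lte_fin.
suff : nrm (partials s (phi N) - D s w) <= a + b + c by move: habc e0; lra.
case: s ss {sd st EE} => [|i [|j [|? ?]]]// _.
- by rewrite -/a; move: b0 c0; lra.
- have : nrm (partials [:: i] (phi N) - D [:: i] w) <= b.
    by apply: (le_term (F := fun i => nrm (partials [:: i] (phi N) - D [:: i] w))) => k; exact: nrm_ge0.
  by move: a0 c0; lra.
have h1 : nrm (partials [:: i; j] (phi N) - D [:: i; j] w) <= \sum_j nrm (partials [:: i; j] (phi N) - D [:: i; j] w).
  by apply: (le_term (F := fun j => nrm (partials [:: i; j] (phi N) - D [:: i; j] w))) => k; exact: nrm_ge0.
have h2 : \sum_j nrm (partials [:: i; j] (phi N) - D [:: i; j] w) <= c.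
  apply: (le_term (F := fun i => \sum_j nrm (partials [:: i; j] (phi N) - D [:: i; j] w))) => k.
  by apply: sumr_ge0 => l _; exact: nrm_ge0.
by move: (le_trans h1 h2) a0 b0; lra.
Qed.

Lemma lap_conv (phi : nat -> V -> R) w : (forall k, test (phi k)) -> sobolev O 2 w ->
  (forall s, (size s <= 2)%N -> tends0 (fun k => nrm (partials s (phi k) - D s w))) ->
  tends0 (fun k => nrm (lap (phi k) - E (laplacian O w))).
Proof.
move=> tp sw lim; apply: (tends0_le _ (tends0_sum (fun i => lim [:: i; i] isT))) => k.
rewrite lap_wd /lap -sumrB; apply: nrm_sum => i _.
exact: (sqB (test_sq (test_partials [:: i; i] (tp k))) (wd_spec oO sw (s := [:: i; i]) isT).1).
Qed.

Lemma nrm_partials s k f : (size s <= k)%N -> nrm (partials s f) <= Nk k f.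
Proof.
elim: k s f => [|k IH] s f; first by rewrite leqn0 => /nilP->; exact: nrm_Nk.
case/lastP: s => [_|s i]; first exact: nrm_Nk.
by rewrite size_rcons ltnS partials_rcons => sk; apply: le_trans (Nk_pd k i f); exact: IH.
Qed.

Lemma partialsB s f g : Coo f -> Coo g -> partials s (f - g) = partials s f - partials s g.
Proof.
move=> cf cg; elim: s => [//|i s IH]; rewrite !partials_cons IH.
by apply: pdB1; exact: (Coo_partials s _ 1%N).
Qed.

Lemma lapL t f g : Ck 2 f -> Ck 2 g -> lap (t *: f + g) = t *: lap f + lap g.
Proof.
move=> Hf Hg; rewrite /lap scaler_sumr -big_split; apply: eq_bigr => i _ /=.
have f1 := Ck_le le1_2 Hf; have g1 := Ck_le le1_2 Hg.
rewrite (pdD1 i (CkZ t f1) g1) (pdZ1 i t f1) (pdD1 i (CkZ t (Ck_pd i Hf)) (Ck_pd i Hg)).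
by rewrite (pdZ1 i t (Ck_pd i Hf)).
Qed.

Lemma lapB' f g : Ck 2 f -> Ck 2 g -> lap (f - g) = lap f - lap g.
Proof. by move=> Hf Hg; rewrite addrC -scaleN1r (lapL _ Hg Hf) scaleN1r addrC. Qed.

Lemma sq_laptest phi : test phi -> sq (lap phi).
Proof. by move=> tp; exact: kc_sq (kc_lap (tc_kc (test_tc 2 tp))). Qed.

Variable L0 : R.
Hypothesis L00 : 0 <= L0.
Hypothesis OL : forall x, O x -> `|x| <= L0.

Lemma test_coercive : exists2 C, 0 <= C & forall phi, test phi -> Nk 2 phi <= C * nrm (lap phi).
Proof.
have [C C0 HC] := @coercive R n L0 L00; exists C => // phi tp; apply: HC; first exact: tc_kc (test_tc 3 tp).
move=> x Lx; apply: (csupp_out tp.2) => Ox; have := OL Ox; lra.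
Qed.

(** Riesz for the energy form on test functions: coercivity makes the approximate representatives
    Cauchy in $H^2$, and [sob0_build] provides the limit. *)
Lemma existence f : sq f -> exists2 w, sobolev0 O 2 w &
  forall psi, test psi -> ip (E (laplacian O w)) (lap psi) = ip f psi.
Proof.
move=> sf; have [C C0 HC] := test_coercive.
have t2 psi : test psi -> Ck 2 psi by move=> [c _]; exact: c.
have tL t u v : test u -> test v -> test (t *: u + v).
  move=> [cu su] [cv sv]; split; first by move=> m; apply: CkD => //; exact: CkZ.
  by apply: csuppD => //; exact: csuppZ.
have enE u : en u u = nrm (lap u) ^+ 2 by rewrite nrm_sq.
have [] := @riesz_approx R (V -> R) test (@en R n.+1) (ip f) ((nrm f * C) ^+ 2).
- by split; [move=> m; exact: (Ck_cst m 0)|exists 1, 0; split => // x; rewrite eqxx].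
- exact: tL.
- by move=> u v _ _; exact: ipC.
- move=> t u v z tu tv tz; rewrite /en (lapL t (t2 _ tu) (t2 _ tv)).
  rewrite (ipDl (sqZ t (sq_laptest tu)) (sq_laptest tv) (sq_laptest tz)).
  by rewrite (ipZl t (sq_laptest tu) (sq_laptest tz)).
- by move=> u _; exact: ip_ge0.
- move=> t u v tu tv; have su := test_sq tu.
  by rewrite (ipDr (sqZ t su) (test_sq tv) sf) (ipZr t su sf).
- move=> u tu; rewrite enE -exprMn -real_normK ?num_real// ler_pXn2r ?nnegrE ?mulr_ge0 ?nrm_ge0//.
  apply: (le_trans (ip_CS sf (test_sq tu))); rewrite -mulrA ler_wpM2l ?nrm_ge0//.
  exact: (le_trans (nrm_Nk 2 u) (HC u tu)).
move=> phi tp Hres.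
have res k psi : test psi -> `|en (phi k) psi - ip f psi| <= k.+1%:R^-1 * nrm (lap psi) by move=> /Hres.
have inv0 k : 0 <= k.+1%:R^-1 :> R by rewrite invr_ge0.
have cauchy k l : Nk 2 (phi k - phi l) <= C * (k.+1%:R^-1 + l.+1%:R^-1).
  have td : test (phi k - phi l) by rewrite addrC -scaleN1r; exact: tL.
  apply: (le_trans (HC _ td)); rewrite ler_wpM2l//.
  have h : nrm (lap (phi k - phi l)) ^+ 2 <= (k.+1%:R^-1 + l.+1%:R^-1) * nrm (lap (phi k - phi l)).
    rewrite -enE {1}/en (lapB' (t2 _ (tp k)) (t2 _ (tp l))).
    rewrite (ipBl (sq_laptest (tp k)) (sq_laptest (tp l))); last first.
      by apply: sqB; exact: sq_laptest.
    rewrite -(lapB' (t2 _ (tp k)) (t2 _ (tp l))).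
    rewrite mulrDl; exact: (cauchy_num (res k _ td) (res l _ td)).
  have [->|N0] := eqVneq (nrm (lap (phi k - phi l))) 0; first by rewrite addr_ge0.
  by move: h; rewrite expr2 ler_pM2r// lt_def N0 nrm_ge0.
have /choice[G HG] : forall s, exists g, (size s <= 2)%N -> sq g /\ tends0 (fun k => nrm (partials s (phi k) - g)).
  move=> s; case: (leqP (size s) 2) => ss; last by exists 0.
  have [|e e0|g sg lim] := @L2_complete R n.+1 (fun k => partials s (phi k)); last by exists g.
    by move=> k; exact: test_sq (test_partials s (tp k)).
  have P1 : 0 < e / (2 * C + 1) by rewrite divr_gt0// ltr_wpDl// mulr_ge0.
  have [N HN] := tends0_inv P1; exists N => k l Nk' Nl.
  rewrite -partialsB; [|exact: (tp k).1|exact: (tp l).1].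
  apply: (le_trans (nrm_partials _ ss)); apply: (le_trans (cauchy k l)).
  have hk := HN k Nk'; have hl := HN l Nl.
  apply: (@le_trans _ _ (2 * C * (e / (2 * C + 1)))).
    by apply: (le_trans (ler_wpM2l C0 (lerD hk hl))); move: (e / _) => t; rewrite -mulrA mulrCA mulr_natl mulr2n.
  have P2 : 0 < 2 * C + 1 by rewrite ltr_wpDl// mulr_ge0.
  by rewrite mulrA ler_pdivrMr// mulrC ler_wpM2l ?(ltW e0)// lerDl.
have [w sw lim] := sob0_build tp HG; exists w => // psi tq.
apply: (ip_lim (fun k => sq_laptest (tp k)) (sq_lap oO sw.1) (sq_laptest tq) (lap_conv tp sw.1 lim)
  (tends0Z (nrm_ge0 (lap psi)) (@tends0_inv R))) => k.
by rewrite mulrC; exact: res.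
Qed.

Variable alpha : R.
Hypothesis cO : of_class_Ckalpha 4 alpha O.

(** The test functions approximating [w] in $H^2$ are the approximate solutions required by
    [local_reg]. Its bounds are glued, and Riesz turns them into third and fourth weak
    derivatives. *)
Lemma regularity w f : sobolev0 O 2 w -> sq f ->
  (forall psi, test psi -> ip (E (laplacian O w)) (lap psi) = ip f psi) -> sobolev O 4 w.
Proof.
move=> sw sf Hw; have [phi [tp Hphi]] := sob0_approx oO sw; have sw2 := sw.1.
have [C C0 HC] := test_coercive.
have sD s : (size s <= 2)%N -> sq (D s w) by move=> ss; exact: (wd_spec oO sw2 ss).1.
have sL := sq_lap oO sw2.
have lim s : (size s <= 2)%N -> tends0 (fun k => nrm (partials s (phi k) - D s w)).
  by move=> ss; apply: (tends0_le _ (@tends0_inv R)) => k; exact: Hphi.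
have inv0 k : 0 <= k.+1%:R^-1 :> R by rewrite invr_ge0.
(* The Laplacian is a sum of $n+1$ second derivatives, each approximated within $1/(k+1)$. *)
pose eps (k : nat) : R := n.+1%:R * k.+1%:R^-1.
have eps0 k : 0 <= eps k by rewrite mulr_ge0.
have epsl : tends0 eps by apply: tends0Z; [exact: ler0n|exact: tends0_inv].
have lapw k : nrm (lap (phi k) - E (laplacian O w)) <= eps k.
  rewrite lap_wd /lap -sumrB; apply: (le_trans (nrm_sum _ (fun i _ => sqB (test_sq (test_partials [:: i; i] (tp k))) (sD [:: i; i] isT)))).
  apply: (le_trans (ler_sum _ (fun i _ => Hphi k [:: i; i] isT))).
  by rewrite sumr_const card_ord /eps mulr_natl.
pose u i j := D [:: i; j] w.
have HM k : Nk 2 (phi k) <= C * (nrm (E (laplacian O w)) + n.+1%:R).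
  apply: (le_trans (HC _ (tp k))); rewrite ler_wpM2l//.
  have sl := sq_laptest (tp k).
  have -> : lap (phi k) = E (laplacian O w) + (lap (phi k) - E (laplacian O w)) by rewrite addrC subrK.
  apply: (le_trans (nrmD sL (sqB sl sL))); rewrite lerD2l; apply: (le_trans (lapw k)).
  by rewrite /eps ler_piMr// invf_le1// ler1n.
(* The difference quotients used as test functions are only $C^4$, since the flow is; the equation
   is extended to them by mollification. *)
have Hw4 psi : tc 4 O psi -> ip (E (laplacian O w)) (lap psi) = ip f psi.
  move=> tq; have kq := tc_kc (tc_le le2_4 tq).
  apply/eqP; rewrite -subr_eq0 -normr_eq0 eq_le normr_ge0 andbT.
  have K0 : 0 <= nrm (E (laplacian O w)) + nrm f by rewrite addr_ge0 ?nrm_ge0.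
  apply: (tends0_lim (tends0Z K0 (@tends0_inv R))) => k; rewrite add0r.
  have e0 : 0 < k.+1%:R^-1 :> R by rewrite invr_gt0.
  have [chi [cc cs Hchi]] := smooth_approx (tc_le le2_4 tq) e0.
  have tchi : test chi by split.
  have kchi := tc_kc (test_tc 2 tchi); have kd := kcB kchi kq.
  have sd := kc_sq kd; have sld := kc_sq (kc_lap kd); have slq := kc_sq (kc_lap kq).
  have E1 : ip (E (laplacian O w)) (lap psi) = ip (E (laplacian O w)) (lap chi) - ip (E (laplacian O w)) (lap (chi - psi)).
    by rewrite (lapB' kchi.1 kq.1) (ipBr (kc_sq (kc_lap kchi)) slq sL) subKr.
  have E2 : ip f psi = ip f chi - ip f (chi - psi).
    by rewrite (ipBr (kc_sq kchi) (kc_sq kq) sf) subKr.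
  have i1 := ip_CS sL sld; have i2 := ip_CS sf sd.
  have j1 := le_trans (nrm_lap_le kd) Hchi; have j2 := le_trans (nrm_Nk 2 (chi - psi)) Hchi.
  have {j1} j1 := ler_wpM2l (nrm_ge0 (E (laplacian O w))) j1; have {j2} j2 := ler_wpM2l (nrm_ge0 f) j2.
  have key := density_num (ip f chi) (le_trans i1 j1) (le_trans i2 j2).
  have e : ip (E (laplacian O w)) (lap psi) - ip f psi = ip f chi - ip (E (laplacian O w)) (lap (chi - psi)) - (ip f chi - ip f (chi - psi)).
    exact: (f_equal2 (fun a b => a - b) (etrans E1 (f_equal (fun a => a - _) (Hw _ tchi))) E2).
  by rewrite e mulrDl; exact: key.
have Hres k psi : tc 4 O psi -> `|en (phi k) psi - ip f psi| <= eps k * nrm (lap psi).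
  move=> tq; have sl := kc_sq (kc_lap (tc_kc (tc_le le2_4 tq))).
  rewrite -(Hw4 _ tq) /en -(ipBl (sq_laptest (tp k)) sL sl).
  apply: (le_trans (ip_CS (sqB (sq_laptest (tp k)) sL) sl)); rewrite ler_wpM2r ?nrm_ge0//; exact: lapw.
have su i j : sq (u i j) by exact: sD.
have ul i j : tends0 (fun k => nrm (pd i (pd j (phi k)) - u i j)) by exact: (lim [:: i; j] isT).
have loc := local_reg (fun k => test_tc 4 (tp k)) HM eps0 epsl sf Hres su ul.
have local x0 : exists2 r, 0 < r & forall a b i j, exists2 C, 0 <= C &
    forall psi, tc 2 (O `&` [set x | `|x - x0| < r]) psi ->
    `|ip (u a b) (pd i psi)| <= C * nrm psi /\ `|ip (u a b) (pd i (pd j psi))| <= C * nrm psi.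
  case: (pselect (closure O x0)) => [/(chart_ex oO cO)[R0 [rho [q Hc]]]|nc]; first exact: loc Hc.
  have oc : open (~` closure O) by rewrite openC; exact: closed_closure.
  have /nbhs_ballP[e /= e0 He] : nbhs x0 (~` closure O) by exact: open_nbhs_nbhs.
  exists e => // a b i j; exists 0 => // psi tq.
  have -> : psi = 0.
    apply/funext => x; apply: (csupp_out tq.2) => -[Ox /= xe].
    by apply: (He x); [rewrite -ball_normE /= distrC|exact: subset_closure].
  have pd0 k : pd k (0 : V -> R) = 0 by exact: (pd_cst k 0).
  by rewrite !pd0 ip0r normr0 nrm0 mulr0.
have rep (T : (V -> R) -> V -> R) a b : (forall h, kc 2 h -> sq (T h)) ->
    (forall t g g', kc 2 g -> kc 2 g' -> T (t *: g + g') = t *: T g + T g') ->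
    (bounded psi in tc 2 O, ip (u a b) (T psi)) ->
    exists2 h, sq h & forall psi, tc 2 O psi -> ip (u a b) (T psi) = ip h psi.
  move=> sT TL [K K0 HK].
  have [|||||h [sh Hh _]] := @L2_riesz R n.+1 (tc 2 O) (fun psi => ip (u a b) (T psi)) K; last by exists h.
  - by split; [exact: (Ck_cst 2 0)|exists 1, 0; split => // x; rewrite eqxx].
  - move=> t g g' [Hg cg] [Hg' cg']; split; first by apply: CkD => //; exact: CkZ.
    by apply: csuppD => //; exact: csuppZ.
  - by move=> g tg; exact: kc_sq (tc_kc tg).
  - move=> t g g' /tc_kc kg /tc_kc kg'; rewrite (TL t _ _ kg kg').
    by rewrite (ipDr (sqZ t (sT _ kg)) (sT _ kg') (su a b)) (ipZr t (sT _ kg) (su a b)).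
  - exact: HK.
have pdL i t g g' : Ck 1 g -> Ck 1 g' -> pd i (t *: g + g') = t *: pd i g + pd i g'.
  by move=> Hg Hg'; rewrite (pdD1 i (CkZ t Hg) Hg') (pdZ1 i t Hg).
have le12 g : kc 2 g -> Ck 1 g by move=> kg; exact: (Ck_le le1_2 kg.1).
have add_of (T : (V -> R) -> V -> R) : (forall t g g', kc 2 g -> kc 2 g' -> T (t *: g + g') = t *: T g + T g') ->
    forall g g', kc 2 g -> kc 2 g' -> T (g + g') = T g + T g'.
  by move=> TL g g' kg kg'; rewrite -{1}[g]scale1r TL// scale1r.
have T3L i t g g' : kc 2 g -> kc 2 g' -> pd i (t *: g + g') = t *: pd i g + pd i g'.
  by move=> kg kg'; exact: pdL (le12 _ kg) (le12 _ kg').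
have T4L i j t g g' : kc 2 g -> kc 2 g' -> pd i (pd j (t *: g + g')) = t *: pd i (pd j g) + pd i (pd j g').
  by move=> kg kg'; rewrite (T3L j t _ _ kg kg'); exact: pdL (Ck_pd j kg.1) (Ck_pd j kg'.1).
have T3s i (h : V -> R) : kc 2 h -> sq (pd i h) by move=> kh; exact: kc_sq (kc_pd i kh).
have T4s i j (h : V -> R) : kc 2 h -> sq (pd i (pd j h)) by move=> kh; exact: kc_sq (kc_pd i (kc_pd j kh)).
have W3 a b i : exists2 h, sq h & forall psi, tc 2 O psi -> ip (u a b) (pd i psi) = ip h psi.
  apply: (rep (pd i) a b (T3s i) (T3L i)); refine (bound_glue OL (su a b) (T3s i) (add_of (pd i) (T3L i)) _) => x0.
  have [r r0 Hr] := local x0; exists r => //; have [K K0 HK] := Hr a b i i.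
  by exists K => // psi /HK[].
have W4 a b i j : exists2 h, sq h & forall psi, tc 2 O psi -> ip (u a b) (pd i (pd j psi)) = ip h psi.
  apply: (rep (fun h => pd i (pd j h)) a b (T4s i j) (T4L i j)).
  refine (bound_glue OL (su a b) (T4s i j) (add_of (fun h => pd i (pd j h)) (T4L i j)) _) => x0.
  have [r r0 Hr] := local x0; exists r => //; have [K K0 HK] := Hr a b i j.
  by exists K => // psi /HK[].
have wd2 i j psi : test psi -> ip (E w) (pd i (pd j psi)) = ip (u i j) psi.
  move=> tq; have [_ H] := wd_spec oO sw2 (s := [:: i; j]) isT.
  by have := H psi tq; rewrite sqrrN expr1n mul1r.
split; first exact: sw2.1.
case=> [|i [|j [|k [|l [|? ?]]]]]// _; try exact: sw2.2.
  have [h sh Hh] := W3 i j k; exists (- h).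
    by apply/(L2P O _); rewrite mulrN; apply: sqN; exact: sq_Ind.
  apply/(weak_derivP oO) => psi tq; rewrite (ipE _ tq) (ipNl sh (test_sq tq)) -(Hh psi (test_tc 2 tq)).
  rewrite /= exprS sqrrN expr1n mulr1 mulrN mulN1r opprK.
  exact: (wd2 i j _ (test_partials [:: k] tq)).
have [h sh Hh] := W4 i j k l; exists h.
  by apply/(L2P O _); exact: sq_Ind.
apply/(weak_derivP oO) => psi tq; rewrite (ipE _ tq) -(Hh psi (test_tc 2 tq)).
have -> : (-1) ^+ size [:: i; j; k; l] = 1 :> R by rewrite /= !exprS expr0; ring.
rewrite mul1r; exact: (wd2 i j _ (test_partials [:: k; l] tq)).
Qed.

End existence_regularity.

(** * Comparison of the two eigenvalue problems *)

Section spectrum.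
Context {R : realType} {n : nat}.
Local Notation V := 'rV[R]_n.+1.
Local Notation vol := (@vol R n.+1).
Implicit Types (f g phi psi u w : V -> R) (s : seq 'I_n.+1).
Variable O : set V.
Hypothesis oO : open O.
Local Notation E f := (Ind O * f).
Local Notation D s w := (E (weak_deriv O s w)).
Local Notation test := (test O).
Local Notation L := (laplacian O).

Lemma E_Z (a : R) f : E (a *: f) = a *: E f.
Proof. by apply/funext => x; rewrite -[LHS]/(Ind O x * (a * f x)) mulrCA. Qed.

Lemma ip_nrm0 h f g : sq h -> sq f -> sq g -> nrm (f - g) = 0 -> ip h f = ip h g.
Proof.
move=> sh sf sg H; apply/eqP; rewrite -subr_eq0 -(ipBr sf sg sh) -normr_eq0 eq_le normr_ge0 andbT.
by have := ip_CS sh (sqB sf sg); rewrite H mulr0.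
Qed.

Lemma tends0_cst (a : R) : 0 <= a -> tends0 (fun=> a) -> a = 0.
Proof.
move=> a0 lim; apply/eqP; rewrite eq_le a0 andbT.
by apply: (tends0_lim lim) => k; rewrite add0r.
Qed.

Lemma sob0_limit w : sobolev0 O 2 w -> exists phi : nat -> V -> R, [/\ forall k, test (phi k),
  tends0 (fun k => nrm (phi k - E w)) & tends0 (fun k => nrm (lap (phi k) - E (L w)))].
Proof.
move=> sw; have [phi [tp Hphi]] := sob0_approx oO sw; have sw2 := sw.1; exists phi; split => //.
  apply: (tends0_le _ (@tends0_inv R)) => k; have [sD _] := wd_spec oO sw2 (s := [::]) isT.
  have := nrm_tri (test_sq (tp k)) sD (sq_sob sw2).
  rewrite [nrm (D [::] w - _)](nrm_distC sD (sq_sob sw2)) (wd_nil oO sw2) addr0 => h; apply: (le_trans h).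
  exact: (Hphi k [::] isT).
apply: (lap_conv oO tp sw2) => s ss; apply: (tends0_le _ (@tends0_inv R)) => k; exact: Hphi.
Qed.

Lemma test_sob0 psi : test psi -> exists2 w, sobolev0 O 2 w &
  nrm (psi - E w) = 0 /\ nrm (lap psi - E (L w)) = 0.
Proof.
move=> tp; have [|w sw lim] := @sob0_build R n O oO (fun=> psi) (fun s => partials s psi) (fun=> tp).
  move=> s ss; split; first exact: test_sq (test_partials s tp).
  by rewrite subrr nrm0; exact: tends0_const0.
have sw2 := sw.1; exists w => //; split.
  have := tends0_cst (nrm_ge0 _) (lim [::] isT) => h0.
  have [sD _] := wd_spec oO sw2 (s := [::]) isT.
  have := nrm_tri (test_sq tp) sD (sq_sob sw2).
  rewrite [nrm (D [::] w - _)](nrm_distC sD (sq_sob sw2)) (wd_nil oO sw2) addr0 /= in h0 * => h.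
  by apply/eqP; rewrite eq_le nrm_ge0 andbT -h0.
exact: tends0_cst (nrm_ge0 _) (lap_conv oO (fun=> tp) sw2 lim).
Qed.

(** Smooth test functions suffice, by density, for both the Laplacian and the function converge
    along the approximating sequence. *)
Lemma dirichletP mu w : dirichlet_eigenspace O mu w <-> sobolev0 O 2 w /\
  forall psi, test psi -> ip (E (L w)) (lap psi) = mu * ip (E w) psi.
Proof.
split=> -[sw H]; split => //; have sL := sq_lap oO sw.1; have sE := sq_sob sw.1.
  move=> psi tp; have [phi sp [h1 h2]] := test_sob0 tp.
  have sLp := sq_lap oO sp.1; have sEp := sq_sob sp.1.
  rewrite (ip_nrm0 sL (sq_laptest tp) sLp h2) (ip_nrm0 sE (test_sq tp) sEp h1).
  by have := H phi sp; rewrite /L2inner !Rint_EE.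
move=> phi sp; have sLp := sq_lap oO sp.1; have sEp := sq_sob sp.1.
have [psi [tp l1 l2]] := sob0_limit sp.
rewrite /L2inner !Rint_EE ipC.
have K0 : 0 <= `|mu| * nrm (E w) by rewrite mulr_ge0 ?nrm_ge0.
apply: (ip_lim (fun k => sq_laptest (tp k)) sLp sL l2 (tends0Z K0 l1)) => k.
rewrite ipC H// -mulrBr normrM -mulrA ler_wpM2l// -(ipBr (test_sq (tp k)) sEp sE).
by apply: ip_CS => //; apply: sqB => //; exact: test_sq.
Qed.

Lemma wd_ex s w g : L2 O g -> is_weak_deriv O s w g -> sq (D s w) /\
  forall phi, test phi -> ip (E w) (partials s phi) = (-1) ^+ size s * ip (D s w) phi.
Proof.
move=> Lg wg; have [] : [set g | L2 O g /\ is_weak_deriv O s w g] (weak_deriv O s w).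
  by apply: (@xgetPex _ _ [set g | L2 O g /\ is_weak_deriv O s w g]); exists g.
by move=> /L2P s1 /(weak_derivP oO) s2.
Qed.

(** The weak second derivatives of [L w] exist because sums of fourth-order weak derivatives of [w]
    serve as witnesses. *)
Lemma lap_lap w : sobolev O 4 w -> sq (E (L (L w))) /\
  forall psi, test psi -> ip (E (L w)) (lap psi) = ip (E (L (L w))) psi.
Proof.
move=> sw; have sw2 := sob_le le2_4 sw.
have sD4 a i := (wd_spec oO sw (s := [:: a; a; i; i]) isT).1.
have sD2 a := (wd_spec oO sw2 (s := [:: a; a]) isT).1.
have sq1 (k : nat) (F : 'I_k -> V -> R) : (forall a, sq (E (F a))) -> sq (E (\sum_a F a)).
  by move=> H; rewrite mulr_sumr; apply: sq_sum.
have W i : sq (D [:: i; i] (L w)) /\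
    forall phi, test phi -> ip (E (L w)) (partials [:: i; i] phi) = (-1) ^+ 2 * ip (D [:: i; i] (L w)) phi.
  apply: (wd_ex (g := \sum_a weak_deriv O [:: a; a; i; i] w)); first by apply/L2P; exact: sq1.
  apply/(weak_derivP oO) => phi tp; have tpp := test_partials [:: i; i] tp.
  rewrite lap_wd mulr_sumr (ip_suml _ (fun a _ => sD2 a) (test_sq tpp)) (ip_suml _ (fun a _ => sD4 a i) (test_sq tp)).
  rewrite sqrrN expr1n mul1r; apply: eq_bigr => a _.
  have [_ H2] := wd_spec oO sw2 (s := [:: a; a]) isT; have [_ H4] := wd_spec oO sw (s := [:: a; a; i; i]) isT.
  have := H4 phi tp; have := H2 _ tpp.
  have -> : (-1) ^+ size [:: a; a; i; i] = 1 :> R by rewrite /= !exprS expr0; ring.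
  by rewrite sqrrN expr1n !mul1r => <- <-.
split; first by rewrite lap_wd; apply: sq_sum => i _; case: (W i).
move=> psi tp; rewrite (lap_wd O (L w)) /lap.
transitivity (\sum_i ip (E (L w)) (partials [:: i; i] psi)).
  exact: (ip_sumr _ (fun i _ => test_sq (test_partials [:: i; i] tp)) (sq_lap oO sw2)).
rewrite (ip_suml _ (fun i _ => (W i).1) (test_sq tp)); apply: eq_bigr => i _.
by rewrite (W i).2// sqrrN expr1n mul1r.
Qed.

Lemma green w u : sobolev0 O 2 w -> sobolev O 4 u -> ip (E w) (E (L (L u))) = ip (E (L w)) (E (L u)).
Proof.
move=> sw su; have [sLL HL] := lap_lap su; have sLu := sq_lap oO (sob_le le2_4 su).
have [phi [tp l1 l2]] := sob0_limit sw.
apply: (ip_lim (fun k => test_sq (tp k)) (sq_sob sw.1) sLL l1 (tends0Z (nrm_ge0 (E (L u))) l2)) => k.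
have sl := sq_laptest (tp k); have sLw := sq_lap oO sw.1.
rewrite ipC -(HL _ (tp k)) ipC -(ipBl sl sLw sLu) [leRHS]mulrC.
exact: (ip_CS (sqB sl sLw) sLu).
Qed.

Variable L0 : R.
Hypothesis L00 : 0 <= L0.
Hypothesis OL : forall x, O x -> `|x| <= L0.

(** Coercivity passed to limits of test functions. Stated for a sequence and its limits, it applies
    to linear combinations as well as to single elements of $H^2_0$. *)
Lemma sob0_coercive : exists2 C, 0 <= C & forall phi : nat -> V -> R, (forall k, test (phi k)) ->
  forall f g, sq f -> sq g -> tends0 (fun k => nrm (phi k - f)) -> tends0 (fun k => nrm (lap (phi k) - g)) ->
  nrm f <= C * nrm g.
Proof.
have [C C0 HC] := test_coercive L00 OL; exists C => // phi tp f g sf sg l1 l2.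
apply: (tends0_lim (tends0D l1 (tends0Z C0 l2))) => k.
have sp := test_sq (tp k); have sl := sq_laptest (tp k).
have i1 : nrm f <= nrm (phi k) + nrm (phi k - f).
  rewrite -{1}[f](subKr (phi k)); exact: nrmB sp (sqB sp sf).
have i2 : nrm (lap (phi k)) <= nrm g + nrm (lap (phi k) - g).
  have {1}-> : lap (phi k) = g + (lap (phi k) - g) by rewrite addrC subrK.
  exact: nrmD sg (sqB sl sg).
have i3 := le_trans (nrm_Nk 2 (phi k)) (HC _ (tp k)); have i4 := ler_wpM2l C0 i2; rewrite mulrDr in i4.
by apply: (le_trans i1); rewrite addrC addrA [X in _ <= X + _]addrC -addrA lerD2l; exact: le_trans i3 i4.
Qed.

Variable alpha : R.
Hypothesis cO : of_class_Ckalpha 4 alpha O.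

Lemma neumann_dirichlet lam u : neumann_solution O lam u <-> dirichlet_eigenspace O lam u.
Proof.
split=> [[[s4 s2] H]|/dirichletP[s2 H]].
  have [sLL HL] := lap_lap s4; have sE := sq_sob s4.
  (* Solving $\Delta^2\varphi = f$ in the space of the first problem and testing with this $\varphi$
     yields $\langle f, f\rangle = 0$. *)
  pose f := E (L (L u)) - lam *: E u; have sf : sq f := sqB sLL (sqZ lam sE).
  have [phi p2 Hp] := existence oO L00 OL sf; have p4 := regularity oO L00 OL cO p2 sf Hp.
  have [sLLp HLp] := lap_lap p4.
  have fE : E f = f.
    by rewrite /f mulrBr E_E E_Z E_E.
  have e1 : nrm (E (L (L phi)) - f) = 0.
    rewrite -(E_E O (L (L phi))) -fE; apply: (weak_uniq oO sLLp sf) => psi tp.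
    by rewrite -(HLp _ tp) (Hp _ tp).
  have e2 : ip f (E (L (L phi))) = 0.
    rewrite /f (ipBl sLL (sqZ lam sE) sLLp) (ipZl lam sE sLLp) (green s2 p4).
    by have := H phi (conj p4 p2); rewrite /L2inner !Rint_EE => ->; rewrite subrr.
  have f0 : nrm f = 0.
    by apply/eqP; rewrite -sqrf_eq0 nrm_sq -(ip_nrm0 sf sLLp sf e1) e2.
  apply/dirichletP; split => // psi tp; have sp := test_sq tp.
  rewrite (HL _ tp) -(ipZl lam sE sp) ipC [RHS]ipC; apply: (ip_nrm0 sp sLL (sqZ lam sE)); exact: f0.
have sE := sq_sob s2.1; have sf := sqZ lam sE.
have s4 : sobolev O 4 u.
  by apply: (regularity oO L00 OL cO s2 sf) => psi tp; rewrite (ipZl lam sE (test_sq tp)); exact: H.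
have [sLL HL] := lap_lap s4; split => // phi [p4 p2]; have [sLLp HLp] := lap_lap p4.
rewrite /L2inner !Rint_EE -(green s2 p4) -(ipZl lam sE sLLp) ipC [RHS]ipC.
apply: (ip_nrm0 sLLp sLL sf); rewrite -(E_E O (L (L u))) -(E_E O u) -E_Z.
apply: (weak_uniq oO sLL sf) => psi tp.
by rewrite -(HL _ tp) (H _ tp) (ipZl lam sE (test_sq tp)).
Qed.

Lemma eq_on0 f : sq (E f) -> eq_on O f (fun=> 0) <-> nrm (E f) = 0.
Proof.
move=> sf; have e0 : E (fun=> 0 : R) = 0.
  by apply/funext => x; rewrite -[LHS]/(Ind O x * 0) mulr0.
by rewrite (eq_onP sf); [rewrite e0 subr0|rewrite e0; exact: sq0].
Qed.

(** If [mu] were nonpositive, testing with [w] would make its Laplacian vanish, hence [w] itself by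
    coercivity. *)
Lemma dirichlet_gt0 mu : dirichlet_eigenvalue O mu -> 0 < mu.
Proof.
move=> [w [sw H] nw]; have sE := sq_sob sw.1; have sL := sq_lap oO sw.1.
have nE : 0 < nrm (E w).
  rewrite lt_def nrm_ge0 andbT; apply/eqP => w0; apply: nw; exact/eq_on0.
have [C C0 HC] := sob0_coercive; have [phi [tp l1 l2]] := sob0_limit sw.
have h1 := HC phi tp _ _ sE sL l1 l2.
have := H w sw; rewrite /L2inner !Rint_EE -!nrm_sq => e.
rewrite ltNge; apply/negP => mu0.
have h2 : nrm (E (L w)) ^+ 2 <= 0 by rewrite e mulr_le0_ge0// sqr_ge0.
have h3 : nrm (E (L w)) = 0 by apply/eqP; rewrite -sqrf_eq0 eq_le h2 sqr_ge0.
by move: h1; rewrite h3 mulr0 leNgt nE.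
Qed.

Lemma E_comb m (c : 'I_m -> R) (F : 'I_m -> V -> R) :
  E (fun x => \sum_i c i * F i x) = \sum_i c i *: E (F i).
Proof.
apply/funext => x; rewrite fct_sumE -[LHS]/(Ind O x * \sum_i c i * F i x) mulr_sumr.
by apply: eq_bigr => i _; rewrite mulrCA.
Qed.

(** Injectivity of the Laplacian on $H^2_0$, by coercivity, and its well-definedness up to null
    sets, by integration by parts; in terms of combinations, as needed to transfer linear
    independence. *)
Lemma comb_lap m (u : 'I_m -> V -> R) (c : 'I_m -> R) : (forall i, sobolev0 O 2 (u i)) ->
  nrm (\sum_i c i *: E (u i)) = 0 <-> nrm (\sum_i c i *: E (L (u i))) = 0.
Proof.
move=> su; have /choice[phi Hphi] := fun i => sob0_limit (su i).
have sEu i : sq (c i *: E (u i)) := sqZ _ (sq_sob (su i).1).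
have sLu i : sq (c i *: E (L (u i))) := sqZ _ (sq_lap oO (su i).1).
have sS : sq (\sum_i c i *: E (u i)) by apply: sq_sum.
have sT : sq (\sum_i c i *: E (L (u i))) by apply: sq_sum.
pose Phi k := \sum_i c i *: phi i k.
have tphi i k : test (phi i k) by case: (Hphi i).
have tPhi k : test (Phi k).
  split; first by move=> a; apply: Ck_sum => i _; apply: CkZ; exact: (tphi i k).1.
  by apply: csupp_sum => i; apply: csuppZ; exact: (tphi i k).2.
have lapPhi k : lap (Phi k) = \sum_i c i *: lap (phi i k).
  rewrite /Phi; have H (r : seq 'I_m) : lap (\sum_(i <- r) c i *: phi i k) = \sum_(i <- r) c i *: lap (phi i k).
    elim: r => [|i r IH].
      rewrite !big_nil /lap big1// => i _; have h : pd i (0 : V -> R) = 0 by exact: (pd_cst i 0).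
      by rewrite !h.
    rewrite !big_cons (lapL (c i) ((tphi i k).1 2%N)) ?IH//.
    by apply: Ck_sum => j _; apply: CkZ; exact: (tphi j k).1.
  exact: H.
have lim (F : 'I_m -> nat -> V -> R) (G : 'I_m -> V -> R) : (forall i k, sq (F i k)) -> (forall i, sq (G i)) ->
    (forall i, tends0 (fun k => nrm (F i k - G i))) ->
    tends0 (fun k => nrm (\sum_i c i *: F i k - \sum_i c i *: G i)).
  move=> sF sG H; apply: (tends0_le _ (tends0_sum (fun i => tends0Z (normr_ge0 (c i)) (H i)))) => k.
  rewrite -sumrB; apply: (le_trans (nrm_sum _ (fun i _ => sqB (sqZ _ (sF i k)) (sqZ _ (sG i))))).
  by apply: ler_sum => i _; rewrite -scalerBr (nrmZ _ (sqB (sF i k) (sG i))).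
have l1 : tends0 (fun k => nrm (Phi k - \sum_i c i *: E (u i))).
  apply: lim => [i k|i|i]; [exact: test_sq|exact: sq_sob (su i).1|by case: (Hphi i)].
have l2 : tends0 (fun k => nrm (lap (Phi k) - \sum_i c i *: E (L (u i)))).
  have := lim (fun i k => lap (phi i k)) (fun i => E (L (u i))) (fun i k => sq_laptest (tphi i k))
    (fun i => sq_lap oO (su i).1) (fun i => let: And3 _ _ h := Hphi i in h).
  by apply: tends0_le => k; rewrite lapPhi.
split=> H; last first.
  have [C C0 HC] := sob0_coercive; have := HC Phi tPhi _ _ sS sT l1 l2.
  by rewrite H mulr0 => h; apply/eqP; rewrite eq_le h nrm_ge0.
have ET : E (\sum_i c i *: E (L (u i))) = \sum_i c i *: E (L (u i)).
  by rewrite mulr_sumr; apply: eq_bigr => i _; rewrite E_Z E_E.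
rewrite -ET -[E _]subr0 -[X in _ - X](mulr0 (Ind O)).
apply: (weak_uniq oO sT (sq0 (n := n.+1))) => psi tp; rewrite ip0l.
apply: (ip_lim (fun k => sq_laptest (tPhi k)) sT (test_sq tp) l2 (tends0Z (nrm_ge0 (lap psi)) l1)) => k.
have sl := sq_laptest tp; have sP := test_sq (tPhi k).
have -> : ip (lap (Phi k)) psi = ip (Phi k) (lap psi).
  transitivity (\sum_i ip (partials [:: i; i] (Phi k)) psi).
    exact: (ip_suml _ (fun i _ => test_sq (test_partials [:: i; i] (tPhi k))) (test_sq tp)).
  transitivity (\sum_i ip (Phi k) (partials [:: i; i] psi)).
    apply: eq_bigr => i _; rewrite (test_byparts (s := [:: i; i]) isT (tPhi k) tp).
    by rewrite sqrrN expr1n mul1r.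
  exact: (esym (ip_sumr _ (fun i _ => test_sq (test_partials [:: i; i] tp)) sP)).
have h0 : ip (lap psi) (\sum_i c i *: E (u i)) = ip (lap psi) 0.
  by apply: ip_nrm0; rewrite ?subr0//; exact: sq0.
rewrite subr0 ipC -[ip _ _]subr0 -[X in _ - X](ip0r (lap psi)) -h0 -(ipBr sP sS sl).
exact: (ip_CS sl (sqB sP sS)).
Qed.

Definition indep m (F : 'I_m -> V -> R) := forall c : 'I_m -> R,
  eq_on O (fun x => \sum_(i < m) c i * F i x) (fun=> 0) -> forall i, c i = 0.

(** If $m' > m$, the matrix of coordinates of [G] in [F] has a nonzero left kernel vector, which is
    a relation almost everywhere between the [G k]. *)
Lemma indep_le m m' (A : set (V -> R)) (F : 'I_m -> V -> R) (G : 'I_m' -> V -> R) :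
  (forall f, A f -> exists c : 'I_m -> R, eq_on O f (fun x => \sum_(i < m) c i * F i x)) ->
  (forall k, A (G k)) -> indep G -> (m' <= m)%N.
Proof.
move=> span AG iG; rewrite leqNgt; apply/negP => mm.
have /choice[c Hc] := fun k => span _ (AG k).
pose M : 'M[R]_(m', m) := \matrix_(k, i) c k i.
have : kermx M != 0.
  rewrite kermx_eq0 /row_free; apply/eqP => rM; have := rank_leq_col M; rewrite rM; lia.
case/rowV0Pn => v /sub_kermxP vM v0.
have : forall k, v ord0 k = 0.
  apply: (iG (fun k => v ord0 k)).
  have : {ae vol, forall x, forall k, O x -> G k x = \sum_(i < m) c k i * F i x}.
    by apply: filter_forall => k; exact: Hc.
  apply: filterS => x Hx Ox; under eq_bigr do rewrite (Hx _ Ox) mulr_sumr.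
  rewrite exchange_big /= big1// => i _.
  under eq_bigr do rewrite mulrA.
  rewrite -mulr_suml; have := f_equal (fun B : 'rV[R]_m => B ord0 i) vM; rewrite !mxE => e.
  have -> : \sum_(k < m') v ord0 k * c k i = 0.
    by rewrite -[RHS]e; apply: eq_bigr => k _; rewrite mxE.
  by rewrite mul0r.
move=> vk; move/eqP: v0; apply; apply/rowP => k; by rewrite mxE vk.
Qed.

Lemma dim_eq t m m' : has_dim O (neumann_eigenspace O t) m -> has_dim O (dirichlet_eigenspace O t) m' -> m = m'.
Proof.
move=> [e [He ie se]] [e' [He' ie' se']]; apply/eqP; rewrite eqn_leq; apply/andP; split.
  have /choice[u Hu] : forall k, exists u, neumann_solution O t u /\ eq_on O (e k) (L u).
    by move=> k; have [u su eu] := He k; exists u.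
  have su k : sobolev0 O 2 (u k) by case: (Hu k) => -[[_]].
  apply: (indep_le se' (G := u)) => [k|c Hc]; first by apply/neumann_dirichlet; case: (Hu k).
  have sEu k := sq_sob (su k).1; have sLu k := sq_lap oO (su k).1.
  apply: ie; have : eq_on O (fun x => \sum_i c i * L (u i) x) (fun=> 0).
    apply/eq_on0; first by rewrite E_comb; apply: sq_sum => k _; exact: sqZ.
    rewrite (E_comb c (fun i => L (u i))); apply/(comb_lap c su); rewrite -(E_comb c u).
    by apply/eq_on0 => //; rewrite E_comb; apply: sq_sum => k _; exact: sqZ.
  have : {ae vol, forall x, forall k, O x -> e k x = L (u k) x}.
    by apply: filter_forall => k; case: (Hu k).
  apply: filterS2 => x Hx H0 Ox; apply: etrans (H0 Ox); apply: eq_bigr => k _; by rewrite Hx.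
have su k : sobolev0 O 2 (e' k) by case: (He' k).
apply: (indep_le se (G := fun k => L (e' k))) => [k|c Hc].
  by exists (e' k); [apply/neumann_dirichlet|apply: nearW => x _].
have sEu k := sq_sob (su k).1; have sLu k := sq_lap oO (su k).1.
apply: ie'; apply/eq_on0; first by rewrite E_comb; apply: sq_sum => k _; exact: sqZ.
rewrite (E_comb c e'); apply/(comb_lap c su); rewrite -(E_comb c (fun i => L (e' i))).
by apply/eq_on0 => //; rewrite E_comb; apply: sq_sum => k _; exact: sqZ.
Qed.

Lemma eigenvalues_eq : [set t | 0 < t /\ neumann_eigenvalue O t] = [set t | dirichlet_eigenvalue O t].
Proof.
apply/seteqP; split => t /=.
  by move=> [_ [_ [u /neumann_dirichlet du nu]]]; exists u.
move=> dt; have t0 := dirichlet_gt0 dt; case: dt => w dw nw; split => //.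
by split; [rewrite gt_eqF|exists w => //; apply/neumann_dirichlet].
Qed.

End spectrum.

(** If $a_j < b_j$, monotonicity puts every index where [b] takes the value $a_j$ before [j], where
    the sequences agree. With [j] itself, [a] would take this value at least once more often than
    [b]. *)
Lemma enum_nlt (R : realType) (a b : nat -> R) j : nondecreasing_seq b ->
  (exists2 m, ([set i | a i = a j] #= `I_m)%card & ([set i | b i = a j] #= `I_m)%card) ->
  (forall i, (i < j)%N -> a i = b i) -> ~ a j < b j.
Proof.
move=> nb [m Ha Hb] eqj lt.
have fa : finite_set [set i | a i = a j] by exists m.
have fb : finite_set [set i | b i = a j] by exists m.
have ca := card_fset_set Ha; have cb := card_fset_set Hb.
have mem (A : set nat) i (fA : finite_set A) : i \in finmap.enum_fset (fset_set A) <-> A i.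
  by split=> [h|Ai]; [apply: set_mem; rewrite -(in_fset_set fA i)|have := mem_set Ai; rewrite -(in_fset_set fA i)].
have : (size (j :: finmap.enum_fset (fset_set [set i | b i = a j])) <= size (finmap.enum_fset (fset_set [set i | a i = a j])))%N.
  apply: uniq_leq_size => [|i].
    rewrite cons_uniq finmap.fset_uniq andbT; apply/negP => /(mem _ _ fb) /= e.
    by move: lt; rewrite e ltxx.
  rewrite in_cons => /predU1P[->|/(mem _ _ fb) /= bi]; apply/(mem _ _ fa) => //=.
  have ij : (i < j)%N by rewrite ltnNge; apply/negP => /nb; rewrite bi leNgt lt.
  by rewrite eqj.
by rewrite /= ca cb ltnn.
Qed.

Theorem theorem3p10 (R : realType) (n : nat) (alpha : R)
    (Omega : set 'rV[R]_n.+1) (lam mu : nat -> R)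
    (alpha01 : 0 < alpha < 1)
    (Omega_open : open Omega)
    (Omega_connected : connected Omega)
    (Omega_bounded : bounded_set Omega)
    (Omega_class : of_class_Ckalpha 4 alpha Omega)
    (lamP : enumerates Omega [set t | 0 < t /\ neumann_eigenvalue Omega t]
              (neumann_eigenspace Omega) lam)
    (muP : enumerates Omega [set t | dirichlet_eigenvalue Omega t]
             (dirichlet_eigenspace Omega) mu) :
  forall j, lam j = mu j.
Proof.
have [M [_ HM]] := Omega_bounded.
pose L0 := Num.max 0 (M + 1); have L00 : 0 <= L0 by rewrite le_max lexx.
have OL x : Omega x -> `|x| <= L0.
  move=> Ox; rewrite le_max; apply/orP; right; apply: HM => //; by rewrite ltrDl.
have [nl rl cl] := lamP; have [nm rm cm] := muP.
have SE := eigenvalues_eq Omega_open L00 OL Omega_class.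
have card t : [set t | dirichlet_eigenvalue Omega t] t ->
    exists2 m, ([set i | lam i = t] #= `I_m)%card & ([set i | mu i = t] #= `I_m)%card.
  move=> St; have [m d1 c1] := cl t (eq_rect _ (fun A : set R => A t) St _ (esym SE)).
  have [m' d2 c2] := cm t St; exists m => //.
  by rewrite (dim_eq Omega_open L00 OL Omega_class d1 d2).
have Sl i : [set t | dirichlet_eigenvalue Omega t] (lam i).
  by rewrite -SE -rl; exists i.
have Sm i : [set t | dirichlet_eigenvalue Omega t] (mu i) by rewrite -rm; exists i.
(* Strong induction: agreement before [j] excludes both strict inequalities at [j]. *)
elim/ltn_ind => j IH; apply/eqP; rewrite eq_le !leNgt; apply/andP; split; apply/negP.
  apply: (enum_nlt nl) => [|i ij]; last by rewrite IH.
  by have [m c1 c2] := card _ (Sm j); exists m.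
by apply: (enum_nlt nm) => [|i ij]; [exact: card (Sl j)|exact: IH].
Qed.
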